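(* Let $T>0$, $\alpha=2\pi/T$, $\beta\neq0$, $u\in C^\infty([y_1,y_2])$ and $s\ge3$. Assume that $c_0\in\bigcup_{k\ge1}(\sigma_d(\mathcal{R}_{k\alpha,\beta})\cap\mathbf{R})$. Then there exist $\varepsilon_0>0$ and a family $\{\vec u_\varepsilon(x-c_\varepsilon t,y)=(u_\varepsilon(x-c_\varepsilon t,y),v_\varepsilon(x-c_\varepsilon t,y)):\varepsilon\in(0,\varepsilon_0)\}$ such that for each $\varepsilon\in(0,\varepsilon_0)$, $\vec u_\varepsilon(x-c_\varepsilon t,y)$ is a traveling wave solution of the $\beta$-plane Euler equation in $D_T$ with period $T$ in $x$ satisfying $$\|(u_\varepsilon,v_\varepsilon)-(u,0)\|_{H^s(D_T)}\le\varepsilon,\qquad \|v_\varepsilon\|_{L^2(D_T)}\ne0,\qquad c_\varepsilon\notin\mathrm{Ran}(u),$$ and $c_\varepsilon\to c_0$ as $\varepsilon\to0^+$. Moreover, $u_\varepsilon(x,y)-c_\varepsilon\ne0$.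
   Context: $y_1<y_2$; $u$ is real-valued; $D_T=(\mathbf{R}/T\mathbf{Z})\times[y_1,y_2]$; $k$ ranges over integers. The $\beta$-plane Euler equation is $$\partial_t\vec v+(\vec v\cdot\nabla)\vec v=-\nabla P-\beta yJ\vec v,\quad \nabla\cdot\vec v=0,\quad J=\begin{pmatrix}0&-1\\1&0\end{pmatrix},\qquad v_2=0\ \text{on } y=y_1,y_2,$$ for $\vec v=(v_1,v_2)$ on $D_T$ with pressure $P$. For $\alpha>0$, $\mathcal{R}_{\alpha,\beta}=-(\partial_y^2-\alpha^2)^{-1}\big((u''-\beta)-u(\partial_y^2-\alpha^2)\big)$ acts on functions of $y\in[y_1,y_2]$ with Dirichlet conditions; its essential spectrum is $\mathrm{Ran}(u)$, $\sigma_d$ is its discrete spectrum, and a real $c\notin\mathrm{Ran}(u)$ is in $\sigma_d(\mathcal{R}_{\alpha,\beta})$ if and only if $-\phi''+\frac{u''-\beta}{u-c}\phi=-\alpha^2\phi$ has a nonzero solution $\phi\in H_0^1\cap H^2(y_1,y_2)$. *)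

(* Defs.v *)
From HB Require Import structures.
From mathcomp Require Import all_boot all_order all_algebra.
From mathcomp Require Import all_classical all_reals all_analysis.
From mathcomp Require Import complex.
Set Implicit Arguments.
Unset Strict Implicit.
Unset Printing Implicit Defensive.
Import Order.TTheory GRing.Theory Num.Theory.
Import numFieldNormedType.Exports.
Local Open Scope classical_set_scope.
Local Open Scope ring_scope.
Local Open Scope complex_scope.

(* C^n on an open set U, stated with the directional derivatives along all    *)
(* vectors; for finite-dimensional V this is the usual class C^n(U).          *)
Fixpoint Cn (R : realType) (V : normedModType R) (U : set V) (n : nat)
    (f : V -> R) : Prop :=
  {in U, continuous f} /\
  match n with
  | 0 => True
  | n'.+1 => forall v : V, (forall p, U p -> derivable f p v) /\
                           Cn U n' (fun p => 'D_v f p)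
  end.

(* C^oo([y1, y2]): restrictions to [y1, y2] of smooth functions on R. *)
Definition smooth_on (R : realType) (y1 y2 : R) (u : R -> R) : Prop :=
  exists w : R -> R,
    (forall n y, derivable (w^`(n))%classic y 1) /\ {in `[y1, y2], u =1 w}.

Definition Ran (R : realType) (y1 y2 : R) (u : R -> R) : set R :=
  u @` `[y1, y2].

(* R_{alpha,beta} acts on the complex Hilbert space H^2 /\ H^1_0 (y1, y2). An
   element is represented by (the restriction to [y1, y2] of) its C^1
   representative; values outside [y1, y2] are irrelevant throughout. *)

(* f is in H^2 /\ H^1_0 (y1, y2), with f' = f1 and f'' = f2: f and f1 are
   absolutely continuous, f2 is in L^2, and f vanishes at both endpoints. *)
Definition H2D_real (R : realType) (y1 y2 : R) (f f1 f2 : R -> R) : Prop :=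
  let I : set R := `[y1, y2]%classic in
  let mu := @lebesgue_measure R in
  [/\ measurable_fun I f2,
      (\int[mu]_(y in I) ((f2 y) ^+ 2)%:E < +oo)%E,
      (forall y, I y -> f1 y = f1 y1 + \int[mu]_(z in `[y1, y]) f2 z),
      (forall y, I y -> f y = f y1 + \int[mu]_(z in `[y1, y]) f1 z) &
      f y1 = 0 /\ f y2 = 0].

Definition H2D (R : realType) (y1 y2 : R) (f f1 f2 : R -> R[i]) : Prop :=
  H2D_real y1 y2 (fun y => complex.Re (f y))
    (fun y => complex.Re (f1 y)) (fun y => complex.Re (f2 y)) /\
  H2D_real y1 y2 (fun y => complex.Im (f y))
    (fun y => complex.Im (f1 y)) (fun y => complex.Im (f2 y)).

Definition sqrnorm (R : realType) (z : R[i]) : R :=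
  complex.Re z ^+ 2 + complex.Im z ^+ 2.

(* The square of the H^2(y1, y2)-norm of f, given f' = f1 and f'' = f2. *)
Definition H2_sqrnorm (R : realType) (y1 y2 : R) (f f1 f2 : R -> R[i]) : R :=
  \int[@lebesgue_measure R]_(y in `[y1, y2])
    (sqrnorm (f y) + sqrnorm (f1 y) + sqrnorm (f2 y)).

(* Graph of R_{alpha,beta}: g = R_{alpha,beta} f, i.e. g is the Dirichlet
   solution of (d^2 - alpha^2) g = - ((u'' - beta) f - u (d^2 - alpha^2) f).
   The equation is between L^2 functions, hence a.e. on (y1, y2). *)
Definition rayleigh (R : realType) (y1 y2 : R) (u : R -> R) (alpha beta : R)
    (f g : R -> R[i]) : Prop :=
  exists f1 f2 g1 g2 : R -> R[i],
  [/\ H2D y1 y2 f f1 f2, H2D y1 y2 g g1 g2 &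
      {ae @lebesgue_measure R, forall y, y1 < y < y2 ->
        g2 y - (alpha ^+ 2)%:C * g y =
        - (((u^`(2))%classic y - beta)%:C * f y
           - (u y)%:C * (f2 y - (alpha ^+ 2)%:C * f y))}].

(* Graph of R_{alpha,beta} - lam. *)
Definition rayleigh_sub (R : realType) (y1 y2 : R) (u : R -> R)
    (alpha beta : R) (lam : R[i]) (f g : R -> R[i]) : Prop :=
  rayleigh y1 y2 u alpha beta f (fun y => g y + lam * f y).

(* R_{alpha,beta} - lam is onto and bounded below for the H^2-norm, i.e. it
   has a bounded everywhere defined inverse. *)
Definition resolvent_set (R : realType) (y1 y2 : R) (u : R -> R)
    (alpha beta : R) : set R[i] :=
  [set lam |
    (forall g g1 g2, H2D y1 y2 g g1 g2 ->
       exists f, rayleigh_sub y1 y2 u alpha beta lam f g) /\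
    (exists C : R, forall f f1 f2 g g1 g2,
       H2D y1 y2 f f1 f2 -> H2D y1 y2 g g1 g2 ->
       rayleigh_sub y1 y2 u alpha beta lam f g ->
       H2_sqrnorm y1 y2 f f1 f2 <= C * H2_sqrnorm y1 y2 g g1 g2)].

(* f is in the kernel of (R_{alpha,beta} - lam)^n. *)
Fixpoint root_vector (R : realType) (y1 y2 : R) (u : R -> R)
    (alpha beta : R) (lam : R[i]) (n : nat) (f : R -> R[i]) : Prop :=
  match n with
  | 0 => forall y, y1 <= y <= y2 -> f y = 0
  | n'.+1 => exists2 g, rayleigh_sub y1 y2 u alpha beta lam f g &
                        root_vector y1 y2 u alpha beta lam n' g
  end.

(* Isolated points of the spectrum that are eigenvalues of finite algebraic
   multiplicity (dimension of the space of all root vectors). *)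
Definition discrete_spectrum (R : realType) (y1 y2 : R) (u : R -> R)
    (alpha beta : R) : set R[i] :=
  [set lam |
    [/\ (exists2 r : R, 0 < r & forall z : R[i],
           z != lam -> `|z - lam| < r%:C ->
           resolvent_set y1 y2 u alpha beta z),
        (exists2 f, rayleigh_sub y1 y2 u alpha beta lam f (fun=> 0) &
           exists2 y, y1 <= y <= y2 & f y != 0) &
        (exists (m : nat) (e : 'I_m -> R -> R[i]), forall n f,
           root_vector y1 y2 u alpha beta lam n f ->
           exists a : 'I_m -> R[i], forall y, y1 <= y <= y2 ->
             f y = \sum_(i < m) a i * e i y)]].

(* Functions on D_T = (R/TZ) x [y1, y2] are functions of (x, y) that are
   T-periodic in x; only their values for y in [y1, y2] matter. *)

Definition cell (R : realType) (T y1 y2 : R) : set (R * R) :=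
  `[0, T] `*` `[y1, y2].

Definition leb2 (R : realType) :
    {measure set (measurableTypeR R * measurableTypeR R) -> \bar R} :=
  (@lebesgue_measure R \x @lebesgue_measure R)%E.

(* Smooth T-periodic functions with compact support in (R/TZ) x (y1, y2). *)
Definition test_fun (R : realType) (T y1 y2 : R) (eta : R * R -> R) : Prop :=
  [/\ (forall n, Cn setT n eta),
      (forall x y, eta (x + T, y) = eta (x, y)) &
      exists a b : R, [/\ y1 < a, b < y2 &
        forall x y, eta (x, y) != 0 -> a <= y <= b]].

(* d_x^i d_y^j eta *)
Definition pderiv (R : realType) (i j : nat) (eta : R * R -> R) :
    R * R -> R :=
  iter i (fun f p => 'D_((1, 0) : R * R) f p)
    (iter j (fun f p => 'D_((0, 1) : R * R) f p) eta).

Definition weak_deriv (R : realType) (T y1 y2 : R) (i j : nat)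
    (f g : R * R -> R) : Prop :=
  [/\ (leb2 R).-integrable (cell T y1 y2) (fun p => (f p)%:E),
      (leb2 R).-integrable (cell T y1 y2) (fun p => (g p)%:E) &
      forall eta, test_fun T y1 y2 eta ->
        \int[leb2 R]_(p in cell T y1 y2) (f p * pderiv i j eta p) =
        (-1) ^+ (i + j) * \int[leb2 R]_(p in cell T y1 y2) (g p * eta p)].

Definition L2_sqrnorm (R : realType) (T y1 y2 : R) (f : R * R -> R) : \bar R :=
  (\int[leb2 R]_(p in cell T y1 y2) ((f p) ^+ 2)%:E)%E.

Definition L2_norm (R : realType) (T y1 y2 : R) (f : R * R -> R) : \bar R :=
  sqrte (L2_sqrnorm T y1 y2 f).

(* Distance on (R/TZ) x R, for points whose abscissae are in [0, T]. *)
Definition cyl_dist (R : realType) (T : R) (p q : R * R) : R :=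
  Num.sqrt (Num.min `|p.1 - q.1| (T - `|p.1 - q.1|) ^+ 2 + (p.2 - q.2) ^+ 2).

(* Squared Gagliardo-Slobodeckij seminorm of order theta in (0, 1); the
   exponent is dimension + 2 theta. *)
Definition gagliardo (R : realType) (T y1 y2 theta : R) (f : R * R -> R) :
    \bar R :=
  (\int[leb2 R]_(p in cell T y1 y2) \int[leb2 R]_(q in cell T y1 y2)
     ((f p - f q) ^+ 2 / (cyl_dist T p q) `^ (2 + 2 * theta))%:E)%E.

(* Squared H^s(D_T)-norm for real s >= 0, with s = m + theta, m integer and
   theta in [0, 1). Weak derivatives are unique a.e., so the infimum below is
   over at most one value; it is +oo when some weak derivative of order <= m
   does not exist, so that H^s(D_T) is where it is finite. *)
Definition Hs_sqrnorm (R : realType) (T y1 y2 s : R) (f : R * R -> R) :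
    \bar R :=
  let m := Num.truncn s in
  let theta := s - m%:R in
  ereal_inf [set N : \bar R | exists2 D : nat -> nat -> R * R -> R,
    (forall i j, (i + j <= m)%N -> weak_deriv T y1 y2 i j f (D i j)) &
    N = (\sum_(i < m.+1) \sum_(j < m.+1 | (i + j <= m)%N)
           L2_sqrnorm T y1 y2 (D i j)
         + (if theta == 0%R then 0 else
            \sum_(i < m.+1) \sum_(j < m.+1 | (i + j == m)%N)
              gagliardo T y1 y2 theta (D i j)))%E].

Definition Hs_norm (R : realType) (T y1 y2 s : R) (f g : R * R -> R) :
    \bar R :=
  sqrte (Hs_sqrnorm T y1 y2 s f + Hs_sqrnorm T y1 y2 s g)%E.

(* Classical solutions on R x D_T, as functions of (t, x, y); since
   J (v1, v2) = (- v2, v1), the Coriolis term - beta y J v is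
   (beta y v2, - beta y v1). *)
Definition beta_plane_euler (R : realType) (T y1 y2 beta : R)
    (v1 v2 : R * R * R -> R) : Prop :=
  let U := [set p : R * R * R | y1 < p.2 < y2] in
  let S := [set p : R * R * R | y1 <= p.2 <= y2] in
  let Dt f p := 'D_((1, 0, 0) : R * R * R) f p in
  let Dx f p := 'D_((0, 1, 0) : R * R * R) f p in
  let Dy f p := 'D_((0, 0, 1) : R * R * R) f p in
  let classical f := [/\ Cn U 1 f, {within S, continuous f} &
    forall t x y, y1 <= y <= y2 -> f (t, x + T, y) = f (t, x, y)] in
  exists P : R * R * R -> R,
  [/\ [/\ classical v1, classical v2 & classical P],
      (forall p, U p ->
         Dt v1 p + v1 p * Dx v1 p + v2 p * Dy v1 p =
         - Dx P p + beta * p.2 * v2 p),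
      (forall p, U p ->
         Dt v2 p + v1 p * Dx v2 p + v2 p * Dy v2 p =
         - Dy P p - beta * p.2 * v1 p),
      (forall p, U p -> Dx v1 p + Dy v2 p = 0) &
      (forall t x, v2 (t, x, y1) = 0 /\ v2 (t, x, y2) = 0)].

(* Main.v *)
Require Import Defs.
From HB Require Import structures.
From mathcomp Require Import all_boot all_order all_algebra.
From mathcomp Require Import all_classical all_reals all_analysis.
From mathcomp Require Import complex.
From mathcomp Require Import ring lra measurable_realfun.
Set Implicit Arguments.
Unset Strict Implicit.
Unset Printing Implicit Defensive.
Import Order.TTheory GRing.Theory Num.Theory.
Import numFieldNormedType.Exports.
Local Open Scope classical_set_scope.
Local Open Scope ring_scope.

(** By Galilean invariance the wave speed can be kept equal to c0 for all
    amplitudes. It is then enough to find, in the frame that moves with the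
    speed c0, steady flows close to the shear flow U = u - c0 that depend on x.
    A stream function psi, constant on the walls, with Lap psi =
    beta y + F(psi) for some function F yields such a flow, with the velocity
    (psi_y, - psi_x) and an explicit pressure ([steady_euler]).

    The hypothesis on c0 is first made classical ([spectrum_classical]). A
    value of u at an interior point y0 is never in the resolvent set: on data
    whose second derivative jumps at y0, the equation would force a pole at y0
    on a square integrable function. So an isolated point of the spectrum lies
    off the range of u, unless u is constant, in which case the eigenfunction
    vanishes because beta <> 0. Off the range, with q0 =
    (u'' - beta) / (u - c0), the eigenvalue equation is phi'' =
    (q0 + (k alpha)^2) phi with phi = 0 on the walls. The largest such k is
    used; with kap = k alpha the modes cos (n kap x), n >= 2, are then not
    resonant.

    As U has no zero, the stream function psi0 of the shear flow is
    injective, so psi0'' = beta y + F(psi0) for a function F on its range, and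
    F'(psi0) = q0: the linearisation at psi0 has the kernel
    phi(y) cos (kap x), from which waves bifurcate. To have a nonlinearity
    defined everywhere and as regular as possible, F is replaced by a
    polynomial P close to F together with its derivatives ([poly_approx]);
    this only moves the shear flow a little, but destroys the exact resonance.
    A parameter restores it: for a suitable polynomial G the vorticity
    functions P + mu G give shear flows for which the solution s_mu of the
    mode 1 equation with s(y1) = 0, s'(y1) = 1 changes its sign at y2 as mu
    varies ([shear_family], by the integral identity [transversal_id]).

    Over each of these shear flows there is a wave psi_mu + a v with
    v = s_mu cos (kap x) + O(a), a sum of cosines for which the modes 0 and
    n >= 2 satisfy all conditions, while mode 1 is allowed to be nonzero at y2
    ([nonlinear_waves]). It is obtained by iteration in a weighted norm on
    lists of cosine terms, uniformly in mu. The remaining equation is scalar: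
    the value of mode 1 at y2 is continuous in mu and, for small a, has the
    signs of s_mu(y2), so that it vanishes for some mu ([steady_waves]).

    All derivatives of the wave are polynomials in a, mu, y, psi_mu, psi_mu'
    and the x-derivatives of v and v_y, whence bounds uniform in a
    ([sem_CB]): the wave is close to the shear flow with as many
    derivatives as desired. These are weak derivatives by integration by
    parts ([weak_deriv_ex]), and the Gagliardo seminorm of a Lipschitz
    function is bounded by a sum over dyadic shells ([gagliardo_bound]), so
    that the flow is close in the Sobolev norm ([Hs_bound]). *)

(** * Derivatives, mean value estimates and function series *)

Section Calc.
Context {R : realType}.
Implicit Types (f g : R -> R) (a b x y K C e r : R).

Lemma is_derive_cont f x d : is_derive x 1 f d -> {for x, continuous f}.
Proof.
by move=> [fd _]; apply: differentiable_continuous; apply/derivable1_diffP.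
Qed.

Lemma is_derive_eps f x d : (forall e, 0 < e -> exists2 r, 0 < r &
    forall h, `|h| < r -> `|f (x + h) - f x - h * d| <= e * `|h|) ->
  is_derive x 1 f d.
Proof.
move=> H.
have K : (fun h => h^-1 *: ((f \o shift x) (h *: 1) - f x)) @ 0^' --> d.
  apply/cvgrPdist_le => e e0; have [r r0 Hr] := H e e0.
  near=> h.
  have h0 : h != 0 by near: h; exact: nbhs_dnbhs_neq.
  have hr : `|h| < r.
    near: h; apply: dnbhs0_lt; exact: r0.
  rewrite /= /GRing.scale /= mulr1 (addrC h).
  have -> : d - h^-1 * (f (x + h) - f x) = - (h^-1 * (f (x + h) - f x - h * d)).
    by field.
  rewrite normrN normrM normfV mulrC ler_pdivrMr ?normr_gt0 //.
  exact: Hr.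
apply: DeriveDef; first by apply/cvg_ex; exists d.
exact: cvg_lim K.
Unshelve. all: end_near.
Qed.

Lemma eps_is_derive f x d : is_derive x 1 f d -> forall e, 0 < e ->
  exists2 r, 0 < r &
    forall h, `|h| < r -> `|f (x + h) - f x - h * d| <= e * `|h|.
Proof.
move=> [fd fE] e e0.
have : (fun h => h^-1 *: ((f \o shift x) (h *: 1) - f x)) @ 0^' --> d.
  by rewrite -fE; exact: fd.
move/cvgrPdist_le => /(_ e e0).
move=> [r /= r0 Hr]; exists r => // h hr.
have [->|h0] := eqVneq h 0; first by rewrite addr0 subrr mul0r subrr normr0 mulr0.
have := Hr h; rewrite /ball_ /= sub0r normrN => /(_ hr h0).
rewrite /GRing.scale /= mulr1 (addrC h).
have -> : d - h^-1 * (f (x + h) - f x) = - (h^-1 * (f (x + h) - f x - h * d)).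
  by field.
by rewrite normrN normrM normfV mulrC ler_pdivrMr ?normr_gt0.
Qed.

Lemma der_eq f x d d' : is_derive x 1 f d -> d = d' -> is_derive x 1 f d'.
Proof. by move=> ? <-. Qed.

Lemma der_cst c x : is_derive x 1 (fun=> c) (0 : R).
Proof. exact: is_derive_cst. Qed.

Lemma der_id x : is_derive x 1 (fun y => y) (1 : R).
Proof. exact: is_derive_id. Qed.

Lemma der_add f g x d d' : is_derive x 1 f d -> is_derive x 1 g d' ->
  is_derive x 1 (fun y => f y + g y) (d + d').
Proof. by move=> *; exact: is_deriveD. Qed.

Lemma der_sub f g x d d' : is_derive x 1 f d -> is_derive x 1 g d' ->
  is_derive x 1 (fun y => f y - g y) (d - d').
Proof. by move=> *; exact: is_deriveB. Qed.

Lemma der_mul f g x d d' : is_derive x 1 f d -> is_derive x 1 g d' ->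
  is_derive x 1 (fun y => f y * g y) (d * g x + f x * d').
Proof.
move=> df dg; apply: (der_eq (is_deriveM df dg)).
by rewrite /GRing.scale /= addrC (mulrC d).
Qed.

Lemma der_scale c f x d : is_derive x 1 f d ->
  is_derive x 1 (fun y => c * f y) (c * d).
Proof. by move=> df; apply: (der_eq (der_mul (der_cst c x) df)); rewrite mul0r add0r. Qed.

Lemma der_opp f x d : is_derive x 1 f d -> is_derive x 1 (fun y => - f y) (- d).
Proof. by move=> df; exact: is_deriveN. Qed.

Lemma der_comp f g x d d' : is_derive (g x) 1 f d -> is_derive x 1 g d' ->
  is_derive x 1 (fun y => f (g y)) (d' * d).
Proof.
move=> df dg; apply: (der_eq (is_derive1_comp df dg)); by rewrite mulrC.
Qed.

Lemma der_inv f x d : f x != 0 -> is_derive x 1 f d ->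
  is_derive x 1 (fun y => (f y)^-1) (- d / f x ^+ 2).
Proof.
move=> fx df; apply: (der_eq (is_deriveV fx df)).
by rewrite /GRing.scale /= mulNr mulrC -mulNr.
Qed.

Lemma mvt_eq f f' a b : a < b ->
  (forall x, a <= x <= b -> {for x, continuous f}) ->
  (forall x, a < x < b -> is_derive x 1 f (f' x)) ->
  exists2 c, a < c < b & f b - f a = f' c * (b - a).
Proof.
move=> ab fc fd.
have H1 x : x \in `]a, b[%R -> is_derive x 1 f (f' x) by rewrite in_itv; exact: fd.
have H2 : {within `[a, b], continuous f}.
  apply/continuous_within_itvP => //; split.
  - by move=> x; rewrite in_itv /= => /andP[h1 h2]; apply: fc; rewrite !ltW.
  - by apply: cvg_at_right_filter; apply: fc; rewrite lexx ltW.
  - by apply: cvg_at_left_filter; apply: fc; rewrite lexx ltW.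
by have [c cab E] := MVT ab H1 H2; exists c => //; move: cab; rewrite in_itv.
Qed.

Lemma mvt_ge0 f f' a b : a <= b ->
  (forall x, a <= x <= b -> {for x, continuous f}) ->
  (forall x, a < x < b -> is_derive x 1 f (f' x)) ->
  (forall x, a < x < b -> 0 <= f' x) -> f a <= f b.
Proof.
rewrite le_eqVlt => /orP[/eqP-> //|ab] fc fd f0.
have [c cab E] := mvt_eq ab fc fd.
by rewrite -subr_ge0 E mulr_ge0 ?f0 // subr_ge0 ltW.
Qed.

Lemma mvt_abs f f' K a b : 0 <= K ->
  (forall x, Num.min a b <= x <= Num.max a b -> is_derive x 1 f (f' x)) ->
  (forall x, Num.min a b <= x <= Num.max a b -> `|f' x| <= K) ->
  `|f b - f a| <= K * `|b - a|.
Proof.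
move=> K0; wlog ab : a b / a <= b => [H|].
  have [ab|ab] := leP a b.
    by move=> *; apply: H => //; rewrite ?min_l ?max_r.
  move=> fd fK; rewrite distrC (distrC b); apply: H; rewrite ?(ltW ab) //.
    by move=> x; rewrite (min_l (ltW ab)) (max_r (ltW ab)); exact: fd.
  by move=> x; rewrite (min_l (ltW ab)) (max_r (ltW ab)); exact: fK.
rewrite min_l // max_r // => fd fK.
move: ab; rewrite le_eqVlt => /orP[/eqP->|ab]; first by rewrite !subrr normr0 mulr0.
have fc x : a <= x <= b -> {for x, continuous f}.
  by move=> xab; apply: is_derive_cont; exact: fd.
have fd' x : a < x < b -> is_derive x 1 f (f' x).
  by move=> /andP[? ?]; apply: fd; rewrite !ltW.
have [c /andP[ac cb] ->] := mvt_eq ab fc fd'.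
by rewrite normrM ler_wpM2r // fK // !ltW.
Qed.

Lemma mvt_le f f' K a b : a <= b -> 0 <= K ->
  (forall x, a <= x <= b -> is_derive x 1 f (f' x)) ->
  (forall x, a <= x <= b -> `|f' x| <= K) ->
  `|f b - f a| <= K * (b - a).
Proof.
move=> ab K0 fd fK; have := @mvt_abs f f' K a b K0.
by rewrite (min_l ab) (max_r ab) (ger0_norm (x := b - a)) ?subr_ge0 //; apply.
Qed.

(** The integrals from the base points m < min (a, x) differ by constants from
    each other, so that after subtraction of their value at a they patch together. *)
Lemma antiderivative f a : continuous f ->
  exists F, F a = 0 /\ forall x, is_derive x 1 F (f x).
Proof.
move=> fc.
have fi c d : (@lebesgue_measure R).-integrable `[c, d] (EFin \o f).
  by apply: continuous_compact_integrable;
    [exact: segment_compact|exact: continuous_subspaceT].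
pose G m (x : R) := \int[@lebesgue_measure R]_(t in `[m, x]) f t.
have Gd m x : m < x -> is_derive x 1 (G m) (f x).
  move=> mx.
  have := @continuous_FTC1 R f (BLeft m) x (x + 1).
  rewrite ltrDl ltr01 => /(_ isT (fi _ _)) /=.
  rewrite lte_fin => /(_ mx (fc x)) [d1 d2].
  by split; [exact: d1|rewrite -derive1E; exact: d2].
have Gs m n x : m < Num.min a x -> n < Num.min a x -> G m x - G m a = G n x - G n a.
  rewrite !lt_min => /andP[ma mx] /andP[na nx].
  suff : `|(G m x - G n x) - (G m a - G n a)| <= 0 * `|x - a|.
    rewrite mul0r normr_le0 => /eqP; lra.
  apply: (@mvt_abs (fun z => G m z - G n z) (fun z => f z - f z)) => // z.
    move=> /andP[]; rewrite ge_min => zax _.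
    have [mz nz] : m < z /\ n < z by case/orP: zax => zz; split; lra.
    by apply: is_deriveB; exact: Gd.
  by rewrite subrr normr0.
pose F x := G (Num.min a x - 1) x - G (Num.min a x - 1) a.
exists F; split; first by rewrite /F subrr.
move=> x; pose m := Num.min a x - 2.
have FE : \forall y \near x, G m y - G m a = F y.
  have h1 : Num.min a x <= a by rewrite ge_min lexx.
  have h2 : Num.min a x <= x by rewrite ge_min lexx orbT.
  near=> y.
  have h3 : x - 1 < y by near: y; apply: lt_nbhsr; rewrite ltrBlDr ltrDl.
  by apply: Gs; [rewrite lt_min /m; apply/andP; split; lra|rewrite ltrBlDr ltrDl].
apply: near_eq_is_derive FE _.
have -> : f x = f x - 0 by rewrite subr0.
apply: is_deriveB; apply: Gd.
by rewrite /m; have h2 : Num.min a x <= x by [rewrite ge_min lexx orbT]; lra.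
Unshelve. all: end_near.
Qed.

Definition sumser (t : nat -> R) : R := limn (series t).

(** All series below are dominated by C 2^-k: this single geometric majorant
    serves for convergence, continuity and differentiability. *)
Lemma sumser_tail (t : nat -> R) C : (forall k, `|t k| <= C * 2^-1 ^+ k) ->
  forall n, `|sumser t - \sum_(0 <= k < n) t k| <= 2 * C * 2^-1 ^+ n.
Proof.
move=> tC.
have C0 : 0 <= C by have := tC 0%N; rewrite expr0 mulr1; apply: le_trans.
have tc : cvgn (series t).
  apply: normed_cvg; apply: (@series_le_cvg R _ (geometric C 2^-1)).
  - by move=> n /=.
  - by move=> n /=; rewrite mulr_ge0 // exprn_ge0 // invr_ge0.
  - by move=> n; exact: tC.
  - by apply: is_cvg_geometric_series; rewrite ger0_norm ?invr_ge0 // invf_lt1 // ltr1n.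
have D n m : (n <= m)%N -> `|series t m - series t n| <= 2 * C * 2^-1 ^+ n.
  move=> nm.
  suff : `|series t m - series t n| <= 2 * C * 2^-1 ^+ n - 2 * C * 2^-1 ^+ m.
    move/le_trans; apply; rewrite gerBl !mulr_ge0 // exprn_ge0 // invr_ge0 //.
  elim: m nm => [|m IH]; first by rewrite leqn0 => /eqP->; rewrite !subrr normr0.
  rewrite leq_eqVlt => /orP[/eqP->|]; first by rewrite !subrr normr0.
  rewrite ltnS => /IH {}IH.
  have -> : series t m.+1 = series t m + t m by rewrite /series /= big_nat_recr.
  rewrite addrAC; apply: le_trans (ler_normD _ _) _.
  apply: le_trans (lerD IH (tC m)) _.
  by rewrite exprS le_eqVlt; apply/orP; left; apply/eqP; field.
move=> n; rewrite -/(series t n).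
have K : `|series t m - series t n| @[m --> \oo] --> `|sumser t - series t n|.
  by apply: cvg_norm; apply: cvgB; [exact: tc|exact: cvg_cst].
apply: (cvgr_to_le K).
by near=> m; apply: D; near: m; exact: nbhs_infty_ge.
Unshelve. all: end_near.
Qed.

Lemma half_pow_small (C e : R) : 0 < e -> exists n, C * 2^-1 ^+ n <= e.
Proof.
move=> e0.
have := @cvg_geometric R C 2^-1.
rewrite ger0_norm ?invr_ge0 // invf_lt1 // ltr1n => /(_ isT).
move/cvgrPdist_le => /(_ e e0) [n _ /(_ n (leqnn n))] /=.
by rewrite sub0r normrN => H; exists n; apply: le_trans (ler_norm _) _.
Qed.

Lemma unif_cont (X : topologicalType) (f : X -> R) (p : X) :
  (forall e, 0 < e -> exists g : X -> R, {for p, continuous g} /\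
     forall z, `|f z - g z| <= e) -> {for p, continuous f}.
Proof.
move=> H; apply/cvgrPdist_le => e e0.
have e3 : 0 < e / 3 by rewrite divr_gt0.
have [g [/cvgrPdist_le/(_ _ e3) gc fg]] := H _ e3.
near=> y.
have -> : f p - f y = (f p - g p) + (g p - g y) + (g y - f y) by ring.
have -> : e = e / 3 + e / 3 + e / 3 by field.
apply: le_trans (ler_normD _ _) _; apply: lerD; last by rewrite distrC.
apply: le_trans (ler_normD _ _) _; apply: lerD; first exact: fg.
by near: y.
Unshelve. all: end_near.
Qed.

Lemma sumser_cont (X : topologicalType) (t : nat -> X -> R) C (p : X) :
  (forall k z, `|t k z| <= C * 2^-1 ^+ k) ->
  (forall k, {for p, continuous (t k)}) ->
  {for p, continuous (fun z => sumser (t ^~ z))}.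
Proof.
move=> tC tc; apply: unif_cont => e e0.
have [n Hn] := half_pow_small (2 * C) e0.
exists (fun z => \sum_(0 <= k < n) t k z); split.
  elim: n {Hn} => [|n IH].
    have -> : (fun z => \sum_(0 <= k < 0) t k z) = cst 0.
      by apply/funext => z; rewrite big_nil.
    exact: cvg_cst.
  have -> : (fun z => \sum_(0 <= k < n.+1) t k z) =
            (fun z => \sum_(0 <= k < n) t k z + t n z).
    by apply/funext => z; rewrite big_nat_recr.
  by apply: continuousD; [exact: IH|exact: tc].
move=> y; apply: le_trans (sumser_tail _ n) Hn => k; exact: tC.
Qed.

(** The mean value estimate bounds the difference quotients of the tail of the
    series of t by the tail of the series of t', so that only finitely many
    terms matter. *)
Lemma sumser_der (t t' : nat -> R -> R) C a b :
  (forall k x, a < x < b -> is_derive x 1 (t k) (t' k x)) ->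
  (forall k x, a < x < b -> `|t k x| <= C * 2^-1 ^+ k) ->
  (forall k x, a < x < b -> `|t' k x| <= C * 2^-1 ^+ k) ->
  forall x, a < x < b ->
  is_derive x 1 (fun y => sumser (t ^~ y)) (sumser (t' ^~ x)).
Proof.
move=> td tC t'C x xab; apply: is_derive_eps => e e0.
have e3 : 0 < e / 3 by rewrite divr_gt0.
have [n Hn] := half_pow_small (2 * C) e3.
pose S m y := \sum_(0 <= k < m) t k y; pose S' m y := \sum_(0 <= k < m) t' k y.
have Sd m y : a < y < b -> is_derive y 1 (S m) (S' m y).
  move=> yab; rewrite /S /S'; elim: m => [|m IH].
    under eq_fun do rewrite big_nil; rewrite big_nil; exact: is_derive_cst.
  by under eq_fun do rewrite big_nat_recr //=; rewrite big_nat_recr //=; apply: is_deriveD; exact: td.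
have [r r0 Hr] := eps_is_derive (Sd n x xab) e3.
have C0 : 0 <= C.
  by have := tC 0%N x xab; rewrite expr0 mulr1; apply: le_trans.
have D m y : (n <= m)%N -> a < y < b ->
    `|(S m y - S n y) - (S m x - S n x)| <= e / 3 * `|y - x|.
  move=> nm yab.
  apply: (@mvt_abs (fun z => S m z - S n z) (fun z => S' m z - S' n z)).
  - exact: ltW.
  - move=> z zxy; have zab : a < z < b by move: zxy; rewrite ge_min le_max; lra.
    by apply: is_deriveB; exact: Sd.
  - move=> z zxy; have zab : a < z < b by move: zxy; rewrite ge_min le_max; lra.
    apply: le_trans Hn.
    suff : `|S' m z - S' n z| <= 2 * C * 2^-1 ^+ n - 2 * C * 2^-1 ^+ m.
      move/le_trans; apply; rewrite gerBl !mulr_ge0 // exprn_ge0 // invr_ge0 //.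
    elim: m nm => [|m IH]; first by rewrite leqn0 => /eqP->; rewrite !subrr normr0.
    rewrite leq_eqVlt => /orP[/eqP->|]; first by rewrite !subrr normr0.
    rewrite ltnS => /IH {}IH.
    have -> : S' m.+1 z = S' m z + t' m z by rewrite /S' big_nat_recr.
    rewrite addrAC; apply: le_trans (ler_normD _ _) _.
    apply: le_trans (lerD IH (t'C m z zab)) _.
    by rewrite exprS le_eqVlt; apply/orP; left; apply/eqP; field.
have DD y : a < y < b ->
    `|(sumser (t ^~ y) - S n y) - (sumser (t ^~ x) - S n x)| <= e / 3 * `|y - x|.
  move=> yab; apply/ler_addgt0Pr => d d0.
  have d2 : 0 < d / 2 by rewrite divr_gt0.
  have [m Hm] := half_pow_small (2 * C) d2.
  pose M := maxn n m.
  have HM : 2 * C * 2^-1 ^+ M <= d / 2.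
    apply: le_trans Hm; rewrite ler_wpM2l ?mulr_ge0 //.
    by rewrite ler_wiXn2l ?invr_ge0 ?invf_le1 ?ler1n ?ltr0n // leq_maxr.
  have T z : a < z < b -> `|sumser (t ^~ z) - S M z| <= d / 2.
    by move=> zab; apply: le_trans HM; apply: sumser_tail => k; exact: tC.
  have := D M y (leq_maxl _ _) yab.
  have := T y yab; have := T x xab.
  set s1 := sumser _; set s2 := sumser _.
  rewrite !ler_norml; lra.
exists (Num.min r (Num.min (x - a) (b - x))).
  by rewrite !lt_min r0 !subr_gt0.
move=> h; rewrite !lt_min => /and3P[hr h1 h2].
have xhab : a < x + h < b.
  by move: h1 h2; rewrite !ltr_norml; lra.
have := DD _ xhab; have := Hr h hr; rewrite (_ : x + h - x = h); last by ring.
have : `|h * (sumser (t' ^~ x) - S' n x)| <= e / 3 * `|h|.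
  rewrite normrM mulrC ler_wpM2r //.
  by apply: le_trans Hn; apply: sumser_tail => k; exact: t'C.
rewrite /S'; set s1 := sumser _; set s2 := sumser _; set s3 := sumser _.
have -> : e * `|h| = e / 3 * `|h| + e / 3 * `|h| + e / 3 * `|h| by field.
rewrite !ler_norml; lra.
Qed.

End Calc.

Section Cont.
Context {R : realType} {X : topologicalType}.
Implicit Types (f g : X -> R) (p : X).

Lemma c_cst (c : R) p : continuous_at p (fun _ : X => c).
Proof. exact: cvg_cst. Qed.

Lemma c_add f g p : continuous_at p f -> continuous_at p g ->
  continuous_at p (fun z => f z + g z).
Proof. by move=> *; apply: continuousD. Qed.

Lemma c_sub f g p : continuous_at p f -> continuous_at p g ->
  continuous_at p (fun z => f z - g z).
Proof. by move=> *; apply: continuousB. Qed.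

Lemma c_opp f p : continuous_at p f -> continuous_at p (fun z => - f z).
Proof. by move=> *; apply: continuousN. Qed.

Lemma c_mul f g p : continuous_at p f -> continuous_at p g ->
  continuous_at p (fun z => f z * g z).
Proof. by move=> *; apply: continuousM. Qed.

Lemma c_comp (h : R -> R) f p : continuous_at (f p) h -> continuous_at p f ->
  continuous_at p (fun z => h (f z)).
Proof. by move=> hc fc; apply: (@continuous_comp _ _ _ f h). Qed.

Lemma c_abs f p : continuous_at p f -> continuous_at p (fun z => `|f z|).
Proof. by move=> fc; apply: (@c_comp (fun z : R => `|z|)) => //; exact: norm_continuous. Qed.

Lemma c_id (x : R) : continuous_at x (fun y : R => y).
Proof. exact: cvg_id. Qed.
End Cont.
Arguments c_cst {R X} c p.
Arguments c_id {R} x.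
Arguments c_add {R X f g p} _ _.
Arguments c_sub {R X f g p} _ _.
Arguments c_mul {R X f g p} _ _.
Arguments c_opp {R X f p} _.
Arguments c_abs {R X f p} _.
Arguments c_comp {R X h f p} _ _.

(** * Second order equations on an interval *)

Section Clamp.
Context {R : realType} (y1 y2 : R).
Hypothesis hy : y1 < y2.
(** Functions on [y1, y2] are extended by composition with [clamp], so
    that the solutions below are differentiable on the whole line. *)
Definition clamp (y : R) : R := Num.max y1 (Num.min y y2).

Lemma clampI y : y1 <= clamp y <= y2.
Proof. by rewrite le_max lexx /= ge_max (ltW hy) ge_min lexx orbT. Qed.

Lemma clamp_id y : y1 <= y <= y2 -> clamp y = y.
Proof. by move=> /andP[h1 h2]; rewrite /clamp min_l // max_r. Qed.

Lemma clamp_cont : continuous clamp.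
Proof.
move=> y.
have -> : clamp = fun y => ((y1 + (y + y2 - `|y - y2|) / 2) +
    `|y1 - (y + y2 - `|y - y2|) / 2|) / 2.
  by apply/funext => z; rewrite /clamp maxr_absE minr_absE.
have mc : {for y, continuous (fun z : R => (z + y2 - `|z - y2|) / 2)}.
  apply: c_mul; last exact: c_cst.
  apply: c_sub; first exact: c_add (c_id _) (c_cst _ _).
  by apply: c_abs; exact: c_sub (c_id _) (c_cst _ _).
apply: c_mul; last exact: c_cst.
apply: c_add; first exact: c_add (c_cst _ _) mc.
by apply: c_abs; exact: c_sub (c_cst _ _) mc.
Qed.

Lemma comp_clamp_cont (f : R -> R) : continuous f -> continuous (f \o clamp).
Proof. by move=> fc y; apply: continuous_comp; [exact: clamp_cont|exact: fc]. Qed.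
End Clamp.

Section Prim.
Context {R : realType}.
Definition prim (a : R) (f : R -> R) : R -> R :=
  xget (cst 0) [set F | F a = 0 /\ forall x : R, is_derive x 1 F (f x)].

Lemma primP (a : R) f : continuous f ->
  prim a f a = 0 /\ forall x : R, is_derive x 1 (prim a f) (f x).
Proof.
move=> fc; have [F HF] := antiderivative a fc.
exact: (@xgetPex _ (cst 0) [set F | F a = 0 /\ forall x : R, is_derive x 1 F (f x)]
  (ex_intro _ F HF)).
Qed.
End Prim.

Section ODE.
Context {R : realType} (y1 y2 : R).
Hypothesis hy : y1 < y2.
Local Notation clamp := (clamp y1 y2).
Local Notation len := (y2 - y1).
Implicit Types (w h : R -> R) (y K e r lam m k F A B : R).

(** The equation w'' = h on the interval, with h frozen at its end values
    outside. *)
Definition sec h w w1 := (forall y, is_derive y 1 w (w1 y)) /\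
  (forall y, is_derive y 1 w1 (h (clamp y))).

Lemma sec_cont h w w1 : sec h w w1 -> continuous w /\ continuous w1.
Proof. by move=> [H1 H2]; split=> y; apply: is_derive_cont. Qed.

Lemma compare1 w w1 b b1 :
  (forall y, y1 <= y <= y2 -> is_derive y 1 w (w1 y)) ->
  (forall y, y1 <= y <= y2 -> is_derive y 1 b (b1 y)) ->
  `|w y1| <= b y1 ->
  (forall y, y1 <= y <= y2 -> `|w1 y| <= b1 y) ->
  forall y, y1 <= y <= y2 -> `|w y| <= b y.
Proof.
move=> dw db w0 wb y yI.
have sub z : y1 <= z <= y -> y1 <= z <= y2 by move: yI; lra.
have dp z : y1 <= z <= y -> is_derive z 1 (fun t => b t + w t) (b1 z + w1 z).
  by move=> zy; apply: is_deriveD; [apply: db|apply: dw]; exact: sub.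
have dm z : y1 <= z <= y -> is_derive z 1 (fun t => b t - w t) (b1 z - w1 z).
  by move=> zy; apply: is_deriveB; [apply: db|apply: dw]; exact: sub.
have y1y : y1 <= y by case/andP: yI.
have P : b y1 + w y1 <= b y + w y.
  apply: (mvt_ge0 y1y (f := fun z => b z + w z) (f' := fun z => b1 z + w1 z)).
  - by move=> z zy; exact: is_derive_cont (dp z zy).
  - by move=> z /andP[h1 h2]; apply: dp; rewrite !ltW.
  - move=> z zy; have := wb z _; rewrite ler_norml; move: zy yI; lra.
have M : b y1 - w y1 <= b y - w y.
  apply: (mvt_ge0 y1y (f := fun z => b z - w z) (f' := fun z => b1 z - w1 z)).
  - by move=> z zy; exact: is_derive_cont (dm z zy).
  - by move=> z /andP[h1 h2]; apply: dm; rewrite !ltW.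
  - move=> z zy; have := wb z _; rewrite ler_norml; move: zy yI; lra.
by move: w0; rewrite !ler_norml; lra.
Qed.

(** The majorant [m e^(lam (y - y1)) / lam^2 + e (y - y1)^2 / 2] of a solution
    with |w''| <= m e^(lam (y - y1)) + e. *)
Lemma exp_major w w1 w2 m e lam : 0 <= m -> 0 <= e -> 0 < lam ->
  w y1 = 0 -> w1 y1 = 0 ->
  (forall y, y1 <= y <= y2 -> is_derive y 1 w (w1 y)) ->
  (forall y, y1 <= y <= y2 -> is_derive y 1 w1 (w2 y)) ->
  (forall y, y1 <= y <= y2 -> `|w2 y| <= m * expR (lam * (y - y1)) + e) ->
  forall y, y1 <= y <= y2 ->
   `|w y| <= m / lam ^+ 2 * expR (lam * (y - y1)) + e * (y - y1) ^+ 2 / 2 /\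
   `|w1 y| <= m / lam * expR (lam * (y - y1)) + e * (y - y1).
Proof.
move=> m0 e0 l0 w0 w10 dw dw1 w2b.
have dl (y : R) : is_derive y 1 (fun y => y - y1) (1 : R).
  by apply: (der_eq (der_sub (der_id y) (der_cst y1 y))); rewrite subr0.
have dE (c y : R) : is_derive y 1 (fun y => c * expR (lam * (y - y1)))
    (c * lam * expR (lam * (y - y1))).
  apply: (der_eq (der_scale c (der_comp (is_derive_expR _) (der_scale lam (dl y))))).
  by rewrite mulr1 mulrA.
have W1 y : y1 <= y <= y2 -> `|w1 y| <= m / lam * expR (lam * (y - y1)) + e * (y - y1).
  apply: (compare1 (b := fun y => m / lam * expR (lam * (y - y1)) + e * (y - y1)) (b1 := fun y => m * expR (lam * (y - y1)) + e) dw1) => //.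
  - move=> z _; apply: der_eq (der_add (dE _ z) (der_scale e (dl z))) _.
    by rewrite mulr1 divfK // gt_eqF.
  - by rewrite w10 normr0 subrr !mulr0 addr0 expR0 mulr1 divr_ge0 // ltW.
move=> y yI; split; last exact: W1.
move: y yI.
apply: (compare1 (b := fun y => m / lam ^+ 2 * expR (lam * (y - y1)) + e * (y - y1) ^+ 2 / 2) (b1 := fun y => m / lam * expR (lam * (y - y1)) + e * (y - y1)) dw) => //.
- move=> z _.
  have -> : (fun y => m / lam ^+ 2 * expR (lam * (y - y1)) + e * (y - y1) ^+ 2 / 2) =
    (fun y => m / lam ^+ 2 * expR (lam * (y - y1)) + e / 2 * ((y - y1) * (y - y1))).
    by apply/funext => t; field; rewrite gt_eqF.
  apply: der_eq (der_add (dE _ z) (der_scale _ (der_mul (dl z) (dl z)))) _.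
  by field; rewrite gt_eqF.
- rewrite w0 normr0 subrr expr0n /= !mulr0 mul0r addr0 expR0 mulr1.
  by rewrite divr_ge0 // exprn_ge0 // ltW.
Qed.

(** A Gronwall constant, generous enough for a solution and its derivative. *)
Definition gC K := (1 + len) ^+ 2 * (1 + K) * expR ((2 * K + 1) * len).

Lemma gC_ge0 K : 0 <= K -> 0 <= gC K.
Proof.
move=> K0; rewrite /gC mulr_ge0 ?expR_ge0 // mulr_ge0 ?addr_ge0 //.
by rewrite exprn_ge0 // addr_ge0 // subr_ge0 ltW.
Qed.

Lemma gC_major K e y : 0 <= K -> 0 <= e -> y1 <= y <= y2 ->
  let lam := 2 * K + 1 in let m := e * len ^+ 2 in
  m * expR (lam * (y - y1)) <= gC K * e /\
  K * m / lam * expR (lam * (y - y1)) + e * (y - y1) <= gC K * e.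
Proof.
move=> K0 e0 yI lam m.
have l1 : 1 <= lam by rewrite /lam; lra.
have E1 : 1 <= expR (lam * len).
  by rewrite -[leLHS]expR0 ler_expR mulr_ge0 //; lra.
have EE : expR (lam * (y - y1)) <= expR (lam * len).
  by rewrite ler_expR ler_wpM2l //; lra.
have len0 : 0 <= len by rewrite subr_ge0 ltW.
have m0 : 0 <= m by rewrite mulr_ge0 // exprn_ge0.
set E := expR (lam * len) in E1 EE; set E' := expR (lam * (y - y1)) in EE *.
have E'0 : 0 <= E' by exact: expR_ge0.
have L2 : 0 <= len ^+ 2 by rewrite exprn_ge0.
have gE : gC K * e = e * E * (1 + 2 * len + len ^+ 2) * (1 + K).
  by rewrite /gC -/lam -/E; ring.
have eE : 0 <= e * E by rewrite mulr_ge0 //; lra.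
have eEL : 0 <= e * E * len by rewrite mulr_ge0.
have eEL2 : 0 <= e * E * len ^+ 2 by rewrite mulr_ge0.
have eK : 0 <= e * E * K by rewrite mulr_ge0.
have eEKL : 0 <= e * E * len * K by rewrite mulr_ge0.
have eEKL2 : 0 <= e * E * len ^+ 2 * K by rewrite mulr_ge0.
have mE : m * E' <= e * E * len ^+ 2.
  have -> : e * E * len ^+ 2 = m * E by rewrite /m; ring.
  by rewrite ler_wpM2l.
have eq1 : e * E * (1 + 2 * len + len ^+ 2) * (1 + K) = e * E + 2 * (e * E * len)
   + e * E * len ^+ 2 + e * E * K + 2 * (e * E * len * K) + e * E * len ^+ 2 * K by ring.
rewrite gE eq1; split; first lra.
have h1 : e * (y - y1) <= e * E * len.
  have : e * (y - y1) <= e * len by rewrite ler_wpM2l //; lra.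
  have : e * len * 1 <= e * len * E by rewrite ler_wpM2l // mulr_ge0.
  lra.
have h2 : K * m / lam * E' <= e * E * len ^+ 2 * K.
  have -> : e * E * len ^+ 2 * K = K * m * E by rewrite /m; ring.
  apply: ler_pM => //.
    by rewrite divr_ge0 ?mulr_ge0 //; lra.
  by rewrite ler_pdivrMr; [rewrite ler_peMr // mulr_ge0|lra].
lra.
Qed.

(** Let m be the maximum of |w| e^(-lam (y - y1)), lam = 2K + 1. By
    [exp_major] the bound m improves itself to K m / lam^2 + e len^2 / 2, and
    K / lam^2 <= 1/2. *)
Lemma gronwall w w1 w2 K e : 0 <= K -> 0 <= e ->
  w y1 = 0 -> w1 y1 = 0 ->
  (forall y, y1 <= y <= y2 -> is_derive y 1 w (w1 y)) ->
  (forall y, y1 <= y <= y2 -> is_derive y 1 w1 (w2 y)) ->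
  (forall y, y1 <= y <= y2 -> `|w2 y| <= K * `|w y| + e) ->
  forall y, y1 <= y <= y2 -> `|w y| <= gC K * e /\ `|w1 y| <= gC K * e.
Proof.
move=> K0 e0 w0 w10 dw dw1 w2b.
pose lam := 2 * K + 1.
have l1 : 1 <= lam by rewrite /lam; lra.
pose g y := `|w y| * expR (- (lam * (y - y1))).
have gc : {within `[y1, y2], continuous g}.
  apply/continuous_within_itvP => //.
  have gcc y : y1 <= y <= y2 -> {for y, continuous g}.
    move=> yI; apply: continuousM.
      by apply: continuous_comp; [exact: is_derive_cont (dw y yI)|exact: norm_continuous].
    apply: continuous_comp; last exact: continuous_expR.
    apply: continuousN; apply: continuousM; first exact: cvg_cst.
    by apply: continuousB; [exact: cvg_id|exact: cvg_cst].
  have h1 : y1 <= y1 <= y2 by rewrite lexx ltW.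
  have h2 : y1 <= y2 <= y2 by rewrite lexx ltW.
  split.
  - by move=> x; rewrite in_itv /= => /andP[a b]; apply: gcc; rewrite !ltW.
  - by apply: cvg_at_right_filter; apply: gcc.
  - by apply: cvg_at_left_filter; apply: gcc.
have [c cI cM] := EVT_max (ltW hy) gc.
rewrite in_itv /= in cI.
pose m := g c.
have m0 : 0 <= m by rewrite /m /g mulr_ge0 // expR_ge0.
have wm y : y1 <= y <= y2 -> `|w y| <= m * expR (lam * (y - y1)).
  move=> yI; have := cM y; rewrite in_itv /= => /(_ yI).
  by rewrite {1}/g expRN ler_pdivrMr // expR_gt0.
have Km0 : 0 <= K * m by rewrite mulr_ge0.
have l0 : 0 < lam by lra.
have M y : y1 <= y <= y2 -> _ := exp_major Km0 e0 l0 w0 w10 dw dw1 _ (y := y).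
have bd y : y1 <= y <= y2 -> `|w2 y| <= K * m * expR (lam * (y - y1)) + e.
  move=> yI; apply: le_trans (w2b y yI) _.
  by rewrite lerD2r -mulrA ler_wpM2l // wm.
have {}M := M bd.
have mle : m <= e * len ^+ 2.
  have [Mc _] := M c cI.
  have Ec : 1 <= expR (lam * (c - y1)).
    by rewrite -[leLHS]expR0 ler_expR mulr_ge0 ?(ltW l0) //; lra.
  set E := expR (lam * (c - y1)) in Mc Ec.
  have wc : `|w c| = m * E by rewrite /m /g expRN divfK // gt_eqF // expR_gt0.
  have Kl : K * m / lam ^+ 2 <= m / 2.
    rewrite ler_pdivrMr ?exprn_gt0 //.
    have -> : m / 2 * lam ^+ 2 = m * (lam ^+ 2 / 2) by field.
    rewrite mulrC ler_wpM2l // /lam.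
    have -> : (2 * K + 1) ^+ 2 / 2 = 2 * K ^+ 2 + 2 * K + 1 / 2 by field.
    have : 0 <= K ^+ 2 by rewrite exprn_ge0.
    lra.
  have h1 : e * (c - y1) ^+ 2 / 2 <= e * len ^+ 2 / 2.
    rewrite ler_wpM2r // ler_wpM2l // ler_sqr ?nnegrE; lra.
  have h2 : K * m / lam ^+ 2 * E <= m / 2 * E by rewrite ler_wpM2r //; lra.
  have h3 : m <= m * E by rewrite ler_peMr.
  move: Mc; rewrite wc; lra.
move=> y yI.
have [h1 h2] := gC_major K0 e0 yI.
have [_ M2] := M y yI.
split.
  apply: le_trans (wm y yI) _; apply: le_trans h1.
  by rewrite ler_wpM2r // expR_ge0.
apply: le_trans M2 _; apply: le_trans h2.
rewrite lerD2r ler_wpM2r ?expR_ge0 // ler_wpM2r ?invr_ge0 ?(ltW l0) //.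
by rewrite ler_wpM2l.
Qed.

Definition I21 h := prim y1 (h \o clamp).
Definition I2 h := prim y1 (I21 h).

Lemma I2P h : continuous (h \o clamp) ->
  [/\ I2 h y1 = 0, I21 h y1 = 0 & sec h (I2 h) (I21 h)].
Proof.
move=> hc; have [h0 hd] := primP y1 hc.
have c1 : continuous (I21 h) by move=> y; exact: is_derive_cont (hd y).
by have [h2 hd2] := primP y1 c1; split.
Qed.

Lemma sec_bound h w w1 e : 0 <= e -> w y1 = 0 -> w1 y1 = 0 -> sec h w w1 ->
  (forall y, y1 <= y <= y2 -> `|h y| <= e) ->
  forall y, y1 <= y <= y2 -> `|w y| <= e * len ^+ 2 / 2.
Proof.
move=> e0 w0 w10 [dw dw1] he y yI.
have d1 z : y1 <= z <= y2 -> is_derive z 1 w (w1 z) by move=> _; exact: dw.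
have d2 z : y1 <= z <= y2 -> is_derive z 1 w1 (h z).
  by move=> zI; have := dw1 z; rewrite clamp_id.
have hb z : y1 <= z <= y2 -> `|h z| <= 0 * expR (1 * (z - y1)) + e.
  by rewrite mul0r add0r; exact: he.
have [+ _] := exp_major (lexx 0) e0 ltr01 w0 w10 d1 d2 hb yI.
rewrite !mul0r add0r => /le_trans; apply.
by rewrite ler_wpM2r // ler_wpM2l // ler_sqr ?nnegrE; lra.
Qed.

Lemma sec_sub h h' w w1 w' w1' : sec h w w1 -> sec h' w' w1' ->
  sec (fun y => h y - h' y) (fun y => w y - w' y) (fun y => w1 y - w1' y).
Proof. by move=> [a b] [c d]; split=> y; exact: der_sub. Qed.

(** Picard iteration in the norm weighted by e^(-lam (y - y1)), lam = 2K + 1,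
    for which the double integral of a K-Lipschitz term is a contraction on
    the whole interval. *)
Lemma ivp (Phi : R -> R -> R) r K e : 0 <= K -> 0 <= e -> gC K * e <= r ->
  (forall w, continuous w -> continuous (fun y => Phi (clamp y) (w (clamp y)))) ->
  (forall y a b, y1 <= y <= y2 -> `|a| <= r -> `|b| <= r ->
     `|Phi y a - Phi y b| <= K * `|a - b|) ->
  (forall y, y1 <= y <= y2 -> `|Phi y 0| <= e) ->
  exists w w1, [/\ w y1 = 0, w1 y1 = 0, sec (fun y => Phi y (w y)) w w1 &
    forall y, y1 <= y <= y2 -> `|w y| <= gC K * e /\ `|w1 y| <= gC K * e].
Proof.
move=> K0 e0 er Pc PL P0.
have r0 : 0 <= r by apply: le_trans er; rewrite mulr_ge0 // gC_ge0.
pose T w := I2 (fun y => Phi y (w y)).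
pose T1 w := I21 (fun y => Phi y (w y)).
have TP w : continuous w ->
    [/\ T w y1 = 0, T1 w y1 = 0 & sec (fun y => Phi y (w y)) (T w) (T1 w)].
  by move=> wc; apply: I2P; exact: Pc.
pose W n := iter n T (fun=> 0).
pose lam := 2 * K + 1; pose D := e * len ^+ 2 / 2.
have l0 : 0 < lam by rewrite /lam; lra.
have len0 : 0 <= len by rewrite subr_ge0 ltW.
have D0 : 0 <= D by rewrite divr_ge0 // mulr_ge0 // exprn_ge0.
pose E y := expR (lam * (y - y1)).
have E1 y : y1 <= y <= y2 -> 1 <= E y.
  by move=> yI; rewrite -[leLHS]expR0 ler_expR mulr_ge0 ?(ltW l0) //; lra.
have DE y : y1 <= y <= y2 -> 2 * D * E y <= r.
  move=> yI; apply: le_trans er.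
  by have [+ _] := gC_major K0 e0 yI; rewrite /D -/lam -/(E y); lra.
have Wc n : continuous (W n).
  elim: n => [|n IH]; first by move=> y; exact: c_cst.
  by have [_ _ /sec_cont[]] := TP _ IH.
have W0r : `|0 : R| <= r by rewrite normr0.
have h2k n : 0 <= 2^-1 ^+ n :> R by rewrite exprn_ge0 // invr_ge0.
have main n : (forall y, y1 <= y <= y2 -> `|W n y| <= 2 * D * E y * (1 - 2^-1 ^+ n)) /\
    (forall y, y1 <= y <= y2 -> `|W n.+1 y - W n y| <= D * 2^-1 ^+ n * E y).
  elim: n => [|n [IH1 IH2]].
    split=> y yI; first by rewrite expr0 subrr mulr0 normr0.
    have [w0 w10 ws] := TP (W 0%N) (Wc 0%N).
    rewrite subr0 expr0 mulr1.
    apply: le_trans (_ : _ <= D) _; last by rewrite ler_peMr // E1.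
    exact: sec_bound e0 w0 w10 ws P0 y yI.
  have B1 y : y1 <= y <= y2 -> `|W n.+1 y| <= 2 * D * E y * (1 - 2^-1 ^+ n.+1).
    move=> yI; have := IH1 y yI; have := IH2 y yI.
    have := ler_normD (W n.+1 y - W n y) (W n y); rewrite subrK exprS.
    have -> : 2 * D * E y * (1 - 2^-1 * 2^-1 ^+ n) =
      2 * D * E y * (1 - 2^-1 ^+ n) + D * 2^-1 ^+ n * E y by field.
    lra.
  split=> // y yI.
  have Wr (m : nat) z : `|W m z| <= 2 * D * E z * (1 - 2^-1 ^+ m) ->
      y1 <= z <= y2 -> `|W m z| <= r.
    move=> h zI; apply: le_trans h _; apply: le_trans (DE z zI).
    rewrite ler_piMr ?gerBl //.
    by rewrite !mulr_ge0 // expR_ge0.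
  have [w0 w10 ws] := TP (W n) (Wc n); have [v0 v10 vs] := TP (W n.+1) (Wc n.+1).
  have [dw dw1] := sec_sub vs ws.
  have m0 : 0 <= K * (D * 2^-1 ^+ n) by rewrite !mulr_ge0.
  have d2 z : y1 <= z <= y2 -> is_derive z 1 (fun y => T1 (W n.+1) y - T1 (W n) y)
     (Phi z (W n.+1 z) - Phi z (W n z)).
    by move=> zI; have := dw1 z; rewrite clamp_id.
  have bd z : y1 <= z <= y2 -> `|Phi z (W n.+1 z) - Phi z (W n z)| <=
      K * (D * 2^-1 ^+ n) * expR (lam * (z - y1)) + 0.
    move=> zI; rewrite addr0 -mulrA.
    apply: le_trans (PL _ _ _ zI (Wr _ _ (B1 z zI) zI) (Wr _ _ (IH1 z zI) zI)) _.
    by rewrite ler_wpM2l // IH2.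
  have z0 : T (W n.+1) y1 - T (W n) y1 = 0 by rewrite w0 v0 subrr.
  have z10 : T1 (W n.+1) y1 - T1 (W n) y1 = 0 by rewrite w10 v10 subrr.
  have [+ _] := exp_major m0 (lexx 0) l0 z0 z10 (fun z _ => dw z) d2 bd yI.
  rewrite !mul0r addr0 => /le_trans; apply.
  rewrite -/(E y) ler_wpM2r ?expR_ge0 // ler_pdivrMr ?exprn_gt0 // exprS.
  have -> : D * (2^-1 * 2^-1 ^+ n) * lam ^+ 2 = (D * 2^-1 ^+ n) * (lam ^+ 2 / 2) by field.
  rewrite mulrC ler_wpM2l ?mulr_ge0 // /lam.
  have -> : (2 * K + 1) ^+ 2 / 2 = 2 * K ^+ 2 + 2 * K + 1 / 2 by field.
  have : 0 <= K ^+ 2 by rewrite exprn_ge0.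
  lra.
pose EE := expR (lam * len).
have EEy y : y1 <= y <= y2 -> E y <= EE.
  by move=> yI; rewrite ler_expR ler_wpM2l ?(ltW l0) //; lra.
pose t n y := W n.+1 (clamp y) - W n (clamp y).
have tb n y : `|t n y| <= D * EE * 2^-1 ^+ n.
  have cI := clampI hy y; have [_ /(_ _ cI) h] := main n.
  apply: le_trans h _; rewrite mulrAC ler_wpM2r // ler_wpM2l //; exact: EEy.
pose w y := sumser (t ^~ y).
have tail n y : `|w y - W n (clamp y)| <= 2 * (D * EE) * 2^-1 ^+ n.
  have := sumser_tail (tb ^~ y) n.
  by rewrite (telescope_sumr (fun k : nat => W k (clamp y))) // subr0.
have wc : continuous w.
  move=> y; apply: sumser_cont => // k.
  by apply: c_sub; apply: comp_clamp_cont.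
have Wr n y : y1 <= y <= y2 -> `|W n y| <= r.
  move=> yI; have [/(_ _ yI) h _] := main n; apply: le_trans h _.
  apply: le_trans (DE y yI); rewrite ler_piMr ?gerBl //.
  by rewrite !mulr_ge0 // expR_ge0.
have wr y : y1 <= y <= y2 -> `|w y| <= r.
  move=> yI; apply/ler_addgt0Pr => d d0.
  have [n Hn] := half_pow_small (2 * (D * EE)) d0.
  have := tail n y; rewrite clamp_id // => h1; have := Wr n y yI.
  have := ler_normD (w y - W n y) (W n y); rewrite subrK; lra.
have [v0 v10 vs] := TP w wc.
have vw y : y1 <= y <= y2 -> T w y = w y.
  move=> yI; apply/eqP; rewrite -subr_eq0 -normr_le0; apply/ler_addgt0Pr => d d0.
  pose c := 2 * (D * EE) * (K * len ^+ 2 / 2 + 1).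
  have [n Hn] := half_pow_small c d0.
  have [u0 u10 us] := TP (W n) (Wc n).
  have z0 : T w y1 - T (W n) y1 = 0 by rewrite v0 u0 subrr.
  have z10 : T1 w y1 - T1 (W n) y1 = 0 by rewrite v10 u10 subrr.
  pose q := K * (2 * (D * EE) * 2^-1 ^+ n).
  have q0 : 0 <= q by rewrite !mulr_ge0 // expR_ge0.
  have bd z : y1 <= z <= y2 -> `|Phi z (w z) - Phi z (W n z)| <= q.
    move=> zI; apply: le_trans (PL _ _ _ zI (wr z zI) (Wr n z zI)) _.
    by rewrite ler_wpM2l //; have := tail n z; rewrite clamp_id.
  have h1 := sec_bound q0 z0 z10 (sec_sub vs us) bd yI.
  have h2 := tail n.+1 y; rewrite clamp_id // in h2.
  have h3 : 2 * (D * EE) * 2^-1 ^+ n.+1 <= 2 * (D * EE) * 2^-1 ^+ n.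
    by rewrite ler_wpM2l ?mulr_ge0 ?expR_ge0 // exprS ler_piMl ?invf_le1 ?ler1n ?ltr0n.
  have h4 : c * 2^-1 ^+ n = q * len ^+ 2 / 2 + 2 * (D * EE) * 2^-1 ^+ n.
    by rewrite /c /q; field.
  have h5 := ler_normD (T w y - T (W n) y) (T (W n) y - w y).
  rewrite subrKA in h5; rewrite distrC in h2.
  rewrite add0r; apply: le_trans Hn; rewrite h4; apply: le_trans h5 _.
  by apply: lerD h1 _; exact: le_trans h2 h3.
have vs' : sec (fun y => Phi y (T w y)) (T w) (T1 w).
  case: vs => d1 d2; split=> // y.
  by have := d2 y; rewrite /= vw // clampI.
exists (T w), (T1 w); split => // y yI.
case: vs' => d1 d2.
have d2' z : y1 <= z <= y2 -> is_derive z 1 (T1 w) (Phi z (T w z)).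
  by move=> zI; have := d2 z; rewrite clamp_id.
apply: (gronwall K0 e0 v0 v10 (fun z _ => d1 z) d2' _ yI) => z zI.
have -> : Phi z (T w z) = (Phi z (T w z) - Phi z 0) + Phi z 0 by rewrite subrK.
apply: le_trans (ler_normD _ _) _; apply: lerD; last exact: P0.
have h : `|T w z| <= r by rewrite vw // wr.
by have := PL _ _ _ zI h W0r; rewrite subr0.
Qed.

Lemma bounded_on h : continuous h -> exists2 M : R, 0 <= M &
  forall y, y1 <= y <= y2 -> `|h y| <= M.
Proof.
move=> hc.
have ac : {within `[y1, y2], continuous (fun y => `|h y|)}.
  by apply: continuous_subspaceT => y; apply: c_abs; exact: hc.
have [c cI cM] := EVT_max (ltW hy) ac.
exists `|h c| => // y yI; apply: cM; by rewrite in_itv.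
Qed.

Definition lC k := 1 + len + gC k * (k * (1 + len) + 1).

Lemma lC_ge0 k : 0 <= k -> 0 <= lC k.
Proof.
move=> k0; have l0 : 0 <= len by rewrite subr_ge0 ltW.
have g0 := gC_ge0 k0; have kl : 0 <= k * (1 + len) by rewrite mulr_ge0 // addr_ge0.
have : 0 <= gC k * (k * (1 + len) + 1) by rewrite mulr_ge0 // addr_ge0.
by rewrite /lC; lra.
Qed.

(** Subtracting the affine function with the same Cauchy data at y1 leads to
    [gronwall]. *)
Lemma lin_est (Q f w w1 : R -> R) k F : 0 <= k -> 0 <= F ->
  (forall y, y1 <= y <= y2 -> `|Q y| <= k) ->
  (forall y, y1 <= y <= y2 -> `|f y| <= F) ->
  sec (fun y => Q y * w y + f y) w w1 ->
  forall y, y1 <= y <= y2 ->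
    `|w y| <= lC k * (`|w y1| + `|w1 y1| + F) /\
    `|w1 y| <= lC k * (`|w y1| + `|w1 y1| + F).
Proof.
move=> k0 F0 Qk fF [dw dw1] y yI.
set A := w y1; set B := w1 y1.
have l0 : 0 <= len by rewrite subr_ge0 ltW.
pose z t := w t - (A + B * (t - y1)).
pose z1 t := w1 t - B.
have dz t : y1 <= t <= y2 -> is_derive t 1 z (z1 t).
  move=> _; apply: der_sub => //.
  apply: der_eq (der_add (der_cst A t) (der_scale B (der_sub (der_id t) (der_cst y1 t)))) _.
  ring.
have dz1 t : y1 <= t <= y2 -> is_derive t 1 z1 (Q t * w t + f t).
  move=> tI; have := dw1 t; rewrite clamp_id // => h.
  by apply: der_eq (der_sub h (der_cst B t)) _; rewrite subr0.
have z0 : z y1 = 0 by rewrite /z subrr mulr0 addr0 subrr.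
have z10 : z1 y1 = 0 by rewrite /z1 subrr.
pose e := k * (`|A| + `|B| * len) + F.
have ABt t : y1 <= t <= y2 -> `|A + B * (t - y1)| <= `|A| + `|B| * len.
  move=> tI; apply: le_trans (ler_normD _ _) _; rewrite lerD2l normrM.
  by rewrite ler_wpM2l // ger0_norm; lra.
have e0 : 0 <= e by rewrite addr_ge0 // mulr_ge0 // addr_ge0 // mulr_ge0.
have bd t : y1 <= t <= y2 -> `|Q t * w t + f t| <= k * `|z t| + e.
  move=> tI; apply: le_trans (ler_normD _ _) _; rewrite /e addrA.
  apply: lerD; last exact: fF.
  rewrite normrM -mulrDr; apply: ler_pM => //; first exact: Qk.
  have -> : w t = z t + (A + B * (t - y1)) by rewrite /z subrK.
  by apply: le_trans (ler_normD _ _) _; rewrite lerD2l ABt.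
have [h1 h2] := gronwall k0 e0 z0 z10 dz dz1 bd yI.
have G0 := gC_ge0 k0.
have eS : e <= (k * (1 + len) + 1) * (`|A| + `|B| + F).
  rewrite /e; have hA : 0 <= `|A| by []. have hB : 0 <= `|B| by [].
  have : 0 <= k * `|B| by rewrite mulr_ge0.
  have : 0 <= k * F by rewrite mulr_ge0.
  have : 0 <= k * len * F by rewrite !mulr_ge0.
  have : 0 <= k * len * `|A| by rewrite !mulr_ge0.
  have -> : (k * (1 + len) + 1) * (`|A| + `|B| + F) =
    k * (`|A| + `|B| * len) + F + k * `|B| + k * F + k * len * F + k * len * `|A|
     + `|A| + `|B| by ring.
  lra.
have GS : gC k * e <= gC k * (k * (1 + len) + 1) * (`|A| + `|B| + F).
  by rewrite -mulrA ler_wpM2l.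
have lS : `|A| + `|B| * len + `|B| <= (1 + len) * (`|A| + `|B| + F).
  have hA : 0 <= `|A| by []. have hB : 0 <= `|B| by [].
  have : 0 <= len * F by rewrite mulr_ge0.
  have : 0 <= len * `|A| by rewrite mulr_ge0.
  have -> : (1 + len) * (`|A| + `|B| + F) = `|A| + `|B| * len + `|B| + F + len * F + len * `|A| by ring.
  lra.
have -> : lC k * (`|A| + `|B| + F) = (1 + len) * (`|A| + `|B| + F) +
  gC k * (k * (1 + len) + 1) * (`|A| + `|B| + F) by rewrite /lC; ring.
have hBl : 0 <= `|B| * len by rewrite mulr_ge0.
split.
  have -> : w y = z y + (A + B * (y - y1)) by rewrite /z subrK.
  apply: le_trans (ler_normD _ _) _; have := ABt y yI; have : 0 <= `|B| by []. lra.
have -> : w1 y = z1 y + B by rewrite /z1 subrK.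
apply: le_trans (ler_normD _ _) _; have : 0 <= `|A| by []. lra.
Qed.

Lemma ivp_lin (Q f : R -> R) A B : continuous (Q \o clamp) -> continuous (f \o clamp) ->
  exists w w1, [/\ w y1 = A, w1 y1 = B & sec (fun y => Q y * w y + f y) w w1].
Proof.
move=> Qc fc.
have [k k0 kQ] := bounded_on Qc.
pose l y := A + B * (y - y1).
have lc : continuous l.
  suff H (y : R) : {for y, continuous l} by exact: H.
  refine (c_add (c_cst A y) (c_mul (c_cst B y) (c_sub (c_id y) (c_cst y1 y)))).
pose Phi y z := Q y * (l y + z) + f y.
have Pc w : continuous w -> continuous (fun y => Phi (clamp y) (w (clamp y))).
  move=> wc y; apply: c_add; last exact: fc.
  by apply: c_mul; [exact: Qc|apply: c_add; apply: comp_clamp_cont].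
have [e e0 He] := bounded_on (Pc (fun=> 0) (fun y => @c_cst _ _ 0 y)).
have L y a b : y1 <= y <= y2 -> `|a| <= gC k * e -> `|b| <= gC k * e ->
    `|Phi y a - Phi y b| <= k * `|a - b|.
  move=> yI _ _.
  have -> : Phi y a - Phi y b = Q y * (a - b) by rewrite /Phi; ring.
  by rewrite normrM ler_wpM2r //; have := kQ y yI; rewrite /= clamp_id.
have P0 y : y1 <= y <= y2 -> `|Phi y 0| <= e.
  by move=> yI; have := He y yI; rewrite clamp_id.
have [w [w1 [w0 w10 [dw dw1] _]]] := ivp k0 e0 (lexx _) Pc L P0.
exists (fun y => w y + l y), (fun y => w1 y + B); split.
- by rewrite w0 /l subrr mulr0 addr0 add0r.
- by rewrite w10 add0r.
- split=> y.
    apply: der_add => //.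
    apply: der_eq (der_add (der_cst A y) (der_scale B (der_sub (der_id y) (der_cst y1 y)))) _.
    ring.
  apply: der_eq (der_add (dw1 y) (der_cst B y)) _.
  by rewrite addr0 /Phi (addrC (w _)).
Qed.
End ODE.

(** * Dirichlet problems for the Fourier modes *)

Section BVP.
Context {R : realType} (y1 y2 : R).
Hypothesis hy : y1 < y2.
Local Notation clamp := (clamp y1 y2).
Local Notation sec := (sec y1 y2).
Local Notation lC := (lC y1 y2).
Local Notation len := (y2 - y1).
Implicit Types (w f Q : R -> R) (y K e r m k F A B kap : R).
Local Notation cc f := (continuous (f \o clamp)).
Local Notation bnd f M := (forall y : R, y1 <= y <= y2 -> `|f y| <= M).

Lemma cc_mul f g : cc f -> cc g -> cc (fun y => f y * g y).
Proof. by move=> fc gc y; apply: c_mul; [exact: fc|exact: gc]. Qed.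
Lemma cc_add f g : cc f -> cc g -> cc (fun y => f y + g y).
Proof. by move=> fc gc y; apply: c_add; [exact: fc|exact: gc]. Qed.
Lemma cc_sub f g : cc f -> cc g -> cc (fun y => f y - g y).
Proof. by move=> fc gc y; apply: c_sub; [exact: fc|exact: gc]. Qed.
Lemma cc_cst (c : R) : cc (fun _ : R => c).
Proof. by move=> y; exact: c_cst. Qed.
Lemma cc_cont f : continuous f -> cc f.
Proof. exact: comp_clamp_cont. Qed.

Lemma bounded_cc f : cc f -> exists2 M : R, 0 <= M & bnd f M.
Proof.
move=> fc; have [M M0 H] := bounded_on hy fc; exists M => // y yI.
by have := H y yI; rewrite /= clamp_id.
Qed.

Lemma sec_ext h h' w w1 : (forall y, y1 <= y <= y2 -> h y = h' y) ->
  sec h w w1 -> sec h' w w1.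
Proof.
by move=> E [a b]; split=> // y; rewrite -E; [exact: b|exact: clampI].
Qed.

Lemma sec_lin (Q f f' w w1 v v1 : R -> R) c :
  sec (fun y => Q y * w y + f y) w w1 -> sec (fun y => Q y * v y + f' y) v v1 ->
  sec (fun y => Q y * (w y - c * v y) + (f y - c * f' y))
    (fun y => w y - c * v y) (fun y => w1 y - c * v1 y).
Proof.
move=> [a b] [a' b']; split=> y.
  by apply: der_sub => //; exact: der_scale.
by apply: der_eq (der_sub (b y) (der_scale c (b' y))) _ => /=; ring.
Qed.

(** At an interior maximum of w above F one would have w'' = Q w + f > 0; the
    same for - w. *)
Lemma max_principle Q f w w1 F : 0 <= F ->
  (forall y, y1 <= y <= y2 -> 1 <= Q y) -> cc Q -> cc f -> bnd f F ->
  sec (fun y => Q y * w y + f y) w w1 -> w y1 = 0 -> w y2 = 0 -> bnd w F.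
Proof.
move=> F0 Q1 Qc fc fF ws w0 w2.
suff H (v v1 g : R -> R) : cc g -> bnd g F -> sec (fun y => Q y * v y + g y) v v1 ->
    v y1 = 0 -> v y2 = 0 -> forall y, y1 <= y <= y2 -> v y <= F.
  move=> y yI; rewrite ler_norml (H _ _ _ fc fF ws w0 w2 y yI) andbT lerNl.
  apply: (H (fun y => - w y) (fun y => - w1 y) (fun y => - f y)) => //.
  - by move=> z; apply: c_opp; exact: fc.
  - by move=> z zI; rewrite normrN fF.
  - case: ws => a b; split=> z; first exact: der_opp.
    by apply: der_eq (der_opp (b z)) _ => /=; ring.
  - by rewrite w0 oppr0.
  - by rewrite w2 oppr0.
move=> gc gF vs v0 v2 y yI.
have [vc v1c] := sec_cont vs.
have [c cI cM] := EVT_max (ltW hy) (continuous_subspaceT (A := `[y1, y2]) vc).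
rewrite in_itv /= in cI.
rewrite leNgt; apply/negP => Fy.
have Fc : F < v c by apply: lt_le_trans Fy _; apply: cM; rewrite in_itv.
have c1 : y1 < c.
  rewrite lt_neqAle; apply/andP; split; last by case/andP: cI.
  by apply/eqP => E; move: Fc; rewrite -E v0; lra.
have c2 : c < y2.
  rewrite lt_neqAle; apply/andP; split; last by case/andP: cI.
  by apply/eqP => E; move: Fc; rewrite E v2; lra.
case: vs => dv dv1.
have v1c0 : v1 c = 0.
  have [+ E] : is_derive c 1 v (v1 c) by [].
  move=> _; rewrite -E.
  have := @derive1_at_max R v y1 y2 c (ltW hy).
  have H1 t : t \in `]y1, y2[%R -> derivable v t 1 by move=> _; have [] := dv t.
  have H2 : c \in `]y1, y2[%R by rewrite in_itv /= c1.
  have H3 t : t \in `]y1, y2[%R -> v t <= v c.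
    by rewrite in_itv /= => /andP[t1 t2]; apply: cM; rewrite in_itv /= !ltW.
  by move=> /(_ H1 H2 H3) [].
pose h z := Q (clamp z) * v (clamp z) + g (clamp z).
have hc : {for c, continuous h}.
  apply: c_add; last exact: gc.
  by apply: c_mul; [exact: Qc|apply: comp_clamp_cont].
have hpos : 0 < h c.
  rewrite /h clamp_id //; have := gF c cI; rewrite ler_norml => /andP[g1 _].
  have : v c <= Q c * v c by rewrite ler_peMl ?Q1 //; lra.
  lra.
have : \forall t \near c, 0 < h t by exact: cvgr_gt hc _ hpos.
move=> /nbhs_ballP [r /= r0 Hr].
pose d := Num.min (r / 2) ((y2 - c) / 2).
have d0 : 0 < d by rewrite lt_min !divr_gt0 // subr_gt0.
have dr : d <= r / 2 by rewrite ge_min lexx.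
have dy : d <= (y2 - c) / 2 by rewrite ge_min lexx orbT.
have hp z : c <= z <= c + d -> 0 < h z.
  move=> zc; apply: Hr; rewrite /ball /= ler0_norm; lra.
have v1p z : c < z <= c + d -> 0 < v1 z.
  move=> zc.
  have cz : c < z by case/andP: zc.
  have [x xc E] : exists2 x, c < x < z & v1 z - v1 c = h x * (z - c).
    apply: (mvt_eq (f' := h)) => //.
    - by move=> t _; exact: is_derive_cont (dv1 t).
  move: E; rewrite v1c0 subr0 => ->; rewrite mulr_gt0 ?subr_gt0 //.
  by apply: hp; lra.
have [x xc E] : exists2 x, c < x < c + d & v (c + d) - v c = v1 x * (c + d - c).
  apply: (mvt_eq (f' := v1)); first lra.
  - by move=> t _; exact: is_derive_cont (dv t).
have : v c < v (c + d).
  rewrite -subr_gt0 E mulr_gt0 //; last lra.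
  by apply: v1p; lra.
have := cM (c + d); rewrite in_itv /= => /(_ _) H.
have : v (c + d) <= v c by apply: H; lra.
lra.
Qed.

(** The solution that is shot from y1 with unit slope; it vanishes at y2
    exactly when the homogeneous Dirichlet problem is solvable. *)
Definition shoot Q s s1 := [/\ sec (fun y => Q y * s y + 0) s s1, s y1 = 0 & s1 y1 = 1].

Lemma shoot_ex Q : cc Q -> exists s s1, shoot Q s s1.
Proof.
move=> Qc; have [s [s1 [s0 s10 ss]]] := ivp_lin hy 0 1 Qc (@cc_cst 0).
by exists s, s1.
Qed.

Lemma lin_est0 Q w w1 : cc Q -> sec (fun y => Q y * w y + 0) w w1 ->
  w y1 = 0 -> w1 y1 = 0 -> forall y, y1 <= y <= y2 -> w y = 0 /\ w1 y = 0.
Proof.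
move=> Qc ws w0 w10 y yI; have [k k0 kQ] := bounded_cc Qc.
have z0 : bnd (fun _ : R => 0 : R) 0 by move=> *; rewrite normr0.
have [] := lin_est hy k0 (lexx 0) kQ z0 ws yI.
by rewrite w0 w10 normr0 !addr0 mulr0 !normr_le0 => /eqP -> /eqP ->.
Qed.

(** The solution with zero Cauchy data at y1 is corrected by the multiple of s
    that cancels its value at y2. *)
Lemma dirichlet_ex Q f s s1 : cc Q -> cc f -> shoot Q s s1 -> s y2 != 0 ->
  exists w w1, [/\ w y1 = 0, w y2 = 0 & sec (fun y => Q y * w y + f y) w w1].
Proof.
move=> Qc fc [ss s0 s10] s2.
have [w [w1 [w0 w10 ws]]] := ivp_lin hy 0 0 Qc fc.
pose c := w y2 / s y2.
exists (fun y => w y - c * s y), (fun y => w1 y - c * s1 y); split.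
- by rewrite w0 s0 mulr0 subrr.
- by rewrite /c divfK // subrr.
- apply: sec_ext (sec_lin c ws ss) => y _; ring.
Qed.

Lemma dirichlet_est Q f s s1 w w1 k F m : cc Q -> 0 <= k -> 0 <= F -> 0 < m ->
  shoot Q s s1 -> m <= `|s y2| -> bnd Q k -> bnd f F ->
  sec (fun y => Q y * w y + f y) w w1 -> w y1 = 0 -> w y2 = 0 ->
  bnd w (lC k * (lC k / m + 1) * F).
Proof.
move=> Qc k0 F0 m0 [ss s0 s10] ms Qk fF ws w0 w2 y yI.
have L0 := lC_ge0 hy k0.
pose b := w1 y1.
have zs := sec_lin b ws ss.
have zs' : sec (fun y => Q y * (w y - b * s y) + f y) (fun y => w y - b * s y)
    (fun y => w1 y - b * s1 y).
  by apply: sec_ext zs => t _; ring.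
have Z t : y1 <= t <= y2 -> `|w t - b * s t| <= lC k * F.
  move=> tI; have [+ _] := lin_est hy k0 F0 Qk fF zs' tI.
  by rewrite w0 s0 s10 mulr0 mulr1 subrr /b subrr normr0 !add0r.
have z0 : bnd (fun _ : R => 0 : R) 0 by move=> *; rewrite normr0.
have [sb _] := lin_est hy k0 (lexx 0) Qk z0 ss yI.
rewrite s0 s10 normr0 normr1 add0r addr0 mulr1 in sb.
have yI2 : y1 <= y2 <= y2 by rewrite lexx ltW.
have bm : `|b| * m <= lC k * F.
  have := Z y2 yI2; rewrite w2 sub0r normrN normrM; apply: le_trans.
  by rewrite ler_wpM2l.
have bF : `|b| <= lC k * F / m by rewrite ler_pdivlMr.
have -> : w y = (w y - b * s y) + b * s y by rewrite subrK.
apply: le_trans (ler_normD _ _) _; rewrite normrM.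
have : `|b| * `|s y| <= lC k * F / m * lC k by apply: ler_pM.
have := Z y yI.
have -> : lC k * (lC k / m + 1) * F = lC k * F + lC k * F / m * lC k by ring.
lra.
Qed.

(** The mean slope of w over the interval is at most 2 A / len, and w' varies
    by at most B len. *)
Lemma deriv_bound h w w1 A B : sec h w w1 -> bnd w A -> bnd h B ->
  bnd w1 (2 * A / len + B * len).
Proof.
move=> [dw dw1] wA hB y yI.
have [c cI E] : exists2 c, y1 < c < y2 & w y2 - w y1 = w1 c * (y2 - y1).
  by apply: (mvt_eq (f' := w1)) => // t _; exact: is_derive_cont (dw t).
have l0 : 0 < len by rewrite subr_gt0.
have yI1 : y1 <= y1 <= y2 by rewrite lexx ltW.
have yI2 : y1 <= y2 <= y2 by rewrite lexx ltW.
have h1 : `|w1 c| <= 2 * A / len.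
  rewrite ler_pdivlMr // -(gtr0_norm l0) -normrM -E.
  apply: le_trans (ler_normB _ _) _; have := wA _ yI1; have := wA _ yI2; lra.
have B0 : 0 <= B by apply: le_trans (hB y yI).
have h2 : `|w1 y - w1 c| <= B * `|y - c|.
  apply: (mvt_abs (f' := fun z => h (clamp z))) => //.
  by move=> x _; apply: hB; exact: clampI.
have h3 : B * `|y - c| <= B * len.
  by rewrite ler_wpM2l // ler_norml; move: cI yI; lra.
have -> : w1 y = (w1 y - w1 c) + w1 c by rewrite subrK.
apply: le_trans (ler_normD _ _) _; lra.
Qed.

(** The difference s - s' has zero Cauchy data and solves the equation for Q
    with right-hand side (Q - Q') s'. *)
Lemma shoot_diff Q Q' s s1 s' s1' k e : cc Q -> 0 <= k -> 0 <= e ->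
  shoot Q s s1 -> shoot Q' s' s1' -> bnd Q k -> bnd Q' k ->
  bnd (fun y => Q y - Q' y) e ->
  bnd (fun y => s y - s' y) (lC k ^+ 2 * e).
Proof.
move=> Qc k0 e0 [[a b] s0 s10] [ss' s0' s10'] Qk Qk' Qe y yI.
have L0 := lC_ge0 hy k0.
have z0 : bnd (fun _ : R => 0 : R) 0 by move=> *; rewrite normr0.
have sb t : y1 <= t <= y2 -> `|s' t| <= lC k.
  move=> tI; have [+ _] := lin_est hy k0 (lexx 0) Qk' z0 ss' tI.
  by rewrite s0' s10' normr0 normr1 add0r addr0 mulr1.
case: ss' => a' b'.
have D : sec (fun y => Q y * (s y - s' y) + (Q y - Q' y) * s' y)
    (fun y => s y - s' y) (fun y => s1 y - s1' y).
  split=> t; first exact: der_sub.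
  by apply: der_eq (der_sub (b t) (b' t)) _ => /=; ring.
have fb : bnd (fun y => (Q y - Q' y) * s' y) (e * lC k).
  by move=> t tI; rewrite normrM ler_pM // ?Qe // sb.
have eL : 0 <= e * lC k by rewrite mulr_ge0.
have [+ _] := lin_est hy k0 eL Qk fb D yI.
rewrite s0 s0' s10 s10' !subrr normr0 !add0r => /le_trans; apply.
by rewrite expr2 -mulrA (mulrC e).
Qed.

(** A function w(y) cos (n kap x) satisfies Lap v = Q v + f cos (n kap x)
    exactly when w'' = pot w + f. *)
Definition pot kap Q (n : nat) (y : R) := Q y + (n%:R * kap) ^+ 2.

(** Stream functions need only be constant on the walls, so mode 0 has no
    condition at y2; the value of mode 1 at y2 is the bifurcation equation,
    which is solved last. Both are therefore initial value problems. *)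
Definition modesol kap Q (n : nat) f w w1 :=
  [/\ w y1 = 0, (if (n < 2)%N then w1 y1 = 0 else w y2 = 0) &
      sec (fun y => pot kap Q n y * w y + f y) w w1].

Lemma pot_cc kap Q n : cc Q -> cc (pot kap Q n).
Proof. by move=> Qc; apply: cc_add => //; exact: cc_cst. Qed.

Lemma shoot_neq0 Q s s1 : cc Q -> (forall y, y1 <= y <= y2 -> 1 <= Q y) ->
  shoot Q s s1 -> s y2 != 0.
Proof.
move=> Qc Q1 [ss s0 s10]; apply/eqP => s2.
have z0 : bnd (fun _ : R => 0 : R) 0 by move=> *; rewrite normr0.
have sz := max_principle (lexx 0) Q1 Qc (@cc_cst 0) z0 ss s0 s2.
have hz : bnd (fun y => Q y * s y + 0) 0.
  by move=> y yI; have := sz y yI; rewrite normr_le0 => /eqP ->; rewrite mulr0 addr0 normr0.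
have yI : y1 <= y1 <= y2 by rewrite lexx ltW.
have := deriv_bound ss sz hz yI.
by rewrite s10 normr1 mulr0 !mul0r addr0 ler10.
Qed.

Section Uniform.
Variables (q0 : R -> R) (kap k : R).
Hypotheses (q0c : cc q0) (kap0 : 0 < kap) (k0 : 0 <= k) (q0k : bnd q0 k).

(** The uniformity in Q allows waves to be constructed over a whole family of
    shear flows at once. *)
Definition modeok n r M := forall Q, cc Q -> bnd (fun y => Q y - q0 y) r ->
  forall f, cc f -> (exists w w1, modesol kap Q n f w w1) /\
   (forall w w1 F, 0 <= F -> bnd f F -> modesol kap Q n f w w1 -> bnd w (M * F)).

Lemma modeokW n r r' M M' : r' <= r -> M <= M' -> modeok n r M -> modeok n r' M'.
Proof.
move=> rr MM H Q Qc Qr f fc.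
have [y yI|a b] := H Q Qc _ f fc; first exact: le_trans (Qr y yI) rr.
split=> // w w1 F F0 fF wF y yI; apply: le_trans (b w w1 F F0 fF wF y yI) _.
by rewrite ler_wpM2r.
Qed.

Lemma Qbnd Q r : r <= 1 -> bnd (fun y => Q y - q0 y) r -> bnd Q (k + 1).
Proof.
move=> r1 Qr y yI; have -> : Q y = q0 y + (Q y - q0 y) by rewrite subrKC.
apply: le_trans (ler_normD _ _) _; have := Qr y yI; have := q0k yI; lra.
Qed.

Definition kn n := k + 1 + (n%:R * kap) ^+ 2.

Lemma kn_ge0 n : 0 <= kn n.
Proof. by rewrite !addr_ge0 // exprn_ge0 // mulr_ge0 // ltW. Qed.

Lemma potbnd Q r n : r <= 1 -> bnd (fun y => Q y - q0 y) r ->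
  bnd (pot kap Q n) (kn n).
Proof.
move=> r1 Qr y yI; apply: le_trans (ler_normD _ _) _.
rewrite /kn; apply: lerD; first exact: Qbnd r1 Qr y yI.
by rewrite ger0_norm // exprn_ge0 // mulr_ge0 // ltW.
Qed.

Lemma modeok_low n : (n < 2)%N -> modeok n 1 (lC (kn n)).
Proof.
move=> n2 Q Qc Qr f fc; split.
  have [w [w1 [a b c]]] := ivp_lin hy 0 0 (@pot_cc kap Q n Qc) fc.
  by exists w, w1; split=> //; rewrite n2.
move=> w w1 F F0 fF [w0 + ws]; rewrite n2 => w10 y yI.
have [+ _] := lin_est hy (kn_ge0 n) F0 (potbnd n (lexx 1) Qr) fF ws yI.
by rewrite w0 w10 normr0 !add0r.
Qed.

Lemma modeok_high n : (2 <= n)%N -> k + 2 <= (n%:R * kap) ^+ 2 -> modeok n 1 1.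
Proof.
move=> n2 nk Q Qc Qr f fc.
have P1 y : y1 <= y <= y2 -> 1 <= pot kap Q n y.
  move=> yI; have := Qbnd (lexx 1) Qr yI; rewrite /pot ler_norml => /andP[h _]; lra.
have Pc := @pot_cc kap Q n Qc.
split.
  have [s [s1 ss]] := shoot_ex Pc.
  have [w [w1 [a b c]]] := dirichlet_ex Pc fc ss (shoot_neq0 Pc P1 ss).
  by exists w, w1; split=> //; rewrite ltnNge n2.
move=> w w1 F F0 fF [w0 + ws]; rewrite ltnNge n2 /= => w2; rewrite mul1r.
exact: max_principle F0 P1 Pc fc fF ws w0 w2.
Qed.

(** By [shoot_diff] the value s(y2) stays away from 0 when Q is close to q0. *)
Lemma modeok_mid n : (2 <= n)%N ->
  (forall s s1, shoot (pot kap q0 n) s s1 -> s y2 != 0) ->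
  exists r M : R, [/\ 0 < r, 0 <= M & modeok n r M].
Proof.
move=> n2 H.
have Pc0 := @pot_cc kap q0 n q0c.
have [s [s1 ss]] := shoot_ex Pc0; have s2 := H _ _ ss.
pose L := lC (kn n); have L0 : 0 <= L := lC_ge0 hy (kn_ge0 n).
pose m := `|s y2| / 2.
have m0 : 0 < m by rewrite divr_gt0 // normr_gt0.
pose r := Num.min 1 (m / (L ^+ 2 + 1)).
have L21 : 0 < L ^+ 2 + 1 by rewrite ltr_wpDl // exprn_ge0.
have r0 : 0 < r by rewrite lt_min ltr01 divr_gt0.
have r1 : r <= 1 by rewrite ge_min lexx.
have rm : L ^+ 2 * r <= m.
  have : r * (L ^+ 2 + 1) <= m by rewrite -ler_pdivlMr // ge_min lexx orbT.
  lra.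
exists r, (L * (L / m + 1)); split=> //.
  by rewrite mulr_ge0 // addr_ge0 // divr_ge0 // ltW.
move=> Q Qc Qr f fc.
have Pc := @pot_cc kap Q n Qc.
have [t [t1 tt]] := shoot_ex Pc.
have yI2 : y1 <= y2 <= y2 by rewrite lexx ltW.
have tm : m <= `|t y2|.
  have qq : bnd (fun y => q0 y - q0 y) 1 by move=> *; rewrite subrr normr0.
  have qd : bnd (fun y => pot kap Q n y - pot kap q0 n y) r.
    by move=> y yI; rewrite /pot opprD addrACA subrr addr0 Qr.
  have := shoot_diff Pc (kn_ge0 n) (ltW r0) tt ss (potbnd n r1 Qr)
    (potbnd n (lexx 1) qq) qd yI2.
  rewrite -/L => h1.
  have := ler_normD (s y2 - t y2) (t y2); rewrite subrK distrC.
  rewrite /m in rm *; lra.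
have t2 : t y2 != 0 by rewrite -normr_gt0; exact: lt_le_trans m0 tm.
split.
  have [w [w1 [a b c]]] := dirichlet_ex Pc fc tt t2.
  by exists w, w1; split=> //; rewrite ltnNge n2.
move=> w w1 F F0 fF [w0 + ws]; rewrite ltnNge n2 /= => w2.
exact: dirichlet_est Pc (kn_ge0 n) F0 m0 tt tm (potbnd n r1 Qr) fF ws w0 w2.
Qed.

(** For large n the potential exceeds 1 and the maximum principle gives the
    bound 1, so that only finitely many modes need the nonresonance
    hypothesis. *)
Lemma modeok_all :
  (forall n s s1, (2 <= n)%N -> shoot (pot kap q0 n) s s1 -> s y2 != 0) ->
  exists r M : R, [/\ 0 < r <= 1, 0 <= M & forall n, modeok n r M].
Proof.
move=> H.
have fin N : exists r M : R, [/\ 0 < r <= 1, 1 <= M & forall n, (n < N)%N -> modeok n r M].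
  elim: N => [|N [r [M [/andP[r0 r1] M1 IH]]]].
    by exists 1, 1; rewrite ltr01 lexx; split.
  have [r' [M' [r'0 M'0 N']]] : exists r M : R, [/\ 0 < r, 0 <= M & modeok N r M].
    have [N2|N2] := ltnP N 2; last by apply: modeok_mid => // s s1; exact: H.
    by exists 1, (lC (kn N)); split; [exact: ltr01|exact (lC_ge0 hy (kn_ge0 N))|exact: modeok_low].
  exists (Num.min r r'), (Num.max M M'); split.
  - by rewrite lt_min r0 r'0 ge_min r1.
  - by rewrite le_max M1.
  - move=> n; rewrite ltnS leq_eqVlt => /orP[/eqP->|nN].
      by apply: modeokW N'; rewrite ?ge_min ?le_max lexx orbT.
    by apply: modeokW (IH n nN); rewrite ?ge_min ?le_max lexx.
pose N := maxn 2 (Num.truncn ((k + 2) / kap ^+ 2)).+1.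
have [r [M [/andP[r0 r1] M1 HN]]] := fin N.
exists r, M; split; rewrite ?r0 ?(le_trans _ M1) // => n.
have [nN|Nn] := ltnP n N; first exact: HN.
apply: modeokW r1 M1 _; apply: modeok_high.
  by apply: leq_trans Nn; rewrite leq_maxl.
have k2 : 0 < kap ^+ 2 by rewrite exprn_gt0.
rewrite exprMn -ler_pdivrMr //.
have h1 : (k + 2) / kap ^+ 2 < N%:R.
  apply: lt_le_trans (truncnS_gt _) _.
  by rewrite ler_nat leq_maxr.
have h2 : N%:R <= n%:R :> R by rewrite ler_nat.
have n1 : 1 <= n%:R :> R.
  by rewrite ler1n; apply: leq_trans Nn; rewrite leq_max.
have h3 : n%:R <= n%:R ^+ 2 :> R by rewrite expr2 ler_peMr //; lra.
lra.
Qed.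
End Uniform.
End BVP.

(** * Polynomial approximation *)

Section Weierstrass.
Context {R : realType}.
Implicit Types (g h : nat -> R) (x c d : R).

(** The Bernstein operator: the expectation of [g] under the binomial law with
    parameters [n] and ['X], conditioning on the first trial. *)
Fixpoint bernstein n g : {poly R} :=
  match n with
  | 0 => (g 0%N)%:P
  | n'.+1 => 'X * bernstein n' (g \o S) + (1 - 'X) * bernstein n' g
  end.

Lemma bernsteinS n g x : (bernstein n.+1 g).[x] =
  x * (bernstein n (g \o S)).[x] + (1 - x) * (bernstein n g).[x].
Proof. by rewrite /= !hornerE. Qed.

Lemma bernstein_le n g h x : 0 <= x <= 1 -> (forall k, (k <= n)%N -> g k <= h k) ->
  (bernstein n g).[x] <= (bernstein n h).[x].
Proof.
move=> x01; elim: n g h => [|n IH] g h gh; first by rewrite /= !hornerC gh.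
rewrite !bernsteinS; apply: lerD; apply: ler_wpM2l; try lra.
  by apply: IH => k kn; exact: gh.
by apply: IH => k kn; apply: gh; exact: leqW.
Qed.

Lemma bernstein_lin n (a b : R) g h x :
  (bernstein n (fun k => a * g k + b * h k)).[x] =
  a * (bernstein n g).[x] + b * (bernstein n h).[x].
Proof.
elim: n g h => [|n IH] g h; first by rewrite /= !hornerC.
rewrite !bernsteinS IH (IH (g \o S)); ring.
Qed.

Lemma bernstein_cst n c x : (bernstein n (fun=> c)).[x] = c.
Proof.
elim: n => [|n IH]; first by rewrite /= hornerC.
rewrite bernsteinS IH; ring.
Qed.

(** Variance plus squared bias of the binomial law. *)
Lemma bernstein_var n c x : (bernstein n (fun k => (k%:R - c) ^+ 2)).[x] =
  n%:R * x * (1 - x) + (n%:R * x - c) ^+ 2.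
Proof.
elim: n c => [|n IH] c; first by rewrite /= hornerC; ring.
rewrite bernsteinS IH.
have -> : (fun k => (k%:R - c) ^+ 2) \o S = (fun k : nat => (k%:R - (c - 1)) ^+ 2 : R).
  by apply/funext => k /=; rewrite -natr1; ring.
rewrite IH -natr1; ring.
Qed.

Lemma heine (f : R -> R) (a b e : R) : continuous f -> 0 < e ->
  exists2 r : R, 0 < r & forall x y, a <= x <= b -> a <= y <= b -> `|x - y| < r ->
    `|f x - f y| <= e.
Proof.
move=> fc e0.
have e2 : 0 < e / 2 by rewrite divr_gt0.
have K : compact `[a, b] by exact: segment_compact.
have [NC _] := compact_near_coveringP `[a, b]; have {}NC := NC K.
pose P (r x : R) := forall y, `|x - y| < r -> `|f x - f y| <= e.
have loc x : `[a, b]%classic x -> \forall x' \near x & r \near (0 : R)^'+, P r x'.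
  move=> _; move/cvgrPdist_le : (fc x) => /(_ _ e2) /nbhs_ballP [s /= s0 Hs].
  exists (ball x (s / 2), [set r | 0 < r < s / 2]) => /=.
    split; first by apply: nbhsx_ballx; rewrite divr_gt0.
    exists (s / 2); rewrite /= ?divr_gt0 // => r /=.
    rewrite sub0r normrN => rs r0; rewrite r0 /=.
    exact: le_lt_trans (ler_norm _) rs.
  move=> [x' r] /= [xx' /andP[r0 rs]] y x'y.
  rewrite /ball /= in xx'.
  have h1 : `|f x - f x'| <= e / 2 by apply: Hs; rewrite /ball /=; lra.
  have h2 : `|f x - f y| <= e / 2.
    apply: Hs; rewrite /ball /=.
    have -> : x - y = (x - x') + (x' - y) by ring.
    by apply: le_lt_trans (ler_normD _ _) _; lra.
  have -> : f x' - f y = (f x - f y) - (f x - f x') by ring.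
  by apply: le_trans (ler_normB _ _) _; lra.
have := NC R (0 : R)^'+ P _ loc.
move=> [s /= s0 Hs]; exists (s / 2); first by rewrite divr_gt0.
move=> x y xI yI; apply: (Hs (s / 2)) => //=.
- by rewrite sub0r normrN ger0_norm; lra.
- by rewrite divr_gt0.
Unshelve. all: end_near.
Qed.

(** Chebyshev's inequality: |f (k / n) - f x| <= d / 2 + c (k / n - x)^2
    whether k / n is close to x or not, and the mean of the square is at most
    1 / n. *)
Lemma weierstrass01 (f : R -> R) d : continuous f -> 0 < d ->
  exists p : {poly R}, forall x, 0 <= x <= 1 -> `|p.[x] - f x| <= d.
Proof.
move=> fc d0.
have d2 : 0 < d / 2 by rewrite divr_gt0.
have [r r0 Hr] := heine 0 1 fc d2.
have [M M0 fM] := bounded_on (y1 := 0) (y2 := 1) ltr01 fc.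
pose c : R := 2 * M / r ^+ 2.
have c0 : 0 <= c by apply: divr_ge0; [exact: mulr_ge0|exact: sqr_ge0].
pose n := (Num.truncn (c / d)).+1.
have n0 : 0 < n%:R :> R by rewrite ltr0n.
have cn : c / n%:R <= d.
  rewrite ler_pdivrMr // mulrC -ler_pdivrMr //; apply: ltW; exact: truncnS_gt.
exists (bernstein n (fun k => f (k%:R / n%:R))) => x x01.
have kn01 k : (k <= n)%N -> 0 <= (k%:R / n%:R : R) <= 1.
  by move=> kn; rewrite divr_ge0 //= ler_pdivrMr // mul1r ler_nat.
have key k : (k <= n)%N -> `|f (k%:R / n%:R) - f x| <=
    d / 2 * 1 + c * (k%:R / n%:R - x) ^+ 2.
  move=> kn; rewrite mulr1; have kI := kn01 k kn.
  have [h|h] := ltP `|k%:R / n%:R - x| r.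
    by apply: le_trans (Hr _ _ kI x01 h) _; rewrite lerDl mulr_ge0 // sqr_ge0.
  have : 2 * M <= c * (k%:R / n%:R - x) ^+ 2.
    rewrite /c mulrAC ler_pdivlMr ?exprn_gt0 // ler_wpM2l ?mulr_ge0 //.
    by rewrite -(real_normK (x := _ - x)) ?num_real // ler_sqr ?nnegrE // ltW.
  have := fM _ kI; have := fM _ x01; have := ler_normB (f (k%:R / n%:R)) (f x); lra.
have varE : (bernstein n (fun k => (k%:R / n%:R - x) ^+ 2)).[x] = x * (1 - x) / n%:R.
  have -> : (fun k : nat => (k%:R / n%:R - x) ^+ 2) = (fun k : nat => n%:R ^- 2 * (k%:R - n%:R * x) ^+ 2 + 0 * 0).
    by apply/funext => k; rewrite mulr0 addr0; field; rewrite gt_eqF.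
  rewrite bernstein_lin bernstein_var subrr expr0n /= mul0r !addr0.
  by field; rewrite gt_eqF.
have major : d / 2 + c * (x * (1 - x) / n%:R) <= d.
  have xx : x * (1 - x) <= 1 / 2.
    have := sqr_ge0 (x - 1 / 2); rewrite (_ : (x - 1 / 2) ^+ 2 = 1 / 4 - x * (1 - x)); last by field.
    lra.
  have : c * (x * (1 - x) / n%:R) <= d / 2.
    have -> : c * (x * (1 - x) / n%:R) = c / n%:R * (x * (1 - x)) by field; rewrite gt_eqF.
    have h0 : 0 <= c / n%:R by rewrite divr_ge0 // ltW.
    have : c / n%:R * (x * (1 - x)) <= c / n%:R * (1 / 2) by rewrite ler_wpM2l.
    lra.
  lra.
have fE : (bernstein n (fun k => f (k%:R / n%:R))).[x] - f x =
    (bernstein n (fun k => f (k%:R / n%:R) - f x)).[x].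
  have -> : (fun k : nat => f (k%:R / n%:R) - f x) =
      (fun k : nat => 1 * f (k%:R / n%:R) + (- f x) * 1).
    by apply/funext => k; ring.
  by rewrite bernstein_lin bernstein_cst; ring.
have upE : (bernstein n (fun k => d / 2 * 1 + c * (k%:R / n%:R - x) ^+ 2)).[x] =
    d / 2 + c * (x * (1 - x) / n%:R).
  by rewrite bernstein_lin bernstein_cst varE mulr1.
rewrite fE; apply: le_trans major; rewrite -upE ler_norml; apply/andP; split.
  rewrite lerNl.
  have -> : - (bernstein n (fun k => f (k%:R / n%:R) - f x)).[x] =
    (bernstein n (fun k => - 1 * (f (k%:R / n%:R) - f x) + 0 * 0)).[x].
    by rewrite bernstein_lin mul0r addr0 mulN1r.
  apply: bernstein_le => // k kn; rewrite mul0r addr0 mulN1r lerNl.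
  by have := key k kn; rewrite ler_norml => /andP[].
apply: bernstein_le => // k kn.
by have := key k kn; rewrite ler_norml => /andP[].
Qed.

Lemma weierstrass (f : R -> R) a b d : a < b -> continuous f -> 0 < d ->
  exists p : {poly R}, forall x, a <= x <= b -> `|p.[x] - f x| <= d.
Proof.
move=> ab fc d0.
have gc : continuous (fun t => f (a + (b - a) * t)).
  move=> t; apply: c_comp; first exact: fc.
  by apply: c_add; [exact: c_cst|apply: c_mul; [exact: c_cst|exact: c_id]].
have [p Hp] := weierstrass01 gc d0.
have ba : 0 < b - a by rewrite subr_gt0.
exists (p \Po ((b - a)^-1 *: ('X - a%:P))) => x xab.
rewrite horner_comp !hornerE.
have h : 0 <= (b - a)^-1 * (x - a) <= 1.
  by rewrite mulrC divr_ge0 /= ?ler_pdivrMr // ?mul1r; lra.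
have := Hp _ h; rewrite (_ : a + _ = x) //; field; rewrite gt_eqF //.
Qed.

Definition antideriv_poly (p : {poly R}) : {poly R} :=
  \poly_(i < (size p).+1) (p`_i.-1 / i%:R).

Lemma antideriv_polyP p : (antideriv_poly p)^`() = p /\ (antideriv_poly p).[0] = 0.
Proof.
split; last by rewrite horner_coef0 coef_poly /= invr0 mulr0.
apply/polyP => i; rewrite coef_deriv coef_poly ltnS /=.
have [h|h] := ltnP i (size p).
  by rewrite -[_ *+ _]mulr_natr divfK // pnatr_eq0.
by rewrite mul0rn nth_default.
Qed.

Lemma der_horner (p : {poly R}) x : is_derive x 1 (fun y => p.[y]) p^`().[x].
Proof.
apply: DeriveDef; first exact: derivable_horner.
by rewrite -derive1E -derivE.
Qed.

Lemma horner_cont (p : {poly R}) x : continuous_at x (fun y => p.[y]).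
Proof. exact: is_derive_cont (der_horner p x). Qed.

Lemma horner_lip (p : {poly R}) (Z K a b : R) : (forall z : R, `|z| <= Z -> `|p^`().[z]| <= K) ->
  `|a| <= Z -> `|b| <= Z -> `|p.[b] - p.[a]| <= K * `|b - a|.
Proof.
move=> pK aZ bZ.
have zZ (z : R) : Num.min a b <= z <= Num.max a b -> `|z| <= Z.
  move: aZ bZ; rewrite !ler_norml ge_min le_max => /andP[a1 a2] /andP[b1 b2].
  by move=> /andP[/orP[h|h] /orP[h'|h']]; lra.
apply: (mvt_abs (f' := fun z => p^`().[z])).
- by apply: le_trans (pK a aZ).
- by move=> x /zZ; exact: pK.
Qed.
End Weierstrass.

(** * The vorticity of a shear flow as a function of its stream function *)

Section Profile.
Context {R : realType} (y1 y2 beta : R) (U : nat -> R -> R).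
Hypotheses (hy : y1 < y2) (Ud : forall i (y : R), is_derive y 1 (U i) (U i.+1 y)).
Hypothesis U0 : forall y, y1 <= y <= y2 -> U 0%N y != 0.
Local Notation clamp := (clamp y1 y2).
Local Notation sec := (sec y1 y2).
Local Notation len := (y2 - y1).
Implicit Types (y z K e r m k F A B d Z : R).
Local Notation cc f := (continuous (f \o clamp)).
Local Notation bnd f M := (forall y : R, y1 <= y <= y2 -> `|f y| <= M).

(** Differential polynomials in the profile, the ordinate and the inverse of
    the profile: closed under differentiation where the profile does not
    vanish. Iterated derivatives of u' - beta y with respect to the stream
    function need nothing else. *)
Inductive ratfun : (R -> R) -> Prop :=
| ratfun_cst c : ratfun (fun=> c)
| ratfun_id : ratfun (fun y => y)
| ratfun_U i : ratfun (U i)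
| ratfun_V : ratfun (fun y => (U 0%N y)^-1)
| ratfun_add f g : ratfun f -> ratfun g -> ratfun (fun y => f y + g y)
| ratfun_mul f g : ratfun f -> ratfun g -> ratfun (fun y => f y * g y).

Lemma ratfun_der f : ratfun f -> exists2 f', ratfun f' &
  forall y, U 0%N y != 0 -> is_derive y 1 f (f' y).
Proof.
elim=> [c||i||g h _ [g' rg dg] _ [h' rh dh]|g h rg0 [g' rg dg] rh0 [h' rh dh]].
- by exists (fun=> 0) => [|y _]; [exact: ratfun_cst|exact: der_cst].
- by exists (fun=> 1) => [|y _]; [exact: ratfun_cst|exact: der_id].
- by exists (U i.+1) => [|y _]; [exact: ratfun_U|exact: Ud].
- exists (fun y => -1 * U 1%N y * ((U 0%N y)^-1 * (U 0%N y)^-1)) => [|y y0].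
    by apply: ratfun_mul; apply: ratfun_mul; [exact: ratfun_cst|exact: ratfun_U|exact: ratfun_V|exact: ratfun_V].
  by apply: der_eq (der_inv y0 (Ud 0%N y)) _; field.
- by exists (fun y => g' y + h' y) => [|y y0]; [exact: ratfun_add|apply: der_add; auto].
- exists (fun y => g' y * h y + g y * h' y) => [|y y0].
    by apply: ratfun_add; apply: ratfun_mul.
  by apply: der_mul; auto.
Qed.

Lemma ratfun_cc f : ratfun f -> cc f.
Proof.
move=> /ratfun_der [f' _ df] y; apply: c_comp; last exact: clamp_cont.
by apply: is_derive_cont (df _ _); apply: U0; exact: clampI.
Qed.

Definition ratD (f : R -> R) : R -> R := xget (cst 0)
  [set f' | ratfun f' /\ forall y, U 0%N y != 0 -> is_derive y 1 f (f' y)].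

Lemma ratDP f : ratfun f -> ratfun (ratD f) /\
  forall y, U 0%N y != 0 -> is_derive y 1 f (ratD f y).
Proof.
move=> /ratfun_der [f' rf' df'].
exact: (@xgetPex _ (cst 0) [set f' | ratfun f' /\ _] (ex_intro _ f' (conj rf' df'))).
Qed.

(** The shear flow U has Lap psi0 = U' = beta y + F(psi0) for a function F on
    the range of psi0; [fF i] is the i-th derivative of F, expressed in the
    ordinate y. *)
Definition fF i : R -> R :=
  iter i (fun f y => ratD f y * (U 0%N y)^-1) (fun y => U 1%N y + - beta * y).

Lemma fF_rat i : ratfun (fF i).
Proof.
elim: i => [|i IH] /=.
  by apply: ratfun_add; [exact: ratfun_U|apply: ratfun_mul; [exact: ratfun_cst|exact: ratfun_id]].
by apply: ratfun_mul; [exact: (ratDP IH).1|exact: ratfun_V].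
Qed.

Lemma fF_der i y : y1 <= y <= y2 -> is_derive y 1 (fF i) (fF i.+1 y * U 0%N y).
Proof.
move=> yI; have y0 := U0 yI.
by apply: der_eq ((ratDP (fF_rat i)).2 y y0) _; rewrite /= divfK.
Qed.

Lemma fF_cc i : cc (fF i).
Proof. exact: ratfun_cc (fF_rat i). Qed.

Lemma fF1E y : y1 <= y <= y2 -> fF 1%N y = (U 2%N y - beta) / U 0%N y.
Proof.
move=> yI; have y0 := U0 yI; have d0 := fF_der 0%N yI.
have d1 : is_derive y 1 (fF 0%N) (U 2%N y - beta).
  by apply: der_eq (der_add (Ud 1%N y) (der_scale (- beta) (der_id y))) _; rewrite mulr1.
have := @derive_val _ _ _ _ _ _ _ d0; rewrite (@derive_val _ _ _ _ _ _ _ d1) => ->.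
by rewrite mulfK.
Qed.

(** The stream function of the shear flow. *)
Definition psi0 := prim y1 (U 0%N).

Lemma U_cont i : continuous (U i).
Proof. by move=> y; exact: is_derive_cont (Ud i y). Qed.

Lemma psi0_0 : psi0 y1 = 0.
Proof. exact: (primP y1 (@U_cont 0%N)).1. Qed.

Lemma psi0_der y : is_derive y 1 psi0 (U 0%N y).
Proof. exact: (primP y1 (@U_cont 0%N)).2. Qed.

Lemma psi0_cont : continuous psi0.
Proof. by move=> y; exact: is_derive_cont (psi0_der y). Qed.

Lemma U_lower : exists2 m : R, 0 < m & forall y, y1 <= y <= y2 -> m <= `|U 0%N y|.
Proof.
have [M M0 HM] := bounded_cc hy (ratfun_cc ratfun_V).
exists (M + 1)^-1; first by rewrite invr_gt0; lra.
move=> y yI; have := HM y yI; rewrite normfV => h.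
have u0 : 0 < `|U 0%N y| by rewrite normr_gt0 U0.
rewrite -[leRHS]invrK lef_pV2 ?posrE ?invr_gt0 //; lra.
Qed.

(** U has no zero, hence a constant sign and a positive lower bound. *)
Lemma psi0_expand : exists2 m : R, 0 < m & forall y z, y1 <= y <= y2 -> y1 <= z <= y2 ->
  m * `|y - z| <= `|psi0 y - psi0 z|.
Proof.
have [m m0 Hm] := U_lower; exists m => // y z.
wlog zy : y z / z <= y => [H yI zI|yI zI].
  by have [h|h] := leP z y; [exact: H|rewrite distrC (distrC (psi0 y)); apply: H; rewrite // ltW].
move: zy; rewrite le_eqVlt => /orP[/eqP->|zy]; first by rewrite !subrr !normr0 mulr0.
have pc x : z <= x <= y -> {for x, continuous psi0} by move=> _; exact: psi0_cont.
have [c cI ->] := mvt_eq zy pc (fun x _ => psi0_der x).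
by rewrite normrM ler_wpM2r // Hm //; lra.
Qed.

(** The inverse of [psi0], extended by constants; its continuity comes from
    [psi0_expand]. *)
Lemma psi0_inv : exists2 g, continuous g & forall y, y1 <= y <= y2 ->
  g (psi0 y) = y /\ forall z, y1 <= g z <= y2.
Proof.
have [m m0 Hm] := psi0_expand.
have pcI (s t : R) : {within `[s, t], continuous psi0}.
  exact: continuous_subspaceT psi0_cont.
have [c1 c1I c1m] := EVT_min (ltW hy) (pcI _ _).
have [c2 c2I c2m] := EVT_max (ltW hy) (pcI _ _).
pose a := psi0 c1; pose b := psi0 c2.
rewrite !in_itv /= in c1I c2I.
have ab : a <= b by apply: c2m; rewrite in_itv.
have ex z : exists y, y1 <= y <= y2 /\ psi0 y = Num.max a (Num.min z b).
  have vab : a <= Num.max a (Num.min z b) <= b.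
    by rewrite le_max lexx /= ge_max ge_min lexx orbT andbT.
  have [h|h] := leP c1 c2.
    have [] := IVT h (pcI _ _) (v := Num.max a (Num.min z b)).
      by rewrite (min_l ab) (max_r ab).
    move=> y; rewrite in_itv /= => yI E; exists y; split=> //; lra.
  have [] := IVT (ltW h) (pcI _ _) (v := Num.max a (Num.min z b)).
    by rewrite (min_r ab) (max_l ab).
  move=> y; rewrite in_itv /= => yI E; exists y; split=> //; lra.
have [g Hg] := choice ex.
have lip z z' : `|Num.max a (Num.min z b) - Num.max a (Num.min z' b)| <= `|z - z'|.
  clear - ab; rewrite ler_norml; have := ler_norm (z - z'); have := ler_norm (z' - z).
  rewrite (distrC z'); rewrite !maxEle !minEle; do !case: ifP; move=> *; lra.
exists g.
  move=> z; apply/cvgrPdist_le => e e0.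
  have em : 0 < e * m by rewrite mulr_gt0.
  apply/nbhs_ballP; exists (e * m) => // z'; rewrite /ball /= => zz.
  have [gI gE] := Hg z; have [gI' gE'] := Hg z'.
  have := Hm _ _ gI gI'; rewrite gE gE' => h.
  have h2 := lip z z'.
  rewrite -(ler_pM2r m0) mulrC; lra.
move=> y yI; split; last by move=> z; exact: (Hg z).1.
have [gI gE] := Hg (psi0 y).
have pI : Num.max a (Num.min (psi0 y) b) = psi0 y.
  by rewrite min_l ?max_r //; [apply: c1m|apply: c2m]; rewrite in_itv.
have := Hm _ _ gI yI; rewrite gE pI subrr normr0 pmulr_rle0 // normr_le0 subr_eq0.
by move=> /eqP.
Qed.

Lemma poly_psi0 g G Z d : cc g -> bnd g G -> 0 < d -> bnd psi0 Z -> 0 < Z ->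
  exists p : {poly R}, (forall y, y1 <= y <= y2 -> `|p.[psi0 y] - g y| <= d) /\
    (forall z, `|z| <= Z -> `|p.[z]| <= G + d).
Proof.
move=> gc gG d0 pZ Z0; have [h hc hI] := psi0_inv.
have hcl z : clamp (h z) = h z.
  rewrite clamp_id //; apply: (hI y1 _).2; by rewrite lexx ltW.
have ghc : continuous (g \o h).
  have -> : g \o h = (g \o clamp) \o h by apply/funext => z /=; rewrite hcl.
  by move=> z; apply: c_comp; [exact: gc|exact: hc].
have ZZ : - Z < Z by lra.
have [p Hp] := weierstrass ZZ ghc d0.
exists p; split.
  move=> y yI; have := Hp (psi0 y); rewrite /= (hI y yI).1; apply.
  by rewrite -ler_norml pZ.
move=> z zZ; have -> : p.[z] = g (h z) + (p.[z] - g (h z)) by rewrite subrKC.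
apply: le_trans (ler_normD _ _) _; apply: lerD.
  by apply: gG; have := (hI y1 _).2; apply; rewrite lexx ltW.
by apply: Hp; rewrite -ler_norml.
Qed.

(** The n-th derivative of F is approximated by a polynomial, which is
    integrated n times. The constants do not depend on the accuracy d. *)
Lemma poly_approx n (f : nat -> R -> R) Z : 0 < Z -> bnd psi0 Z ->
  (forall i, cc (f i)) ->
  (forall i y, y1 <= y <= y2 -> is_derive y 1 (f i) (f i.+1 y * U 0%N y)) ->
  exists2 K : R, 0 <= K & forall d, 0 < d <= 1 -> exists P : {poly R},
   (forall i y, (i <= n)%N -> y1 <= y <= y2 -> `|P^`(i).[psi0 y] - f i y| <= K * d) /\
   (forall i z, (i <= n)%N -> `|z| <= Z -> `|P^`(i).[z]| <= K).
Proof.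
move=> Z0 pZ; elim: n f => [|n IH] f fc fd.
  have [G G0 fG] := bounded_cc hy (fc 0%N).
  exists (G + 1); first lra.
  move=> d /andP[d0 d1]; have [p [p1 p2]] := poly_psi0 (fc 0%N) fG d0 pZ Z0.
  exists p; split=> [i y|i z]; rewrite leqn0 => /eqP-> h; rewrite derivn0.
    by apply: le_trans (p1 y h) _; rewrite ler_peMl //; lra.
  by apply: le_trans (p2 z h) _; lra.
have [K K0 HK] := IH (fun i => f i.+1) (fun i => fc i.+1) (fun i => fd i.+1).
have [M M0 UM] := bounded_cc hy (@cc_cont _ y1 y2 _ (@U_cont 0%N)).
have [G G0 fG] := bounded_cc hy (fc 0%N).
have len0 : 0 <= len by rewrite subr_ge0 ltW.
pose K' : R := K + K * M * len + G + K * Z.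
have KM : 0 <= K * M * len by rewrite !mulr_ge0.
have KZ : 0 <= K * Z by rewrite mulr_ge0 // ltW.
have K'0 : 0 <= K' by rewrite /K'; lra.
exists K' => // d d01; have [P [P1 P2]] := HK d d01.
case/andP: d01 => d0 d1.
pose A := antideriv_poly P.
have [Ad A0] := antideriv_polyP P.
pose Q := (f 0%N y1)%:P + A.
have Qd : Q^`() = P by rewrite /Q derivD derivC add0r.
have Qi i : Q^`(i.+1) = P^`(i) by rewrite derivSn Qd.
have yI1 : y1 <= y1 <= y2 by rewrite lexx ltW.
exists Q; split.
- case=> [|i] y iN yI; last first.
    rewrite Qi; apply: le_trans (P1 i y iN yI) _.
    by rewrite ler_wpM2r ?(ltW d0) // /K'; lra.
  rewrite derivn0.
  have h x : y1 <= x <= y2 -> is_derive x 1 (fun t => Q.[psi0 t] - f 0%N t)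
      (U 0%N x * P.[psi0 x] - f 1%N x * U 0%N x).
    move=> xI; apply: der_sub; last exact: fd.
    by rewrite -Qd; apply: der_comp (der_horner _ _) (psi0_der x).
  have KMd : 0 <= K * d * M by rewrite !mulr_ge0 // ltW.
  have y1y : y1 <= y by case/andP: yI.
  have Q0 : Q.[psi0 y1] = f 0%N y1 by rewrite psi0_0 /Q hornerD hornerC A0 addr0.
  have sub x : y1 <= x <= y -> y1 <= x <= y2 by move: yI; lra.
  have bd x : y1 <= x <= y -> `|U 0%N x * P.[psi0 x] - f 1%N x * U 0%N x| <= K * d * M.
    move=> /sub xI; rewrite (mulrC (U _ _)) -mulrBl normrM.
    apply: ler_pM => //; last exact: UM.
    by have := P1 0%N x (leq0n _) xI; rewrite derivn0.
  have := mvt_le y1y KMd (fun x xy => h x (sub x xy)) bd.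
  rewrite Q0 subrr subr0 => /le_trans; apply.
  have : K * d * M * (y - y1) <= K * d * M * len by rewrite ler_wpM2l //; lra.
  have -> : K * d * M * len = K * M * len * d by ring.
  have : K * M * len * d <= K' * d by rewrite ler_wpM2r ?(ltW d0) // /K'; lra.
  lra.
- case=> [|i] z iN zZ; last by rewrite Qi; apply: le_trans (P2 i z iN zZ) _; rewrite /K'; lra.
  rewrite derivn0 /Q hornerD hornerC; apply: le_trans (ler_normD _ _) _.
  have := fG y1 yI1.
  have PZ t : `|t| <= Z -> `|A^`().[t]| <= K.
    by move=> tZ; rewrite Ad; have := P2 0%N t (leq0n _) tZ; rewrite derivn0.
  have z0 : `|0 : R| <= Z by rewrite normr0 ltW.
  have := horner_lip PZ z0 zZ; rewrite A0 !subr0 => h.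
  have : K * `|z| <= K * Z by rewrite ler_wpM2l.
  rewrite /K'; lra.
Qed.

Lemma horner_taylor (p : {poly R}) Z K a b : 0 <= K ->
  (forall z, `|z| <= Z -> `|p^`(2).[z]| <= K) -> `|a| <= Z -> `|b| <= Z ->
  `|p.[b] - p.[a] - p^`().[a] * (b - a)| <= K * `|b - a| ^+ 2.
Proof.
move=> K0 pK aZ bZ.
have zZ z : Num.min a b <= z <= Num.max a b -> `|z| <= Z /\ `|z - a| <= `|b - a|.
  move: aZ bZ; rewrite !ler_norml ge_min le_max => /andP[a1 a2] /andP[b1 b2].
  have h1 := ler_norm (b - a); have h2 := ler_norm (a - b); rewrite distrC in h2.
  move=> /andP[/orP[h|h] /orP[h'|h']]; split; lra.
have p2 : p^`()^`() = p^`(2) by rewrite derivSn derivn1.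
have -> : p.[b] - p.[a] - p^`().[a] * (b - a) =
    (p.[b] - p^`().[a] * b) - (p.[a] - p^`().[a] * a) by ring.
rewrite expr2 mulrA.
apply: (@mvt_abs R (fun z => p.[z] - p^`().[a] * z) (fun z => p^`().[z] - p^`().[a])).
- by rewrite mulr_ge0.
- move=> x _; apply: der_eq (der_sub (der_horner p x) (der_scale _ (der_id x))) _.
  by rewrite mulr1.
- move=> x /zZ [xZ xa].
  have := horner_lip (p := p^`()) (K := K) _ aZ xZ.
  rewrite p2 => /(_ pK) /le_trans; apply; exact: ler_wpM2l.
Qed.

Lemma poly_bound (p : {poly R}) n Z : 0 < Z -> exists2 K : R, 0 <= K &
  forall i z, (i <= n)%N -> `|z| <= Z -> `|p^`(i).[z]| <= K.
Proof.
move=> Z0; elim: n => [|n [K K0 IH]].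
  have ZZ : - Z < Z by lra.
  have [M M0 HM] := @bounded_on R (- Z) Z ZZ (fun z => p.[z]) (@horner_cont R p).
  exists M => // i z; rewrite leqn0 => /eqP-> zZ; rewrite derivn0.
  by apply: HM; rewrite -ler_norml.
have ZZ : - Z < Z by lra.
have [M M0 HM] := @bounded_on R (- Z) Z ZZ (fun z => p^`(n.+1).[z]) (@horner_cont R _).
exists (Num.max K M); first by rewrite le_max K0.
move=> i z; rewrite leq_eqVlt => /orP[/eqP->|iN] zZ.
  by rewrite le_max HM ?orbT // -ler_norml.
by rewrite le_max IH.
Qed.
End Profile.

(** * Classes of functions with uniformly bounded derivatives *)

Section Classes.
Context {R : realType} (T y1 y2 : R).
Hypothesis hy : y1 < y2.
Local Notation clamp := (clamp y1 y2).
Local Notation cc f := (continuous (f \o clamp)).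
Implicit Types (g h : R * R -> R) (M : R).

(** Bounded continuous T-periodic derivatives up to order [N], the ordinate
    derivatives being taken inside the strip. One bound for all of them
    suffices, because only sums of terms O(eps) have to be estimated. *)
Fixpoint CB M N g : Prop :=
  [/\ continuous g, (forall p, `|g p| <= M), (forall x y, g (x + T, y) = g (x, y)) &
   match N with
   | 0 => True
   | N'.+1 => exists gx gy : R * R -> R,
      [/\ (forall x y : R, is_derive x 1 (fun x => g (x, y)) (gx (x, y))),
          (forall x y : R, y1 < y < y2 -> is_derive y 1 (fun y => g (x, y)) (gy (x, y))),
          CB M N' gx & CB M N' gy]
   end].

Lemma CB_le M M' N g : M <= M' -> CB M N g -> CB M' N g.
Proof.
move=> MM; elim: N g => [|N IH] g [gc gM gp rest]; split=> //.
- by move=> p; apply: le_trans MM.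
- by move=> p; apply: le_trans MM.
- case: rest => gx [gy [a b c d]]; exists gx, gy; split=> //; exact: IH.
Qed.

Lemma CB_cst0 M N : 0 <= M -> CB M N (fun _ => 0).
Proof.
move=> M0; elim: N => [|N IH]; split=> //; try (by move=> p; rewrite ?normr0 //; exact: c_cst).
exists (fun=> 0), (fun=> 0); split=> // *; exact: der_cst.
Qed.

Lemma CB_add M M' N g h : CB M N g -> CB M' N h -> CB (M + M') N (fun p => g p + h p).
Proof.
elim: N g h => [|N IH] g h [gc gM gp rest] [hc hM hp rest']; split.
- by move=> p; apply: c_add; [exact: gc|exact: hc].
- by move=> p; apply: le_trans (ler_normD _ _) _; exact: lerD.
- by move=> x y; rewrite gp hp.
- by [].
- by move=> p; apply: c_add; [exact: gc|exact: hc].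
- by move=> p; apply: le_trans (ler_normD _ _) _; exact: lerD.
- by move=> x y; rewrite gp hp.
case: rest => gx [gy [a b c d]]; case: rest' => hx [hy' [a' b' c' d']].
exists (fun p => gx p + hx p), (fun p => gy p + hy' p); split.
- by move=> x y; exact: der_add (a x y) (a' x y).
- by move=> x y yI; exact: der_add (b x y yI) (b' x y yI).
- exact: IH.
- exact: IH.
Qed.

Lemma snd_cont (f : R -> R) : continuous f -> continuous (fun p : R * R => f p.2).
Proof. by move=> fc p; apply: c_comp; [exact: fc|exact: cvg_snd]. Qed.

Section Near.
Context (L : Type) (e : L -> R).
Hypothesis e0 : forall l, 0 <= e l.
Implicit Types (f k : L -> R -> R) (C : R).

(** A family f l that converges to f0 together with its first [N] derivatives,
    at the rate e l; the class is closed under sums and products. *)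
Fixpoint near N f (f0 : R -> R) : Prop :=
  [/\ forall l, cc (f l), cc f0,
   (exists2 C : R, 0 <= C & forall l y, y1 <= y <= y2 ->
      [/\ `|f l y| <= C, `|f0 y| <= C & `|f l y - f0 y| <= C * e l]) &
   match N with
   | 0 => True
   | N'.+1 => exists f' f0',
      [/\ forall l y, y1 < y < y2 -> is_derive y 1 (f l) (f' l y),
          forall y, y1 < y < y2 -> is_derive y 1 f0 (f0' y) &
          near N' f' f0']
   end].

Lemma nearW N f (f0 : R -> R) : near N.+1 f f0 -> near N f f0.
Proof.
elim: N f f0 => [|N IH] f f0; first by case.
move=> [a b c [f' [f0' [d d' n]]]]; split=> //.
by exists f', f0'; split=> //; exact: IH.
Qed.

Lemma near_base_add f (f0 : R -> R) k (k0 : R -> R) C C' : 0 <= C -> 0 <= C' ->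
  (forall l y, y1 <= y <= y2 -> [/\ `|f l y| <= C, `|f0 y| <= C & `|f l y - f0 y| <= C * e l]) ->
  (forall l y, y1 <= y <= y2 -> [/\ `|k l y| <= C', `|k0 y| <= C' & `|k l y - k0 y| <= C' * e l]) ->
  exists2 C : R, 0 <= C & forall l y, y1 <= y <= y2 ->
      [/\ `|f l y + k l y| <= C, `|f0 y + k0 y| <= C & `|f l y + k l y - (f0 y + k0 y)| <= C * e l].
Proof.
move=> C0 C'0 H H'; exists (C + C'); first exact: addr_ge0.
move=> l y yI; have [a b c] := H l y yI; have [a' b' c'] := H' l y yI; split.
- by apply: le_trans (ler_normD _ _) _; exact: lerD.
- by apply: le_trans (ler_normD _ _) _; exact: lerD.
- by rewrite opprD addrACA mulrDl; apply: le_trans (ler_normD _ _) _; exact: lerD.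
Qed.

Lemma near_add N f (f0 : R -> R) k (k0 : R -> R) : near N f f0 -> near N k k0 ->
  near N (fun l y => f l y + k l y) (fun y => f0 y + k0 y).
Proof.
elim: N f f0 k k0 => [|N IH] f f0 k k0 [a b [C C0 c] d] [a' b' [C' C'0 c'] d']; split.
- by move=> l; apply: cc_add.
- exact: cc_add.
- exact: near_base_add c c'.
- by [].
- by move=> l; apply: cc_add.
- exact: cc_add.
- exact: near_base_add c c'.
case: d => f' [f0' [d1 d2 d3]]; case: d' => k' [k0' [d1' d2' d3']].
exists (fun l y => f' l y + k' l y), (fun y => f0' y + k0' y); split.
- by move=> l y yI; exact: der_add (d1 l y yI) (d1' l y yI).
- by move=> y yI; exact: der_add (d2 y yI) (d2' y yI).
- exact: IH.
Qed.

Lemma near_base_mul f (f0 : R -> R) k (k0 : R -> R) C C' : 0 <= C -> 0 <= C' ->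
  (forall l y, y1 <= y <= y2 -> [/\ `|f l y| <= C, `|f0 y| <= C & `|f l y - f0 y| <= C * e l]) ->
  (forall l y, y1 <= y <= y2 -> [/\ `|k l y| <= C', `|k0 y| <= C' & `|k l y - k0 y| <= C' * e l]) ->
  exists2 C : R, 0 <= C & forall l y, y1 <= y <= y2 ->
      [/\ `|f l y * k l y| <= C, `|f0 y * k0 y| <= C & `|f l y * k l y - f0 y * k0 y| <= C * e l].
Proof.
move=> C0 C'0 H H'; have CC : 0 <= C * C' by exact: mulr_ge0.
exists (2 * (C * C')); first by rewrite mulr_ge0.
move=> l y yI; have [a b c] := H l y yI; have [a' b' c'] := H' l y yI; split.
- rewrite normrM; apply: le_trans (_ : _ <= C * C') _; [exact: ler_pM|lra].
- rewrite normrM; apply: le_trans (_ : _ <= C * C') _; [exact: ler_pM|lra].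
- have -> : f l y * k l y - f0 y * k0 y = (f l y - f0 y) * k l y + f0 y * (k l y - k0 y) by ring.
  apply: le_trans (ler_normD _ _) _; rewrite !normrM.
  have h1 : `|f l y - f0 y| * `|k l y| <= C * e l * C' by exact: ler_pM.
  have h2 : `|f0 y| * `|k l y - k0 y| <= C * (C' * e l) by exact: ler_pM.
  have -> : 2 * (C * C') * e l = C * e l * C' + C * (C' * e l) by ring.
  exact: lerD.
Qed.

Lemma near_mul N f (f0 : R -> R) k (k0 : R -> R) : near N f f0 -> near N k k0 ->
  near N (fun l y => f l y * k l y) (fun y => f0 y * k0 y).
Proof.
elim: N f f0 k k0 => [|N IH] f f0 k k0 nf nk.
  case: nf nk => [a b [C C0 c] d] [a' b' [C' C'0 c'] d']; split=> //.
  - by move=> l; apply: cc_mul.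
  - exact: cc_mul.
  - exact: near_base_mul c c'.
have nf' := nearW nf; have nk' := nearW nk.
case: nf nk => [a b [C C0 c] d] [a' b' [C' C'0 c'] d']; split.
- by move=> l; apply: cc_mul.
- exact: cc_mul.
- exact: near_base_mul c c'.
case: d => f' [f0' [d1 d2 d3]]; case: d' => k' [k0' [d1' d2' d3']].
exists (fun l y => f' l y * k l y + f l y * k' l y),
  (fun y => f0' y * k0 y + f0 y * k0' y); split.
- by move=> l y yI; exact: der_mul (d1 l y yI) (d1' l y yI).
- by move=> y yI; exact: der_mul (d2 y yI) (d2' y yI).
- by apply: near_add; apply: IH.
Qed.

Lemma near_cst N (c : R) : near N (fun _ _ => c) (fun=> c).
Proof.
elim: N c => [|N IH] c; split=> //; try (by move=> *; exact: cc_cst).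
- by exists `|c| => // l y _; split=> //; rewrite subrr normr0 mulr_ge0.
- by exists `|c| => // l y _; split=> //; rewrite subrr normr0 mulr_ge0.
- exists (fun _ _ => 0), (fun=> 0); split=> // *; exact: der_cst.
Qed.

Lemma near_id N (b : R) : near N (fun _ y => b * y) (fun y => b * y).
Proof.
have c : cc (fun y => b * y).
  by apply: cc_mul; [exact: cc_cst|apply: cc_cont => y; exact: c_id].
have [C C0 H] := bounded_cc hy c.
have base : exists2 C : R, 0 <= C & forall (l : L) y, y1 <= y <= y2 ->
      [/\ `|b * y| <= C, `|b * y| <= C & `|b * y - b * y| <= C * e l].
  by exists C => // l y yI; split; rewrite ?H // subrr normr0 mulr_ge0.
case: N => [|N]; split=> //.
exists (fun _ _ => b), (fun=> b); split; last exact: near_cst.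
- by move=> l y _; apply: der_eq (der_scale b (der_id y)) _; rewrite mulr1.
- by move=> y _; apply: der_eq (der_scale b (der_id y)) _; rewrite mulr1.
Qed.

Lemma der_clamp (f : R -> R) (d y : R) : y1 < y < y2 ->
  is_derive y 1 f d -> is_derive y 1 (f \o clamp) d.
Proof.
move=> /andP[a b] df; apply: near_eq_is_derive df.
near=> z; rewrite /= clamp_id //.
have z1 : y1 < z by near: z; exact: lt_nbhsr.
have z2 : z < y2 by near: z; exact: lt_nbhsl.
by rewrite !ltW.
Unshelve. all: end_near.
Qed.

(** This is how closeness of profiles becomes closeness of plane flows. *)
Lemma near_CB N f (f0 : R -> R) : near N f f0 -> exists2 C : R, 0 <= C & forall l,
  CB (C * e l) N (fun p => f l (clamp p.2) - f0 (clamp p.2)).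
Proof.
have base (g : L -> R -> R) (g0 : R -> R) l : cc (g l) -> cc g0 ->
    continuous (fun p : R * R => g l (clamp p.2) - g0 (clamp p.2)).
  move=> a b; apply: (@snd_cont (fun y => g l (clamp y) - g0 (clamp y))) => y.
  by apply: c_sub; [exact: a|exact: b].
elim: N f f0 => [|N IH] f f0 [a b [C C0 c] d].
  exists C => // l; split=> //; first exact: base.
  by move=> p; have [] := c l (clamp p.2) (clampI hy _).
case: d => f' [f0' [d1 d2 /IH [C' C'0 d3]]].
exists (C + C'); first exact: addr_ge0.
have CC l : C' * e l <= (C + C') * e l by rewrite ler_wpM2r // lerDr.
move=> l; split=> //; first exact: base.
  move=> p; have [_ _ h] := c l (clamp p.2) (clampI hy _).
  by apply: le_trans h _; rewrite ler_wpM2r // lerDl.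
exists (fun=> 0), (fun p => f' l (clamp p.2) - f0' (clamp p.2)); split.
- by move=> x y /=; exact: der_cst.
- move=> x y yI; rewrite /= clamp_id; last by case/andP: yI => *; rewrite !ltW.
  have h := der_sub (d1 l y yI) (d2 y yI).
  exact: (@der_clamp (fun y => f l y - f0 y) _ y yI h).
- by apply: CB_cst0; rewrite mulr_ge0 // addr_ge0.
- exact: CB_le (CC l) (d3 l).
Qed.
End Near.
End Classes.

(** * Shear flows with polynomial vorticity function *)

Section Shear.
Context {R : realType} (y1 y2 beta : R) (U : nat -> R -> R).
Hypotheses (hy : y1 < y2) (Ud : forall i (y : R), is_derive y 1 (U i) (U i.+1 y)).
Hypothesis U0 : forall y, y1 <= y <= y2 -> U 0%N y != 0.
Local Notation clamp := (clamp y1 y2).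
Local Notation sec := (sec y1 y2).
Local Notation gC := (gC y1 y2).
Local Notation lC := (lC y1 y2).
Local Notation len := (y2 - y1).
Local Notation psi0 := (psi0 y1 U).
Local Notation fF := (fF beta U).
Implicit Types (y z K e r m k A B d Z C mu : R) (P G : {poly R}) (W V : R -> R).
Local Notation cc f := (continuous (f \o clamp)).
Local Notation bnd f M := (forall y : R, y1 <= y <= y2 -> `|f y| <= M).

(** psi0 + W is the stream function of the parallel flow with Lap psi = beta y
    + P(psi) and the Cauchy data of psi0 at y1. *)
Definition shear P W W1 := [/\ W y1 = 0, W1 y1 = 0 &
  sec (fun y => P.[psi0 y + W y] - fF 0 y) W W1].

Lemma psi0c : continuous psi0. Proof. by move=> y; apply: psi0_cont. Qed.
Lemma fFc i : cc (fF i). Proof. by move=> y; apply: fF_cc. Qed.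
Lemma psi0d y : is_derive y 1 psi0 (U 0%N y). Proof. exact: psi0_der. Qed.
Lemma fFd i y : y1 <= y <= y2 -> is_derive y 1 (fF i) (fF i.+1 y * U 0%N y).
Proof. exact: fF_der. Qed.
Lemma Uc i : continuous (U i). Proof. by move=> y; apply: U_cont. Qed.

Lemma shear_src_cont P W : continuous W ->
  continuous (fun y => P.[psi0 (clamp y) + W (clamp y)] - fF 0 (clamp y)).
Proof.
move=> Wc y; apply: c_sub; last exact: fFc.
apply: (@c_comp R R (fun z => P.[z]) (fun y => psi0 (clamp y) + W (clamp y))).
  exact: horner_cont.
by apply: c_add; apply: comp_clamp_cont => //; exact: psi0c.
Qed.

(** The source P(psi0 + W) - F(psi0) is Lipschitz in W and O(e) at W = 0, so
    [ivp] applies. *)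
Lemma shear_ex K Z : 0 <= K -> 1 <= Z -> bnd psi0 (Z - 1) -> forall P e, 0 <= e ->
  (forall z, `|z| <= Z -> `|P^`().[z]| <= K) ->
  (forall y, y1 <= y <= y2 -> `|P.[psi0 y] - fF 0 y| <= e) -> gC K * e <= 1 ->
  exists W W1, shear P W W1 /\
    forall y, y1 <= y <= y2 -> `|W y| <= gC K * e /\ `|W1 y| <= gC K * e.
Proof.
move=> K0 Z1 pZ P e e0 PK Pe e1.
pose Phi y w := P.[psi0 y + w] - fF 0 y.
have Z' y a : y1 <= y <= y2 -> `|a| <= 1 -> `|psi0 y + a| <= Z.
  by move=> yI a1; apply: le_trans (ler_normD _ _) _; have := pZ y yI; lra.
have L y a b : y1 <= y <= y2 -> `|a| <= 1 -> `|b| <= 1 ->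
    `|Phi y a - Phi y b| <= K * `|a - b|.
  move=> yI a1 b1.
  have := horner_lip PK (Z' y b yI b1) (Z' y a yI a1).
  have -> : psi0 y + a - (psi0 y + b) = a - b by ring.
  by rewrite /Phi opprB addrA subrK.
have P0 y : y1 <= y <= y2 -> `|Phi y 0| <= e by move=> yI; rewrite /Phi addr0 Pe.
have [W [W1 [a b c d]]] := ivp hy K0 e0 e1 (@shear_src_cont P) L P0.
by exists W, W1.
Qed.

Lemma shear_diff K Z P P' W W1 V V1 e : 0 <= K -> 0 <= e -> bnd psi0 (Z - 1) ->
  (forall z, `|z| <= Z -> `|P^`().[z]| <= K) ->
  (forall z, `|z| <= Z -> `|P.[z] - P'.[z]| <= e) ->
  bnd W 1 -> bnd V 1 -> shear P W W1 -> shear P' V V1 ->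
  forall y, y1 <= y <= y2 -> `|W y - V y| <= gC K * e /\ `|W1 y - V1 y| <= gC K * e.
Proof.
move=> K0 e0 pZ PK PP Wr Vr [W0 W10 [dW dW1]] [V0 V10 [dV dV1]] y yI.
have Z' z a : y1 <= z <= y2 -> `|a| <= 1 -> `|psi0 z + a| <= Z.
  by move=> zI a1; apply: le_trans (ler_normD _ _) _; have := pZ z zI; lra.
apply: (@gronwall R y1 y2 hy (fun z => W z - V z) (fun z => W1 z - V1 z)
  (fun z => P.[psi0 z + W z] - P'.[psi0 z + V z]) K e) => //.
- by rewrite W0 V0 subrr.
- by rewrite W10 V10 subrr.
- move=> z zI; apply: der_eq (der_sub (dW1 z) (dV1 z)) _.
  by rewrite clamp_id //; ring.
move=> z zI.
have -> : P.[psi0 z + W z] - P'.[psi0 z + V z] = (P.[psi0 z + W z] - P.[psi0 z + V z])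
  + (P.[psi0 z + V z] - P'.[psi0 z + V z]) by ring.
apply: le_trans (ler_normD _ _) _; apply: lerD; last by apply: PP; exact: Z' (Vr z zI).
have := horner_lip PK (Z' z _ zI (Vr z zI)) (Z' z _ zI (Wr z zI)).
by have -> : psi0 z + W z - (psi0 z + V z) = W z - V z by ring.
Qed.

Section NearShear.
Context (L : Type) (e : L -> R) (P : L -> {poly R}) (W W1 : L -> R -> R).
Context (N : nat) (K Z C : R).
Hypotheses (e0 : forall l, 0 <= e l) (K0 : 0 <= K) (C0 : 0 <= C) (e1 : forall l, e l <= 1).
Hypothesis pZ : bnd psi0 (Z - 1).
Hypothesis PF : forall l i y, (i <= N)%N -> y1 <= y <= y2 ->
  `|(P l)^`(i).[psi0 y] - fF i y| <= K * e l.
Hypothesis PK : forall l i z, (i <= N)%N -> `|z| <= Z -> `|(P l)^`(i).[z]| <= K.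
Hypothesis WS : forall l, shear (P l) (W l) (W1 l).
Hypothesis WC : forall l y, y1 <= y <= y2 ->
  [/\ `|W l y| <= 1, `|W l y| <= C * e l & `|W1 l y| <= C * e l].

Lemma shear_der_in l y : y1 <= y <= y2 ->
  is_derive y 1 (fun y => psi0 y + W l y) (U 0%N y + W1 l y) /\
  is_derive y 1 (fun y => U 0%N y + W1 l y) ((P l).[psi0 y + W l y] + beta * y).
Proof.
move=> yI; have [_ _ [dW dW1]] := WS l; split.
  exact: der_add (psi0d y) (dW y).
apply: der_eq (der_add (Ud 0%N y) (dW1 y)) _.
by rewrite clamp_id // (_ : fF 0 y = U 1%N y + - beta * y) //; ring.
Qed.

Lemma shear_cc l : cc (fun y => psi0 y + W l y) /\ cc (fun y => U 0%N y + W1 l y).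
Proof.
have [_ _ ws] := WS l; have [wc w1c] := sec_cont ws.
by split; apply: cc_add; apply: cc_cont => // y; [exact: psi0c|exact: Uc].
Qed.

(** Bootstrap: a derivative of the profile is a polynomial in psi0 + W plus
    beta y, and a derivative of that is again a product of quantities of lower
    order. *)
Lemma near_shear (k : nat) :
  ((k <= N)%N -> near y1 y2 e k (fun l y => U 0%N y + W1 l y) (U 0%N)) /\
  (forall i, (i + k < N)%N -> near y1 y2 e k (fun l y => (P l)^`(i).[psi0 y + W l y]) (fF i)).
Proof.
have U0c : cc (U 0%N) by apply: cc_cont; exact: (@Uc 0%N).
have bU : exists2 C : R, 0 <= C & forall l y, y1 <= y <= y2 ->
    [/\ `|U 0%N y + W1 l y| <= C, `|U 0%N y| <= C & `|U 0%N y + W1 l y - U 0%N y| <= C * e l].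
  have [M M0 HM] := bounded_cc hy U0c.
  exists (M + C); first exact: addr_ge0.
  move=> l y yI; have [_ _ h] := WC l yI; have hM := HM y yI.
  have Ce : C * e l <= C by rewrite ler_piMr.
  split.
  - apply: le_trans (ler_normD _ _) _; lra.
  - by apply: le_trans hM _; rewrite lerDl.
  - by rewrite addrC addKr; apply: le_trans h _; rewrite ler_wpM2r // lerDr.
have Pc i l : cc (fun y => (P l)^`(i).[psi0 y + W l y]).
  move=> y; apply: (@c_comp R R (fun z => (P l)^`(i).[z])); first exact: horner_cont.
  exact: (shear_cc l).1.
have Z' l z : y1 <= z <= y2 -> `|psi0 z + W l z| <= Z /\ `|psi0 z| <= Z.
  move=> zI; have [w _ _] := WC l zI; have := pZ zI; split; last lra.
  by apply: le_trans (ler_normD _ _) _; lra.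
have bP i : (i < N)%N -> exists2 C : R, 0 <= C & forall l y, y1 <= y <= y2 ->
    [/\ `|(P l)^`(i).[psi0 y + W l y]| <= C, `|fF i y| <= C &
        `|(P l)^`(i).[psi0 y + W l y] - fF i y| <= C * e l].
  move=> iN; have [M M0 HM] := bounded_cc hy (@fFc i).
  have KC : 0 <= K * C by rewrite mulr_ge0.
  have K0' := K0; exists (M + K * C + K); first by rewrite !addr_ge0.
  move=> l y yI; have [zZ pZ'] := Z' l y yI; split.
  - by apply: le_trans (PK _ (ltnW iN) zZ) _; lra.
  - by apply: le_trans (HM y yI) _; lra.
  have -> : (P l)^`(i).[psi0 y + W l y] - fF i y =
    ((P l)^`(i).[psi0 y + W l y] - (P l)^`(i).[psi0 y]) + ((P l)^`(i).[psi0 y] - fF i y) by ring.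
  apply: le_trans (ler_normD _ _) _.
  have h1 := PF l (ltnW iN) yI.
  have dK z : `|z| <= Z -> `|((P l)^`(i))^`().[z]| <= K.
    by move=> zz; rewrite -derivnS; exact: PK.
  have := horner_lip dK pZ' zZ; rewrite (_ : psi0 y + W l y - psi0 y = W l y); last by ring.
  move=> h2.
  have [_ w _] := WC l yI.
  have h3 : K * `|W l y| <= K * (C * e l) by rewrite ler_wpM2l.
  have h4 : 0 <= M * e l by rewrite mulr_ge0.
  have -> : (M + K * C + K) * e l = M * e l + K * (C * e l) + K * e l by ring.
  lra.
have yint y : y1 < y < y2 -> y1 <= y <= y2 by move=> /andP[? ?]; rewrite !ltW.
elim: k => [|k [IH1 IH2]].
  split=> [_|i]; first by split=> // l; exact: (shear_cc l).2.
  by rewrite addn0 => iN; split=> //; [exact: (@fFc i)|exact: bP].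
split=> [kN|i ikN].
  split=> //; first by move=> l; exact: (shear_cc l).2.
  exists (fun l y => (P l)^`(0).[psi0 y + W l y] + beta * y), (fun y => fF 0 y + beta * y).
  split.
  - by move=> l y /yint yI; rewrite derivn0; exact: (shear_der_in l yI).2.
  - move=> y /yint yI; apply: der_eq (Ud 0%N y) _.
    by rewrite (_ : fF 0 y = U 1%N y + - beta * y) //; ring.
  - apply: near_add; first by apply: IH2; rewrite add0n.
    exact: near_id.
split=> //.
- exact: (@fFc i).
- by apply: bP; apply: leq_ltn_trans ikN; rewrite leq_addr.
exists (fun l y => (P l)^`(i.+1).[psi0 y + W l y] * (U 0%N y + W1 l y)),
  (fun y => fF i.+1 y * U 0%N y); split.
- move=> l y /yint yI.
  apply: der_eq (der_comp (der_horner (P l)^`(i) _) (shear_der_in l yI).1) _.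
  by rewrite -derivnS mulrC.
- by move=> y /yint yI; exact: fFd.
- rewrite addnS in ikN.
  apply: near_mul; first by apply: IH2; rewrite addSn.
  by apply: IH1; apply: leq_trans (ltnW ikN); rewrite -addSn leq_addl.
Qed.
End NearShear.
End Shear.

(** * A perturbation that moves the eigenvalue *)

Section Transversal.
Context {R : realType} (y1 y2 beta : R) (U : nat -> R -> R).
Hypotheses (hy : y1 < y2) (Ud : forall i (y : R), is_derive y 1 (U i) (U i.+1 y)).
Hypothesis U0 : forall y, y1 <= y <= y2 -> U 0%N y != 0.
Local Notation clamp := (clamp y1 y2).
Local Notation sec := (sec y1 y2).
Local Notation gC := (gC y1 y2).
Local Notation len := (y2 - y1).
Local Notation psi0 := (psi0 y1 U).
Local Notation fF := (fF beta U).
Implicit Types (y z K e r m k A B d Z C mu : R) (f g h W V : R -> R).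
Local Notation cc f := (continuous (f \o clamp)).
Local Notation bnd f M := (forall y : R, y1 <= y <= y2 -> `|f y| <= M).

(** Integrals of continuous functions over [y1, y2], as increments of an
    antiderivative. *)
Definition intI f : R := prim y1 (f \o clamp) y2.

Lemma intI_ftc f F : cc f -> (forall y, y1 <= y <= y2 -> is_derive y 1 F (f y)) ->
  intI f = F y2 - F y1.
Proof.
move=> fc dF; have [p0 dp] := primP y1 fc.
have := @mvt_le R (fun y => F y - prim y1 (f \o clamp) y) (fun y => f y - f y) 0 y1 y2 (ltW hy) (lexx 0).
rewrite mul0r p0 subr0 => H.
have : `|F y2 - prim y1 (f \o clamp) y2 - F y1| <= 0.
  apply: H => y yI; last by rewrite subrr normr0.
  by apply: der_sub; [exact: dF|apply: der_eq (dp y) _; rewrite /= clamp_id].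
by rewrite normr_le0 subr_eq0 /intI => /eqP <-; ring.
Qed.

Lemma intI_add f g : cc f -> cc g -> intI (fun y => f y + g y) = intI f + intI g.
Proof.
move=> fc gc; have [f0 df] := primP y1 fc; have [g0 dg] := primP y1 gc.
have d y : y1 <= y <= y2 ->
    is_derive y 1 (fun y => prim y1 (f \o clamp) y + prim y1 (g \o clamp) y) (f y + g y).
  by move=> yI; apply: der_eq (der_add (df y) (dg y)) _; rewrite /= clamp_id.
by rewrite (intI_ftc (cc_add fc gc) d) f0 g0 addr0 subr0.
Qed.

Lemma intI_scale c f : cc f -> intI (fun y => c * f y) = c * intI f.
Proof.
move=> fc; have [f0 df] := primP y1 fc.
have d y : y1 <= y <= y2 -> is_derive y 1 (fun y => c * prim y1 (f \o clamp) y) (c * f y).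
  by move=> yI; apply: der_eq (der_scale c (df y)) _; rewrite /= clamp_id.
by rewrite (intI_ftc (cc_mul (@cc_cst _ _ _ c) fc) d) f0 mulr0 subr0.
Qed.

Lemma intI_le f M : cc f -> 0 <= M -> bnd f M -> `|intI f| <= M * len.
Proof.
move=> fc M0 fM; have [f0 df] := primP y1 fc.
have b y : y1 <= y <= y2 -> `|(f \o clamp) y| <= M by move=> yI; apply: fM; exact: clampI.
by have := mvt_le (ltW hy) M0 (fun y _ => df y) b; rewrite f0 subr0.
Qed.

Lemma interior_closure f c : cc f -> (forall y, y1 < y < y2 -> f y = c) ->
  forall y, y1 <= y <= y2 -> f y = c.
Proof.
move=> fc H y yI; apply/eqP; rewrite -subr_eq0 -normr_le0; apply/ler_addgt0Pr => e e0.
have := fc y => /cvgrPdist_le /(_ e e0) /nbhs_ballP [r /= r0 Hr].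
have l0 : 0 < len by rewrite subr_gt0.
pose t := Num.min (r / 2) (len / 2).
have t0 : 0 < t by rewrite lt_min !divr_gt0.
have tr : t <= r / 2 by rewrite ge_min lexx.
have tl : t <= len / 2 by rewrite ge_min lexx orbT.
pose z := if y <= (y1 + y2) / 2 then y + t / 2 else y - t / 2.
have zy : `|y - z| < r.
  by rewrite /z; case: ifP => _; [rewrite opprD addrA subrr sub0r normrN|rewrite opprB addrC subrK]; rewrite ger0_norm; lra.
have zI : y1 < z < y2 by rewrite /z; case: ifP => h; lra.
have zI' : y1 <= z <= y2 by case/andP: zI => *; rewrite !ltW.
by have := Hr z zy; rewrite /= (clamp_id yI) (clamp_id zI') (H z zI) add0r.
Qed.

Lemma intI_sqr_eq0 f : cc f -> intI (fun y => f y * f y) = 0 ->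
  forall y, y1 <= y <= y2 -> f y = 0.
Proof.
move=> fc I0; apply: interior_closure => // y /andP[yy1 yy2].
have f2c : cc (fun y => f y * f y) by exact: cc_mul.
have [p0 dp] := primP y1 f2c.
set p := prim y1 _ in p0 dp.
have mono a b : a <= b -> p a <= p b.
  move=> ab; apply: (mvt_ge0 (f' := fun y => (f (clamp y)) * (f (clamp y)))) ab _ _ _ => //.
  - by move=> x _; exact: is_derive_cont (dp x).
  - by move=> x _; rewrite -expr2 sqr_ge0.
have pz z : y1 <= z <= y2 -> p z = 0.
  move=> /andP[a b]; apply/eqP; rewrite eq_le -{1}I0 /intI -/p mono //= -p0; exact: mono.
have d0 : is_derive y 1 p (0 : R).
  apply: near_eq_is_derive (der_cst 0 y); near=> z; apply/esym/pz.
  have z1 : y1 < z by near: z; exact: lt_nbhsr.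
  have z2 : z < y2 by near: z; exact: lt_nbhsl.
  by rewrite !ltW.
have := @derive_val _ _ _ _ _ _ _ d0; rewrite (@derive_val _ _ _ _ _ _ _ (dp y)) /=.
rewrite clamp_id; last by rewrite !ltW.
by move=> /eqP; rewrite mulf_eq0 orbb => /eqP.
Unshelve. all: end_near.
Qed.

Variables (kap : R) (phi phi1 : R -> R).
Hypothesis phiS : shoot y1 y2 (pot kap (fF 1%N) 1) phi phi1.
Hypothesis phi2 : phi y2 = 0.

(** The function th = phi^2 / U. By [transversal_id] a perturbation G of F
    acts on the eigenvalue through Lam = th'' - F'(psi0) th alone; its
    derivatives are listed explicitly. *)
Let V y := (U 0%N y)^-1.
Let V1 y := - U 1%N y * V y ^+ 2.
Let V2 y := - U 2%N y * V y ^+ 2 + 2 * U 1%N y ^+ 2 * V y ^+ 3.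
Let p y := fF 1%N y + kap ^+ 2.
Let th y := phi y ^+ 2 * V y.
Let th1 y := 2 * phi y * phi1 y * V y + phi y ^+ 2 * V1 y.
Let th2 y := (2 * phi1 y ^+ 2 + 2 * p y * phi y ^+ 2) * V y + 4 * phi y * phi1 y * V1 y
  + phi y ^+ 2 * V2 y.
Let Lam y := th2 y - fF 1%N y * th y.

Lemma Ucc i : cc (U i). Proof. by apply: cc_cont => y; apply: U_cont. Qed.
Lemma Vcc : cc V. Proof. exact: (ratfun_cc hy Ud U0 (ratfun_V U)). Qed.

Lemma phi_cc : cc phi /\ cc phi1.
Proof. by case: phiS => /sec_cont [a b] _ _; split; exact: cc_cont. Qed.

Lemma cc_sqr f : cc f -> cc (fun y => f y ^+ 2).
Proof. by move=> fc y; under [fun _ => _]funext do rewrite /= expr2; exact: (cc_mul fc fc). Qed.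

Lemma V_der y : y1 <= y <= y2 -> is_derive y 1 V (V1 y) /\ is_derive y 1 V1 (V2 y).
Proof.
move=> yI; have y0 := U0 yI.
have d : is_derive y 1 V (V1 y).
  by apply: der_eq (der_inv y0 (Ud 0%N y)) _; rewrite /V1 /V; field.
split=> //.
have -> : V1 = fun y => - U 1%N y * (V y * V y) by apply/funext => z; rewrite /V1 expr2.
apply: der_eq (der_mul (der_opp (Ud 1%N y)) (der_mul d d)) _.
by rewrite /V2 /V1; ring.
Qed.

Lemma phi_der y : y1 <= y <= y2 ->
  is_derive y 1 phi (phi1 y) /\ is_derive y 1 phi1 (p y * phi y).
Proof.
move=> yI; have [[d d1] _ _] := phiS; split=> //.
by apply: der_eq (d1 y) _; rewrite clamp_id // /pot addr0 mul1r.
Qed.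

Lemma th_der y : y1 <= y <= y2 -> is_derive y 1 th (th1 y) /\ is_derive y 1 th1 (th2 y).
Proof.
move=> yI; have [d d1] := phi_der yI; have [dV dV1] := V_der yI; split.
  have -> : th = fun y => (phi y * phi y) * V y by apply/funext => z; rewrite /th expr2.
  apply: der_eq (der_mul (der_mul d d) dV) _; rewrite /th1; ring.
have -> : th1 = fun y => 2 * (phi y * (phi1 y * V y)) + (phi y * phi y) * V1 y.
  by apply/funext => z; rewrite /th1; ring.
apply: der_eq (der_add (der_scale 2 (der_mul d (der_mul d1 dV))) (der_mul (der_mul d d) dV1)) _.
rewrite /th2; ring.
Qed.

Lemma Lam_cc : cc Lam.
Proof.
have [a b] := phi_cc; have v := Vcc; have f1 : cc (fF 1%N) by move=> y; apply: fF_cc.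
have u1 := @Ucc 1%N; have u2 := @Ucc 2%N.
have pc : cc p by apply: cc_add => //; exact: cc_cst.
have v1 : cc V1.
  apply: (@cc_mul _ _ _ (fun y => - U 1%N y)); last exact: cc_sqr.
  by move=> y; apply: c_opp; exact: u1.
have v2 : cc V2.
  apply: cc_add.
    apply: (@cc_mul _ _ _ (fun y => - U 2%N y)); last exact: cc_sqr.
    by move=> y; apply: c_opp; exact: u2.
  apply: cc_mul; first by apply: cc_mul; [exact: cc_cst|exact: cc_sqr].
  move=> y; under [fun _ => _]funext do rewrite /= exprS; exact: (cc_mul v (cc_sqr v)).
have t : cc th by apply: cc_mul => //; exact: cc_sqr.
apply: cc_sub; last exact: cc_mul.
have a2 := cc_sqr a; have b2 := cc_sqr b.
have c2 := @cc_cst _ y1 y2 2; have c4 := @cc_cst _ y1 y2 4.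
exact: (cc_add (cc_add (cc_mul (cc_add (cc_mul c2 b2) (cc_mul (cc_mul c2 pc) a2)) v)
  (cc_mul (cc_mul (cc_mul c4 a) b) v1)) (cc_mul a2 v2)).
Qed.

Lemma th_bd : [/\ th y1 = 0, th1 y1 = 0, th y2 = 0 & th1 y2 = 0].
Proof.
case: phiS => _ p0 p10; rewrite /th /th1 phi2 p0 expr0n /= !(mulr0, mul0r).
by rewrite addr0.
Qed.

(** Otherwise th would solve a linear equation with zero Cauchy data at y1,
    whence th = 0 and phi = 0. *)
Lemma Lam_neq0 : ~ (forall y, y1 <= y <= y2 -> Lam y = 0).
Proof.
move=> L0; have [t0 t10 _ _] := th_bd.
have [k k0 kQ] := bounded_cc hy (@fFc R y1 y2 beta U hy Ud U0 1).
have G : bnd th 0.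
  move=> y yI; have := @gronwall R y1 y2 hy th th1 th2 k 0 k0 (lexx 0) t0 t10
    (fun y yI => (th_der yI).1) (fun y yI => (th_der yI).2) _ y yI.
  rewrite mulr0 => H; apply H => z zI.
  have := L0 z zI; rewrite /Lam => /eqP; rewrite subr_eq0 => /eqP ->.
  by rewrite addr0 normrM ler_wpM2r // kQ.
have P0 : bnd phi 0.
  move=> y yI; have := G y yI; rewrite normr_le0 mulf_eq0 invr_eq0 (negbTE (U0 yI)) orbF.
  by rewrite expf_eq0 /= => /eqP ->; rewrite normr0.
have [ps p0 p10] := phiS.
have hz : bnd (fun y => pot kap (fF 1%N) 1 y * phi y + 0) 0.
  by move=> y yI; have := P0 y yI; rewrite normr_le0 => /eqP ->; rewrite mulr0 addr0 normr0.
have yI : y1 <= y1 <= y2 by rewrite lexx ltW.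
have := deriv_bound hy ps P0 hz yI.
by rewrite p10 normr1 mulr0 !mul0r addr0 ler10.
Qed.

(** The left-hand side is the derivative of the potential along the
    perturbation G of F, tested against phi^2, with [chi] the response of the
    stream function. Both integrands differ by the derivative of chi'' th -
    chi' th', and th vanishes to second order at both ends. *)
Lemma transversal_id (G : {poly R}) chi chi1 : chi y1 = 0 -> chi1 y1 = 0 ->
  sec (fun y => fF 1%N y * chi y + G.[psi0 y]) chi chi1 ->
  intI (fun y => (fF 2%N y * chi y + G^`().[psi0 y]) * phi y ^+ 2) =
  intI (fun y => chi1 y * Lam y).
Proof.
move=> c0 c10 cs; have [cc0 cc1] := sec_cont cs.
have [a b] := phi_cc.
have pc : cc psi0 by apply: cc_cont => y; apply: psi0_cont.
have Gc (H : {poly R}) : cc (fun y => H.[psi0 y]).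
  by move=> y; apply: (@c_comp R R (fun z => H.[z])); [exact: horner_cont|exact: pc].
have Lc := Lam_cc.
have c1 : cc (fun y => (fF 2%N y * chi y + G^`().[psi0 y]) * phi y ^+ 2).
  apply: cc_mul; last exact: cc_sqr.
  apply: cc_add; last exact: Gc.
  by apply: cc_mul; [apply: fFc|exact: cc_cont].
have c2 : cc (fun y => -1 * (chi1 y * Lam y)).
  by apply: cc_mul; [exact: cc_cst|apply: cc_mul => //; exact: cc_cont].
have c3 : cc (fun y => chi1 y * Lam y) by apply: cc_mul => //; exact: cc_cont.
apply/eqP; rewrite -subr_eq0 -mulN1r -(intI_scale (-1) c3) -intI_add //.
pose F y := (fF 1%N y * chi y + G.[psi0 y]) * th y - chi1 y * th1 y.
suff dF y : y1 <= y <= y2 -> is_derive y 1 F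
    ((fF 2%N y * chi y + G^`().[psi0 y]) * phi y ^+ 2 + -1 * (chi1 y * Lam y)).
  rewrite (intI_ftc (cc_add c1 c2) dF).
  by have [t0 t10 t2 t12] := th_bd; rewrite /F t0 t10 t2 t12 !mulr0 !subrr.
move=> yI; have [dt dt1] := th_der yI; have [d d1] := cs.
have dF1 := fF_der beta Ud U0 1%N yI.
have dG : is_derive y 1 (fun y => G.[psi0 y]) (U 0%N y * G^`().[psi0 y]).
  by apply: (der_comp (der_horner G _)); exact: psi0_der.
have d1' : is_derive y 1 chi1 (fF 1%N y * chi y + G.[psi0 y]).
  by apply: der_eq (d1 y) _; rewrite clamp_id.
apply: der_eq (der_sub (der_mul (der_add (der_mul dF1 (d y)) dG) dt) (der_mul d1' dt1)) _.
have y0 := U0 yI.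
have tE : th y = phi y ^+ 2 / U 0%N y by [].
rewrite /Lam tE; field => //.
Qed.

(** Let J be the integral of Lam from y to y2. If chi'' = J, then an
    integration by parts turns the integral of chi' Lam into that of J^2,
    which is positive. The forcing g that produces this chi is approximated by
    a polynomial in psi0. *)
Lemma transversal_ex : exists (G : {poly R}) chi chi1,
  [/\ chi y1 = 0, chi1 y1 = 0, sec (fun y => fF 1%N y * chi y + G.[psi0 y]) chi chi1 &
    intI (fun y => (fF 2%N y * chi y + G^`().[psi0 y]) * phi y ^+ 2) != 0].
Proof.
have Lc := Lam_cc.
have [l0 dl] := primP y1 Lc.
pose J y := intI Lam - prim y1 (Lam \o clamp) y.
have dJ y : is_derive y 1 J (- Lam (clamp y)).
  by apply: der_eq (der_sub (der_cst _ y) (dl y)) _; rewrite sub0r.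
have Jc : continuous J by move=> y; exact: is_derive_cont (dJ y).
have [e0 de] := primP y1 Jc; set eta := prim y1 J in e0 de.
have ec : continuous eta by move=> y; exact: is_derive_cont (de y).
have [x0 dx] := primP y1 ec; set chi := prim y1 eta in x0 dx.
have xc : continuous chi by move=> y; exact: is_derive_cont (dx y).
pose g y := J y - fF 1%N y * chi y.
have gc : cc g.
  by apply: cc_sub; [exact: cc_cont|apply: cc_mul; [apply: fFc|exact: cc_cont]].
have I0 : intI (fun y => eta y * Lam y) = intI (fun y => J y * J y).
  have a1 : cc (fun y => -1 * (eta y * Lam y)).
    by apply: cc_mul; [exact: cc_cst|apply: cc_mul => //; exact: cc_cont].
  have a2 : cc (fun y => eta y * Lam y) by apply: cc_mul => //; exact: cc_cont.
  have a3 : cc (fun y => J y * J y) by apply: cc_mul; exact: cc_cont.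
  apply/eqP; rewrite eq_sym -subr_eq0 -mulN1r -(intI_scale (-1) a2) -intI_add //.
  have dEJ y : y1 <= y <= y2 -> is_derive y 1 (fun y => eta y * J y)
      (J y * J y + -1 * (eta y * Lam y)).
    move=> yI; apply: der_eq (der_mul (de y) (dJ y)) _.
    by rewrite clamp_id //; ring.
  by rewrite (intI_ftc (cc_add a3 a1) dEJ) e0 /J /intI subrr mulr0 mul0r subrr.
have Ipos : intI (fun y => eta y * Lam y) != 0.
  rewrite I0; apply/eqP => /(intI_sqr_eq0 (@cc_cont _ _ _ _ Jc)) J0.
  apply: Lam_neq0; apply: interior_closure => // y /andP[a b].
  have d0 : is_derive y 1 J (0 : R).
    apply: near_eq_is_derive (der_cst 0 y); near=> z; apply/esym/J0.
    have z1 : y1 < z by near: z; exact: lt_nbhsr.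
    have z2 : z < y2 by near: z; exact: lt_nbhsl.
    by rewrite !ltW.
  have := @derive_val _ _ _ _ _ _ _ d0; rewrite (@derive_val _ _ _ _ _ _ _ (dJ y)).
  rewrite clamp_id; last by rewrite !ltW.
  by move=> /eqP; rewrite oppr_eq0 => /eqP.
(* a polynomial so close to g in psi0 that chi' changes by less than needed
   to make the integral vanish *)
have [k k0 kQ] := bounded_cc hy (@fFc R y1 y2 beta U hy Ud U0 1).
have [M M0 LM] := bounded_cc hy Lc.
have len0 : 0 <= len by rewrite subr_ge0 ltW.
have gk0 := gC_ge0 hy k0.
pose I := `|intI (fun y => eta y * Lam y)|.
have Ip : 0 < I by rewrite normr_gt0.
pose D := gC k * M * len + 1.
have D0 : 0 < D by rewrite /D ltr_wpDl // (mulr_ge0 (mulr_ge0 gk0 M0) len0).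
pose d := I / (2 * D).
have d0 : 0 < d by rewrite divr_gt0 // mulr_gt0.
have [Gb Gb0 gG] := bounded_cc hy gc.
have pc : cc psi0 by apply: cc_cont => y; apply: psi0_cont.
have [Z Z0 pZ] := bounded_cc hy pc.
have pZ' : bnd psi0 (Z + 1) by move=> y yI; apply: le_trans (pZ y yI) _; rewrite lerDl.
have Z1 : 0 < Z + 1 by rewrite ltr_wpDl.
have [G [G1 _]] := poly_psi0 hy Ud U0 gc gG d0 pZ' Z1.
have Gc (H : {poly R}) : cc (fun y => H.[psi0 y]).
  by move=> y; apply: (@c_comp R R (fun z => H.[z])); [exact: horner_cont|exact: pc].
have [x [x1 [xx0 xx10 xs]]] := ivp_lin hy 0 0 (@fFc R y1 y2 beta U hy Ud U0 1) (Gc G).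
exists G, x, x1; split=> //; rewrite (transversal_id xx0 xx10 xs).
have [xs0 xs1] := xs.
have diff y : y1 <= y <= y2 -> `|x1 y - eta y| <= gC k * d.
  move=> yI.
  have := @gronwall R y1 y2 hy (fun y => x y - chi y) (fun y => x1 y - eta y)
    (fun y => fF 1%N y * x y + G.[psi0 y] - J y) k d k0 (ltW d0) _ _ _ _ _ y yI.
  case.
  - by rewrite xx0 x0 subrr.
  - by rewrite xx10 e0 subrr.
  - move=> z zI; apply: der_eq (der_sub (xs1 z) (de z)) _.
    by rewrite clamp_id.
  - move=> z zI.
    have -> : fF 1%N z * x z + G.[psi0 z] - J z = fF 1%N z * (x z - chi z) + (G.[psi0 z] - g z).
      by rewrite /g; ring.
    apply: le_trans (ler_normD _ _) _; apply: lerD; last exact: G1.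
    by rewrite normrM ler_wpM2r // kQ.
  - by [].
have x1c : cc x1 by apply: cc_cont; have [] := sec_cont xs.
have b1 : cc (fun y => x1 y * Lam y) by exact: cc_mul.
have b2 : cc (fun y => -1 * (eta y * Lam y)).
  by apply: cc_mul; [exact: cc_cst|apply: cc_mul => //; exact: cc_cont].
have b3 : cc (fun y => eta y * Lam y) by apply: cc_mul => //; exact: cc_cont.
have close : `|intI (fun y => x1 y * Lam y) - intI (fun y => eta y * Lam y)| <= gC k * d * M * len.
  rewrite -mulN1r -(intI_scale (-1) b3) -intI_add //.
  apply: intI_le; first exact: cc_add.
    by rewrite (mulr_ge0 (mulr_ge0 gk0 (ltW d0)) M0).
  move=> y yI; have -> : x1 y * Lam y + -1 * (eta y * Lam y) = (x1 y - eta y) * Lam y by ring.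
  by rewrite normrM; apply: ler_pM => //; [exact: diff|exact: LM].
apply/eqP => E; rewrite E sub0r normrN -/I in close.
have : gC k * d * M * len <= D * d by rewrite /D; have -> : gC k * d * M * len = gC k * M * len * d by [ring]; rewrite ler_wpM2r ?(ltW d0) // lerDl.
have -> : D * d = I / 2 by rewrite /d; field; rewrite gt_eqF.
lra.
Unshelve. all: end_near.
Qed.
End Transversal.

(** * A family of shear flows across the resonance *)

Lemma CB_down (R : realType) (T y1 y2 M : R) (k n : nat) g :
  (k <= n)%N -> CB T y1 y2 M n g -> CB T y1 y2 M k g.
Proof.
elim: k n g => [|k IH] [|n] g kn //; first by case.
case=> a b c [gx [gy [e f h i]]]; split=> //.
by exists gx, gy; split=> //; apply: IH kn _.
Qed.

Lemma opposite_signs (R : realType) (t X Y c : R) : c < `|t| ->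
  `|X + t| <= c -> `|Y - t| <= c -> X * Y < 0.
Proof.
move=> ct; rewrite !ler_norml => /andP[x1 x2] /andP[z1 z2].
have [t0|t0] := leP 0 t.
  by rewrite ger0_norm // in ct; rewrite nmulr_rlt0; lra.
by rewrite ltr0_norm // in ct; rewrite pmulr_rlt0; lra.
Qed.

Section ShearFamily.
Context {R : realType} (y1 y2 beta : R) (U : nat -> R -> R).
Hypotheses (hy : y1 < y2) (Ud : forall i (y : R), is_derive y 1 (U i) (U i.+1 y)).
Hypothesis U0 : forall y, y1 <= y <= y2 -> U 0%N y != 0.
Local Notation clamp := (clamp y1 y2).
Local Notation sec := (sec y1 y2).
Local Notation gC := (gC y1 y2).
Local Notation lC := (lC y1 y2).
Local Notation len := (y2 - y1).
Local Notation psi0 := (psi0 y1 U).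
Local Notation fF := (fF beta U).
Local Notation shear := (shear y1 y2 beta U).
Local Notation intI := (intI y1 y2).
Implicit Types (y z K e r m k A B d Z C mu : R) (f g h W V : R -> R) (P G : {poly R}).
Local Notation cc f := (continuous (f \o clamp)).
Local Notation bnd f M := (forall y : R, y1 <= y <= y2 -> `|f y| <= M).

Variables (kap : R) (phi phi1 : R -> R).
Hypothesis phiS : shoot y1 y2 (pot kap (fF 1%N) 1) phi phi1.
Hypothesis phi2 : phi y2 = 0.

(** The potential of the equation linearised at the shear flow psi0 + W. *)
Definition Qpot P W y := P^`().[psi0 y + W y].

Lemma Qpot_cc P W : continuous W -> cc (Qpot P W).
Proof.
move=> Wc y; apply: (@c_comp R R (fun z => P^`().[z]) (fun y => psi0 (clamp y) + W (clamp y))).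
  exact: horner_cont.
by apply: c_add; apply: comp_clamp_cont => // z; apply: psi0_cont.
Qed.

Section Sign.
Variables (K Z C1 : R) (G : {poly R}) (chi chi1 : R -> R).
Hypotheses (K0 : 0 <= K) (C10 : 0 <= C1) (pZ : bnd psi0 (Z - 1)).
Hypothesis GK : forall i z, (i <= 2)%N -> `|z| <= Z -> `|G^`(i).[z]| <= K.
Hypotheses (chi0 : chi y1 = 0) (chi10 : chi1 y1 = 0).
Hypothesis chiS : sec (fun y => fF 1%N y * chi y + G.[psi0 y]) chi chi1.

Let qdot y := fF 2%N y * chi y + G^`().[psi0 y].
Let J := intI (fun y => qdot y * phi y ^+ 2).

(** P approximates F to third order, with the accuracy d and bounds
    independent of d. *)
Definition goodP P d :=
  (forall i y, (i <= 3)%N -> y1 <= y <= y2 -> `|P^`(i).[psi0 y] - fF i y| <= K * d) /\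
  (forall i z, (i <= 3)%N -> `|z| <= Z -> `|P^`(i).[z]| <= K).

(** Green's identity for s and phi gives - s(y2) phi'(y2) as the integral of
    (Q - q0) s phi, and Q - q0 = mu qdot up to O(d + mu^2), s = phi up to O(d
    + |mu|). *)
Lemma sign_est : exists2 C : R, 0 <= C & forall d mu P W W1,
  0 < d <= 1 -> `|mu| <= 1 -> d + `|mu| <= 1 -> goodP P d -> shear (P + mu *: G) W W1 ->
  bnd W 1 -> bnd W (C1 * (d + `|mu|)) ->
  bnd (fun y => Qpot (P + mu *: G) W y - fF 1%N y) (C * (d + `|mu|)) /\
  forall s s1, shoot y1 y2 (pot kap (Qpot (P + mu *: G) W) 1) s s1 ->
  `|s y2 * phi1 y2 + mu * J| <= C * (d + mu ^+ 2).
Proof.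
have pc : cc psi0 by apply: cc_cont => y; apply: psi0_cont.
have Hc (H : {poly R}) : cc (fun y => H.[psi0 y]).
  by move=> y; apply: (@c_comp R R (fun z => H.[z])); [exact: horner_cont|exact: pc].
have [xc x1c] := sec_cont chiS.
have [k1 k10 F1] := bounded_cc hy (fFc hy Ud U0 (beta := beta) (i := 1%N)).
have [k2 k20 F2] := bounded_cc hy (fFc hy Ud U0 (beta := beta) (i := 2%N)).
have qc : cc qdot.
  apply: cc_add; last exact: Hc.
  by apply: cc_mul; [apply: fFc|exact: cc_cont].
have [q q0 qB] := bounded_cc hy qc.
have [pcc p1cc] := phi_cc phiS.
have [ph ph0 pB] := bounded_cc hy pcc.
have len0 : 0 <= len by rewrite subr_ge0 ltW.
have g0 := gC_ge0 hy k10.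
pose Cr := 2 * (K * C1 ^+ 2) + 2 * K + 2 * (K * C1).
have KC0 : 0 <= K * C1 by rewrite mulr_ge0.
have KC20 : 0 <= K * C1 ^+ 2 by rewrite mulr_ge0 // exprn_ge0.
have Cr0 : 0 <= Cr by rewrite /Cr !addr_ge0 // mulr_ge0.
pose Cx := gC k1 * Cr.
have Cx0 : 0 <= Cx by rewrite mulr_ge0.
pose Cq := Cr + k2 * Cx.
have k2C : 0 <= k2 * Cx by rewrite mulr_ge0.
have Cq0 : 0 <= Cq by rewrite addr_ge0.
pose C3 := Cq + q.
have C30 : 0 <= C3 by rewrite addr_ge0.
pose kk := k1 + C3 + (1%:R * kap) ^+ 2.
have kap2 : 0 <= (1%:R * kap) ^+ 2 by rewrite sqr_ge0.
have kk0 : 0 <= kk := addr_ge0 (addr_ge0 k10 C30) kap2.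
pose L := lC kk ^+ 2.
have L0 : 0 <= L := sqr_ge0 _.
pose C4 := (Cq * ph ^+ 2 + 2 * (C3 * (L * C3) * ph)) * len.
have C40 : 0 <= C4.
  apply: mulr_ge0 len0; apply: addr_ge0; first exact: mulr_ge0 Cq0 (sqr_ge0 _).
  exact: mulr_ge0 (ler0n _ 2) (mulr_ge0 (mulr_ge0 C30 (mulr_ge0 L0 C30)) ph0).
exists (C3 + C4); first exact: addr_ge0.
move=> d mu P W W1 /andP[d0 d1] mu1 e1 [PF PK] WS Wr WC.
set e := d + `|mu| in e1 WC *.
set e2 := d + mu ^+ 2.
have mu0 : 0 <= `|mu| by [].
have e0 : 0 <= e by rewrite addr_ge0 // ltW.
have mu2 : mu ^+ 2 = `|mu| ^+ 2 by rewrite real_normK // num_real.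
have mm : `|mu| ^+ 2 <= `|mu| by rewrite expr2 ler_piMr.
have e20 : 0 <= e2 by rewrite /e2 mu2 addr_ge0 ?exprn_ge0 // ltW.
have e2e : e2 <= e by rewrite /e2 mu2 lerD2l.
have de2 : d <= e2 by rewrite lerDl sqr_ge0.
have ee : e ^+ 2 <= 2 * e2.
  have : d ^+ 2 <= d by rewrite expr2 ler_piMr // ltW.
  have : 0 <= (d - `|mu|) ^+ 2 by rewrite sqr_ge0.
  have -> : e ^+ 2 = 2 * d ^+ 2 + 2 * `|mu| ^+ 2 - (d - `|mu|) ^+ 2 by rewrite /e; ring.
  rewrite /e2 mu2; clear -hy Ud U0 phiS phi2 K0 C10 pZ GK chi0 chi10 chiS; lra.
have mue : `|mu| * e <= 2 * e2.
  apply: le_trans ee; rewrite expr2 ler_wpM2r // /e lerDr; exact: ltW.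
have Z' y : y1 <= y <= y2 -> `|psi0 y + W y| <= Z /\ `|psi0 y| <= Z.
  move=> yI; have := Wr y yI; have := pZ yI; clear -hy Ud U0 phiS phi2 K0 C10 pZ GK chi0 chi10 chiS=> h1 h2; split; last lra.
  by apply: le_trans (ler_normD _ _) _; lra.
have W2 y : y1 <= y <= y2 -> `|W y| ^+ 2 <= C1 ^+ 2 * (2 * e2).
  move=> yI; apply: le_trans (_ : _ <= (C1 * e) ^+ 2) _.
    by rewrite ler_sqr ?nnegrE ?mulr_ge0 ?WC.
  by rewrite exprMn ler_wpM2l // exprn_ge0.
have Pd i z : (i <= 2)%N -> `|z| <= Z -> `|(P^`(i))^`().[z]| <= K.
  by move=> i2 zZ; rewrite -derivnS; exact: PK.
(* Second order errors are at most a multiple of e2 = d + mu^2, thanks to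
   e^2 <= 2 e2 for e = d + |mu|. *)
have T0 (H : {poly R}) y : (forall z, `|z| <= Z -> `|H^`(2).[z]| <= K) -> y1 <= y <= y2 ->
    `|H.[psi0 y + W y] - H.[psi0 y] - H^`().[psi0 y] * W y| <= 2 * (K * C1 ^+ 2) * e2.
  move=> HK yI; have [z1 z2] := Z' y yI.
  have := horner_taylor K0 HK z2 z1.
  rewrite (_ : psi0 y + W y - psi0 y = W y); last by ring.
  move=> /le_trans; apply.
  have -> : 2 * (K * C1 ^+ 2) * e2 = K * (C1 ^+ 2 * (2 * e2)) by ring.
  by rewrite ler_wpM2l // W2.
have T1 y i : (i <= 3)%N -> y1 <= y <= y2 -> `|P^`(i).[psi0 y] - fF i y| <= K * e2.
  by move=> i3 yI; apply: le_trans (PF i y i3 yI) _; rewrite ler_wpM2l.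
have T2 y i : (i <= 3)%N -> y1 <= y <= y2 -> `|(P^`(i).[psi0 y] - fF i y) * W y| <= K * e2.
  move=> i3 yI; rewrite normrM -[leRHS]mulr1; apply: ler_pM => //; [exact: T1|exact: Wr].
have T3 (H : {poly R}) y : (forall z, `|z| <= Z -> `|H^`().[z]| <= K) -> y1 <= y <= y2 ->
    `|mu * (H.[psi0 y + W y] - H.[psi0 y])| <= 2 * (K * C1) * e2.
  move=> HK yI; have [z1 z2] := Z' y yI.
  have := horner_lip HK z2 z1.
  rewrite (_ : psi0 y + W y - psi0 y = W y); last by ring.
  move=> h; rewrite normrM.
  have h2 : K * `|W y| <= K * (C1 * e) by rewrite ler_wpM2l // WC.
  have h3 : `|mu| * `|H.[psi0 y + W y] - H.[psi0 y]| <= `|mu| * (K * (C1 * e)).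
    by rewrite ler_wpM2l //; exact: le_trans h h2.
  apply: le_trans h3 _.
  have -> : `|mu| * (K * (C1 * e)) = K * C1 * (`|mu| * e) by ring.
  have -> : 2 * (K * C1) * e2 = K * C1 * (2 * e2) by ring.
  by rewrite ler_wpM2l.
have [W0 W10 [dW dW1]] := WS.
case: chiS => dx dx1.
have Hm (z : R) : (P + mu *: G).[z] = P.[z] + mu * G.[z] by rewrite hornerD hornerZ.
have X y : y1 <= y <= y2 -> `|W y - mu * chi y| <= Cx * e2.
  move=> yI; have Cre : 0 <= Cr * e2 by rewrite mulr_ge0.
  pose x2 z := P.[psi0 z + W z] + mu * G.[psi0 z + W z] - fF 0 z
      - mu * (fF 1%N z * chi z + G.[psi0 z]).
  have a0 : W y1 - mu * chi y1 = 0 by rewrite W0 chi0 mulr0 subrr.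
  have a1 : W1 y1 - mu * chi1 y1 = 0 by rewrite W10 chi10 mulr0 subrr.
  have a2 z : y1 <= z <= y2 -> is_derive z 1 (fun y => W1 y - mu * chi1 y) (x2 z).
    move=> zI; apply: der_eq (der_sub (dW1 z) (der_scale mu (dx1 z))) _.
    by rewrite clamp_id // Hm.
  have a3 z : y1 <= z <= y2 -> `|x2 z| <= k1 * `|W z - mu * chi z| + Cr * e2.
    move=> zI.
    have -> : x2 z = fF 1%N z * (W z - mu * chi z) +
      ((P.[psi0 z + W z] - P.[psi0 z] - P^`().[psi0 z] * W z) + (P^`(0).[psi0 z] - fF 0%N z)
      + (P^`(1).[psi0 z] - fF 1%N z) * W z + mu * (G.[psi0 z + W z] - G.[psi0 z])).
      by rewrite /x2 derivn0 derivn1; ring.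
    apply: le_trans (ler_normD _ _) _; apply: lerD.
      by rewrite normrM ler_wpM2r // F1.
    apply: le_trans (ler_normD _ _) _; apply: le_trans (lerD (ler_normD _ _) (lexx _)) _.
    apply: le_trans (lerD (lerD (ler_normD _ _) (lexx _)) (lexx _)) _.
    have PK2 w : `|w| <= Z -> `|P^`(2).[w]| <= K by move=> h; exact: PK.
    have b1 := T0 P z PK2 zI.
    have b2 := T1 z 0%N isT zI. have b3 := T2 z 1%N isT zI.
    have GK1 w : `|w| <= Z -> `|G^`().[w]| <= K by move=> h; rewrite -derivn1; exact: GK.
    have b4 := T3 G z GK1 zI.
    have -> : Cr * e2 = 2 * (K * C1 ^+ 2) * e2 + K * e2 + K * e2 + 2 * (K * C1) * e2.
      by rewrite /Cr; ring.
    by rewrite !lerD.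
  have [h _] := gronwall hy k10 Cre a0 a1
    (fun z _ => der_sub (dW z) (der_scale mu (dx z))) a2 a3 yI.
  by apply: le_trans h _; rewrite mulrA.
have QE y : y1 <= y <= y2 -> `|Qpot (P + mu *: G) W y - fF 1%N y - mu * qdot y| <= Cq * e2.
  move=> yI.
  have -> : Qpot (P + mu *: G) W y - fF 1%N y - mu * qdot y =
     fF 2%N y * (W y - mu * chi y) +
     ((P^`().[psi0 y + W y] - P^`().[psi0 y] - P^`()^`().[psi0 y] * W y)
      + (P^`(1).[psi0 y] - fF 1%N y)
      + (P^`(2).[psi0 y] - fF 2%N y) * W y
      + mu * (G^`().[psi0 y + W y] - G^`().[psi0 y])).
    rewrite /Qpot derivD derivZ hornerD hornerZ /qdot derivn1 derivSn derivn1; ring.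
  apply: le_trans (ler_normD _ _) _.
  have -> : Cq * e2 = k2 * (Cx * e2) + Cr * e2 by rewrite /Cq; ring.
  apply: lerD.
    by rewrite normrM; apply: ler_pM => //; [exact: F2|exact: X].
  apply: le_trans (ler_normD _ _) _; apply: le_trans (lerD (ler_normD _ _) (lexx _)) _.
  apply: le_trans (lerD (lerD (ler_normD _ _) (lexx _)) (lexx _)) _.
  have PK3 w : `|w| <= Z -> `|P^`()^`(2).[w]| <= K.
    by move=> h; rewrite -derivSn; exact: PK.
  have b1 := T0 P^`() y PK3 yI.
  have b2 := T1 y 1%N isT yI. have b3 := T2 y 2%N isT yI.
  have GK2 w : `|w| <= Z -> `|G^`()^`().[w]| <= K.
    by move=> h; have := GK (i := 2%N) isT h; rewrite derivSn derivn1.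
  have b4 := T3 G^`() y GK2 yI.
  have -> : Cr * e2 = 2 * (K * C1 ^+ 2) * e2 + K * e2 + K * e2 + 2 * (K * C1) * e2.
    by rewrite /Cr; ring.
  by rewrite !lerD.
have QF y : y1 <= y <= y2 -> `|Qpot (P + mu *: G) W y - fF 1%N y| <= C3 * e.
  move=> yI; rewrite -(subrK (mu * qdot y) (_ - _)).
  apply: le_trans (ler_normD _ _) _; rewrite /C3 mulrDl; apply: lerD.
    by apply: le_trans (QE y yI) _; rewrite ler_wpM2l.
  rewrite normrM mulrC; apply: ler_pM => //; first exact: qB.
  by rewrite /e lerDr ltW.
split.
  move=> y yI; apply: le_trans (QF y yI) _.
  by rewrite ler_wpM2r // lerDl.
move=> s s1 sS.
set Q := Qpot (P + mu *: G) W in QE QF sS *.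
have Wcont : continuous W by move=> y; exact: is_derive_cont (dW y).
have Qc : cc Q by exact: Qpot_cc.
have C3e : C3 * e <= C3 by rewrite ler_piMr.
have pk : bnd (pot kap Q 1) kk.
  move=> y yI; rewrite /pot /kk; apply: le_trans (ler_normD _ _) _.
  rewrite (ger0_norm kap2) lerD2r.
  have -> : Q y = fF 1%N y + (Q y - fF 1%N y) by rewrite subrKC.
  apply: le_trans (ler_normD _ _) _; apply: lerD; first exact: F1.
  by apply: le_trans (QF y yI) _.
have pk' : bnd (pot kap (fF 1%N) 1) kk.
  move=> y yI; rewrite /pot /kk; apply: le_trans (ler_normD _ _) _.
  rewrite (ger0_norm kap2) lerD2r; apply: le_trans (F1 y yI) _.
  by rewrite lerDl.
have pd : bnd (fun y => pot kap Q 1 y - pot kap (fF 1%N) 1 y) (C3 * e).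
  by move=> y yI; rewrite /pot opprD addrACA subrr addr0 QF.
have C3e0 : 0 <= C3 * e by rewrite mulr_ge0.
have sd := shoot_diff hy (@pot_cc _ y1 y2 kap Q 1 Qc) kk0 C3e0 sS phiS pk pk' pd.
case: sS => [[ds ds1] s0 s10]; case: phiS => [[dp dp1] p0 p10].
have sc : cc s by apply: cc_cont => y; exact: is_derive_cont (ds y).
pose g y := (Q y - fF 1%N y) * s y * phi y.
have gc : cc g by apply: cc_mul => //; apply: cc_mul => //; apply: cc_sub => //; apply: fFc.
have dg y : y1 <= y <= y2 -> is_derive y 1 (fun y => s1 y * phi y - s y * phi1 y) (g y).
  move=> yI.
  apply: der_eq (der_sub (der_mul (ds1 y) (dp y)) (der_mul (ds y) (dp1 y))) _.
  by rewrite clamp_id // /g /pot; ring.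
have gI : intI g = - (s y2 * phi1 y2).
  by rewrite (intI_ftc hy gc dg) s0 p0 phi2 !mulr0 mul0r !subr0 sub0r.
have hc : cc (fun y => qdot y * phi y ^+ 2) by apply: cc_mul => //; exact: cc_sqr.
have hc' : cc (fun y => (- mu) * (qdot y * phi y ^+ 2)) by apply: cc_mul => //; exact: cc_cst.
have -> : s y2 * phi1 y2 + mu * J = - intI (fun y => g y + (- mu) * (qdot y * phi y ^+ 2)).
  by rewrite (intI_add hy gc hc') (intI_scale hy (- mu) hc) gI -/J; ring.
rewrite normrN; apply: le_trans (intI_le hy (M := (Cq * ph ^+ 2 + 2 * (C3 * (L * C3) * ph)) * e2) (cc_add gc hc') _ _) _.
- apply: mulr_ge0 e20; apply: addr_ge0; first exact: mulr_ge0 Cq0 (sqr_ge0 _).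
  exact: mulr_ge0 (ler0n _ 2) (mulr_ge0 (mulr_ge0 C30 (mulr_ge0 L0 C30)) ph0).
- move=> y yI.
  have -> : g y + - mu * (qdot y * phi y ^+ 2) =
    (Q y - fF 1%N y - mu * qdot y) * phi y ^+ 2 + (Q y - fF 1%N y) * (s y - phi y) * phi y.
    by rewrite /g; ring.
  apply: le_trans (ler_normD _ _) _; rewrite [leRHS]mulrDl; apply: lerD.
    rewrite normrM mulrAC; apply: ler_pM => //; first exact: QE.
    by rewrite normrX ler_sqr ?nnegrE // pB.
  rewrite !normrM.
  have h : `|Q y - fF 1%N y| * `|s y - phi y| * `|phi y| <= (C3 * e) * (L * (C3 * e)) * ph.
    by apply: ler_pM; [exact: mulr_ge0|exact: normr_ge0|apply: ler_pM => //; [exact: QF|exact: sd]|exact: pB].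
  apply: le_trans h _.
  have -> : C3 * e * (L * (C3 * e)) * ph = C3 * (L * C3) * ph * e ^+ 2 by ring.
  have -> : 2 * (C3 * (L * C3) * ph) * e2 = C3 * (L * C3) * ph * (2 * e2) by ring.
  by rewrite ler_wpM2l // (mulr_ge0 (mulr_ge0 C30 (mulr_ge0 L0 C30)) ph0).
- rewrite mulrAC -/C4 ler_wpM2r // lerDr //.
Qed.
End Sign.

(** By [sign_est], s(y2) phi'(y2) = - mu J + O(d + mu^2) with J <> 0: with d =
    mu1^2 and mu1 small, the shooting functions for mu = mu1 and mu = - mu1
    have opposite signs at y2. The flows are merely
    close to the given one, since F need not be a polynomial. *)
Theorem shear_family (T eps : R) (N : nat) : 0 < eps ->
  exists (P G : {poly R}) (mu1 Lc Z : R) (W W1 : R -> R -> R),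
  let Pm mu := P + mu *: G in
  [/\ 0 < mu1, 0 <= Lc,
   (forall mu, `|mu| <= mu1 ->
     [/\ shear (Pm mu) (W mu) (W1 mu), bnd (fun y => psi0 y + W mu y) Z,
        CB T y1 y2 eps N (fun p => W1 mu (clamp p.2)) &
        bnd (fun y => Qpot (Pm mu) (W mu) y - fF 1%N y) eps]),
   (forall mu mu', `|mu| <= mu1 -> `|mu'| <= mu1 -> forall y, y1 <= y <= y2 ->
      `|W mu y - W mu' y| <= Lc * `|mu - mu'| /\ `|W1 mu y - W1 mu' y| <= Lc * `|mu - mu'|) &
   (forall s s1 s' s1', shoot y1 y2 (pot kap (Qpot (Pm mu1) (W mu1)) 1) s s1 ->
      shoot y1 y2 (pot kap (Qpot (Pm (- mu1)) (W (- mu1))) 1) s' s1' -> s y2 * s' y2 < 0)].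
Proof.
move=> eps0.
have [G [chi [chi1 [c0 c10 cS J0]]]] := transversal_ex hy Ud U0 phiS phi2.
have pc : cc psi0 by apply: cc_cont => y; apply: psi0_cont.
have [Z0 Z00 pZ0] := bounded_cc hy pc.
pose Z := Z0 + 1; have Z1 : 1 <= Z by rewrite /Z lerDr.
have pZ : bnd psi0 (Z - 1) by rewrite /Z addrK.
have Zp : 0 < Z by apply: lt_le_trans Z1.
have pZ' : bnd psi0 Z by move=> y yI; apply: le_trans (pZ y yI) _; rewrite gerBl.
pose n := maxn N 3.
have n3 : (3 <= n)%N by rewrite leq_maxr.
have [KG KG0 HKG] := poly_bound G n Zp.
have fFcc i : cc (fF i) by apply: fFc.
have fFdd i y : y1 <= y <= y2 -> is_derive y 1 (fF i) (fF i.+1 y * U 0%N y).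
  exact: (fF_der beta Ud U0).
have [KP KP0 HKP] := poly_approx hy Ud U0 n Zp pZ' fFcc fFdd.
pose K := KP + KG.
have K0 : 0 <= K := addr_ge0 KP0 KG0.
have g0 := gC_ge0 hy K0.
pose C1 := gC K * K; have C10 : 0 <= C1 := mulr_ge0 g0 K0.
have GK i z : (i <= 2)%N -> `|z| <= Z -> `|G^`(i).[z]| <= K.
  move=> i2 zZ; apply: le_trans (HKG i z _ zZ) _; last by rewrite lerDr.
  exact: leq_trans (leqW i2) n3.
have [C C0 HC] := sign_est K0 C10 pZ GK c0 c10 cS.
set J := intI _ in HC J0.
(* near_CB is applied to the family of all admissible data, because its
   constant has to be known before mu1 and P are chosen *)
pose adm (l : R * R * {poly R} * (R -> R) * (R -> R)) :=
  let: (d, mu, P, W, W1) := l in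
  [/\ 0 < d <= 1, d + `|mu| <= 1,
    (forall i y, (i <= n)%N -> y1 <= y <= y2 -> `|P^`(i).[psi0 y] - fF i y| <= KP * d),
    (forall i z, (i <= n)%N -> `|z| <= Z -> `|P^`(i).[z]| <= KP) &
    [/\ shear (P + mu *: G) W W1, bnd W 1, bnd W (C1 * (d + `|mu|)) &
       bnd W1 (C1 * (d + `|mu|))]].
pose L := {l | adm l}.
pose le (l : L) : R := let: (d, mu, P, W, W1) := sval l in d + `|mu|.
pose lP (l : L) := let: (d, mu, P, W, W1) := sval l in P + mu *: G.
pose lW (l : L) := let: (d, mu, P, W, W1) := sval l in W.
pose lW1 (l : L) := let: (d, mu, P, W, W1) := sval l in W1.
have derPm P mu i z : (P + mu *: G)^`(i).[z] = P^`(i).[z] + mu * G^`(i).[z].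
  by rewrite derivnD derivnZ hornerD hornerZ.
have a1 l : 0 <= le l.
  case: l => [[[[[d mu] P] W] W1] H]; rewrite /le /=; case: H => [/andP[d0 _] *].
  by rewrite addr_ge0 // ltW.
have a2 l : le l <= 1 by case: l => [[[[[d mu] P] W] W1] []].
have a3 l i y : (i <= n)%N -> y1 <= y <= y2 -> `|(lP l)^`(i).[psi0 y] - fF i y| <= K * le l.
  case: l => [[[[[d mu] P] W] W1] H] iN yI; rewrite /lP /le /=; case: H => [/andP[d0 d1] e1 PF PK _].
  rewrite derPm addrAC; apply: le_trans (ler_normD _ _) _.
  have h1 := PF i y iN yI.
  have h2 : `|mu * G^`(i).[psi0 y]| <= `|mu| * KG by rewrite normrM ler_wpM2l // HKG // pZ'.
  have h3 : 0 <= KP * `|mu| by rewrite mulr_ge0.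
  have h4 : 0 <= KG * d by rewrite mulr_ge0 // ltW.
  have -> : K * (d + `|mu|) = KP * d + `|mu| * KG + KP * `|mu| + KG * d by rewrite /K; ring.
  clear -h1 h2 h3 h4 hy Ud U0 phiS phi2; lra.
have PmK mu P i z : `|mu| <= 1 -> (forall i z, (i <= n)%N -> `|z| <= Z -> `|P^`(i).[z]| <= KP) ->
    (i <= n)%N -> `|z| <= Z -> `|(P + mu *: G)^`(i).[z]| <= K.
  move=> m1 PK iN zZ; rewrite derPm; apply: le_trans (ler_normD _ _) _.
  apply: lerD; first exact: PK.
  rewrite normrM -[leRHS]mul1r; apply: ler_pM => //; exact: HKG.
have a4 l i z : (i <= n)%N -> `|z| <= Z -> `|(lP l)^`(i).[z]| <= K.
  case: l => [[[[[d mu] P] W] W1] H] iN zZ; rewrite /lP /=; case: H => [/andP[d0 d1] e1 PF PK _].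
  by apply: PmK => //; clear -d0 e1 hy Ud U0 phiS phi2; lra.
have a5 l : shear (lP l) (lW l) (lW1 l).
  case: l => [[[[[d mu] P] W] W1] H]; rewrite /lP /lW /lW1 /=.
  by case: H => [_ _ _ _ []].
have a6 l y : y1 <= y <= y2 ->
    [/\ `|lW l y| <= 1, `|lW l y| <= C1 * le l & `|lW1 l y| <= C1 * le l].
  case: l => [[[[[d mu] P] W] W1] H] yI; rewrite /le /lW /lW1 /=.
  by case: H => [_ _ _ _ [_ b c e]]; split; [apply: b|apply: c|apply: e].
have [near1 _] := near_shear hy Ud U0 a1 K0 C10 a2 pZ a3 a4 a5 a6 n.
have [CN CN0 HCN] := near_CB T hy a1 (near1 (leqnn n)).
(* m dominates all constants above; d = mu1^2 below makes the error of
   sign_est smaller than mu1 |J| *)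
pose m := 1 + gC K * K + C + CN.
have m1 : 1 <= m by rewrite /m -!addrA lerDl !addr_ge0.
have m0 : 0 < m := lt_le_trans ltr01 m1.
pose mu1 := Num.min (Num.min (1 / (2 * m)) (eps / (2 * m))) (`|J| / (4 * m)).
have Jp : 0 < `|J| by rewrite normr_gt0.
have mu0 : 0 < mu1.
  by rewrite /mu1 !lt_min !divr_gt0 // mulr_gt0.
have b1 : 2 * mu1 * m <= 1.
  have : mu1 <= 1 / (2 * m) by rewrite /mu1 !ge_min lexx.
  by rewrite ler_pdivlMr ?mulr_gt0 //; clear -hy Ud U0 phiS phi2; lra.
have b2 : 2 * mu1 * m <= eps.
  have : mu1 <= eps / (2 * m) by rewrite /mu1 !ge_min lexx orbT.
  by rewrite ler_pdivlMr ?mulr_gt0 //; clear -hy Ud U0 phiS phi2; lra.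
have b3 : 4 * mu1 * m <= `|J|.
  have : mu1 <= `|J| / (4 * m) by rewrite /mu1 ge_min lexx orbT.
  by rewrite ler_pdivlMr ?mulr_gt0 //; clear -hy Ud U0 phiS phi2; lra.
have leM (c : R) : 0 <= c -> c <= m -> 2 * mu1 * c <= 2 * mu1 * m.
  by move=> c0' cm; rewrite ler_wpM2l // mulr_ge0 // ltW.
have gm : gC K * K <= m by rewrite /m; clear -C0 CN0 hy Ud U0 phiS phi2; lra.
have CNm : CN <= m by have := C10; rewrite /C1 /m; clear -C0 CN0 hy Ud U0 phiS phi2; lra.
have Cm : C <= m by have := C10; rewrite /C1 /m; clear -C0 CN0 hy Ud U0 phiS phi2; lra.
have mm1 : mu1 <= 1.
  have : 2 * mu1 * 1 <= 2 * mu1 * m by apply: leM.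
  clear -b1 hy Ud U0 phiS phi2; lra.
pose d : R := mu1 ^+ 2.
have d0 : 0 < d by rewrite exprn_gt0.
have dmu : d <= mu1 by rewrite /d expr2 ler_piMr // ltW.
have d01 : 0 < d <= 1 by rewrite d0 /=; clear -dmu mm1 hy Ud U0 phiS phi2; lra.
have [P [PF PK]] := HKP d d01.
have emu mu : `|mu| <= mu1 -> d + `|mu| <= 2 * mu1 by move=> h; clear -h dmu hy Ud U0 phiS phi2; lra.
have ex mu : exists WW : (R -> R) * (R -> R), `|mu| <= mu1 ->
   shear (P + mu *: G) WW.1 WW.2 /\
   forall y, y1 <= y <= y2 -> `|WW.1 y| <= C1 * (d + `|mu|) /\ `|WW.2 y| <= C1 * (d + `|mu|).
  have [hmu|hmu] := leP `|mu| mu1; last by exists (fun=> 0, fun=> 0) => h; clear -h hmu hy Ud U0 phiS phi2; lra.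
  have e0 : 0 <= K * (d + `|mu|) by rewrite mulr_ge0 // addr_ge0 // ltW.
  have h1 z : `|z| <= Z -> `|(P + mu *: G)^`().[z]| <= K.
    move=> zZ; have := PmK mu P 1%N z (le_trans hmu mm1) PK (@leq_trans 3 1 n isT n3) zZ.
    by rewrite derivn1.
  have h2 y : y1 <= y <= y2 -> `|(P + mu *: G).[psi0 y] - fF 0 y| <= K * (d + `|mu|).
    move=> yI; rewrite hornerD hornerZ addrAC; apply: le_trans (ler_normD _ _) _.
    have q1 := PF 0%N y (leq0n _) yI; rewrite derivn0 in q1.
    have q2 : `|mu * G.[psi0 y]| <= `|mu| * KG.
      rewrite normrM ler_wpM2l //; have := HKG 0%N (psi0 y) (leq0n _) (pZ' y yI).
      by rewrite derivn0.
    have h3 : 0 <= KP * `|mu| by rewrite mulr_ge0.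
    have h4 : 0 <= KG * d by rewrite mulr_ge0 // ltW.
    have -> : K * (d + `|mu|) = KP * d + `|mu| * KG + KP * `|mu| + KG * d by rewrite /K; ring.
    clear -q1 q2 h3 h4 hy Ud U0 phiS phi2; lra.
  have h3 : gC K * (K * (d + `|mu|)) <= 1.
    rewrite mulrA; apply: le_trans b1; rewrite mulrC.
    by apply: ler_pM => //; [rewrite addr_ge0 // ltW|exact: emu].
  have [W [W1 [WS WB]]] := shear_ex hy Ud U0 K0 Z1 pZ e0 h1 h2 h3.
  by exists (W, W1) => _; split=> // y yI; have := WB y yI; rewrite mulrA.
have [WW HWW] := choice ex.
pose W mu := (WW mu).1; pose W1 mu := (WW mu).2.
have C1m mu : `|mu| <= mu1 -> C1 * (d + `|mu|) <= 1.
  move=> h; apply: le_trans b1; rewrite mulrC.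
  by apply: ler_pM => //; [rewrite addr_ge0 // ltW|exact: emu].
have WP mu : `|mu| <= mu1 -> [/\ shear (P + mu *: G) (W mu) (W1 mu), bnd (W mu) 1,
    bnd (W mu) (C1 * (d + `|mu|)) & bnd (W1 mu) (C1 * (d + `|mu|))].
  move=> h; have [a b] := HWW mu h; split=> //.
  - by move=> y yI; apply: le_trans (b y yI).1 _; exact: C1m.
  - by move=> y yI; exact: (b y yI).1.
  - by move=> y yI; exact: (b y yI).2.
have dmu1 mu : `|mu| <= mu1 -> d + `|mu| <= 1.
  by move=> h; have := emu mu h; have := leM 1 ler01 m1; clear -b1 hy Ud U0 phiS phi2; lra.
have adm_mu mu : `|mu| <= mu1 -> adm (d, mu, P, W mu, W1 mu).
  by move=> h; split=> //; [exact: dmu1|exact: WP].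
have gP : goodP K Z P d.
  split=> i z i3 zz.
    apply: le_trans (PF i z (leq_trans i3 n3) zz) _.
    by rewrite ler_wpM2r ?(ltW d0) // lerDl.
  by apply: le_trans (PK i z (leq_trans i3 n3) zz) _; rewrite lerDl.
have sgn mu : `|mu| <= mu1 ->
    bnd (fun y => Qpot (P + mu *: G) (W mu) y - fF 1%N y) (C * (d + `|mu|)) /\
    forall s s1, shoot y1 y2 (pot kap (Qpot (P + mu *: G) (W mu)) 1) s s1 ->
      `|s y2 * phi1 y2 + mu * J| <= C * (d + mu ^+ 2).
  move=> h; have [a b c _] := WP mu h.
  exact: HC d mu P (W mu) (W1 mu) d01 (le_trans h mm1) (dmu1 mu h) gP a b c.
exists P, G, mu1, (gC K * KG), Z, W, W1; split=> //.
- by rewrite mulr_ge0.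
- move=> mu hmu; have [wS w1 wC w1C] := WP mu hmu; split=> //.
  + by move=> y yI; apply: le_trans (ler_normD _ _) _; have := pZ y yI; have := w1 y yI; clear -hy Ud U0 phiS phi2; lra.
  + have := HCN (exist _ _ (adm_mu mu hmu)).
    rewrite /lW1 /le /= => H.
    have {}H : CB T y1 y2 eps n (fun p => U 0%N (clamp p.2) + W1 mu (clamp p.2) - U 0%N (clamp p.2)).
      apply: CB_le H; apply: le_trans b2; rewrite mulrC.
      apply: ler_pM => //; [by rewrite addr_ge0 // ltW|exact: emu].
    have -> : (fun p : R * R => W1 mu (clamp p.2)) =
      (fun p => U 0%N (clamp p.2) + W1 mu (clamp p.2) - U 0%N (clamp p.2)).
      by apply/funext => p; ring.
    by apply: CB_down H; rewrite leq_maxl.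
  + have [+ _] := sgn mu hmu => H y yI; apply: le_trans (H y yI) _.
    apply: le_trans b2; rewrite mulrC.
    apply: ler_pM => //; [by rewrite addr_ge0 // ltW|exact: emu].
- move=> mu mu' h h' y yI; have [wS w1 _ _] := WP mu h; have [wS' w1' _ _] := WP mu' h'.
  have h1 z : `|z| <= Z -> `|(P + mu *: G)^`().[z]| <= K.
    move=> zZ; have := PmK mu P 1%N z (le_trans h mm1) PK (@leq_trans 3 1 n isT n3) zZ.
    by rewrite derivn1.
  have e0 : 0 <= KG * `|mu - mu'| by rewrite mulr_ge0.
  have h2 z : `|z| <= Z -> `|(P + mu *: G).[z] - (P + mu' *: G).[z]| <= KG * `|mu - mu'|.
    move=> zZ; have -> : (P + mu *: G).[z] - (P + mu' *: G).[z] = (mu - mu') * G.[z].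
      by rewrite !hornerD !hornerZ; ring.
    rewrite normrM mulrC; apply: ler_pM => //.
    by have := HKG 0%N z (leq0n _) zZ; rewrite derivn0.
  have := shear_diff hy K0 e0 pZ h1 h2 w1 w1' wS wS' yI.
  by rewrite !mulrA.
- move=> s s1 s' s1' sS sS'.
  have hp : `|mu1| <= mu1 by rewrite gtr0_norm.
  have hm : `|- mu1| <= mu1 by rewrite normrN gtr0_norm.
  have [_ /(_ _ _ sS) e1] := sgn mu1 hp.
  have [_ /(_ _ _ sS') e2] := sgn (- mu1) hm.
  rewrite sqrrN in e2.
  have bb : C * (d + mu1 ^+ 2) < mu1 * `|J|.
    have -> : C * (d + mu1 ^+ 2) = mu1 * (2 * mu1 * C) by rewrite /d; ring.
    rewrite ltr_pM2l //.
    have : 2 * mu1 * C <= 2 * mu1 * m by apply: leM.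
    clear -b3 Jp hy Ud U0 phiS phi2; lra.
  have p2 : (s y2 * phi1 y2) * (s' y2 * phi1 y2) < 0.
    rewrite mulNr in e2.
    have e0 : C * (d + mu1 ^+ 2) < `|mu1 * J| by rewrite normrM (gtr0_norm mu0).
    exact: opposite_signs e0 e1 e2.
  rewrite mulrACA -expr2 in p2.
  have := sqr_ge0 (phi1 y2); rewrite le_eqVlt => /orP[/eqP E|h].
    by move: p2; rewrite -E mulr0 ltxx.
  by rewrite pmulr_llt0 in p2.
Qed.
End ShearFamily.

(** * Cosine series with coefficients depending on a parameter *)

Section Terms.
Context {R : realType} (y1 y2 kap : R).
Hypothesis hy : y1 < y2.
Hypothesis kap0 : 0 < kap.
Local Notation clamp := (clamp y1 y2).
Local Notation cc f := (continuous (f \o clamp)).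
Local Notation bnd f M := (forall y : R, y1 <= y <= y2 -> `|f y| <= M).
Implicit Types (b m x y : R) (c : R -> R -> R) (n i j : nat).

(** Coefficients c(m, y), bounded by b, continuous in y and Lipschitz in the
    parameter m uniformly in y. *)
Definition adm b c := [/\ 0 <= b, (forall m, cc (c m)), (forall m, bnd (c m) b) &
  exists2 L : R, 0 <= L & forall m m' y, y1 <= y <= y2 ->
    `|c m y - c m' y| <= L * `|m - m'|].

Lemma adm_mul b b' c c' : adm b c -> adm b' c' ->
  adm (b * b') (fun m y => c m y * c' m y).
Proof.
move=> [b0 cc1 cb [L L0 cL]] [b0' cc2 cb' [L' L0' cL']]; split.
- exact: mulr_ge0.
- by move=> m; apply: cc_mul.
- by move=> m y yI; rewrite normrM; apply: ler_pM => //; [exact: cb|exact: cb'].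
exists (L * b' + b * L'); first by rewrite addr_ge0 // mulr_ge0.
move=> m m' y yI.
have -> : c m y * c' m y - c m' y * c' m' y =
  (c m y - c m' y) * c' m y + c m' y * (c' m y - c' m' y) by ring.
apply: le_trans (ler_normD _ _) _; rewrite !normrM mulrDl; apply: lerD.
  rewrite mulrAC; apply: ler_pM => //; [exact: cL|exact: cb'].
rewrite -mulrA; apply: ler_pM => //; [exact: cb|exact: cL'].
Qed.

Lemma adm_cst k : adm `|k| (fun _ _ => k).
Proof.
split=> //; first by move=> m; exact: cc_cst.
by exists 0 => // m m' y _; rewrite subrr normr0 mul0r.
Qed.

Lemma adm_le b b' c : b <= b' -> adm b c -> adm b' c.
Proof.
move=> bb [b0 a1 a2 a3]; split=> //; first exact: le_trans bb.
by move=> m y yI; apply: le_trans (a2 m y yI) bb.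
Qed.

(** [(n, b, c)] stands for [c cos (n kap x)], with [b] a bound for [c]. *)
Definition term : Type := nat * R * (R -> R -> R).
Implicit Types (t : term) (l v d : seq term).
Definition wf l := forall t, List.In t l -> adm t.1.2 t.2.
(** The weight e^n makes the norm submultiplicative, and absorbs the powers of
    n that come from derivatives in x. *)
Definition nrm l : R := foldr (fun t s => expR t.1.1%:R * t.1.2 + s) 0 l.

(** The i-th derivative of the cosine, as a phase shift. *)
Definition cosd i (z : R) := cos (z + i%:R * (pi / 2)).

Lemma cosd_der i (z : R) : is_derive z 1 (cosd i) (cosd i.+1 z).
Proof.
have h : is_derive (z + i%:R * (pi / 2)) 1 (@cos R) (- sin (z + i%:R * (pi / 2))) by exact: is_derive_cos.
have h2 : is_derive z 1 (fun z => z + i%:R * (pi / 2)) 1.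
  by apply: der_eq (der_add (der_id z) (der_cst _ z)) _; rewrite addr0.
change (is_derive z 1 (fun z => cos (z + i%:R * (pi / 2))) (cosd i.+1 z)).
apply: der_eq (@der_comp R cos (fun z => z + i%:R * (pi / 2)) z _ _ h h2) _.
rewrite mul1r /cosd -cosDpihalf -[i.+1%:R]natr1; congr cos; ring.
Qed.

Lemma cosd_le1 i (z : R) : `|cosd i z| <= 1.
Proof. by rewrite ler_norml cos_geN1 cos_le1. Qed.

(** The i-th derivative of cos (n kap x). *)
Definition osc i n x := (n%:R * kap) ^+ i * cosd i (n%:R * kap * x).

Lemma osc_der i n x : is_derive x 1 (osc i n) (osc i.+1 n x).
Proof.
have h := der_scale (n%:R * kap) (der_id x).
apply: der_eq (der_scale _ (der_comp (cosd_der i _) h)) _.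
by rewrite /osc exprS; ring.
Qed.

(** The value of the i-th derivative in x of the sum of the terms. *)
Definition ev i l m x y : R := foldr (fun t s => t.2 m y * osc i t.1.1 x + s) 0 l.

Lemma ev_cat i l l' m x y : ev i (l ++ l') m x y = ev i l m x y + ev i l' m x y.
Proof. by elim: l => [|t l IH] /=; rewrite ?add0r // IH addrA. Qed.

Lemma nrm_cat l l' : nrm (l ++ l') = nrm l + nrm l'.
Proof. by elim: l => [|t l IH] /=; rewrite ?add0r // IH addrA. Qed.

Lemma wf_cons t l : wf (t :: l) <-> adm t.1.2 t.2 /\ wf l.
Proof.
split=> [H|[h1 h2] t'].
  by split=> [|t' ht]; apply: H; [left|right].
by move=> /= [<-|] //; exact: h2.
Qed.

Lemma wf_cat l l' : wf l -> wf l' -> wf (l ++ l').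
Proof.
move=> h h'; elim: l h => [|t l IH] //= /wf_cons [a b].
by apply/wf_cons; split=> //; exact: IH.
Qed.

Lemma nrm_ge0 l : wf l -> 0 <= nrm l.
Proof.
elim: l => [|t l IH] //= /wf_cons [[b0 _ _ _] b].
by rewrite addr_ge0 ?IH // mulr_ge0 // expR_ge0.
Qed.

(** cos a cos b = (cos (a + b) + cos (a - b)) / 2, where the frequency |n -
    n'| is written with truncated subtractions. *)
Definition mulT t t' : seq term :=
  [:: ((t.1.1 + t'.1.1)%N, 2^-1 * (t.1.2 * t'.1.2), fun m y => 2^-1 * (t.2 m y * t'.2 m y));
      ((t.1.1 - t'.1.1 + (t'.1.1 - t.1.1))%N, 2^-1 * (t.1.2 * t'.1.2),
        fun m y => 2^-1 * (t.2 m y * t'.2 m y))].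
Definition mul l l' : seq term := foldr (fun t s => foldr (fun t' s => mulT t t' ++ s) [::] l' ++ s) [::] l.

Lemma adm_half b b' c c' : adm b c -> adm b' c' ->
  adm (2^-1 * (b * b')) (fun m y => 2^-1 * (c m y * c' m y)).
Proof.
move=> h h'; have := adm_mul (adm_cst 2^-1) (adm_mul h h').
by rewrite ger0_norm // invr_ge0.
Qed.

Lemma wf_mul l l' : wf l -> wf l' -> wf (mul l l').
Proof.
move=> h h'; elim: l h => [|t l IH] //= /wf_cons [ta /IH hl].
apply: wf_cat hl => {IH}; elim: l' h' => [|t' l' IH] //= /wf_cons [ta' /IH hl'].
by apply/wf_cons; split; [exact: adm_half|apply/wf_cons; split=> //; exact: adm_half].
Qed.

Lemma osc00 x : osc 0 0 x = 1.
Proof.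
rewrite /osc /cosd expr0 mul1r (_ : _ + _ = 0); last by rewrite !mul0r addr0.
exact: cos0.
Qed.

Lemma osc_mul n n' x :
  osc 0 n x * osc 0 n' x = 2^-1 * (osc 0 (n + n') x + osc 0 (n - n' + (n' - n)) x).
Proof.
rewrite /osc /cosd !expr0 !mul1r !mul0r !addr0.
have E : cos ((n - n' + (n' - n))%:R * kap * x) = cos (n%:R * kap * x - n'%:R * kap * x).
  have [nn|/ltnW nn] := leqP n n'.
    rewrite (eqP nn) add0n natrB // -cosN; congr cos; ring.
  rewrite (eqP nn) addn0 natrB //; congr cos; ring.
have E' : cos ((n + n')%:R * kap * x) = cos (n%:R * kap * x + n'%:R * kap * x).
  by congr cos; rewrite natrD; ring.
by rewrite E E' cosB cosD; field.
Qed.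

Lemma ev_mul l l' m x y : ev 0 (mul l l') m x y = ev 0 l m x y * ev 0 l' m x y.
Proof.
elim: l => [|t l IH] /=; first by rewrite mul0r.
rewrite ev_cat IH mulrDl; congr (_ + _).
elim: l' {IH} => [|t' l' IH] /=; first by rewrite mulr0.
by rewrite IH mulrDr addrA; congr (_ + _); rewrite -mulrDr mulrACA osc_mul; ring.
Qed.

Lemma nrm_mul l l' : wf l -> wf l' -> nrm (mul l l') <= nrm l * nrm l'.
Proof.
move=> h h'; elim: l h => [|t l IH] /=; first by rewrite mul0r.
move=> /wf_cons [[t0 _ _ _] hl]; rewrite nrm_cat mulrDl; apply: lerD; last exact: IH.
elim: l' h' {IH} => [|t' l' IH] /=; first by rewrite mulr0.
move=> /wf_cons [[t0' _ _ _] /IH hl']; rewrite mulrDr addrA; apply: lerD hl'.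
have -> : expR t.1.1%:R * t.1.2 * (expR t'.1.1%:R * t'.1.2) =
  expR t.1.1%:R * expR t'.1.1%:R * (2^-1 * (t.1.2 * t'.1.2)) * 2 by field.
have bb : 0 <= 2^-1 * (t.1.2 * t'.1.2) by rewrite !mulr_ge0 // invr_ge0.
rewrite -mulrDl mulrAC ler_wpM2r // -expRD natrD mulrDr mulr1 lerD2l ler_expR.
by rewrite -natrD ler_nat leq_add // leq_subr.
Qed.

Definition scl b c l : seq term :=
  [seq ((t.1.1, b * t.1.2, fun m y => c m y * t.2 m y) : term) | t <- l].

Lemma wf_scl b c l : adm b c -> wf l -> wf (scl b c l).
Proof.
move=> h; elim: l => [|t l IH] //= /wf_cons [ta /IH hl].
by apply/wf_cons; split=> //; exact: adm_mul.
Qed.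

Lemma ev_scl i b c l m x y : ev i (scl b c l) m x y = c m y * ev i l m x y.
Proof. by elim: l => [|t l IH] /=; rewrite ?mulr0 // IH mulrDr mulrA. Qed.

Lemma nrm_scl b c l : nrm (scl b c l) = b * nrm l.
Proof. by elim: l => [|t l IH] /=; rewrite ?mulr0 // IH; ring. Qed.

(** Powers, and the difference [(v + d)^i - v^i] written without
    cancellation, so that its norm is controlled by that of [d]. *)
Fixpoint pw v i : seq term :=
  if i is i'.+1 then mul (pw v i') v else [:: (0%N, 1, fun _ _ => 1)].
Fixpoint dpw v d i : seq term :=
  if i is i'.+1 then mul (dpw v d i') (v ++ d) ++ mul (pw v i') d else [::].

Lemma wf_pw v i : wf v -> wf (pw v i).
Proof.
move=> h; elim: i => [|i IH] /=; last exact: wf_mul.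
apply/wf_cons; split=> //=; have := adm_cst 1; rewrite normr1; exact.
Qed.

Lemma ev_pw v i m x y : ev 0 (pw v i) m x y = ev 0 v m x y ^+ i.
Proof.
elim: i => [|i IH] /=; last by rewrite ev_mul IH exprSr.
by rewrite osc00 mul1r addr0 expr0.
Qed.

Lemma wf_dpw v d i : wf v -> wf d -> wf (dpw v d i).
Proof.
move=> h h'; elim: i => [|i IH] //=.
by apply: wf_cat; apply: wf_mul => //; [exact: wf_cat|exact: wf_pw].
Qed.

Lemma ev_dpw v d i m x y :
  ev 0 (dpw v d i) m x y = (ev 0 v m x y + ev 0 d m x y) ^+ i - ev 0 v m x y ^+ i.
Proof.
elim: i => [|i IH] /=; first by rewrite !expr0 subrr.
by rewrite ev_cat !ev_mul IH ev_cat ev_pw !exprSr; ring.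
Qed.

Lemma nrm_pw v i N : wf v -> 1 <= N -> nrm v <= N -> nrm (pw v i) <= N ^+ i.
Proof.
move=> h N1 vN; elim: i => [|i IH] /=.
  by rewrite expR0 !mulr1 addr0 expr0.
apply: le_trans (nrm_mul (wf_pw (i := i) h) h) _; rewrite exprSr.
by apply: ler_pM => //; apply: nrm_ge0 => //; exact: wf_pw.
Qed.

Lemma nrm_dpw v d i N : wf v -> wf d -> 1 <= N -> nrm v + nrm d <= N ->
  nrm (dpw v d i) <= i%:R * N ^+ i * nrm d.
Proof.
move=> h h' N1 vdN.
have d0 := nrm_ge0 h'; have v0 := nrm_ge0 h.
have vN : nrm v <= N by lra.
have N0 : 0 <= N by lra.
elim: i => [|i IH] /=; first by rewrite !mul0r.
have wd := @wf_dpw v d i h h'.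
rewrite nrm_cat; apply: le_trans (lerD (nrm_mul wd (wf_cat h h'))
  (nrm_mul (wf_pw (i := i) h) h')) _.
have h1 : nrm (dpw v d i) * nrm (v ++ d) <= i%:R * N ^+ i * nrm d * N.
  apply: ler_pM => //; [exact: nrm_ge0|by rewrite nrm_cat addr_ge0|by rewrite nrm_cat].
have h2 : nrm (pw v i) * nrm d <= N ^+ i * N * nrm d.
  rewrite ler_wpM2r //; apply: le_trans (nrm_pw i h N1 vN) _.
  by rewrite ler_peMr // exprn_ge0.
apply: le_trans (lerD h1 h2) _.
by rewrite exprSr -natr1 le_eqVlt; apply/orP; left; apply/eqP; ring.
Qed.

(** The increment of the nonlinearity [sum_(i < D) q_i v^(i+2)]. *)
Definition dRl K (q : nat -> R -> R -> R) D v d : seq term :=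
  flatten [seq scl K (q i) (dpw v d i.+2) | i <- iota 0 D].

Lemma wf_flatten (ll : seq (seq term)) : (forall l, List.In l ll -> wf l) -> wf (flatten ll).
Proof.
elim: ll => [|l ll IH] H //=; apply: wf_cat; first by apply: H; left.
by apply: IH => l' h; apply: H; right.
Qed.

Lemma in_map_iota (f : nat -> seq term) s D l : List.In l [seq f i | i <- iota s D] ->
  exists2 i, (i < s + D)%N & l = f i.
Proof.
elim: D s => [|D IH] s //= [<-|/IH [i iD E]]; first by exists s => //; rewrite addnS ltnS leq_addr.
by exists i => //; rewrite addnS.
Qed.

Section Nonlinear.
Variables (K : R) (q : nat -> R -> R -> R) (D : nat).
Hypothesis qK : forall i, (i < D)%N -> adm K (q i).

Lemma wf_dRl v d : wf v -> wf d -> wf (dRl K q D v d).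
Proof.
move=> h h'; apply: wf_flatten => l /in_map_iota [i iD ->].
by apply: wf_scl; [exact: qK|exact: wf_dpw].
Qed.

Lemma ev_dRl v d m x y : let X := ev 0 v m x y in let Y := ev 0 d m x y in
  ev 0 (dRl K q D v d) m x y =
  \sum_(i < D) q i m y * (X + Y) ^+ i.+2 - \sum_(i < D) q i m y * X ^+ i.+2.
Proof.
move=> X Y; rewrite -sumrB -(big_mkord xpredT (fun i => q i m y * (X + Y) ^+ i.+2 - q i m y * X ^+ i.+2)).
rewrite /dRl /index_iota subn0; elim: (iota 0 D) => [|i s IH]; first by rewrite big_nil.
rewrite big_cons -IH map_cons.
rewrite -[flatten _]/(scl K (q i) (dpw v d i.+2) ++ flatten [seq scl K (q i) (dpw v d i.+2) | i <- s]).
by rewrite ev_cat ev_scl ev_dpw; ring.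
Qed.

Lemma nrm_dRl v d N : 0 <= K -> wf v -> wf d -> 1 <= N -> nrm v + nrm d <= N ->
  nrm (dRl K q D v d) <= D%:R * (K * (D.+1%:R * N ^+ D.+1)) * nrm d.
Proof.
move=> K0 h h' N1 vdN; have d0 := nrm_ge0 h'.
have N0 : 0 <= N by lra.
have step i : (i < D)%N -> nrm (scl K (q i) (dpw v d i.+2)) <= K * (D.+1%:R * N ^+ D.+1) * nrm d.
  move=> iD; rewrite nrm_scl -mulrA ler_wpM2l //.
  apply: le_trans (nrm_dpw i.+2 h h' N1 vdN) _; rewrite ler_wpM2r //.
  apply: ler_pM; rewrite ?exprn_ge0 ?ler_nat //.
  by rewrite ler_weXn2l.
have : forall s n, (s + n <= D)%N -> nrm (flatten [seq scl K (q i) (dpw v d i.+2) | i <- iota s n])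
    <= n%:R * (K * (D.+1%:R * N ^+ D.+1)) * nrm d.
  move=> s n; elim: n s => [|n IH] s sn; first by rewrite /= !mul0r.
  rewrite -[flatten _]/(scl K (q s) (dpw v d s.+2) ++ flatten [seq scl K (q i) (dpw v d i.+2) | i <- iota s.+1 n]).
  rewrite nrm_cat -natr1 addrC.
  have -> : (n%:R + 1) * (K * (D.+1%:R * N ^+ D.+1)) * nrm d =
    n%:R * (K * (D.+1%:R * N ^+ D.+1)) * nrm d + K * (D.+1%:R * N ^+ D.+1) * nrm d by ring.
  apply: lerD; first by apply: IH; rewrite addSnnS.
  by apply: step; apply: leq_trans sn; rewrite addnS ltnS leq_addr.
by apply.
Qed.
End Nonlinear.

(** Derivatives in [x] cost powers of [n], absorbed by the weight [e^n]. *)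
Lemma freq_bound i : exists2 C : R, 0 <= C & forall n : nat, (n%:R * kap) ^+ i <= C * expR n%:R.
Proof.
exists (kap ^+ i * i`!%:R) => [|n]; first by rewrite mulr_ge0 // exprn_ge0 // ltW.
have h : n%:R ^+ i <= i`!%:R * expR n%:R :> R.
  case: i => [|i]; first by rewrite expr0 fact0 mul1r -expR0 ler_expR.
  have := @expR_ge1Dxn R n%:R i (ler0n _ n).
  rewrite [_ * expR _]mulrC -ler_pdivrMr ?ltr0n ?fact_gt0 //; lra.
by rewrite exprMn mulrC -mulrA ler_wpM2l // exprn_ge0 // ltW.
Qed.

Lemma osc_bound i n x : `|osc i n x| <= (n%:R * kap) ^+ i.
Proof.
have h : 0 <= (n%:R * kap) ^+ i by rewrite exprn_ge0 // mulr_ge0 // ltW.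
by rewrite /osc normrM ger0_norm // ler_piMr // cosd_le1.
Qed.

Lemma osc_cont i n : continuous (osc i n).
Proof. by move=> x; apply: is_derive_cont (osc_der i n x). Qed.

Lemma ev_per i l m x y T : (exists k : nat, kap * T = k%:R * (pi * 2)) ->
  ev i l m (x + T) y = ev i l m x y.
Proof.
move=> [k kT]; elim: l => [|t l IH] //=; rewrite IH; congr (_ * _ + _).
rewrite /osc /cosd; congr (_ * _).
have -> : t.1.1%:R * kap * (x + T) + i%:R * (pi / 2) =
  (t.1.1%:R * kap * x + i%:R * (pi / 2)) + (t.1.1 * k)%:R * (pi * 2).
  have -> : (t.1.1 * k)%:R * (pi * 2) = t.1.1%:R * (kap * T) by rewrite natrM -mulrA kT.
  ring.
set z := _ + i%:R * _; elim: (t.1.1 * k)%N => [|j IHj]; first by rewrite mul0r addr0.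
rewrite -[RHS]IHj -[RHS]cosD2pi; congr cos; rewrite -[j.+1%:R]natr1; ring.
Qed.

End Terms.

(** * Bifurcating waves as convergent cosine series *)

Section Series.
Context {R : realType}.
Implicit Types (t : nat -> R) (C : R).
Local Notation geo t C := (forall k, `|t k| <= C * 2^-1 ^+ k).

Lemma sumser_cvg t C : geo t C -> (fun n => \sum_(0 <= k < n) t k) @ \oo --> sumser t.
Proof.
move=> tC; apply/cvgrPdist_le => e e0.
have [n Hn] := half_pow_small (2 * C) e0.
exists n => // k nk /=; apply: le_trans (sumser_tail tC k) _.
apply: le_trans Hn; have C0 : 0 <= C.
  by have := tC 0%N; rewrite expr0 mulr1; apply: le_trans.
by rewrite ler_wpM2l ?mulr_ge0 // ler_wiXn2l // ?invr_ge0 // invf_le1 // ler1n.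
Qed.

Lemma sumser_lim t C l : geo t C -> (fun n => \sum_(0 <= k < n) t k) @ \oo --> l ->
  sumser t = l.
Proof. by move=> tC; apply: cvg_unique (sumser_cvg tC). Qed.

Lemma sumser_add t (t' : nat -> R) C C' : geo t C -> geo t' C' ->
  sumser (fun k => t k + t' k) = sumser t + sumser t'.
Proof.
move=> tC tC'; apply: (@sumser_lim _ (C + C')).
  by move=> k; rewrite mulrDl; apply: le_trans (ler_normD _ _) _; exact: lerD.
rewrite (_ : (fun n => _) = (fun n => \sum_(0 <= k < n) t k + \sum_(0 <= k < n) t' k)).
  exact: cvgD (sumser_cvg tC) (sumser_cvg tC').
by apply/funext => n; rewrite big_split.
Qed.

Lemma sumser_scale t C c : geo t C -> sumser (fun k => c * t k) = c * sumser t.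
Proof.
move=> tC; apply: (@sumser_lim _ (`|c| * C)).
  by move=> k; rewrite normrM -mulrA ler_wpM2l.
rewrite (_ : (fun n => _) = (fun n => c * \sum_(0 <= k < n) t k)).
  exact: cvgMr (sumser_cvg tC).
by apply/funext => n; rewrite big_distrr.
Qed.

Lemma sumser0 t : (forall k, t k = 0) -> sumser t = 0.
Proof.
move=> t0; apply: (@sumser_lim _ 0) => [k|]; first by rewrite t0 normr0 mul0r.
rewrite (_ : (fun n => _) = (fun=> 0)); first exact: cvg_cst.
by apply/funext => n; rewrite big1.
Qed.

Lemma sumser_le t C : geo t C -> `|sumser t| <= 2 * C.
Proof. by move=> tC; have := sumser_tail tC 0; rewrite big_geq // subr0 expr0 mulr1. Qed.

Lemma sumser_shift t C : geo t C -> sumser t = t 0%N + sumser (fun k => t k.+1).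
Proof.
move=> tC; apply: (sumser_lim tC).
have C0 : 0 <= C by have := tC 0%N; rewrite expr0 mulr1; apply: le_trans.
have sC : geo (fun k => t k.+1) C.
  move=> k; apply: le_trans (tC k.+1) _; rewrite ler_wpM2l // exprS.
  by rewrite ler_piMl ?exprn_ge0 ?invr_ge0 // invf_le1 // ler1n.
rewrite -(cvg_shiftS (fun n => \sum_(0 <= k < n) t k)).
rewrite (_ : (fun n => _) = (fun n => t 0%N + \sum_(0 <= k < n) t k.+1)).
  by apply: cvgD; [exact: cvg_cst|exact: sumser_cvg sC].
by apply/funext => n; rewrite big_nat_recl.
Qed.
End Series.

Lemma c_sum (R : realType) n (F : nat -> R -> R) z : (forall i, continuous_at z (F i)) ->
  continuous_at z (fun x => \sum_(i < n) F i x).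
Proof.
move=> Fc; elim: n => [|n IH].
  rewrite (_ : (fun x => _) = fun=> 0); first exact: c_cst.
  by apply/funext => x; rewrite big_ord0.
rewrite (_ : (fun x => _) = fun x => \sum_(i < n) F i x + F n x); first exact: c_add.
by apply/funext => x; rewrite big_ord_recr.
Qed.

Section Iteration.
Context {R : realType} (y1 y2 kap : R).
Hypothesis hy : y1 < y2.
Hypothesis kap0 : 0 < kap.
Local Notation clamp := (clamp y1 y2).
Local Notation cc f := (continuous (f \o clamp)).
Local Notation bnd f M := (forall y : R, y1 <= y <= y2 -> `|f y| <= M).
Local Notation adm := (adm y1 y2).
Local Notation wf := (wf y1 y2).
Local Notation ev := (ev kap).
Local Notation osc := (osc kap).
Local Notation len := (y2 - y1).
Implicit Types (m x y a : R) (i j n : nat).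

(** A Fourier mode [mc cos (mn kap x)] which solves the linearised equation
    with forcing [mf]; [mc1] is the derivative of [mc] in y, and [mb] bounds
    both [mc] and [mf]. *)
Record mode := Mode { mn : nat; mb : R; mc : R -> R -> R; mc1 : R -> R -> R; mf : R -> R -> R }.
Implicit Types (e : mode) (l d : seq mode) (g : mode -> R -> R -> R).

Variables (Q : R -> R -> R) (q0 : R -> R) (r M k : R).
Hypotheses (r1 : r <= 1) (M0 : 0 <= M) (k0 : 0 <= k).
Hypotheses (q0c : cc q0) (q0k : bnd q0 k).
Hypothesis QA : adm (k + 1) Q.
Hypothesis Qr : forall m, bnd (fun y => Q m y - q0 y) r.
Hypothesis Hok : forall n, modeok y1 y2 q0 kap n r M.

Definition M' := Num.max M 1.
Definition Cd := 1 + 2 / len + (k + 2) * len.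

Record okM e : Prop := OkM {
  ok_c : adm (mb e) (mc e);
  ok_f : adm (mb e) (mf e);
  ok_c1 : forall m, bnd (mc1 e m) (Cd * (1 + ((mn e)%:R * kap) ^+ 2) * mb e);
  ok_sec : forall m, sec y1 y2 (fun y => pot kap (Q m) (mn e) y * mc e m y + mf e m y) (mc e m) (mc1 e m);
  ok_1 : forall m, mc e m y1 = 0;
  ok_2 : (2 <= mn e)%N -> forall m, mc e m y2 = 0 }.

Lemma len0 : 0 < len. Proof. by rewrite subr_gt0. Qed.
Lemma Cd1 : 1 <= Cd.
Proof.
have l0 := len0; have h : 0 <= 2 / len := divr_ge0 (ler0n _ 2) (ltW l0).
have h' : 0 <= (k + 2) * len := mulr_ge0 (addr_ge0 k0 (ler0n _ 2)) (ltW l0).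
by rewrite /Cd -addrA lerDl addr_ge0.
Qed.

(** The equation bounds the second derivative by (k + 2 + (n kap)^2) b, and
    [deriv_bound] applies. *)
Lemma mode_c1 n b (w w1 f : R -> R) m : 0 <= b -> bnd w b -> bnd f b ->
  sec y1 y2 (fun y => pot kap (Q m) n y * w y + f y) w w1 ->
  bnd w1 (Cd * (1 + (n%:R * kap) ^+ 2) * b).
Proof.
move=> b0 wb fb wS y yI.
have s0 : 0 <= (n%:R * kap) ^+ 2 by rewrite exprn_ge0 // mulr_ge0 // ltW.
have [_ _ Qb _] := QA; have l0 := len0.
have hb : bnd (fun y => pot kap (Q m) n y * w y + f y) ((k + 2 + (n%:R * kap) ^+ 2) * b).
  move=> z zI; apply: le_trans (ler_normD _ _) _.
  have -> : (k + 2 + (n%:R * kap) ^+ 2) * b = (k + 1 + (n%:R * kap) ^+ 2) * b + b by ring.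
  apply: lerD; last exact: fb; rewrite normrM; apply: ler_pM => //; last exact: wb.
  apply: le_trans (ler_normD _ _) _; rewrite (ger0_norm s0) lerD2r; exact: Qb.
apply: le_trans (deriv_bound hy wS wb hb yI) _.
rewrite /Cd; set S := (_ * kap) ^+ 2 in s0 *.
have h1 : 0 <= 2 / len * S * b by rewrite !mulr_ge0 // ?invr_ge0 // ltW.
have h2 : 0 <= k * S * len * b by rewrite !mulr_ge0 // ltW.
have h3 : 0 <= S * len * b by rewrite !mulr_ge0 // ltW.
have h4 : 0 <= S * b by rewrite mulr_ge0.
have -> : (1 + 2 / len + (k + 2) * len) * (1 + S) * b =
  2 * b / len + (k + 2 + S) * b * len + (b + S * b + 2 / len * S * b + k * S * len * b + S * len * b).
  by field; rewrite gt_eqF.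
by rewrite lerDl !addr_ge0.
Qed.

Lemma sol_ex n b f : adm b f -> exists e, [/\ okM e, mn e = n, mb e = M' * b & mf e = f].
Proof.
move=> [b0 fc fb [L L0 fL]].
have [_ Qc Qb [LQ LQ0 QL]] := QA.
have ex m : exists ww : (R -> R) * (R -> R), modesol y1 y2 kap (Q m) n (f m) ww.1 ww.2.
  have [[w [w1 h]] _] := Hok n (Qc m) (Qr m) (fc m).
  by exists (w, w1).
have [ww wwP] := choice ex.
have MM : M <= M' by rewrite /M' le_max lexx.
have M1 : 1 <= M' by rewrite /M' le_max lexx orbT.
have Mb0 : 0 <= M' * b by rewrite mulr_ge0 // (le_trans M0).
have wb m : bnd (ww m).1 (M' * b).
  have [_ h] := Hok n (Qc m) (Qr m) (fc m).
  move=> y yI; apply: le_trans (h _ _ b b0 (fb m) (wwP m) y yI) _.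
  by rewrite ler_wpM2r.
have fb' m : bnd (f m) (M' * b).
  by move=> y yI; apply: le_trans (fb m y yI) _; rewrite ler_peMl.
exists (Mode n (M' * b) (fun m => (ww m).1) (fun m => (ww m).2) f); split=> //.
split=> /=.
- split=> //.
    by move=> m; have [_ _ s] := wwP m; apply: cc_cont; exact: (sec_cont s).1.
  have LL0 : 0 <= LQ * (M' * b) + L := addr_ge0 (mulr_ge0 LQ0 Mb0) L0.
  exists (M * (LQ * (M' * b) + L)); first exact: mulr_ge0.
  move=> m m' y yI.
  have [a1 b1 s1] := wwP m; have [a2 b2 s2] := wwP m'.
  pose F := (fun y => (Q m y - Q m' y) * (ww m').1 y + (f m y - f m' y)).
  have Fc : cc F.
    apply: cc_add; last exact: cc_sub.
    apply: cc_mul; first exact: cc_sub.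
    by apply: cc_cont; exact: (sec_cont s2).1.
  have [_ h] := Hok n (Qc m) (Qr m) Fc.
  have Fb : bnd F ((LQ * (M' * b) + L) * `|m - m'|).
    move=> z zI; apply: le_trans (ler_normD _ _) _; rewrite [leRHS]mulrDl; apply: lerD; last exact: fL.
    by rewrite normrM mulrAC; apply: ler_pM => //; [exact: QL|exact: wb].
  have F0 : 0 <= (LQ * (M' * b) + L) * `|m - m'| := mulr_ge0 LL0 (normr_ge0 _).
  have dS : modesol y1 y2 kap (Q m) n F (fun y => (ww m).1 y - (ww m').1 y)
     (fun y => (ww m).2 y - (ww m').2 y).
    split; first by rewrite a1 a2 subrr.
      by case: ifP b1 b2 => _ -> ->; rewrite subrr.
    apply: (sec_ext hy _ (sec_sub s1 s2)) => z zI; rewrite /F /pot; ring.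
  by have := h _ _ _ F0 Fb dS y yI; rewrite mulrA.
- by split=> //; exists L.
- by move=> m; have [_ _ s] := wwP m; exact: mode_c1 Mb0 (wb m) (fb' m) s.
- by move=> m; have [] := wwP m.
- by move=> m; have [] := wwP m.
- by move=> n2 m; have [_ + _] := wwP m; rewrite ltnNge n2.
Qed.

(** The solution operator of the linearised equation, acting term by term. *)
Lemma sol_choice : exists S : term -> mode, forall t : term, adm t.1.2 t.2 ->
  [/\ okM (S t), mn (S t) = t.1.1, mb (S t) = M' * t.1.2 & mf (S t) = t.2].
Proof.
have ex (t : term) : exists e, adm t.1.2 t.2 ->
  [/\ okM e, mn e = t.1.1, mb e = M' * t.1.2 & mf e = t.2].
  have [h|h] := pselect (adm t.1.2 t.2); last first.
    by exists (Mode 0 0 (fun _ _ => 0) (fun _ _ => 0) (fun _ _ => 0)) => /h.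
  by have [e he] := sol_ex t.1.1 h; exists e.
by have [S HS] := choice ex; exists S.
Qed.

Definition tc e : term := (mn e, mb e, mc e).
Definition tf e : term := (mn e, mb e, mf e).
Definition okL l := forall e, List.In e l -> okM e.
Definition nrmM l : R := nrm (map tc l).

(** One summation operator for the coefficients, their ordinate derivatives
    and the forcings, according to the choice of [g]. *)
Definition evm i g l m x y : R := foldr (fun e s => g e m y * osc i (mn e) x + s) 0 l.

Lemma evm_c i l m x y : evm i mc l m x y = ev i (map tc l) m x y.
Proof. by elim: l => //= e l ->. Qed.
Lemma evm_f i l m x y : evm i mf l m x y = ev i (map tf l) m x y.
Proof. by elim: l => //= e l ->. Qed.

Lemma okL_cons e l : okL (e :: l) <-> okM e /\ okL l.
Proof.
split=> [H|[h1 h2] t']; first by split=> [|t' ht]; apply: H; [left|right].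
by move=> /= [<-|] //; exact: h2.
Qed.

Lemma okL_cat l l' : okL l -> okL l' -> okL (l ++ l').
Proof.
move=> h h'; elim: l h => [|t l IH] //= /okL_cons [a b].
by apply/okL_cons; split=> //; exact: IH.
Qed.

Lemma okL_wf l : okL l -> wf (map tc l) /\ wf (map tf l).
Proof.
elim: l => [|e l IH] //= /okL_cons [h /IH [a b]].
by split; apply/wf_cons; split=> //; [exact: ok_c|exact: ok_f].
Qed.

Lemma nrmM_ge0 l : okL l -> 0 <= nrmM l.
Proof. by move=> /okL_wf [h _]; exact: nrm_ge0 h. Qed.

(** The bound that [mc], [mc1] and [mf] share, so that their series converge
    by the same argument. *)
Definition gok g := forall e m, okM e -> cc (g e m) /\
  bnd (g e m) (Cd * (1 + ((mn e)%:R * kap) ^+ 2) * mb e).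

Lemma gok_le e : okM e -> mb e <= Cd * (1 + ((mn e)%:R * kap) ^+ 2) * mb e.
Proof.
move=> [[b0 _ _ _] _ _ _ _ _]; rewrite ler_peMl //.
have h := Cd1; have h2 : 0 <= ((mn e)%:R * kap) ^+ 2 by rewrite exprn_ge0 // mulr_ge0 // ltW.
apply: le_trans (_ : 1 <= Cd * 1) _; first by rewrite mulr1.
by rewrite ler_wpM2l ?lerDl // (le_trans ler01).
Qed.

Lemma gok_mc : gok mc.
Proof.
move=> e m h; have hb := gok_le h; have [_ a b _] := ok_c h; split=> // y yI.
exact: le_trans (b m y yI) hb.
Qed.
Lemma gok_mf : gok mf.
Proof.
move=> e m h; have hb := gok_le h; have [_ a b _] := ok_f h; split=> // y yI.
exact: le_trans (b m y yI) hb.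
Qed.
Lemma gok_mc1 : gok mc1.
Proof.
move=> e m h; split; last exact: ok_c1.
by apply: cc_cont; exact: (sec_cont (ok_sec h m)).2.
Qed.

Lemma evm_bound i : exists2 C : R, 0 <= C & forall g l m x y, gok g -> okL l ->
  y1 <= y <= y2 -> `|evm i g l m x y| <= C * nrmM l.
Proof.
have [C C0 HC] := freq_bound kap0 i; have [C' C0' HC'] := freq_bound kap0 i.+2.
have Cd0 : 0 <= Cd := le_trans ler01 Cd1.
exists (Cd * (C + C')); first by rewrite mulr_ge0 // addr_ge0.
move=> g l m x y gk + yI; elim: l => [|e l IH]; first by rewrite /= normr0 mulr0.
move=> /okL_cons [h /IH hl]; rewrite /= /nrmM /= mulrDr.
apply: le_trans (ler_normD _ _) _; apply: lerD hl; rewrite normrM.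
have [_ gb] := gk e m h; have [b0 _ _ _] := ok_c h.
apply: le_trans (ler_pM (normr_ge0 _) (normr_ge0 _) (gb y yI) (osc_bound kap0 _ _ _)) _.
have -> : Cd * (1 + ((mn e)%:R * kap) ^+ 2) * mb e * ((mn e)%:R * kap) ^+ i =
  Cd * mb e * (((mn e)%:R * kap) ^+ i + ((mn e)%:R * kap) ^+ i.+2) by rewrite !exprS; ring.
have -> : Cd * (C + C') * (expR (mn e)%:R * mb e) =
  Cd * mb e * (C * expR (mn e)%:R + C' * expR (mn e)%:R) by ring.
by rewrite ler_wpM2l ?mulr_ge0 // lerD.
Qed.

Lemma evm_cont i g l m : gok g -> okL l ->
  continuous (fun p : R * R => evm i g l m p.1 (clamp p.2)).
Proof.
move=> gk + p; elim: l => [|e l IH] /=; first by move=> _; exact: c_cst.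
move=> /okL_cons [/(gk e m) [gc _] /IH hl]; apply: c_add hl; apply: c_mul.
  by apply: (@continuous_comp _ _ _ snd (g e m \o clamp)); [exact: cvg_snd|exact: gc].
by apply: (@continuous_comp _ _ _ fst (osc i (mn e))); [exact: cvg_fst|exact: osc_cont].
Qed.

Lemma evm_derx i g l m x y : is_derive x 1 (fun x => evm i g l m x y) (evm i.+1 g l m x y).
Proof.
elim: l => [|t l IH] /=; first exact: der_cst.
by apply: der_add IH; apply: der_scale; exact: osc_der.
Qed.

Lemma evm_per i g l m x y T n : kap * T = n%:R * (pi * 2) ->
  evm i g l m (x + T) y = evm i g l m x y.
Proof.
move=> nT; elim: l => [|e l IH] //=; rewrite IH; congr (_ + _).
have := @ev_per R kap i [:: (mn e, 0, g e)] m x y T (ex_intro _ n nT).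
by rewrite /= !addr0.
Qed.

Lemma evm_dery0 i l m x y : okL l ->
  is_derive y 1 (fun y => evm i mc l m x y) (evm i mc1 l m x y).
Proof.
elim: l => [|e l IH] /=; first by move=> _; exact: der_cst.
move=> /okL_cons [h /IH hl]; apply: der_add hl.
have [d _] := ok_sec h m.
by apply: der_eq (der_mul (d y) (der_cst _ y)) _; rewrite mulr0 addr0.
Qed.

Lemma oscSS i n x : osc i.+2 n x = - ((n%:R * kap) ^+ 2 * osc i n x).
Proof.
rewrite /osc /cosd (_ : _ + i.+2%:R * _ = n%:R * kap * x + i%:R * (pi / 2) + pi).
  by rewrite cosDpi !exprS expr0; ring.
by rewrite -[i.+2%:R]natr1 -[i.+1%:R]natr1; field.
Qed.

Lemma evm_dery1 i l m x y : okL l -> y1 <= y <= y2 ->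
  is_derive y 1 (fun y => evm i mc1 l m x y)
   (Q m y * evm i mc l m x y - evm i.+2 mc l m x y + evm i mf l m x y).
Proof.
move=> + yI; elim: l => [|e l IH] /=.
  by move=> _; apply: der_eq (der_cst 0 y) _; rewrite mulr0 subrr addr0.
move=> /okL_cons [h /IH hl].
have [_ d] := ok_sec h m.
apply: der_eq (der_add (der_mul (d y) (der_cst _ y)) hl) _.
by rewrite clamp_id // /pot oscSS; ring.
Qed.

Lemma evm_y1 i l m x : okL l -> evm i mc l m x y1 = 0.
Proof.
elim: l => [|e l IH] //= /okL_cons [h /IH ->].
by rewrite (ok_1 h) mul0r addr0.
Qed.

(** Amplitude of the first mode at the upper wall, the only obstruction to the
    boundary condition by [evm_y2]. *)
Definition amp l m : R := foldr (fun e s => (if mn e == 1%N then mc e m y2 else 0) + s) 0 l.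

Lemma evm_y2 i l m x : okL l -> evm i.+1 mc l m x y2 = osc i.+1 1 x * amp l m.
Proof.
elim: l => [|e l IH] /=; first by rewrite mulr0.
move=> /okL_cons [h /IH ->]; rewrite mulrDr; congr (_ + _).
case E : (mn e) => [|[|n]].
- by rewrite /osc !mul0r expr0n /= mul0r !mulr0.
- by rewrite mulrC.
- by rewrite (ok_2 h) ?E // mul0r mulr0.
Qed.

Lemma y2I : y1 <= y2 <= y2. Proof. by rewrite lexx ltW. Qed.

Lemma amp_bound l m : okL l -> `|amp l m| <= nrmM l.
Proof.
elim: l => [|e l IH]; first by rewrite /= normr0.
move=> /okL_cons [h /IH hl]; rewrite /nrmM /=; apply: le_trans (ler_normD _ _) _.
apply: lerD hl; have [b0 _ cb _] := ok_c h.
apply: le_trans (_ : _ <= mb e) _; first by case: eqP => _; [exact: cb y2I|rewrite normr0].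
by rewrite ler_peMl // -expR0 ler_expR.
Qed.

Lemma amp_cont l : okL l -> continuous (amp l).
Proof.
move=> + m; elim: l => [|e l IH] /=; first by move=> _; exact: c_cst.
move=> /okL_cons [h /IH hl]; apply: c_add hl.
case: eqP => _; last exact: c_cst.
have [_ _ _ [L L0 HL]] := ok_c h.
apply/cvgrPdist_le => eps e0; near=> m'.
apply: le_trans (HL m m' y2 y2I) _.
have : `|m - m'| <= eps / (L + 1).
  by near: m'; apply: cvgr_dist_le; [exact: cvg_id|rewrite divr_gt0 // ltr_wpDl].
move=> h1; apply: le_trans (ler_wpM2l L0 h1) _.
rewrite mulrA ler_pdivrMr ?ltr_wpDl // mulrDr mulr1 mulrC lerDl; exact: ltW.
Unshelve. all: by end_near.
Qed.


(** [v i] is the i-th derivative in x of the perturbation of the stream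
    function divided by the amplitude a, [w i] the same for its derivative in
    y, and [s i] for the forcing. The last field says that v is s0 cos (kap x)
    to leading order. *)
Record wave a (q : nat -> R -> R -> R) D (B : nat -> R) (bd : R) m (s0 : R -> R) (v w s : nat -> R * R -> R) : Prop := Wave {
  wv_cont : forall i, continuous (v i) /\ continuous (w i);
  wv_bound : forall i p, `|v i p| <= B i /\ `|w i p| <= B i;
  wv_per : forall T n, kap * T = n%:R * (pi * 2) -> forall i x y,
    v i (x + T, y) = v i (x, y) /\ w i (x + T, y) = w i (x, y);
  wv_dx : forall i x y, [/\ is_derive x 1 (fun x => v i (x, y)) (v i.+1 (x, y)),
    is_derive x 1 (fun x => w i (x, y)) (w i.+1 (x, y)) &
    is_derive x 1 (fun x => s i (x, y)) (s i.+1 (x, y))];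
  wv_dy : forall i x y, y1 < y < y2 -> is_derive y 1 (fun y => v i (x, y)) (w i (x, y)) /\
    is_derive y 1 (fun y => w i (x, y))
      (Q m y * v i (x, y) - v i.+2 (x, y) + s i (x, y));
  wv_s0 : forall x y, y1 <= y <= y2 ->
    s 0%N (x, y) = a * \sum_(i < D) q i m y * v 0%N (x, y) ^+ i.+2;
  wv_y1 : forall i x, v i (x, y1) = 0;
  wv_y2 : forall i x, v i.+1 (x, y2) = osc i.+1 1 x * bd;
  wv_lin : forall i x y, y1 <= y <= y2 -> `|v i (x, y) - s0 y * osc i 1 x| <= B i * a }.

Section Fixed.
Variables (S : @term R -> mode) (v0 : mode) (K : R) (D : nat).
Hypothesis HS : forall t : @term R, adm t.1.2 t.2 ->
  [/\ okM (S t), mn (S t) = t.1.1, mb (S t) = M' * t.1.2 & mf (S t) = t.2].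
Hypotheses (ok0 : okM v0) (n0 : mn v0 = 1%N) (f0 : mf v0 = fun _ _ => 0) (K0 : 0 <= K).

(** The sum of the increments is at most 2 nv0, and [A2] is the Lipschitz
    constant of the solution operator composed with the nonlinearity in the
    ball of radius [NN]. *)
Definition nv0 := nrmM [:: v0].
Definition NN := 2 * nv0 + 1.
Definition A2 := M' * (D%:R * (K * (D.+1%:R * NN ^+ D.+1))).

Lemma nv0_ge0 : 0 <= nv0.
Proof. by apply: nrmM_ge0; apply/okL_cons; split=> [|e []]. Qed.
Lemma M'_ge0 : 0 <= M'. Proof. by rewrite /M' le_max M0. Qed.
Lemma NN1 : 1 <= NN. Proof. by rewrite /NN lerDr mulr_ge0 // nv0_ge0. Qed.
Lemma A2_ge0 : 0 <= A2.
Proof.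
have N0 := le_trans ler01 NN1.
exact: mulr_ge0 M'_ge0 (mulr_ge0 (ler0n _ _) (mulr_ge0 K0 (mulr_ge0 (ler0n _ _) (exprn_ge0 _ N0)))).
Qed.

Variables (a : R) (q : nat -> R -> R -> R).
Hypotheses (a0 : 0 < a) (aA : a * A2 <= 2^-1).
Hypothesis qK : forall i, (i < D)%N -> adm K (q i).

(** The iteration v_(j+1) = v0 + S (a R(v_j)), kept as the list V of terms
    found so far and the list d of the new ones. The next increment S (a (R(V
    + d) - R(V))) is expanded without cancellation, so that its norm is at
    most half the norm of d. *)
Fixpoint st j : seq mode * seq mode := if j is j'.+1 then
  let: (V, d) := st j' in
  (V ++ d, map S (scl a (fun _ _ => a) (dRl K q D (map tc V) (map tc d))))
  else ([::], [:: v0]).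

Lemma stS j : st j.+1 = ((st j).1 ++ (st j).2,
  map S (scl a (fun _ _ => a) (dRl K q D (map tc (st j).1) (map tc (st j).2)))).
Proof. by rewrite /=; case: (st j). Qed.

Lemma map_S (l : seq (@term R)) : wf l -> [/\ okL (map S l), map tf (map S l) =
  map (fun t : term => (t.1.1, M' * t.1.2, t.2)) l & nrmM (map S l) = M' * nrm l].
Proof.
elim: l => [|t l IH] /=; first by split=> //; rewrite /nrmM /= mulr0.
move=> /wf_cons [h /IH [a1 a2 a3]]; have [b1 b2 b3 b4] := HS h; split.
- by apply/okL_cons.
- by rewrite a2 /tf b2 b3 b4.
- by rewrite /nrmM /= -[nrm _]/(nrmM _) a3 b2 b3; ring.
Qed.

Lemma adm_a : adm a (fun _ _ => a).
Proof. by have := adm_cst y1 y2 a; rewrite gtr0_norm. Qed.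

Lemma st_inv j : [/\ okL (st j).1, okL (st j).2,
  nrmM (st j).1 <= 2 * nv0 * (1 - 2^-1 ^+ j), nrmM (st j).2 <= nv0 * 2^-1 ^+ j &
  nrmM (st j.+1).2 <= a * A2 * nrmM (st j).2 /\ okL (st j.+1).2].
Proof.
have aux V d (h : R) : okL V -> okL d -> 0 <= h <= 1 -> nrmM V <= 2 * nv0 * (1 - h) -> nrmM d <= nv0 * h ->
  let d' := map S (scl a (fun _ _ => a) (dRl K q D (map tc V) (map tc d))) in
  nrmM d' <= a * A2 * nrmM d /\ okL d'.
  move=> oV od /andP[h0 h1] hV hd d'.
  have [wV _] := okL_wf oV; have [wd _] := okL_wf od.
  have wR := wf_dRl qK wV wd.
  have [r1' r2 r3] := map_S (wf_scl adm_a wR).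
  split=> //; rewrite r3 nrm_scl.
  have sN : nrmM V + nrmM d <= NN.
    apply: le_trans (lerD hV hd) _; have := mulr_ge0 nv0_ge0 h0; rewrite /NN.
    have := nv0_ge0; lra.
  have := nrm_dRl q D K0 wV wd NN1 sN; rewrite -/(nrmM _).
  move=> hR; have := ler_wpM2l (mulr_ge0 (ltW a0) M'_ge0) hR.
  by rewrite /A2 [M' * (a * _)]mulrCA !mulrA.
elim: j => [|j [oV od hV hd [hd' od']]].
  have h1 : okL [:: v0] by apply/okL_cons.
  split=> //=; rewrite ?expr0 ?subrr ?mulr0 ?mulr1 //.
  by apply: (aux [::] [:: v0] 1) => //; rewrite ?ler01 ?lexx // ?subrr ?mulr0 ?mulr1.
have E : st j.+1 = ((st j).1 ++ (st j).2, (st j.+1).2) by rewrite stS.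
have p0 : 0 <= 2^-1 ^+ j :> R by rewrite exprn_ge0 // invr_ge0.
have p1 : 2^-1 ^+ j <= 1 :> R by rewrite exprn_ile1 // ?invr_ge0 // invf_le1 // ler1n.
have hV' : nrmM (st j.+1).1 <= 2 * nv0 * (1 - 2^-1 ^+ j.+1).
  rewrite E /= /nrmM map_cat nrm_cat -!/(nrmM _) exprS.
  by apply: le_trans (lerD hV hd) _; rewrite le_eqVlt; apply/orP; left; apply/eqP; field.
have hd1 : nrmM (st j.+1).2 <= nv0 * 2^-1 ^+ j.+1.
  apply: le_trans hd' _; rewrite exprS.
  rewrite (_ : nv0 * _ = 2^-1 * (nv0 * 2^-1 ^+ j)); last by ring.
  apply: ler_pM => //; [exact: mulr_ge0 (ltW a0) A2_ge0|exact: nrmM_ge0].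
have oV2 : okL (st j.+1).1 by rewrite E; apply: okL_cat.
split=> //.
rewrite [st j.+2]stS.
apply: (aux (st j.+1).1 (st j.+1).2 (2^-1 ^+ j.+1)) => //.
by rewrite exprn_ge0 ?invr_ge0 // exprn_ile1 // ?invr_ge0 // invf_le1 // ler1n.
Qed.

Definition dd j := (st j).2.
Lemma dd_ok j : okL (dd j). Proof. by case: (st_inv j). Qed.
Lemma dd_nrm j : nrmM (dd j) <= nv0 * 2^-1 ^+ j. Proof. by case: (st_inv j). Qed.
Lemma dd_nrm1 j : nrmM (dd j.+1) <= a * A2 * nv0 * 2^-1 ^+ j.
Proof.
have [_ _ _ h [h' _]] := st_inv j; apply: le_trans h' _; rewrite -[leRHS]mulrA.
by apply: ler_wpM2l h; exact: mulr_ge0 (ltW a0) A2_ge0.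
Qed.

Lemma dd_sum i g m x y n : \sum_(0 <= j < n) evm i g (dd j) m x y = evm i g (st n).1 m x y.
Proof.
elim: n => [|n IH]; first by rewrite big_geq.
rewrite big_nat_recr //= IH /dd; case: (st n) => V d /=.
by elim: V {IH} => [|e l IH] /=; rewrite ?add0r // -IH addrA.
Qed.

Definition RR m y (z : R) := \sum_(i < D) q i m y * z ^+ i.+2.

Lemma forcing_sum m x y n : \sum_(0 <= j < n.+1) evm 0 mf (dd j) m x y =
  a * RR m y (evm 0 mc (st n).1 m x y).
Proof.
elim: n => [|n IH].
  rewrite big_nat1 /dd /= f0 mul0r add0r /RR big1 ?mulr0 // => i _.
  by rewrite expr0n mulr0.
rewrite big_nat_recr //= IH.
have [oV od _ _ _] := st_inv n.
have [wV _] := okL_wf oV; have [wd _] := okL_wf od.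
have [_ r2 _] := map_S (wf_scl adm_a (wf_dRl qK wV wd)).
have -> : evm 0 mf (dd n.+1) m x y =
  ev 0 (scl a (fun _ _ => a) (dRl K q D (map tc (st n).1) (map tc (st n).2))) m x y.
  rewrite evm_f /dd /=; move: r2; case: (st n) => V d /= ->.
  by elim: (scl _ _ _) => //= t l ->.
rewrite ev_scl ev_dRl -!evm_c -/(RR _ _ _) -/(RR _ _ _).
have -> : evm 0 mc (let: (V, d) := st n in (V ++ d, map S (scl a (fun _ _ => a) (dRl K q D (map tc V) (map tc d))))).1 m x y
  = evm 0 mc (st n).1 m x y + evm 0 mc (st n).2 m x y.
  case: (st n) => V d /=.
  by elim: V => [|e l IH2] /=; rewrite ?add0r // IH2 addrA.
ring.
Qed.

Definition sol g m i (p : R * R) := sumser (fun j => evm i g (dd j) m p.1 (clamp p.2)).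
Definition bsum m := sumser (fun j => amp (dd j) m).

Lemma amp_geo m j : `|amp (dd j) m| <= nv0 * 2^-1 ^+ j.
Proof. by apply: le_trans (amp_bound _ (@dd_ok j)) (dd_nrm j). Qed.

Lemma bsum_cont : continuous bsum.
Proof.
move=> m; apply: (sumser_cont (C := nv0)); first by move=> j z; exact: amp_geo.
by move=> j; apply: amp_cont; exact: dd_ok.
Qed.

(** All increments after the first carry a factor a. *)
Lemma head_est (t : nat -> R) C : 0 <= C -> (forall j, `|t j| <= C * nrmM (dd j)) ->
  `|sumser t - t 0%N| <= 2 * (C * A2 * nv0) * a.
Proof.
move=> C0 tC.
have g j : `|t j| <= C * nv0 * 2^-1 ^+ j.
  by apply: le_trans (tC j) _; rewrite -mulrA ler_wpM2l // dd_nrm.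
rewrite (sumser_shift g) addrC addKr -mulrA; apply: sumser_le => j.
apply: le_trans (tC j.+1) _.
have -> : C * A2 * nv0 * a * 2^-1 ^+ j = C * (a * A2 * nv0 * 2^-1 ^+ j) by ring.
by rewrite ler_wpM2l // dd_nrm1.
Qed.

Lemma bsum_est m : `|bsum m - mc v0 m y2| <= 2 * (A2 * nv0) * a.
Proof.
have := @head_est (fun j => amp (dd j) m) 1 ler01 _.
rewrite /= n0 eqxx addr0 !mul1r; apply => j.
by rewrite mul1r; exact: amp_bound (@dd_ok j).
Qed.


Definition Cev i := sval (cid2 (evm_bound i)).
Lemma Cev_ge0 i : 0 <= Cev i. Proof. by rewrite /Cev; case: cid2. Qed.
Lemma CevP i g l m x y : gok g -> okL l -> y1 <= y <= y2 ->
  `|evm i g l m x y| <= Cev i * nrmM l.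
Proof. by rewrite /Cev; case: cid2 => C /= _ h; exact: h. Qed.

Lemma evm_geo i g m x y : gok g -> y1 <= y <= y2 ->
  forall j, `|evm i g (dd j) m x y| <= Cev i * nv0 * 2^-1 ^+ j.
Proof.
move=> gk yI j; apply: le_trans (CevP i m x gk (@dd_ok j) yI) _.
by rewrite -[leRHS]mulrA; exact: ler_wpM2l (Cev_ge0 i) _ _ (dd_nrm j).
Qed.

Lemma sol_cont g m i : gok g -> continuous (sol g m i).
Proof.
move=> gk p; apply: (sumser_cont (C := Cev i * nv0)) => [j z|j].
  by apply: evm_geo => //; exact: clampI.
by apply: evm_cont => //; exact: dd_ok.
Qed.

Lemma sol_dx g m i x y : gok g ->
  is_derive x 1 (fun x => sol g m i (x, y)) (sol g m i.+1 (x, y)).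
Proof.
move=> gk; rewrite /sol /=.
have yI := clampI hy y; have c0 := Cev_ge0 i; have c1 := Cev_ge0 i.+1.
have b0 := nv0_ge0.
apply: (@sumser_der R (fun j x => evm i g (dd j) m x (clamp y))
  (fun j x => evm i.+1 g (dd j) m x (clamp y)) ((Cev i + Cev i.+1) * nv0) (x - 1) (x + 1)).
- by move=> j z _; exact: evm_derx.
- move=> j z _; apply: le_trans (evm_geo i m z gk yI j) _.
  by rewrite ler_wpM2r ?exprn_ge0 ?invr_ge0 // ler_wpM2r // lerDl.
- move=> j z _; apply: le_trans (evm_geo i.+1 m z gk yI j) _.
  by rewrite ler_wpM2r ?exprn_ge0 ?invr_ge0 // ler_wpM2r // lerDr.
- by rewrite ltrBlDr !ltrDl ltr01.
Qed.

Lemma sol_dy (g g' : mode -> R -> R -> R) (F : (mode -> R -> R -> R) -> seq mode -> R -> R) m i x y C :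
  gok g -> y1 < y < y2 ->
  (forall j z, y1 <= z <= y2 -> is_derive z 1 (fun z => evm i g (dd j) m x z) (F g' (dd j) z)) ->
  (forall j z, y1 <= z <= y2 -> `|F g' (dd j) z| <= C * 2^-1 ^+ j) ->
  is_derive y 1 (fun y => sol g m i (x, y)) (sumser (fun j => F g' (dd j) y)).
Proof.
move=> gk yI dF bF; have yI' : y1 <= y <= y2 by case/andP: yI => *; rewrite !ltW.
have C0 : 0 <= C by have := bF 0%N y yI'; rewrite expr0 mulr1; apply: le_trans.
have cn : 0 <= Cev i * nv0 := mulr_ge0 (Cev_ge0 i) nv0_ge0.
rewrite (_ : (fun y => _) = (fun y => sumser (fun j => evm i g (dd j) m x y)) \o clamp) //.
apply: der_clamp => //.
apply: (@sumser_der R (fun j z => evm i g (dd j) m x z) (fun j z => F g' (dd j) z) (Cev i * nv0 + C) y1 y2) => //.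
- by move=> j z /andP[h1 h2]; apply: dF; rewrite !ltW.
- move=> j z /andP[h1 h2]; have zI : y1 <= z <= y2 by rewrite !ltW.
  apply: le_trans (evm_geo i m x gk zI j) _.
  by rewrite ler_wpM2r ?exprn_ge0 ?invr_ge0 // lerDl.
- move=> j z /andP[h1 h2]; have zI : y1 <= z <= y2 by rewrite !ltW.
  apply: le_trans (bF j z zI) _.
  by rewrite ler_wpM2r ?exprn_ge0 ?invr_ge0 // lerDr.
Qed.

Definition Bw i := 2 * (Cev i * nv0) + 2 * (Cev i * A2 * nv0) + 2 * (A2 * nv0).

Lemma Bw_ge i : [/\ 2 * (Cev i * nv0) <= Bw i, 2 * (Cev i * A2 * nv0) <= Bw i &
  2 * (A2 * nv0) <= Bw i].
Proof.
have h1 : 0 <= Cev i * nv0 := mulr_ge0 (Cev_ge0 i) nv0_ge0.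
have h2 : 0 <= Cev i * A2 * nv0 := mulr_ge0 (mulr_ge0 (Cev_ge0 i) A2_ge0) nv0_ge0.
have h3 : 0 <= A2 * nv0 := mulr_ge0 A2_ge0 nv0_ge0.
rewrite /Bw; move: h1 h2 h3; set u := Cev i * nv0; set v := Cev i * A2 * nv0; set w := A2 * nv0.
by move=> *; split; lra.
Qed.

Lemma sol_wave m : wave a q D Bw (bsum m) m (mc v0 m) (sol mc m) (sol mc1 m) (sol mf m).
Proof.
have wv g i p : gok g -> `|sol g m i p| <= Bw i.
  move=> gk; have [h _ _] := Bw_ge i; apply: le_trans h.
  by apply: sumser_le => j; apply: evm_geo => //; exact: clampI.
split.
- by move=> i; split; apply: sol_cont; [exact: gok_mc|exact: gok_mc1].
- by move=> i p; split; apply: wv; [exact: gok_mc|exact: gok_mc1].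
- move=> T n nT i x y.
  have E g : sol g m i (x + T, y) = sol g m i (x, y).
    rewrite /sol /=; congr sumser; apply/funext => j; exact: evm_per nT.
  by split; exact: E.
- by move=> i x y; split; apply: sol_dx; [exact: gok_mc|exact: gok_mc1|exact: gok_mf].
- move=> i x y yI; split.
    rewrite {2}/sol /= clamp_id; last by case/andP: yI => *; rewrite !ltW.
    apply: (@sol_dy mc mc1 (fun g l z => evm i g l m x z) m i x y (Cev i * nv0)) => //.
    + exact: gok_mc.
    + by move=> j z _; apply: evm_dery0; exact: dd_ok.
    + by move=> j z zI; apply: evm_geo => //; exact: gok_mc1.
  have [_ _ Qb _] := QA.
  have yI' : y1 <= y <= y2 by case/andP: yI => *; rewrite !ltW.
  have g1 z : y1 <= z <= y2 -> forall j, `|Q m z * evm i mc (dd j) m x z| <= (k + 1) * (Cev i * nv0) * 2^-1 ^+ j.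
    move=> zI j; rewrite normrM -mulrA; apply: ler_pM => //; first exact: Qb.
    by apply: evm_geo => //; exact: gok_mc.
  have g2 z : y1 <= z <= y2 -> forall j, `|(-1) * evm i.+2 mc (dd j) m x z| <= Cev i.+2 * nv0 * 2^-1 ^+ j.
    by move=> zI j; rewrite mulN1r normrN; apply: evm_geo => //; exact: gok_mc.
  have g3 z : y1 <= z <= y2 -> forall j, `|evm i mf (dd j) m x z| <= Cev i * nv0 * 2^-1 ^+ j.
    by move=> zI j; apply: evm_geo => //; exact: gok_mf.
  have g12 z (zI : y1 <= z <= y2) : forall j,
     `|Q m z * evm i mc (dd j) m x z + (-1) * evm i.+2 mc (dd j) m x z| <=
        ((k + 1) * (Cev i * nv0) + Cev i.+2 * nv0) * 2^-1 ^+ j.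
    move=> j; rewrite mulrDl; apply: le_trans (ler_normD _ _) _; apply: lerD; [exact: g1|exact: g2].
  have := @sol_dy mc1 mf (fun g l z => (Q m z * evm i mc l m x z + (-1) * evm i.+2 mc l m x z) + evm i g l m x z)
    m i x y ((k + 1) * (Cev i * nv0) + Cev i.+2 * nv0 + Cev i * nv0) gok_mc1 yI.
  rewrite (sumser_add (g12 y yI') (g3 y yI')) (sumser_add (g1 y yI') (g2 y yI')).
  rewrite (sumser_scale _ (evm_geo i m x gok_mc yI')) (sumser_scale _ (evm_geo i.+2 m x gok_mc yI')).
  rewrite /sol /= clamp_id // mulN1r; apply.
  + by move=> j z zI; apply: der_eq (evm_dery1 _ _ _ (@dd_ok j) zI) _; rewrite mulN1r.
  + move=> j z zI; rewrite mulrDl; apply: le_trans (ler_normD _ _) _.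
    by apply: lerD; [exact: g12|exact: g3].
- move=> x y yI; rewrite /sol /= clamp_id //.
  have gc := evm_geo 0 m x gok_mc yI; have gf := evm_geo 0 m x gok_mf yI.
  apply: (sumser_lim gf).
  rewrite -(cvg_shiftS (fun n => \sum_(0 <= k < n) evm 0 mf (dd k) m x y)).
  rewrite (_ : (fun n => _) = (fun n => a * RR m y (\sum_(0 <= j < n) evm 0 mc (dd j) m x y))); last first.
    by apply/funext => n; rewrite forcing_sum dd_sum.
  have RRc : continuous (fun z => a * RR m y z).
    move=> z; apply: c_mul; first exact: c_cst.
    apply: (@c_sum _ D (fun i z => q i m y * z ^+ i.+2)) => i; apply: c_mul; first exact: c_cst.
    exact: exprn_continuous.
  by apply: (continuous_cvg _ (RRc _) (sumser_cvg gc)).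
- move=> i x; apply: sumser0 => j /=.
  rewrite clamp_id ?lexx ?ltW //; apply: evm_y1; exact: dd_ok.
- move=> i x; rewrite /sol /= clamp_id ?lexx ?ltW //.
  rewrite -(sumser_scale _ (amp_geo m)); congr sumser; apply/funext => j.
  by apply: evm_y2; exact: dd_ok.
- move=> i x y yI; rewrite /sol /= clamp_id //.
  have [_ h _] := Bw_ge i.
  have := @head_est (fun j => evm i mc (dd j) m x y) (Cev i) (Cev_ge0 i).
  rewrite /= n0 addr0 => h1; apply: le_trans (h1 _) _.
    by move=> j; apply: CevP => //; [exact: gok_mc|exact: dd_ok].
  by rewrite ler_wpM2r // ltW.
Qed.

End Fixed.

(** The number a1 and the bounds B must precede a and q: the amplitude is
    chosen after the other bounds are known, and then the parameter m is found
    by continuity of bd. *)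
Theorem nonlinear_waves (v0 : mode) K D : okM v0 -> mn v0 = 1%N -> mf v0 = (fun _ _ => 0) ->
  0 <= K -> exists (a1 : R) (B : nat -> R), 0 < a1 /\
  forall a (q : nat -> R -> R -> R), 0 < a <= a1 -> (forall i, (i < D)%N -> adm K (q i)) ->
  exists bd : R -> R, [/\ continuous bd, (forall m, `|bd m - mc v0 m y2| <= B 0%N * a) &
    forall m, exists v w s, wave a q D B (bd m) m (mc v0 m) v w s].
Proof.
move=> ok0 n0 f0 K0; have [S HS] := sol_choice.
have A0 := A2_ge0 D ok0 K0.
have A1 : 0 < A2 v0 K D + 1 by rewrite ltr_wpDl.
exists (1 / (2 * (A2 v0 K D + 1))), (Bw v0 K D).
have p0 : 0 < 2 * (A2 v0 K D + 1) by rewrite mulr_gt0.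
split; first by rewrite divr_gt0.
move=> a q /andP[a0 aa] qK.
have aA : a * A2 v0 K D <= 2^-1.
  move: aa; rewrite ler_pdivlMr // => aa.
  have : 0 < a * 1 by rewrite mulr1.
  rewrite mulr1; move: aa; rewrite mulrCA mulrDr mulr1 => aa ?.
  by rewrite -[2^-1]mul1r ler_pdivlMr //; lra.
exists (bsum S v0 K D a q); split.
- exact: bsum_cont.
- move=> m; have [_ _ h] := Bw_ge D ok0 K0 0.
  apply: le_trans (bsum_est _ _ _ _ _ _ _ _) _ => //.
  by rewrite ler_wpM2r // ltW.
- move=> m; do 3 eexists; exact: sol_wave.
Qed.

End Iteration.

(** * Uniform smoothness of the waves *)

Lemma der_unique (R : realType) (f : R -> R) (x d d' : R) :
  is_derive x 1 f d -> is_derive x 1 f d' -> d = d'.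
Proof. by move=> [_ <-] [_ <-]. Qed.

Section Expressions.
Context {R : realType} (y1 y2 beta kap T : R) (nk : nat).
Hypotheses (hy : y1 < y2) (kT : kap * T = nk%:R * (pi * 2)).
Variables (P G : {poly R}) (D : nat).
Hypothesis PD : (size P <= D.+2)%N.
Hypothesis GD : (size G <= D.+2)%N.
Local Notation clamp := (clamp y1 y2).
Local Notation cc f := (continuous (f \o clamp)).
Local Notation bnd f M := (forall y : R, y1 <= y <= y2 -> `|f y| <= M).

(** Polynomial expressions in the data of a wave. The equations express the
    ordinate derivatives of psi, psi' and w through these data, so that the
    class is closed under both partial derivatives; as it is syntactic, the
    resulting bounds hold for all waves at once. *)
Inductive expr :=
| EC of R | EA | EMu | EY | EPsi | EUps | EV of nat | EW of nat
| EAdd of expr & expr | EMul of expr & expr.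
Implicit Types (e : expr).

Record data := Data { da : R; dmu : R; dpsi : R -> R; dups : R -> R;
  dv : nat -> R * R -> R; dw : nat -> R * R -> R }.
Implicit Types (E : data) (p : R * R) (x y z : R) (i j n N : nat).

Fixpoint sem E e p : R := match e with
| EC c => c | EA => da E | EMu => dmu E | EY => clamp p.2
| EPsi => dpsi E (clamp p.2) | EUps => dups E (clamp p.2)
| EV i => dv E i p | EW i => dw E i p
| EAdd e1 e2 => sem E e1 p + sem E e2 p
| EMul e1 e2 => sem E e1 p * sem E e2 p end.

Fixpoint dx e := match e with
| EV i => EV i.+1 | EW i => EW i.+1
| EAdd e1 e2 => EAdd (dx e1) (dx e2)
| EMul e1 e2 => EAdd (EMul (dx e1) e2) (EMul e1 (dx e2))
| _ => EC 0 end.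

Definition epoly (p : {poly R}) e := foldr (fun c acc => EAdd (EMul acc e) (EC c)) (EC 0) p.
Fixpoint epow e n := if n is n'.+1 then EMul (epow e n') e else EC 1.
Fixpoint esum n (f : nat -> expr) := if n is n'.+1 then EAdd (esum n' f) (f n') else EC 0.
(** The i-th Taylor coefficient of P + mu G. *)
Definition etay i e := EAdd (epoly P^`N(i) e) (EMul EMu (epoly G^`N(i) e)).
Definition eterm i := EMul (EMul (epow EA i) (etay i.+1 EPsi)) (epow (EV 0) i.+1).
(** The equation for v divided by a: w_y = - v_xx + sum_i a^i T_(i+1) v^(i+1),
    with T_i the Taylor coefficients at the shear flow. *)
Definition erhs := EAdd (EMul (EC (-1)) (EV 2)) (esum D.+1 eterm).

Fixpoint dy e := match e with
| EY => EC 1 | EPsi => EUps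
| EUps => EAdd (EMul (EC beta) EY) (etay 0 EPsi)
| EV i => EW i | EW i => iter i dx erhs
| EAdd e1 e2 => EAdd (dy e1) (dy e2)
| EMul e1 e2 => EAdd (EMul (dy e1) e2) (EMul e1 (dy e2))
| _ => EC 0 end.

Lemma sem_epoly E q e p : sem E (epoly q e) p = q.[sem E e p].
Proof. by rewrite /epoly /horner; elim: (polyseq q) => //= c s ->. Qed.
Lemma sem_epow E e n p : sem E (epow e n) p = sem E e p ^+ n.
Proof. by elim: n => [|n IH] //=; rewrite IH exprSr. Qed.
Lemma sem_esum E n f p : sem E (esum n f) p = \sum_(i < n) sem E (f i) p.
Proof. by elim: n => [|n IH] /=; rewrite ?big_ord0 // big_ord_recr IH. Qed.

Definition tay E i z := (P + dmu E *: G)^`N(i).[z].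

Lemma sem_etay E i e p : sem E (etay i e) p = tay E i (sem E e p).
Proof. by rewrite /= !sem_epoly /tay nderivnD nderivnZ hornerD hornerZ. Qed.

Lemma sem_eterm E i p : sem E (eterm i) p =
  da E ^+ i * tay E i.+1 (dpsi E (clamp p.2)) * dv E 0 p ^+ i.+1.
Proof.
rewrite -[sem E (eterm i) p]/(sem E (epow EA i) p * sem E (etay i.+1 EPsi) p * sem E (epow (EV 0) i.+1) p).
by rewrite sem_etay !sem_epow.
Qed.

(** Taylor expansion of P + mu G at the shear flow: the full stream function
    psi + a v satisfies the vorticity equation. *)
Lemma sem_taylor E x y : y1 <= y <= y2 ->
  sem E (EMul EA (EV 2)) (x, y) + sem E (dy (EAdd EUps (EMul EA (EW 0)))) (x, y) =
  beta * y + (P + dmu E *: G).[sem E (EAdd EPsi (EMul EA (EV 0))) (x, y)].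
Proof.
move=> yI; set v := dv E 0 (x, y); set z := dpsi E y.
have -> : sem E (dy (EAdd EUps (EMul EA (EW 0)))) (x, y) = beta * y + tay E 0 z +
    (0 * dw E 0 (x, y) + da E * (-1 * dv E 2 (x, y) + sem E (esum D.+1 eterm) (x, y))).
  have <- : sem E (etay 0 EPsi) (x, y) = tay E 0 z by rewrite sem_etay /= clamp_id.
  rewrite -[LHS]/(beta * clamp y + sem E (etay 0 EPsi) (x, y) +
    (0 * dw E 0 (x, y) + da E * (-1 * dv E 2 (x, y) + sem E (esum D.+1 eterm) (x, y)))).
  by rewrite clamp_id.
have -> : sem E (EAdd EPsi (EMul EA (EV 0))) (x, y) = z + da E * v by rewrite /= clamp_id.
have -> : sem E (EMul EA (EV 2)) (x, y) = da E * dv E 2 (x, y) by [].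
rewrite (@nderiv_taylor_wide R D.+2 (P + dmu E *: G) z (da E * v) (mulrC _ _)); last first.
  apply: leq_trans (size_polyD _ _) _; rewrite geq_max PD /=.
  exact: leq_trans (size_scale_leq _ _) GD.
rewrite big_ord_recl expr0 mulr1 -/(tay E 0 z) sem_esum.
have -> : \sum_(i < D.+1) (P + dmu E *: G)^`N(lift ord0 i).[z] * (da E * v) ^+ lift ord0 i =
   da E * \sum_(i < D.+1) sem E (eterm i) (x, y).
  rewrite mulr_sumr; apply: eq_bigr => i _.
  rewrite sem_eterm [(x, y).2]/= clamp_id // -/z -/v [lift ord0 i : nat]/= /bump add1n -/(tay E i.+1 z) exprMn [da E ^+ i.+1]exprS; ring.
by ring.
Qed.

Variables (mu1 Z Zu : R) (B : nat -> R).

(** Data of a wave with bounds that depend neither on the amplitude nor on the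
    parameter. *)
Record good E : Prop := Good {
  g_a : 0 < da E <= 1; g_mu : `|dmu E| <= mu1;
  g_psi : cc (dpsi E); g_ups : cc (dups E);
  g_psib : bnd (dpsi E) Z; g_upsb : bnd (dups E) Zu;
  g_dpsi : forall y, y1 < y < y2 -> is_derive y 1 (dpsi E) (dups E y);
  g_dups : forall y, y1 < y < y2 -> is_derive y 1 (dups E) (beta * y + tay E 0 (dpsi E y));
  g_wave : exists (Q : R -> R -> R) (q : nat -> R -> R -> R) bd m s0 s, [/\
    (forall y, Q m y = tay E 1 (dpsi E y)),
    (forall i y, q i m y = da E ^+ i * tay E i.+2 (dpsi E y)) &
    wave y1 y2 kap Q (da E) q D B bd m s0 (dv E) (dw E) s] }.

Lemma sem_cont E e : good E -> continuous (sem E e).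
Proof.
move=> gE; have [Q [q [bd [m [s0 [s [_ _ W]]]]]]] := g_wave gE.
elim: e => [c||||||i|i|e1 h1 e2 h2|e1 h1 e2 h2] p /=; try exact: c_cst.
- apply: (@snd_cont R clamp); exact: clamp_cont.
- by apply: (@snd_cont R (dpsi E \o clamp)); exact: g_psi.
- by apply: (@snd_cont R (dups E \o clamp)); exact: g_ups.
- exact: (wv_cont W i).1.
- exact: (wv_cont W i).2.
- by apply: c_add; [exact: h1|exact: h2].
- by apply: c_mul; [exact: h1|exact: h2].
Qed.

Fixpoint ebd e : R := match e with
| EC c => `|c| | EA => 1 | EMu => mu1 | EY => `|y1| + `|y2|
| EPsi => Z | EUps => Zu | EV i => B i | EW i => B i
| EAdd e1 e2 => ebd e1 + ebd e2 | EMul e1 e2 => ebd e1 * ebd e2 end.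

Lemma clamp_bound y : `|clamp y| <= `|y1| + `|y2|.
Proof.
have /andP[h1 h2] := clampI hy y; rewrite ler_norml.
have h3 := ler_norm y2.
have h4 : - y1 <= `|y1| by rewrite -normrN ler_norm.
have h5 := normr_ge0 y1; have h6 := normr_ge0 y2.
by apply/andP; split; lra.
Qed.

Lemma sem_bound E e p : good E -> `|sem E e p| <= ebd e.
Proof.
move=> gE; have [Q [q [bd [m [s0 [s [_ _ W]]]]]]] := g_wave gE.
have yI := clampI hy p.2.
elim: e => [c||||||i|i|e1 h1 e2 h2|e1 h1 e2 h2] //=.
- by have /andP[a0 a1] := g_a gE; rewrite ger0_norm // ltW.
- exact: g_mu.
- exact: clamp_bound.
- exact: g_psib.
- exact: g_upsb.
- exact: (wv_bound W i p).1.
- exact: (wv_bound W i p).2.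
- by apply: le_trans (ler_normD _ _) _; exact: lerD.
- by rewrite normrM; apply: ler_pM.
Qed.

Lemma sem_per E e x y : good E -> sem E e (x + T, y) = sem E e (x, y).
Proof.
move=> gE; have [Q [q [bd [m [s0 [s [_ _ W]]]]]]] := g_wave gE.
elim: e => [c||||||i|i|e1 h1 e2 h2|e1 h1 e2 h2] //=; rewrite ?h1 ?h2 //.
- by rewrite (wv_per W kT i x y).1.
- by rewrite (wv_per W kT i x y).2.
Qed.

Lemma sem_dx E e x y : good E ->
  is_derive x 1 (fun x => sem E e (x, y)) (sem E (dx e) (x, y)).
Proof.
move=> gE; have [Q [q [bd [m [s0 [s [_ _ W]]]]]]] := g_wave gE.
elim: e => [c||||||i|i|e1 h1 e2 h2|e1 h1 e2 h2] /=; try exact: der_cst.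
- by have [] := wv_dx W i x y.
- by have [] := wv_dx W i x y.
- exact: der_add.
- by apply: der_eq (der_mul h1 h2) _; rewrite /= addrC [_ * sem E e2 _]mulrC addrC; congr (_ + _); exact: mulrC.
Qed.

(** The equation for [w = v_y], differentiated in [x]. *)
Lemma sem_rhs E Q q bd m s0 s i x y : good E -> y1 <= y <= y2 ->
  (forall y, Q m y = tay E 1 (dpsi E y)) ->
  (forall i y, q i m y = da E ^+ i * tay E i.+2 (dpsi E y)) ->
  wave y1 y2 kap Q (da E) q D B bd m s0 (dv E) (dw E) s ->
  sem E (iter i dx erhs) (x, y) = Q m y * dv E i (x, y) - dv E i.+2 (x, y) + s i (x, y).
Proof.
move=> gE yI HQ Hq W; elim: i x => [|i IH] x.
  rewrite (wv_s0 W x yI) -[sem E _ _]/(-1 * dv E 2 (x, y) + sem E (esum D.+1 eterm) (x, y)).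
  have ET n : sem E (eterm n) (x, y) = da E ^+ n * tay E n.+1 (dpsi E y) * dv E 0 (x, y) ^+ n.+1.
    by rewrite sem_eterm [(x, y).2]/= clamp_id.
  rewrite sem_esum; under eq_bigr do rewrite ET.
  rewrite big_ord_recl /= expr0 !mul1r expr1 -HQ.
  rewrite mulN1r addrA [_ + Q m y * _]addrC; congr (_ + _).
  rewrite big_distrr /=; apply: eq_bigr => j _; rewrite Hq /bump /= add1n.
  by rewrite !exprS; ring.
rewrite iterS.
have h1 := sem_dx (iter i dx erhs) x y gE.
have E1 : (fun x => sem E (iter i dx erhs) (x, y)) =
  fun x => Q m y * dv E i (x, y) - dv E i.+2 (x, y) + s i (x, y) by apply/funext => z; exact: IH.
rewrite E1 in h1.
have [d1 _ d3] := wv_dx W i x y; have [d2 _ _] := wv_dx W i.+2 x y.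
exact: der_unique h1 (der_add (der_sub (der_scale (Q m y) d1) d2) d3).
Qed.

Lemma sem_dy E e x y : good E -> y1 < y < y2 ->
  is_derive y 1 (fun y => sem E e (x, y)) (sem E (dy e) (x, y)).
Proof.
move=> gE yI; have [Q [q [bd [m [s0 [s [HQ Hq W]]]]]]] := g_wave gE.
have yI' : y1 <= y <= y2 by case/andP: yI => *; rewrite !ltW.
elim: e => [c||||||i|i|e1 h1 e2 h2|e1 h1 e2 h2]; try exact: der_cst.
- exact: (der_clamp (f := id) yI (der_id y)).
- rewrite /= clamp_id //; exact: (der_clamp (f := dpsi E) yI (g_dpsi gE yI)).
- rewrite -[sem E (dy EUps) _]/(beta * clamp y + sem E (etay 0 EPsi) (x, y)) sem_etay /= clamp_id //.
  exact: (der_clamp (f := dups E) yI (g_dups gE yI)).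
- by have [] := wv_dy W i x yI.
- rewrite [dy _]/= (sem_rhs i x gE yI' HQ Hq W).
  by have [] := wv_dy W i x yI.
- exact: der_add.
- by apply: der_eq (der_mul h1 h2) _; rewrite /= addrC [_ * sem E e2 _]mulrC addrC; congr (_ + _); exact: mulrC.
Qed.

(** Induction on the order of differentiation: derivatives of an expression
    are values of expressions, and values are bounded by [ebd]. *)
Lemma sem_CB N e : exists2 M : R, 0 <= M & forall E, good E -> CB T y1 y2 M N (sem E e).
Proof.
elim: N e => [|N IH] e.
  exists `|ebd e| => // E gE; split=> //; first exact: sem_cont.
    by move=> p; apply: le_trans (sem_bound e p gE) (ler_norm _).
  by move=> x y; exact: sem_per.
have [M1 M10 H1] := IH (dx e); have [M2 M20 H2] := IH (dy e).
exists (`|ebd e| + M1 + M2); first by rewrite !addr_ge0.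
move=> E gE; have b0 := normr_ge0 (ebd e); split.
- exact: sem_cont.
- move=> p; apply: le_trans (sem_bound e p gE) _; apply: le_trans (ler_norm _) _.
  by rewrite -addrA lerDl addr_ge0.
- by move=> x y; exact: sem_per.
exists (sem E (dx e)), (sem E (dy e)); split.
- by move=> x y; exact: sem_dx.
- by move=> x y; exact: sem_dy.
- by apply: CB_le (H1 E gE); rewrite -addrA addrCA lerDl addr_ge0.
- by apply: CB_le (H2 E gE); rewrite lerDr addr_ge0.
Qed.
End Expressions.

(** * Steady waves near the shear flow *)

Lemma eq_ler (R : realType) (x y : R) : x = y -> x <= y.
Proof. by move=> ->. Qed.

Lemma CB_scale (R : realType) (T y1 y2 c K M : R) N g : `|c| <= K ->
  CB T y1 y2 M N g -> CB T y1 y2 (K * M) N (fun p => c * g p).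
Proof.
move=> cK; elim: N g => [|N IH] g [gc gM gp rest]; split=> //.
- by move=> p; apply: c_mul; [exact: c_cst|exact: gc].
- by move=> p; rewrite normrM ler_pM.
- by move=> x y; rewrite gp.
- by move=> p; apply: c_mul; [exact: c_cst|exact: gc].
- by move=> p; rewrite normrM ler_pM.
- by move=> x y; rewrite gp.
case: rest => gx [gy [a b d e]].
exists (fun p => c * gx p), (fun p => c * gy p); split.
- by move=> x y; exact: der_scale.
- by move=> x y yI; apply: der_scale; exact: b.
- exact: IH.
- exact: IH.
Qed.

Lemma clamp_lip (R : realType) (a b m m' : R) : a <= b ->
  `|clamp a b m - clamp a b m'| <= `|m - m'|.
Proof.
move=> ab; wlog mm : m m' / m' <= m => [H|].
  have [h|/ltW h] := leP m' m; first exact: H.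
  by rewrite distrC [leRHS]distrC; exact: H.
rewrite [leRHS]ger0_norm ?subr_ge0 // /clamp.
have [h3|h3] := leP a (Num.min m b); have [h4|h4] := leP a (Num.min m' b);
  move: h3 h4; have [h1|h1] := leP m b; have [h2|h2] := leP m' b => h3 h4;
  by rewrite ler_norml; apply/andP; split; lra.
Qed.

Lemma sign_change (R : realType) (s s' x x' : R) : s * s' < 0 ->
  `|x - s| < `|s| -> `|x' - s'| < `|s'| -> Num.min x x' <= 0 <= Num.max x x'.
Proof.
move=> ss; rewrite !ltr_norml => /andP[a1 a2] /andP[b1 b2].
rewrite ge_min le_max.
have [s0|s0] := leP 0 s.
  rewrite ger0_norm // in a1 a2.
  have s'0 : s' < 0 by rewrite ltNge; apply/negP => h; move: ss; rewrite ltNge mulr_ge0.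
  rewrite ltr0_norm // in b1 b2.
  by apply/andP; split; apply/orP; [right|left]; lra.
rewrite ltr0_norm // in a1 a2.
have s'0 : 0 < s' by rewrite nmulr_rlt0 in ss.
rewrite gtr0_norm // in b1 b2.
by apply/andP; split; apply/orP; [left|right]; lra.
Qed.

Lemma small_amplitude (R : realType) (a1 bb e1 e2 e3 : R) : 0 < a1 -> 0 < bb ->
  0 < e1 -> 0 < e2 -> 0 < e3 -> exists a : R, [/\ 0 < a, a <= a1, a <= 1,
    a * bb < e1 /\ a * bb < 1 & a * bb < e2 /\ a * bb < e3].
Proof.
move=> a10 bb0 e10 e20 e30; pose w := Num.min (Num.min e1 1) (Num.min e2 e3).
have w0 : 0 < w by rewrite !lt_min e10 ltr01 e20 e30.
pose t := Num.min (Num.min a1 1) (w / (2 * bb)).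
have t0 : 0 < t by rewrite !lt_min a10 ltr01 divr_gt0 // mulr_gt0.
have tb : t * bb < w.
  have : t <= w / (2 * bb) by rewrite ge_min lexx orbT.
  rewrite ler_pdivlMr ?mulr_gt0 //.
  have : 0 < t * bb by rewrite mulr_gt0.
  by rewrite [t * (2 * bb)]mulrCA; lra.
move: tb; rewrite !lt_min => /andP[/andP[b1 b2] /andP[b3 b4]].
by exists t; split=> //; rewrite !ge_min lexx ?orbT.
Qed.

Section Adm.
Context {R : realType} (y1 y2 : R).
Local Notation adm := (adm y1 y2).

Lemma adm_add b b' c c' : adm b c -> adm b' c' ->
  adm (b + b') (fun m y => c m y + c' m y).
Proof.
move=> [b0 cc1 cb [L L0 cL]] [b0' cc2 cb' [L' L0' cL']]; split.
- exact: addr_ge0.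
- by move=> m; apply: cc_add.
- by move=> m y yI; apply: le_trans (ler_normD _ _) _; apply: lerD; [exact: cb|exact: cb'].
exists (L + L'); first by rewrite addr_ge0.
move=> m m' y yI; rewrite opprD addrACA mulrDl.
by apply: le_trans (ler_normD _ _) _; apply: lerD; [exact: cL|exact: cL'].
Qed.
End Adm.

(** A steady flow, in the frame of the wave, with stream function [psi]; the
    velocity is [(Y, - X)]. *)
Record steady (R : realType) (T y1 y2 beta eps : R) (N : nat) (U : R -> R) (F : {poly R})
    (psi X Y Xx Xy Yy : R * R -> R) : Prop := Steady {
  st_cont : [/\ continuous psi, continuous Xx, continuous Xy & continuous Yy];
  st_per : forall x y : R, psi (x + T, y) = psi (x, y) /\ Y (x + T, y) = Y (x, y);
  st_dx : forall x y : R, [/\ is_derive x 1 (fun x => psi (x, y)) (X (x, y)),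
    is_derive x 1 (fun x => X (x, y)) (Xx (x, y)) &
    is_derive x 1 (fun x => Y (x, y)) (Xy (x, y))];
  st_dy : forall x y : R, y1 < y < y2 -> [/\ is_derive y 1 (fun y => psi (x, y)) (Y (x, y)),
    is_derive y 1 (fun y => X (x, y)) (Xy (x, y)) &
    is_derive y 1 (fun y => Y (x, y)) (Yy (x, y))];
  st_eq : forall x y : R, y1 <= y <= y2 -> Xx (x, y) + Yy (x, y) = beta * y + F.[psi (x, y)];
  st_bd : forall x : R, X (x, y1) = 0 /\ X (x, y2) = 0;
  st_X : CB T y1 y2 eps N X;
  st_Y : CB T y1 y2 eps N (fun p => Y p - U (clamp y1 y2 p.2)) }.

Section Waves.
Context {R : realType} (y1 y2 beta : R) (U : nat -> R -> R).
Hypotheses (hy : y1 < y2) (Ud : forall i (y : R), is_derive y 1 (U i) (U i.+1 y)).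
Hypothesis U0 : forall y, y1 <= y <= y2 -> U 0%N y != 0.
Local Notation clamp := (clamp y1 y2).
Local Notation lC := (lC y1 y2).
Local Notation len := (y2 - y1).
Local Notation psi0 := (psi0 y1 U).
Local Notation fF := (fF beta U).
Local Notation adm := (adm y1 y2).
Local Notation cc f := (continuous (f \o clamp)).
Local Notation bnd f M := (forall y : R, y1 <= y <= y2 -> `|f y| <= M).
Implicit Types (m x y a : R) (H : {poly R}).

Variables (T kap : R) (nk : nat) (phi phi1 : R -> R).
Hypotheses (kap0 : 0 < kap) (kT : kap * T = nk%:R * (pi * 2)).
Hypothesis phiS : shoot y1 y2 (pot kap (fF 1%N) 1) phi phi1.
Hypothesis phi2 : phi y2 = 0.
Hypothesis Hn : forall n s s1, (2 <= n)%N -> shoot y1 y2 (pot kap (fF 1%N) n) s s1 -> s y2 != 0.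

(** The family of [shear_family], with the parameter cut off so that it ranges
    over the whole line. *)
Record shears (eps r : R) N (P G : {poly R}) (c : R -> R) (psi ups : R -> R -> R) (mu1 Z : R) : Prop := Shears {
  sh_mu : 0 < mu1;
  sh_c : adm mu1 (fun m _ => c m);
  sh_psi : forall H, exists K, adm K (fun m y => H.[psi m y]);
  sh_psib : forall m, bnd (psi m) Z;
  sh_cc : forall m, cc (psi m) /\ cc (ups m);
  sh_d : forall m y, y1 <= y <= y2 -> is_derive y 1 (psi m) (ups m y) /\
    is_derive y 1 (ups m) (beta * y + (P + c m *: G).[psi m y]);
  sh_CB : forall m, CB T y1 y2 eps N (fun p => ups m (clamp p.2) - U 0 (clamp p.2));
  sh_Q : forall m, bnd (fun y => (P + c m *: G)^`().[psi m y] - fF 1%N y) r;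
  sh_s : exists m1 m2, [/\ m1 <= m2 & forall s s1 s' s1',
    shoot y1 y2 (pot kap (fun y => (P + c m1 *: G)^`().[psi m1 y]) 1) s s1 ->
    shoot y1 y2 (pot kap (fun y => (P + c m2 *: G)^`().[psi m2 y]) 1) s' s1' ->
    s y2 * s' y2 < 0] }.

Lemma shears_ex (eps r : R) N : 0 < eps -> 0 < r ->
  exists P G c psi ups mu1 Z, shears eps r N P G c psi ups mu1 Z.
Proof.
move=> eps0 r0; have e0 : 0 < Num.min eps r by rewrite lt_min eps0.
have [P [G [mu1 [Lc [Z [W [W1 [mu0 Lc0 HW HL Hs]]]]]]]] :=
  shear_family hy Ud U0 phiS phi2 T N e0.
have mm : - mu1 < mu1 by rewrite gtrN.
pose c m := Num.max (- mu1) (Num.min m mu1).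
have cE m : - mu1 <= m <= mu1 -> c m = m := @clamp_id R (- mu1) mu1 m.
have cI m : `|c m| <= mu1 by rewrite ler_norml; exact: (clampI mm).
have cL m m' : `|c m - c m'| <= `|m - m'| by apply: (@clamp_lip R (- mu1) mu1); exact: ltW.
exists P, G, c, (fun m y => psi0 y + W (c m) y), (fun m y => U 0%N y + W1 (c m) y), mu1, Z.
have Wc m : continuous (W (c m)) /\ continuous (W1 (c m)).
  by have [[_ _ s] _ _ _] := HW _ (cI m); exact: sec_cont s.
have pc m : cc (fun y => psi0 y + W (c m) y).
  by apply: cc_add; apply: cc_cont; [move=> y; exact: psi0_cont|exact: (Wc m).1].
have Zb m : bnd (fun y => psi0 y + W (c m) y) (`|Z| + 1).
  move=> y yI; have [_ h _ _] := HW _ (cI m); apply: le_trans (h y yI) _.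
  by apply: le_trans (ler_norm _) _; rewrite lerDl.
have Zp : 0 < `|Z| + 1 by rewrite ltr_wpDl.
split=> //.
- split=> //; first exact: ltW; first by move=> m; exact: cc_cst.
  by exists 1 => // m m' y _; rewrite mul1r.
- move=> H; have [K K0 HK] := poly_bound H 1 Zp; exists K; split=> //.
  + by move=> m y; apply: (@c_comp R R (fun z => H.[z])); [exact: horner_cont|exact: pc].
  + by move=> m y yI; have := HK 0%N _ isT (Zb m y yI); rewrite derivn0.
  exists (K * Lc); first exact: mulr_ge0.
  move=> m m' y yI.
  have h1 z : `|z| <= `|Z| + 1 -> `|H^`().[z]| <= K by move=> h; rewrite -derivn1; exact: HK.
  apply: le_trans (horner_lip h1 (Zb m' y yI) (Zb m y yI)) _.
  rewrite -mulrA ler_wpM2l // opprD addrACA subrr add0r.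
  apply: le_trans (HL _ _ (cI m) (cI m') y yI).1 _.
  by rewrite ler_wpM2l.
- by move=> m; have [] := HW _ (cI m).
- move=> m; split=> //; apply: cc_add; apply: cc_cont; last exact: (Wc m).2.
  by move=> y; exact: U_cont.
- move=> m y yI; have [[_ _ [d d1]] _ _ _] := HW _ (cI m); split.
    by apply: der_add => //; exact: psi0_der.
  apply: der_eq (der_add (Ud 0 y) (d1 y)) _; rewrite clamp_id //.
  by rewrite /fF /=; ring.
- move=> m; have [_ _ h _] := HW _ (cI m).
  rewrite (_ : (fun p => _) = fun p : R * R => W1 (c m) (clamp p.2)); last first.
    by apply/funext => p; ring.
  by apply: CB_le h; rewrite ge_min lexx.
- move=> m y yI; have [_ _ _ h] := HW _ (cI m).
  by apply: le_trans (h y yI) _; rewrite ge_min lexx orbT.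
- exists (- mu1), mu1; split; first exact: ltW.
  move=> s s1 s' s1' h h'; rewrite mulrC; apply: (Hs s' s1' s s1).
    by move: h'; rewrite cE // lexx ltW.
  by move: h; rewrite cE // lexx ltW.
Qed.

(** Over the shear flow with parameter m there is a wave of amplitude a which
    satisfies all conditions except that the amplitude bd(m) of its first mode
    at y2 need not vanish. For a small, bd is close to the shooting value
    s_m(y2), which changes sign: the intermediate value theorem provides m. *)
Theorem steady_waves (eps : R) N : 0 < eps -> exists F psi X Y Xx Xy Yy,
  steady T y1 y2 beta eps N (U 0%N) F psi X Y Xx Xy Yy /\
  exists x y, y1 < y < y2 /\ X (x, y) != 0.
Proof.
move=> eps0.
have fc : cc (fF 1%N) by move=> y; apply: fF_cc.
have [kq kq0 kqb] := bounded_cc hy fc.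
have [r [M [/andP[r0 r1] M0 Hok]]] := modeok_all hy fc kap0 kq0 kqb Hn.
have e20 : 0 < eps / 2 by rewrite divr_gt0.
have [P [G [c [psi [ups [mu1 [Z SH]]]]]]] := shears_ex N e20 r0.
pose tc i m y := (P + c m *: G)^`N(i).[psi m y].
have admT i : exists K, adm K (tc i).
  have [K1 h1] := sh_psi SH P^`N(i); have [K2 h2] := sh_psi SH G^`N(i).
  exists (K1 + mu1 * K2); rewrite (_ : tc i = fun m y => P^`N(i).[psi m y] + c m * G^`N(i).[psi m y]).
    by apply: adm_add h1 _; exact: adm_mul (sh_c SH) h2.
  by apply/funext => m; apply/funext => y; rewrite /tc nderivnD nderivnZ hornerD hornerZ.
have [KT HT] := choice admT.
have KT0 i : 0 <= KT i by case: (HT i).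
pose k := KT 1%N + kq; have k0 : 0 <= k by rewrite addr_ge0.
have QA : adm (k + 1) (tc 1%N) by apply: adm_le (HT 1%N); rewrite /k; lra.
have QE m : tc 1%N m = fun y => (P + c m *: G)^`().[psi m y].
  by apply/funext => y; rewrite /tc nderivn1.
have Qr m : bnd (fun y => tc 1%N m y - fF 1%N y) r.
  by rewrite QE; have := sh_Q SH m.
have [_ Qc Qb [LQ LQ0 QL]] := QA.
(* the shooting solutions s_m, which form the leading term of the wave *)
have ex m : exists ss : (R -> R) * (R -> R), shoot y1 y2 (pot kap (tc 1%N m) 1) ss.1 ss.2.
  by have [s [s1 h]] := shoot_ex hy (@pot_cc _ y1 y2 kap _ 1 (Qc m)); exists (s, s1).
have [ss Hss] := choice ex.
pose s m := (ss m).1; pose s1 m := (ss m).2.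
pose kk := k + 1 + (1%:R * kap) ^+ 2.
have kk0 : 0 <= kk by rewrite /kk addr_ge0 ?sqr_ge0 // addr_ge0.
have pb m : bnd (pot kap (tc 1%N m) 1) kk.
  move=> y yI; apply: le_trans (ler_normD _ _) _.
  by rewrite (ger0_norm (sqr_ge0 _)) lerD2r; exact: Qb.
have L0 := lC_ge0 hy kk0.
have z0 : bnd (fun _ : R => 0 : R) 0 by move=> *; rewrite normr0.
have sb m : bnd (s m) (lC kk).
  move=> y yI; have [sS s0 s10] := Hss m.
  have [+ _] := lin_est hy kk0 (lexx 0) (pb m) z0 sS yI.
  by rewrite s0 s10 normr0 normr1 add0r addr0 mulr1.
have sA : adm (lC kk) s.
  split=> //.
    by move=> m; have [sS _ _] := Hss m; apply: cc_cont; exact: (sec_cont sS).1.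
  exists (lC kk ^+ 2 * LQ); first by rewrite mulr_ge0 ?sqr_ge0.
  move=> m m' y yI; rewrite -mulrA.
  apply: (shoot_diff hy (@pot_cc _ y1 y2 kap _ 1 (Qc m)) kk0 _ (Hss m) (Hss m') (pb m) (pb m')) => //.
    exact: mulr_ge0.
  by move=> z zI; rewrite /pot opprD addrACA subrr addr0; exact: QL.
pose v0 := Mode 1 (lC kk) s s1 (fun _ _ => 0).
have ok0 : okM y1 y2 kap (tc 1%N) k v0.
  split=> //=.
  - by apply: adm_le (adm_cst y1 y2 0); rewrite normr0.
  - move=> m; have [sS _ _] := Hss m.
    apply: (mode_c1 hy kap0 k0 QA L0 (sb m) _ sS) => y yI; by rewrite normr0.
  - by move=> m; have [] := Hss m.
  - by move=> m; have [] := Hss m.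
pose D := maxn (size P) (size G).
have PD : (size P <= D.+2)%N by rewrite /D 2?leqW // leq_maxl.
have GD : (size G <= D.+2)%N by rewrite /D 2?leqW // leq_maxr.
pose K := \sum_(i < D) KT i.+2.
have K0 : 0 <= K by apply: sumr_ge0.
have KD i : (i < D)%N -> KT i.+2 <= K.
  by move=> iD; rewrite /K (bigD1 (Ordinal iD)) //= lerDl; apply: sumr_ge0.
have [a1 [B [a10 HW]]] := nonlinear_waves hy kap0 M0 k0 QA Qr Hok D ok0 erefl erefl K0.
(* M1, M2 and B are fixed before the amplitude a *)
have [Um Um0 HUm] := bounded_cc hy (@cc_cont _ y1 y2 _ (@U_cont _ _ Ud 0%N)).
pose Zu := Um + eps / 2.
pose good := good y1 y2 beta kap P G D mu1 Z Zu B.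
have [M1 M10 HM1] := @sem_CB _ y1 y2 beta kap T nk hy kT P G D mu1 Z Zu B N (EV 1).
have [M2 M20 HM2] := @sem_CB _ y1 y2 beta kap T nk hy kT P G D mu1 Z Zu B N (EW 0).
have [m1 [m2 [m12 Hsg]]] := sh_s SH.
have sg : s m1 y2 * s m2 y2 < 0.
  by apply: (Hsg _ (s1 m1) _ (s1 m2)); [have := Hss m1|have := Hss m2]; rewrite QE.
have sp1 : 0 < `|s m1 y2|.
  by rewrite normr_gt0; apply/eqP => h; move: sg; rewrite h mul0r ltxx.
have sp2 : 0 < `|s m2 y2|.
  by rewrite normr_gt0; apply/eqP => h; move: sg; rewrite h mulr0 ltxx.
pose c1 := 2 / len + kk * len.
have l0 : 0 < len by rewrite subr_gt0.
have c10 : 0 <= c1 := addr_ge0 (divr_ge0 (ler0n _ 2) (ltW l0)) (mulr_ge0 kk0 (ltW l0)).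
pose bb : R := `|B 0%N| + `|B 1%N| / kap * c1 + M1 + M2 + 1.
have bp : 0 <= `|B 1%N| / kap * c1 by rewrite !mulr_ge0 // invr_ge0 ltW.
have bb0 : 0 < bb by rewrite /bb ltr_wpDl // !addr_ge0.
have [M1b M2b bpb] : [/\ M1 <= bb, M2 <= bb & `|B 1%N| / kap * c1 <= bb].
  move: bp (normr_ge0 (B 0%N)); rewrite /bb; clear -M10 M20 hy Ud U0 kap0 kT phiS phi2 Hn.
  by move: (_ * c1) `|B 0%N| => u w hu hw; split; lra.
have [a [a0 aa1 a1' [ae as2] as1]] := small_amplitude a10 bb0 e20 sp1 sp2.
pose q i m y := a ^+ i * tc i.+2 m y.
have qK i : (i < D)%N -> adm K (q i).
  move=> iD; have h := adm_mul (adm_cst y1 y2 (a ^+ i)) (HT i.+2).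
  apply: adm_le h; apply: le_trans (KD i iD); rewrite ler_piMl //.
  by rewrite normrX gtr0_norm // exprn_ile1 // ltW.
have [bd [bdc bdB Hw]] := HW a q (introT andP (conj a0 aa1)) qK.
have B0a : B 0%N * a <= a * bb.
  rewrite mulrC ler_wpM2l ?(ltW a0) // /bb; apply: le_trans (ler_norm _) _.
  by rewrite -!addrA lerDl !addr_ge0.
have [m [_ bm]] : exists m, m1 <= m <= m2 /\ bd m = 0.
  have h1 : `|bd m1 - s m1 y2| < `|s m1 y2|.
    by apply: le_lt_trans (bdB m1) _; apply: le_lt_trans B0a _; case: as1.
  have h2 : `|bd m2 - s m2 y2| < `|s m2 y2|.
    by apply: le_lt_trans (bdB m2) _; apply: le_lt_trans B0a _; case: as1.
  have h3 := sign_change sg h1 h2.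
  have [m + bm] := IVT m12 (continuous_subspaceT bdc) h3.
  by rewrite in_itv /= => mI; exists m.
have [v [w [ff WV]]] := Hw m; rewrite bm in WV.
pose E := Data a (c m) (psi m) (ups m) v w.
have upsb : bnd (ups m) Zu.
  move=> y yI; have := sh_CB SH m; case: N {HM1 HM2 SH} => [|n] => -[_ + _ _] => /(_ (0, y)) /=;
  rewrite clamp_id // => h; rewrite -(subrK (U 0%N y) (ups m y)); apply: le_trans (ler_normD _ _) _;
  by rewrite /Zu addrC; apply: lerD => //; exact: HUm.
have gE : good E.
  split=> //=.
  - by rewrite a0.
  - by have [_ _ h _] := sh_c SH; exact: (h m y1 (introT andP (conj (lexx _) (ltW hy)))).
  - exact: (sh_cc SH m).1.
  - exact: (sh_cc SH m).2.
  - exact: sh_psib SH m.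
  - by move=> y /andP[h1 h2]; apply: (sh_d SH m _).1; rewrite !ltW.
  - move=> y /andP[h1 h2]; rewrite /tay nderivn0; apply: (sh_d SH m _).2; by rewrite !ltW.
  - by exists (tc 1%N), q, 0, m, (s m), ff; split.
pose ePsi : @expr R := EAdd EPsi (EMul EA (EV 0)).
pose eX : @expr R := EMul EA (EV 1).
pose eY : @expr R := EAdd EUps (EMul EA (EW 0)).
pose eXx : @expr R := EMul EA (EV 2).
pose eXy : @expr R := EMul EA (EW 1).
pose eYy := dy beta P G D eY.
pose se e := sem y1 y2 E e.
exists (P + c m *: G), (se ePsi), (se eX), (se eY), (se eXx), (se eXy), (se eYy); split.
  have sc e : continuous (se e) := @sem_cont _ y1 y2 beta kap P G D mu1 Z Zu B E e gE.
  have sx e x y := sem_dx e x y gE.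
  have sy e x y (yI : y1 < y < y2) := sem_dy e x gE yI.
  have sp e x y : se e (x + T, y) = se e (x, y) := sem_per kT e x y gE.
  split.
  - by split.
  - by [].
  - move=> x y; split.
    + by apply: der_eq (sx ePsi x y) _; rewrite /se /=; ring.
    + by apply: der_eq (sx eX x y) _; rewrite /se /=; ring.
    + by apply: der_eq (sx eY x y) _; rewrite /se /=; ring.
  - move=> x y yI; split.
    + by apply: der_eq (sy ePsi x y yI) _; rewrite /se /=; ring.
    + by apply: der_eq (sy eX x y yI) _; rewrite /se /=; ring.
    + exact: sy.
  - by move=> x y yI; exact: (sem_taylor beta PD GD E x yI).
  - move=> x; rewrite /se /= (wv_y1 WV) (wv_y2 WV) !mulr0; by split.
  - apply: CB_le (CB_scale (eq_ler (ger0_norm (ltW a0))) (HM1 E gE)); apply: ltW.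
    apply: le_lt_trans (ler_wpM2l (ltW a0) M1b) _; apply: lt_trans ae _.
    by rewrite ltr_pdivrMr // ltr_pMr // ltr1n.
  - have := CB_add (sh_CB SH m) (CB_scale (eq_ler (ger0_norm (ltW a0))) (HM2 E gE)).
    rewrite (_ : (fun p => _) = (fun p => se eY p - U 0 (clamp p.2))); last first.
      by apply/funext => p; rewrite /se /=; ring.
    apply: CB_le; rewrite [leRHS]splitr lerD2l; apply: ltW; apply: le_lt_trans ae.
    exact: ler_wpM2l (ltW a0) M2 bb M2b.
(* If X vanished, its leading term at x = pi / (2 kap) would give s_m = O(a),
   contrary to s_m'(y1) = 1. *)
apply: contrapT => Hnz.
have X0 y : y1 < y < y2 -> v 1%N (pi / (2 * kap), y) = 0.
  move=> yI; apply: contrapT => /eqP h; apply: Hnz; exists (pi / (2 * kap)), y; split=> //.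
  by rewrite /se /= mulf_neq0 // gt_eqF.
have osc1 : osc kap 1 1 (pi / (2 * kap)) = - kap.
  rewrite /osc /cosd expr1 !mul1r (_ : _ + _ = pi); first by rewrite cospi mulrN1.
  by field; rewrite gt_eqF.
have sm y : y1 < y < y2 -> `|s m y| <= `|B 1%N| / kap * a.
  move=> yI; have := wv_lin WV 1 (pi / (2 * kap)) (y := y).
  rewrite X0 // osc1 sub0r mulrN opprK normrM (gtr0_norm kap0) => h.
  have {}h : `|s m y| * kap <= B 1%N * a by apply: h; case/andP: yI => *; rewrite !ltW.
  rewrite mulrAC ler_pdivlMr //; apply: le_trans h _.
  by rewrite ler_wpM2r ?(ltW a0) // ler_norm.
have [sS s0 s10] := Hss m.
have A0 : 0 <= `|B 1%N| / kap * a := mulr_ge0 (divr_ge0 (normr_ge0 _) (ltW kap0)) (ltW a0).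
have sm' : bnd (s m) (`|B 1%N| / kap * a).
  move=> y /andP[h1 h2]; have [<-|n1] := eqVneq y1 y; first by rewrite (s0 : s m y1 = 0) normr0.
  have [E2|n2] := eqVneq y y2.
    rewrite E2; have KK : `|s m z| @[z --> y2^'-] --> `|s m y2|.
      apply: cvg_norm; apply: cvg_at_left_filter.
      exact: ((sec_cont sS).1 y2).
    apply: (cvgr_to_le KK).
    near=> z; apply: sm; apply/andP; split.
      by near: z; apply: nbhs_left_gt.
    by near: z; exact: nbhs_left_lt.
  by apply: sm; rewrite !lt_neqAle n1 n2 h1.
have hb : bnd (fun y => pot kap (tc 1%N m) 1 y * s m y + 0) (kk * (`|B 1%N| / kap * a)).
  by move=> y yI; rewrite addr0 normrM; apply: ler_pM => //; [exact: pb|exact: sm'].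
have := deriv_bound hy sS sm' hb (introT andP (conj (lexx y1) (ltW hy))).
rewrite s10 normr1 leNgt => /negP; apply.
have -> : 2 * (`|B 1%N| / kap * a) / len + kk * (`|B 1%N| / kap * a) * len = a * (`|B 1%N| / kap * c1).
  by rewrite /c1; ring.
apply: le_lt_trans as2; exact: ler_wpM2l (ltW a0) _ _ bpb.
Unshelve. all: end_near.
Qed.
End Waves.

(** * Travelling wave solutions of the beta-plane Euler equation *)

Section Cont2.
Context {R : realType} {X : topologicalType}.
Implicit Types h k : X -> R.
Lemma cont_mul h k : continuous h -> continuous k -> continuous (fun p => h p * k p).
Proof. by move=> hc kc p; apply: c_mul; [exact: hc|exact: kc]. Qed.
Lemma cont_add h k : continuous h -> continuous k -> continuous (fun p => h p + k p).
Proof. by move=> hc kc p; apply: c_add; [exact: hc|exact: kc]. Qed.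
Lemma cont_sub h k : continuous h -> continuous k -> continuous (fun p => h p - k p).
Proof. by move=> hc kc p; apply: c_sub; [exact: hc|exact: kc]. Qed.
End Cont2.

Lemma dir_line (R : realType) (V : normedModType R) (f : V -> R) (p v : V) (d : R) :
  is_derive (0 : R) (1 : R) (fun h : R => f (h *: v + p)) d -> is_derive p v f d.
Proof.
move=> [df dE].
have E : (fun h : R => h^-1 *: (((fun h : R => f (h *: v + p)) \o shift 0) (h *: (1 : R)) - f (0 *: v + p))) =
  (fun h : R => h^-1 *: ((f \o shift p) (h *: v) - f p)).
  by apply/funext => h; rewrite /= addr0 scale0r add0r; congr (_ *: (f (_ *: v + p) - _)); rewrite /GRing.scale /= mulr1.
split; first by move: df; rewrite /derivable E.
by move: dE; rewrite /derive E.
Qed.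

(** Only one of the partial derivatives has to be continuous: the increment in
    y is taken at x, the increment in x by the mean value theorem. *)
Lemma dir2 (R : realType) (g gx : R * R -> R) (x y a b gy r0 : R) : 0 < r0 ->
  continuous gx ->
  (forall x' y' : R, `|y' - y| < r0 -> is_derive x' 1 (fun x => g (x, y')) (gx (x', y'))) ->
  is_derive y 1 (fun y => g (x, y)) gy ->
  is_derive (0 : R) 1 (fun h : R => g (x + h * a, y + h * b)) (a * gx (x, y) + b * gy).
Proof.
move=> r00 gxc dx dy; apply: is_derive_eps => e e0.
have e1 : 0 < e / (2 * (`|a| + 1)) by rewrite divr_gt0 // mulr_gt0 // ltr_wpDl.
have e2 : 0 < e / 2 by rewrite divr_gt0.
have dyb : is_derive (0 : R) 1 (fun h => g (x, y + h * b)) (b * gy).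
  have h1 : is_derive (0 : R) 1 (fun h => y + h * b) b.
    by apply: der_eq (der_add (der_cst y 0) (der_mul (der_id 0) (der_cst b 0))) _; rewrite /=; ring.
  have h2 : is_derive (y + 0 * b) 1 (fun y => g (x, y)) gy by rewrite mul0r addr0.
  exact: (@der_comp R (fun y => g (x, y)) (fun h => y + h * b) 0 gy b h2 h1).
have [r1 r10 H1] := eps_is_derive dyb e2.
have [r2 r20 H2] : exists2 r2 : R, 0 < r2 & forall x' y' : R, `|x' - x| < r2 -> `|y' - y| < r2 ->
    `|gx (x', y') - gx (x, y)| < e / (2 * (`|a| + 1)).
  have /cvgrPdist_lt/(_ _ e1) [[A B] /= [/nbhs_ballP[ra ra0 Ha] /nbhs_ballP[rb rb0 Hb]] H] := gxc (x, y).
  exists (Num.min ra rb); first by rewrite lt_min ra0.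
  move=> x' y'; rewrite !lt_min => /andP[h1 _] /andP[_ h2]; rewrite distrC.
  by apply: (H (x', y')); split=> /=; [apply: Ha|apply: Hb]; rewrite /ball /= distrC.
pose r := Num.min r1 (Num.min (r2 / (`|a| + `|b| + 1)) (r0 / (`|b| + 1))).
have ab : 0 < `|a| + `|b| + 1 by rewrite ltr_wpDl // addr_ge0.
have b1 : 0 < `|b| + 1 by rewrite ltr_wpDl.
exists r; first by rewrite !lt_min r10 !divr_gt0.
move=> h; rewrite !lt_min => /and3P[hr1 hr2 hr0].
rewrite ltr_pdivlMr // in hr2; rewrite ltr_pdivlMr // in hr0.
have ha : `|h * a| < r2.
  apply: le_lt_trans hr2; rewrite normrM ler_wpM2l //.
  by rewrite -addrA lerDl addr_ge0.
have hb : `|h * b| < r2.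
  apply: le_lt_trans hr2; rewrite normrM ler_wpM2l //.
  by rewrite addrAC lerDr addr_ge0.
have hb0 : `|h * b| < r0.
  by apply: le_lt_trans hr0; rewrite normrM ler_wpM2l // lerDl.
rewrite add0r mul0r mul0r !addr0.
have A : `|(g (x + h * a, y + h * b) - gx (x, y) * (x + h * a)) - (g (x, y + h * b) - gx (x, y) * x)|
    <= e / (2 * (`|a| + 1)) * `|x + h * a - x|.
  apply: (@mvt_abs R (fun z => g (z, y + h * b) - gx (x, y) * z) (fun z => gx (z, y + h * b) - gx (x, y))).
  - exact: ltW.
  - move=> z _; apply: der_sub.
      by apply: dx; rewrite addrC addKr.
    by apply: der_eq (der_scale _ (der_id z)) _; rewrite mulr1.
  - move=> z zI; apply: ltW; apply: H2; last by rewrite addrC addKr.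
    apply: le_lt_trans ha; move: zI; rewrite ge_min le_max => /andP[/orP z1 /orP z2].
    rewrite ler_norml; have := ler_norm (h * a); have : - (h * a) <= `|h * a| by rewrite -normrN ler_norm.
    have := normr_ge0 (h * a).
    move=> n0 n1 n2; clear - z1 z2 n0 n1 n2.
    by apply/andP; split; case: z1; case: z2; lra.
have B := H1 h hr1; rewrite add0r mul0r addr0 in B.
have -> : g (x + h * a, y + h * b) - g (x, y) - h * (a * gx (x, y) + b * gy) =
  ((g (x + h * a, y + h * b) - gx (x, y) * (x + h * a)) - (g (x, y + h * b) - gx (x, y) * x)) +
  (g (x, y + h * b) - g (x, y) - h * (b * gy)) by ring.
apply: le_trans (ler_normD _ _) _; apply: le_trans (lerD A B) _.
have -> : x + h * a - x = h * a by ring.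
rewrite normrM [leRHS](_ : _ = e / 2 * `|h| + e / 2 * `|h|); last by field.
rewrite lerD2r.
have -> : e / (2 * (`|a| + 1)) * (`|h| * `|a|) = e / 2 * `|h| * (`|a| / (`|a| + 1)).
  by field; rewrite gt_eqF // ltr_wpDl.
rewrite -[leRHS]mulr1; apply: ler_wpM2l; first exact: mulr_ge0 (ltW e2) (normr_ge0 _).
by rewrite ler_pdivrMr ?ltr_wpDl // mul1r lerDl.
Qed.

Section Travel.
Context {R : realType} (y1 y2 c : R).
Implicit Types (g gx gy : R * R -> R).
Local Notation U := [set p : R * R * R | y1 < p.2 < y2].
Local Notation S := [set p : R * R * R | y1 <= p.2 <= y2].

Definition frame (p : R * R * R) : R * R := (p.1.2 - c * p.1.1, p.2).

Lemma frame_cont : continuous frame.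
Proof.
move=> p; have h1 : continuous_at p (fun q : R * R * R => q.1.2).
  by apply: (@continuous_comp _ _ _ fst snd); [exact: cvg_fst|exact: cvg_snd].
have h2 : continuous_at p (fun q : R * R * R => q.1.1).
  by apply: (@continuous_comp _ _ _ fst fst); [exact: cvg_fst|exact: cvg_fst].
have h3 : continuous_at p (fun q : R * R * R => q.1.2 - c * q.1.1).
  by apply: c_sub h1 _; apply: c_mul h2; exact: c_cst.
exact: (cvg_pair h3 (@cvg_snd _ _ _ _ _)).
Qed.

Lemma U_open (p : R * R * R) : U p -> \forall q \near p, U q.
Proof.
move=> /andP[h1 h2].
have sc : (fun q : R * R * R => q.2) @ p --> p.2 by exact: cvg_snd.
near=> q; apply/andP; split.
  by near: q; apply: (sc [set z | y1 < z]); exact: lt_nbhsr.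
by near: q; apply: (sc [set z | z < y2]); exact: lt_nbhsl.
Unshelve. all: end_near.
Qed.

Section Class.
Variables g gx gy : R * R -> R.
Hypotheses (gc : continuous g) (gxc : continuous gx) (gyc : continuous gy).
Hypothesis dx : forall x y : R, is_derive x 1 (fun x => g (x, y)) (gx (x, y)).
Hypothesis dy : forall x y : R, y1 < y < y2 -> is_derive y 1 (fun y => g (x, y)) (gy (x, y)).

Definition tder (v p : R * R * R) := (v.1.2 - c * v.1.1) * gx (frame p) + v.2 * gy (frame p).

Lemma travel_der p v : U p -> is_derive p v (g \o frame) (tder v p).
Proof.
move=> Up; apply: dir_line.
have := @dir2 R g gx (frame p).1 (frame p).2 (v.1.2 - c * v.1.1) v.2 (gy (frame p)) 1 ltr01 gxc
  (fun x y _ => dx x y) (dy _ Up).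
rewrite -surjective_pairing.
rewrite (_ : (fun h : R => g _) = (fun h : R => (g \o frame) (h *: v + p))) //.
apply/funext => h; rewrite /frame /=; congr g; congr pair; rewrite /GRing.scale /=; ring.
Qed.

Lemma travel_Cn : Cn U 1 (g \o frame).
Proof.
have fc : continuous (g \o frame).
  by move=> p; apply: continuous_comp; [exact: frame_cont|exact: gc].
split; first by move=> p _; exact: fc.
move=> v; split; first by move=> p Up; have [] := travel_der v Up.
split=> // p /set_mem Up.
have E q : U q -> 'D_v (g \o frame) q = tder v q by move=> Uq; have [_ ->] := travel_der v Uq.
rewrite /continuous_at E //.
have tc : continuous_at p (tder v).
  apply: c_add; (apply: c_mul; first exact: c_cst).
    by apply: continuous_comp; [exact: frame_cont|exact: gxc].
  by apply: continuous_comp; [exact: frame_cont|exact: gyc].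
apply: cvg_trans tc; apply: near_eq_cvg; near=> q; rewrite E //.
by near: q; exact: U_open.
Unshelve. all: end_near.
Qed.

Lemma travel_within : {within S, continuous (g \o frame)}.
Proof.
apply: continuous_subspaceT => p.
by apply: continuous_comp; [exact: frame_cont|exact: gc].
Qed.

Lemma travel_D p v : U p -> 'D_v (g \o frame) p = tder v p.
Proof. by move=> Up; have [_ ->] := travel_der v Up. Qed.
End Class.
End Travel.

(** The pressure is f(psi) - (X^2 + Y^2) / 2 - c beta y^2 / 2, where f is an
    antiderivative of F: in the moving frame this is Bernoulli's law, and the
    last term compensates the Coriolis force on the velocity c of the frame. *)
Theorem steady_euler (R : realType) (T y1 y2 beta eps c : R) N U F psi X Y Xx Xy Yy :
  y1 < y2 -> continuous U -> steady T y1 y2 beta eps N U F psi X Y Xx Xy Yy ->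
  beta_plane_euler T y1 y2 beta (fun p => c + Y (p.1.2 - c * p.1.1, p.2))
    (fun p => - X (p.1.2 - c * p.1.1, p.2)).
Proof.
move=> hy Uc ST; have [pc xxc xyc yyc] := st_cont ST.
have Xc : continuous X by have := st_X ST; case: N {ST} => [|N] [].
have Yc : continuous Y.
  have h : continuous (fun p => Y p - U (clamp y1 y2 p.2)) by have := st_Y ST; case: N {ST} => [|N] [].
  move=> p; rewrite (_ : Y = fun p => Y p - U (clamp y1 y2 p.2) + U (clamp y1 y2 p.2)).
    apply: c_add; first exact: h.
    by apply: (@snd_cont R (U \o clamp y1 y2)); exact: comp_clamp_cont.
  by apply/funext => q; rewrite subrK.
pose f := antideriv_poly F.
have [fE _] := antideriv_polyP F.
pose g1 p := c + Y p. pose g2 p := - X p.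
pose P p : R := f.[psi p] - 2^-1 * (X p * X p + Y p * Y p) - c * beta * 2^-1 * (p.2 * p.2).
pose Px p := F.[psi p] * X p - (X p * Xx p + Y p * Xy p).
pose Py p := F.[psi p] * Y p - (X p * Xy p + Y p * Yy p) - c * beta * p.2.
have hpc (H : {poly R}) : continuous (fun p => H.[psi p]).
  by move=> p; apply: (@c_comp R _ (fun z => H.[z])); [exact: horner_cont|exact: pc].
have c2 : continuous (fun p : R * R => p.2) by move=> p; exact: cvg_snd.
have kc (k : R) : continuous (fun _ : R * R => k) by move=> p; exact: c_cst.
have Pc : continuous P.
  by apply: cont_sub; [apply: cont_sub => //; apply: cont_mul => //; apply: cont_add; apply: cont_mul|apply: cont_mul => //; exact: cont_mul].
have Pxc : continuous Px by apply: cont_sub; [exact: cont_mul|apply: cont_add; exact: cont_mul].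
have Pyc : continuous Py.
  by apply: cont_sub; [apply: cont_sub; [exact: cont_mul|apply: cont_add; exact: cont_mul]|exact: cont_mul].
have g1c : continuous g1 by exact: cont_add.
have g2c : continuous g2 by move=> p; apply: c_opp; exact: Xc.
have nxxc : continuous (fun p => - Xx p) by move=> p; apply: c_opp; exact: xxc.
have nxyc : continuous (fun p => - Xy p) by move=> p; apply: c_opp; exact: xyc.
have g1x (x y : R) : is_derive x 1 (fun x => g1 (x, y)) (Xy (x, y)).
  by have [_ _ h] := st_dx ST x y; apply: der_eq (der_add (der_cst c x) h) _; rewrite add0r.
have g1y (x y : R) : y1 < y < y2 -> is_derive y 1 (fun y => g1 (x, y)) (Yy (x, y)).
  move=> yI; have [_ _ h] := st_dy ST x yI.
  by apply: der_eq (der_add (der_cst c y) h) _; rewrite add0r.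
have g2x (x y : R) : is_derive x 1 (fun x => g2 (x, y)) (- Xx (x, y)).
  by have [_ h _] := st_dx ST x y; exact: der_opp.
have g2y (x y : R) : y1 < y < y2 -> is_derive y 1 (fun y => g2 (x, y)) (- Xy (x, y)).
  by move=> yI; have [_ h _] := st_dy ST x yI; exact: der_opp.
have PX (x y : R) : is_derive x 1 (fun x => P (x, y)) (Px (x, y)).
  have [h1 h2 h3] := st_dx ST x y.
  have hf := @der_comp R (fun z => f.[z]) (fun x => psi (x, y)) x _ _ (der_horner f _) h1.
  rewrite /P /=; apply: der_eq (der_sub (der_sub hf (der_scale 2^-1 (der_add (der_mul h2 h2) (der_mul h3 h3)))) (der_cst _ x)) _.
  by rewrite fE /Px /=; field.
have PY (x y : R) : y1 < y < y2 -> is_derive y 1 (fun y => P (x, y)) (Py (x, y)).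
  move=> yI; have [h1 h2 h3] := st_dy ST x yI.
  have hf := @der_comp R (fun z => f.[z]) (fun y => psi (x, y)) y _ _ (der_horner f _) h1.
  rewrite /P /=; apply: der_eq (der_sub (der_sub hf (der_scale 2^-1 (der_add (der_mul h2 h2) (der_mul h3 h3))))
    (der_scale (c * beta * 2^-1) (der_mul (der_id y) (der_id y)))) _.
  by rewrite fE /Py /=; field.
have Xp x y : X (x + T, y) = X (x, y) by have := st_X ST; case: N {ST} => [|N] [].
have E1 v p : y1 < p.2 < y2 -> 'D_v (fun p => c + Y (p.1.2 - c * p.1.1, p.2)) p = tder c Xy Yy v p.
  exact: (@travel_D R y1 y2 c g1 Xy Yy xyc g1x g1y).
have E2 v p : y1 < p.2 < y2 -> 'D_v (fun p => - X (p.1.2 - c * p.1.1, p.2)) p =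
    tder c (fun p => - Xx p) (fun p => - Xy p) v p.
  exact: (@travel_D R y1 y2 c g2 _ _ nxxc g2x g2y).
have E3 v p : y1 < p.2 < y2 -> 'D_v (P \o frame c) p = tder c Px Py v p.
  exact: (@travel_D R y1 y2 c P Px Py Pxc PX PY).
exists (P \o frame c); split.
- split.
  + rewrite -[fun p => c + _]/(g1 \o frame c).
    split; [exact: (@travel_Cn R y1 y2 c g1 Xy Yy g1c xyc yyc g1x g1y)|exact: (@travel_within R y1 y2 c g1 g1c)|].
    by move=> t x y yI; rewrite /= addrAC (st_per ST _ _).2.
  + rewrite -[fun p => - _]/(g2 \o frame c).
    split; [exact: (@travel_Cn R y1 y2 c g2 _ _ g2c nxxc nxyc g2x g2y)|exact: (@travel_within R y1 y2 c g2 g2c)|].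
    by move=> t x y yI; rewrite /g2 /frame /= addrAC; congr (- _); exact: Xp.
  + split; [exact: (@travel_Cn R y1 y2 c P Px Py Pc Pxc Pyc PX PY)|exact: (@travel_within R y1 y2 c P Pc)|].
    move=> t x y yI; have E : frame c (t, x + T, y) = (x - c * t + T, y) by rewrite /frame /= addrAC.
    rewrite /comp E /P Xp; have [-> ->] := st_per ST (x - c * t) y.
    by [].
- move=> p Up; rewrite !E1 // !E3 // /tder /=.
  have yI : y1 <= p.2 <= y2 by case/andP: Up => *; rewrite !ltW.
  have := st_eq ST (frame c p).1 yI; rewrite -[((frame c p).1, p.2)]/(frame c p) /Px.
  move=> /(canRL (addrK _)) ->; ring.
- move=> p Up; rewrite !E2 // !E3 // /tder /=.
  have yI : y1 <= p.2 <= y2 by case/andP: Up => *; rewrite !ltW.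
  have := st_eq ST (frame c p).1 yI; rewrite -[((frame c p).1, p.2)]/(frame c p) /Py -[p.2]/((frame c p).2).
  move=> /(canRL (addrK _)) ->; ring.
- by move=> p Up; rewrite E1 // E2 // /tder /=; ring.
- by move=> t x; have [h1 h2] := st_bd ST (x - c * t); rewrite /= h1 h2 oppr0.
Qed.

(** * Weak derivatives of classically differentiable functions *)

Section Plane.
Context {R : realType}.
Local Notation plane := (measurableTypeR R * measurableTypeR R)%type.

(** The preimage of an open interval is a countable union of boxes with
    rational corners. *)
Lemma cont_measurable2 (h : R * R -> R) : continuous h ->
  measurable_fun [set: plane] (h : plane -> measurableTypeR R).
Proof.
move=> hc; apply: (measurability _ (measurable_realfun.RGenOpens.measurableE R)).
move=> _ [_ [a [b ->] <-]]; rewrite setTI.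
set A := h @^-1` _.
have Ao (p : R * R) : A p -> \forall q \near p, A q.
  by move=> Ap; apply: (hc p); apply: open_nbhs_nbhs; split => //; exact: interval_open.
pose box (q1 q2 q3 q4 : rat) : set plane := `]ratr q1, ratr q2[ `*` `]ratr q3, ratr q4[.
pose bx (q1 q2 q3 q4 : rat) : set plane := if `[< box q1 q2 q3 q4 `<=` A >] then box q1 q2 q3 q4 else set0.
have -> : A = \bigcup_q1 \bigcup_q2 \bigcup_q3 \bigcup_q4 bx q1 q2 q3 q4.
  apply/seteqP; split; last first.
    move=> p [q1 _ [q2 _ [q3 _ [q4 _]]]]; rewrite /bx; case: asboolP => // h' hb; apply: h'; exact: hb.
  move=> [x y] /Ao [[B1 B2] /= [/nbhs_ballP[r1 /= r10 H1] /nbhs_ballP[r2 /= r20 H2]] HA].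
  have E (z r : R) : 0 < r -> exists q q' : rat, [/\ ratr q < z, z < ratr q' &
      forall t : R, ratr q < t < ratr q' -> `|z - t| < r].
    move=> r0; have [q] := @rat_in_itvoo R (z - r) z ltac:(by rewrite ltrBlDr ltrDl).
    rewrite in_itv /= => /andP[q1 q2].
    have [q'] := @rat_in_itvoo R z (z + r) ltac:(by rewrite ltrDl).
    rewrite in_itv /= => /andP[q1' q2'].
    exists q, q'; split=> // t /andP[t1 t2]; rewrite ltr_norml; apply/andP; split; lra.
  have [q1 [q2 [a1 a2 a3]]] := E x r1 r10; have [q3 [q4 [b1 b2 b3]]] := E y r2 r20.
  exists q1 => //; exists q2 => //; exists q3 => //; exists q4 => //.
  rewrite /bx; case: asboolP => [_|]; first by split; rewrite /= in_itv /= ?a1 ?b1.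
  case=> -[x' y'] [/=]; rewrite !in_itv /= => h1 h2; apply: (HA (x', y')); split=> /=.
    by apply: H1; exact: a3.
  by apply: H2; exact: b3.
do 4 (apply: bigcupT_measurable_rat => ?).
rewrite /bx; case: asboolP => // _; apply: measurableX; exact: measurable_itv.
Qed.
End Plane.

Section Cell.
Context {R : realType} (T y1 y2 : R).
Hypotheses (hT : 0 < T) (hy : y1 < y2).
Local Notation plane := (measurableTypeR R * measurableTypeR R)%type.
Local Notation cell := (cell T y1 y2).
Local Notation mu2 := (leb2 R).
Local Notation leb := (@lebesgue_measure R).
Local Notation cc f := (continuous (f : R * R -> R)).

Lemma cell_measurable : measurable (cell : set plane).
Proof. by apply: measurableX; exact: measurable_itv. Qed.

Lemma cell_measure : mu2 cell = (T * (y2 - y1))%:E.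
Proof.
rewrite /leb2 [LHS]product_measure1E; [|exact: measurable_itv|exact: measurable_itv].
transitivity (leb `[0%R, T]%classic * leb `[y1, y2]%classic)%E; first by [].
by rewrite !lebesgue_measure_itv /= !lte_fin hT hy -EFinM subr0.
Qed.

Lemma bounded_integrable (h : R * R -> R) (M : R) : continuous h ->
  (forall p, `|h p| <= M) -> mu2.-integrable cell (fun p => (h p)%:E).
Proof.
move=> hc hM; have M0 : 0 <= M := le_trans (normr_ge0 _) (hM (0, 0)).
have mh : measurable_fun cell (fun p : plane => h p).
  by apply: measurable_funTS; exact: cont_measurable2.
apply: (@measurable_bounded_integrable _ _ R mu2 h cell cell_measurable _ mh _).
  by rewrite [X in (X < _)%E]cell_measure ltry.
by exists M; split=> [|x Mx p _]; [exact: num_real|exact: le_trans (hM p) (ltW Mx)].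
Qed.

Lemma cell_fubini (h : R * R -> R) (M : R) : continuous h -> (forall p, `|h p| <= M) ->
  (\int[mu2]_(p in cell) (h p)%:E =
     \int[leb]_(x in `[0%R, T]) \int[leb]_(y in `[y1, y2]) (h (x, y))%:E)%E /\
  (\int[mu2]_(p in cell) (h p)%:E =
     \int[leb]_(y in `[y1, y2]) \int[leb]_(x in `[0%R, T]) (h (x, y))%:E)%E.
Proof.
move=> hc hM; have hI := bounded_integrable hc hM.
pose H : plane -> \bar R := ((fun p => (h p)%:E) \_ cell).
have HI : mu2.-integrable setT H.
  by apply/(integrable_mkcond _ cell_measurable).
have F1 := integral12_prod_meas1 HI; have F2 := integral21_prod_meas1 HI.
split; rewrite [LHS]integral_mkcond -/H.
  rewrite -[LHS]F1 [RHS]integral_mkcond; apply: eq_integral => x _.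
  rewrite /fubini_F patchE; case: ifPn => [|] xI.
    rewrite [RHS]integral_mkcond; apply: eq_integral => y _; rewrite /H !patchE.
    by rewrite in_setX /= xI.
  rewrite (eq_integral (fun=> 0%E)) ?integral0 // => y _; rewrite /H patchE in_setX /=.
  by rewrite (negPf xI).
rewrite -[LHS]F2 [RHS]integral_mkcond; apply: eq_integral => y _.
rewrite /fubini_G patchE; case: ifPn => [|] yI.
  rewrite [RHS]integral_mkcond; apply: eq_integral => x _; rewrite /H !patchE.
  by rewrite in_setX /= yI andbT.
rewrite (eq_integral (fun=> 0%E)) ?integral0 // => x _; rewrite /H patchE in_setX /=.
by rewrite (negPf yI) andbF.
Qed.

Lemma ftc0 (G g : R -> R) (a b : R) : a < b -> continuous g ->
  (forall x : R, a <= x <= b -> {for x, continuous G}) ->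
  (forall x : R, a < x < b -> is_derive x 1 G (g x)) -> G a = G b ->
  (\int[leb]_(x in `[a, b]) (g x)%:E = 0)%E.
Proof.
move=> ab gc Gc dG Gab.
rewrite (@continuous_FTC2 _ g G a b ab); first by rewrite Gab subee.
- exact: continuous_subspaceT.
- split.
  + by move=> x; rewrite in_itv /= => xI; have [] := dG x xI.
  + by apply: cvg_at_right_filter; apply: Gc; rewrite lexx ltW.
  + by apply: cvg_at_left_filter; apply: Gc; rewrite lexx ltW.
- by move=> x; rewrite in_itv /= => xI; rewrite derive1E; have [_ ->] := dG x xI.
Qed.

Lemma slice_cont (h : R * R -> R) x y : continuous h ->
  continuous (fun x => h (x, y)) /\ continuous (fun y => h (x, y)).
Proof.
move=> hc; split=> z.
  apply: (@continuous_comp _ _ _ (fun x => (x, y)) h); last exact: hc.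
  by apply: (cvg_pair (@cvg_id _ _) (@cvg_cst _ _ _ _ _)).
apply: (@continuous_comp _ _ _ (fun y => (x, y)) h); last exact: hc.
by apply: (cvg_pair (@cvg_cst _ _ _ _ _) (@cvg_id _ _)).
Qed.

Lemma ibp_sum (a b : R * R -> R) (Ma Mb : R) : continuous a -> continuous b ->
  (forall p, `|a p| <= Ma) -> (forall p, `|b p| <= Mb) ->
  (\int[mu2]_(p in cell) (a p + b p)%:E = 0)%E ->
  \int[mu2]_(p in cell) a p = - \int[mu2]_(p in cell) b p.
Proof.
move=> ac bc aM bM h; apply/eqP; rewrite -addr_eq0.
rewrite -RintegralD; [|exact: cell_measurable|exact: bounded_integrable aM|exact: bounded_integrable bM].
by rewrite /Rintegral h.
Qed.

Lemma periodic_rep (z : R * R -> R) : (forall x y, z (x + T, y) = z (x, y)) ->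
  forall x y, exists2 x', 0 <= x' <= T & z (x', y) = z (x, y).
Proof.
move=> zp x y.
have zn n : forall x y, z (x + n%:R * T, y) = z (x, y).
  elim: n => [|n IH] x' y'; first by rewrite mul0r addr0.
  by rewrite -natr1 mulrDl mul1r addrA zp.
pose n := Num.truncn (`|x| / T).
have h1 : `|x| / T < n.+1%:R by exact: truncnS_gt.
rewrite ltr_pdivrMr // in h1.
have x0 : 0 <= x + n.+1%:R * T by have := ler_norm (- x); rewrite normrN; lra.
pose k := Num.truncn ((x + n.+1%:R * T) / T).
have q0 : 0 <= (x + n.+1%:R * T) / T by rewrite divr_ge0 // ltW.
have h2 : k%:R <= (x + n.+1%:R * T) / T by rewrite truncn_le.
have h3 : (x + n.+1%:R * T) / T < k.+1%:R by exact: truncnS_gt.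
rewrite ler_pdivlMr // in h2; rewrite ltr_pdivrMr // -natr1 mulrDl mul1r in h3.
exists (x + n.+1%:R * T - k%:R * T); first by apply/andP; split; lra.
by rewrite -(zn k) subrK zn.
Qed.

(** Periodicity and the support condition reduce the plane to a compact
    rectangle. *)
Lemma bounded_periodic (z : R * R -> R) (a b : R) : continuous z -> (forall x y, z (x + T, y) = z (x, y)) ->
  (forall x y, z (x, y) != 0 -> a <= y <= b) -> exists M : R, forall p, `|z p| <= M.
Proof.
move=> zc zp zs.
have K : compact (`[0, T] `*` `[a, b] : set (R * R)).
  by apply: compact_setX; exact: segment_compact.
have [M [_ HM]] := @compact_bounded _ _ _ (continuous_compact (continuous_subspaceT zc) K).
have HM1 : forall p, (`[0, T] `*` `[a, b] : set (R * R)) p -> `|z p| <= `|M| + 1.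
  move=> p pK; apply: (HM (`|M| + 1)); last by exists p.
  by apply: le_lt_trans (ler_norm _) _; rewrite ltrDl.
exists (`|M| + 1) => -[x y].
have [->|h] := eqVneq (z (x, y)) 0; first by rewrite normr0 addr_ge0.
have [x' x'I <-] := periodic_rep zp x y; apply: HM1; split; rewrite /= in_itv /= //.
exact: zs h.
Qed.
End Cell.

Section TestFun.
Context {R : realType} (T y1 y2 : R).
Hypotheses (hT : 0 < T) (hy : y1 < y2).
Implicit Types (z eta : R * R -> R).
Local Notation mu2 := (leb2 R).
Local Notation cell := (cell T y1 y2).

Lemma partial1 z (p : R * R) : derivable z p ((1, 0) : R * R) ->
  is_derive p.1 1 (fun x => z (x, p.2)) ('D_((1, 0) : R * R) z p).
Proof.
move=> dz; have E : (fun h : R => h^-1 *: (((fun x => z (x, p.2)) \o shift p.1) (h *: (1 : R)) - z (p.1, p.2))) =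
  (fun h : R => h^-1 *: ((z \o shift p) (h *: ((1, 0) : R * R)) - z p)).
  apply/funext => h; rewrite /= -surjective_pairing; congr (_ *: (z _ - _)).
  by case: p {dz} => x y; congr pair; rewrite /= /GRing.scale /= mulr0 add0r.
by split; [move: dz; rewrite /derivable -E|rewrite /derive E].
Qed.

Lemma partial2 z (p : R * R) : derivable z p ((0, 1) : R * R) ->
  is_derive p.2 1 (fun y => z (p.1, y)) ('D_((0, 1) : R * R) z p).
Proof.
move=> dz; have E : (fun h : R => h^-1 *: (((fun y => z (p.1, y)) \o shift p.2) (h *: (1 : R)) - z (p.1, p.2))) =
  (fun h : R => h^-1 *: ((z \o shift p) (h *: ((0, 1) : R * R)) - z p)).
  apply/funext => h; rewrite /= -surjective_pairing; congr (_ *: (z _ - _)).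
  by case: p {dz} => x y; congr pair; rewrite /= /GRing.scale /= mulr0 add0r.
by split; [move: dz; rewrite /derivable -E|rewrite /derive E].
Qed.

Lemma test_cont z : test_fun T y1 y2 z -> continuous z.
Proof. by case=> /(_ 0%N) [h _] _ _ p; apply: h; rewrite inE. Qed.

Lemma test_derivable z v p : test_fun T y1 y2 z -> derivable z p v.
Proof. by case=> /(_ 1%N) [_ /(_ v) [h _]] _ _; exact: h. Qed.

(** The support condition is inherited because the function vanishes near
    every point off the closed strip that carries its support. *)
Lemma test_D z v : test_fun T y1 y2 z -> test_fun T y1 y2 (fun p => 'D_v z p).
Proof.
move=> tz; have [zn zp [a [b [ya yb zs]]]] := tz; split.
- by move=> n; have [_ /(_ v) []] := zn n.+1.
- move=> x y; rewrite /derive.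
  rewrite (_ : (fun h : R => _) = (fun h : R => h^-1 *: ((z \o shift (x, y)) (h *: v) - z (x, y)))) //.
  apply/funext => h; congr (_ *: (_ - _)); last exact: zp.
  by rewrite /= -[RHS]zp; congr z; congr pair; rewrite /= addrA.
exists a, b; split=> // x y; apply: contraNT => yab.
have Z : \forall q \near (x, y), z q = 0.
  have sc : (fun q : R * R => q.2) @ (x, y) --> y by exact: cvg_snd.
  move: yab; rewrite negb_and -!ltNge => /orP[h|h].
    near=> q; apply: contrapT => /eqP; rewrite (surjective_pairing q) => /zs /andP[+ _].
    apply/negP; rewrite -ltNge; near: q; apply: (sc [set t | t < a]); exact: lt_nbhsl.
  near=> q; apply: contrapT => /eqP; rewrite (surjective_pairing q) => /zs /andP[_].
  apply/negP; rewrite -ltNge; near: q; apply: (sc [set t | b < t]); exact: lt_nbhsr.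
have [_ <-//] : is_derive (x, y) v z 0.
have c0 : is_derive (x, y) v (cst 0 : R * R -> R) 0 by exact: is_derive_cst.
apply: near_eq_is_derive c0.
by apply: filterS Z => q ->.
Unshelve. all: end_near.
Qed.

Lemma test_pderiv i j z : test_fun T y1 y2 z -> test_fun T y1 y2 (pderiv i j z).
Proof.
move=> tz; elim: i => [|i IH]; last exact: test_D IH.
by elim: j => [|j IH] //; exact: test_D IH.
Qed.

Lemma test_bounded z : test_fun T y1 y2 z -> exists M : R, forall p, `|z p| <= M.
Proof.
move=> tz; have [_ zp [a [b [_ _ zs]]]] := tz.
exact: (bounded_periodic hT (@test_cont z tz) zp zs).
Qed.

Lemma bound_mul (a b : R * R -> R) (Ma Mb : R) : (forall p, `|a p| <= Ma) -> (forall p, `|b p| <= Mb) ->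
  forall p, `|a p * b p| <= Ma * Mb.
Proof. by move=> ha hb p; rewrite normrM; apply: ler_pM. Qed.

(** The derivative of f z in x has integral 0 over a period. *)
Lemma ibp_x (f fx : R * R -> R) (M : R) z : continuous f -> continuous fx -> (forall p, `|f p| <= M) ->
  (forall p, `|fx p| <= M) -> (forall x y, f (x + T, y) = f (x, y)) ->
  (forall x y : R, is_derive x 1 (fun x => f (x, y)) (fx (x, y))) -> test_fun T y1 y2 z ->
  \int[mu2]_(p in cell) (f p * 'D_((1, 0) : R * R) z p) =
  - \int[mu2]_(p in cell) (fx p * z p).
Proof.
move=> fc fxc fM fxM fp df tz.
have tz' := test_D ((1, 0) : R * R) tz.
have [Mz HMz] := test_bounded tz; have [Mz' HMz'] := test_bounded tz'.
have c1 := cont_mul fc (@test_cont _ tz'); have c2 := cont_mul fxc (@test_cont _ tz).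
have b1 := bound_mul fM HMz'; have b2 := bound_mul fxM HMz.
apply: (ibp_sum hT hy c1 c2 b1 b2).
have b3 p : `|f p * 'D_((1, 0) : R * R) z p + fx p * z p| <= M * Mz' + M * Mz.
  by apply: le_trans (ler_normD _ _) (lerD (b1 p) (b2 p)).
rewrite (cell_fubini hT hy (cont_add c1 c2) b3).2.
rewrite (eq_integral (fun=> 0%E)) ?integral0 // => y _.
have D (x : R) : is_derive x 1 (fun x => f (x, y) * z (x, y)) (f (x, y) * 'D_((1, 0) : R * R) z (x, y) + fx (x, y) * z (x, y)).
  have dz := partial1 (@test_derivable z ((1, 0) : R * R) (x, y) tz).
  by apply: der_eq (der_mul (df x y) dz) _; rewrite /= addrC.
apply: (@ftc0 R (fun x => f (x, y) * z (x, y)) (fun x => f (x, y) * 'D_((1, 0) : R * R) z (x, y) + fx (x, y) * z (x, y))) => //.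
- exact: (slice_cont 0 y (cont_add c1 c2)).1.
- by move=> x _; exact: is_derive_cont (D x).
- by have [_ zp _] := tz; rewrite -(add0r T) fp zp.
Qed.

(** Here z vanishes near the walls. *)
Lemma ibp_y (f fy : R * R -> R) (M : R) z : continuous f -> continuous fy -> (forall p, `|f p| <= M) ->
  (forall p, `|fy p| <= M) ->
  (forall x y : R, y1 < y < y2 -> is_derive y 1 (fun y => f (x, y)) (fy (x, y))) -> test_fun T y1 y2 z ->
  \int[mu2]_(p in cell) (f p * 'D_((0, 1) : R * R) z p) =
  - \int[mu2]_(p in cell) (fy p * z p).
Proof.
move=> fc fyc fM fyM df tz.
have tz' := test_D ((0, 1) : R * R) tz.
have [Mz HMz] := test_bounded tz; have [Mz' HMz'] := test_bounded tz'.
have c1 := cont_mul fc (@test_cont _ tz'); have c2 := cont_mul fyc (@test_cont _ tz).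
have b1 := bound_mul fM HMz'; have b2 := bound_mul fyM HMz.
apply: (ibp_sum hT hy c1 c2 b1 b2).
have b3 p : `|f p * 'D_((0, 1) : R * R) z p + fy p * z p| <= M * Mz' + M * Mz.
  by apply: le_trans (ler_normD _ _) (lerD (b1 p) (b2 p)).
rewrite (cell_fubini hT hy (cont_add c1 c2) b3).1.
rewrite (eq_integral (fun=> 0%E)) ?integral0 // => x _.
have D (y : R) : y1 < y < y2 -> is_derive y 1 (fun y => f (x, y) * z (x, y)) (f (x, y) * 'D_((0, 1) : R * R) z (x, y) + fy (x, y) * z (x, y)).
  move=> yI; have dz := partial2 (@test_derivable z ((0, 1) : R * R) (x, y) tz).
  by apply: der_eq (der_mul (df x y yI) dz) _; rewrite /= addrC.
have [_ _ [a [b [ya yb zs]]]] := tz.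
have z1 : z (x, y1) = 0 by apply: contrapT => /eqP /zs /andP[h _]; move: ya; rewrite ltNge h.
have z2 : z (x, y2) = 0 by apply: contrapT => /eqP /zs /andP[_ h]; move: yb; rewrite ltNge h.
apply: (@ftc0 R (fun y => f (x, y) * z (x, y)) (fun y => f (x, y) * 'D_((0, 1) : R * R) z (x, y) + fy (x, y) * z (x, y))) => //.
- exact: (slice_cont x 0 (cont_add c1 c2)).2.
- by move=> y _; exact: (slice_cont x 0 (cont_mul fc (@test_cont _ tz))).2.
- by rewrite z1 z2 !mulr0.
Qed.

Lemma weak_deriv_ex i j N f (M : R) : (i + j <= N)%N -> CB T y1 y2 M N f ->
  exists2 g, CB T y1 y2 M (N - (i + j)) g & weak_deriv T y1 y2 i j f g.
Proof.
have base N0 g : CB T y1 y2 M N0 g -> mu2.-integrable cell (fun p => (g p)%:E).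
  by case: N0 => [|N0] [gc gM _ _]; exact: bounded_integrable gM.
elim: i N f => [|i IH] N f.
  elim: j N f => [|j IH] N f ijN Hf.
    exists f; first by rewrite subn0.
    split; [exact: base Hf|exact: base Hf|move=> eta te].
    by rewrite expr0 mul1r.
  case: N ijN Hf => // N ijN [fc fM fp [fx [fy [dx dy cx cy]]]].
  have [g cg [i1 i2 H]] := IH N fy ijN cy.
  exists g => //; split=> //.
    by apply: bounded_integrable fM.
  move=> eta te; rewrite addnS exprS mulN1r mulNr -H //.
  have [fyc fyM] : continuous fy /\ (forall p, `|fy p| <= M) by case: (N) cy => [|?] [].
  exact: ibp_y (test_pderiv 0 j te).
case: N => // N ijN [fc fM fp [fx [fy [dx dy cx cy]]]].
have [g cg [i1 i2 H]] := IH N fx ijN cx.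
exists g => //; split=> //.
  by apply: bounded_integrable fM.
move=> eta te; rewrite addSn exprS mulN1r mulNr -H //.
have [fxc fxM] : continuous fx /\ (forall p, `|fx p| <= M) by case: (N) cx => [|?] [].
exact: ibp_x (test_pderiv i j te).
Qed.
End TestFun.

(** * Sobolev norms of functions with bounded derivatives *)

Section Slobodeckij.
Context {R : realType}.

(** The integral of a nonnegative function is a supremum over the simple
    functions below it, whence monotonicity without any measurability. *)
Lemma ge0_le_integral_any d (X : measurableType d) (mu : {measure set X -> \bar R})
    (D : set X) (f g : X -> \bar R) :
  (forall x, D x -> (0 <= f x)%E) -> (forall x, D x -> (f x <= g x)%E) ->
  (\int[mu]_(x in D) f x <= \int[mu]_(x in D) g x)%E.
Proof.
move=> f0 fg; have g0 x : D x -> (0 <= g x)%E by move=> Dx; apply: le_trans (fg x Dx); exact: f0.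
rewrite !ge0_integralE //; apply: le_ereal_sup; apply: image_subset => h /= hf x.
apply: le_trans (hf x) _; rewrite !patchE; case: ifPn => // /set_mem; exact: fg.
Qed.

Section Gagliardo.
Variables (T y1 y2 : R).
Hypotheses (hT : 0 < T) (hy : y1 < y2).
Local Notation plane := (measurableTypeR R * measurableTypeR R)%type.
Local Notation mu2 := (leb2 R).
Local Notation leb := (@lebesgue_measure R).
Local Notation cell := (cell T y1 y2).
Let ell := T + (y2 - y1).

Let ell0 : 0 < ell. Proof. by rewrite addr_gt0 // subr_gt0. Qed.

(** Distance of two abscissae on the circle. *)
Definition circ_dist (x x' : R) := Num.min `|x - x'| (T - `|x - x'|).

Lemma cyl_distE p q : cyl_dist T p q = Num.sqrt (circ_dist p.1 q.1 ^+ 2 + (p.2 - q.2) ^+ 2).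
Proof. by []. Qed.

Lemma circ_dist_ge0 (x x' : R) : 0 <= x <= T -> 0 <= x' <= T -> 0 <= circ_dist x x' <= T.
Proof.
move=> /andP[a b] /andP[c d].
have h : `|x - x'| <= T by rewrite ler_norml; apply/andP; split; lra.
by rewrite /circ_dist le_min ge_min normr_ge0 subr_ge0 h.
Qed.

Lemma cyl_dist_ge (p q : R * R) : cell p -> cell q ->
  circ_dist p.1 q.1 <= cyl_dist T p q /\ `|p.2 - q.2| <= cyl_dist T p q.
Proof.
rewrite /Defs.cell /= !in_itv /= => -[p1 _] [q1 _]; have /andP[m0 _] := circ_dist_ge0 p1 q1.
rewrite cyl_distE; split.
  by rewrite -{1}(ger0_norm m0) -sqrtr_sqr ler_wsqrtr // lerDl sqr_ge0.
by rewrite -sqrtr_sqr ler_wsqrtr // lerDr sqr_ge0.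
Qed.

Lemma cyl_dist_le (p q : R * R) : cell p -> cell q -> cyl_dist T p q <= ell.
Proof.
rewrite /Defs.cell /= !in_itv /= => -[p1 /andP[a b]] [q1 /andP[c d]].
have /andP[m0 mT] := circ_dist_ge0 p1 q1.
have h : `|p.2 - q.2| <= y2 - y1 by rewrite ler_norml; apply/andP; split; lra.
rewrite cyl_distE -[leRHS]ger0_norm ?(ltW ell0) // -sqrtr_sqr ler_wsqrtr //.
rewrite -[X in _ + X]real_normK ?num_real // /ell.
have h1 : circ_dist p.1 q.1 ^+ 2 <= T ^+ 2 by rewrite ler_pXn2r // nnegrE ltW.
have h2 : `|p.2 - q.2| ^+ 2 <= (y2 - y1) ^+ 2 by rewrite ler_pXn2r // nnegrE ?normr_ge0 // subr_ge0 ltW.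
have h3 : 0 <= T * (y2 - y1) by rewrite mulr_ge0 ?subr_ge0 ?ltW.
rewrite sqrrD; lra.
Qed.

(** The shorter of the two arcs between the abscissae may cross the seam of
    the circle, where periodicity is used. *)
Lemma CB_lipschitz (M : R) f p q : CB T y1 y2 M 1 f -> cell p -> cell q ->
  `|f p - f q| <= 2 * M * cyl_dist T p q.
Proof.
move=> [fc fM fp [fx [fy [dx dy [_ fxM _ _] [_ fyM _ _]]]]] cp cq.
have M0 : 0 <= M := le_trans (normr_ge0 _) (fM (0, 0)).
have [d1 d2] := cyl_dist_ge cp cq.
have Lx (x x' y : R) : `|f (x, y) - f (x', y)| <= M * `|x - x'|.
  by apply: (@mvt_abs R (fun x => f (x, y)) (fun x => fx (x, y))).
have Lc (x x' y : R) : `|f (x, y) - f (x', y)| <= M * circ_dist x x' \/ T < `|x - x'|.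
  have [h|h] := leP `|x - x'| T; [left|by right].
  rewrite /circ_dist; have [_|_] := leP `|x - x'| (T - `|x - x'|); first exact: Lx.
  have [xx|xx] := leP x x'.
    rewrite -(fp x); apply: le_trans (Lx _ _ _) _; apply: ler_wpM2l => //.
    move: h; rewrite distrC ger0_norm ?subr_ge0 // => h.
    by rewrite ger0_norm; lra.
  rewrite -(fp x'); apply: le_trans (Lx _ _ _) _; apply: ler_wpM2l => //.
  move: h; rewrite gtr0_norm ?subr_gt0 // => h.
  by rewrite distrC ger0_norm; lra.
have Ly (x y y' : R) : y1 <= y <= y2 -> y1 <= y' <= y2 -> `|f (x, y) - f (x, y')| <= M * `|y - y'|.
  wlog yy : y y' / y < y' => [H|] yI yI'.
    have [yy|yy|->] := ltgtP y y'; last by rewrite !subrr normr0 mulr0.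
      exact: H.
    by rewrite distrC (distrC y); exact: H.
  rewrite distrC (distrC y).
  have fc' : continuous (fun y => f (x, y)) by exact: (slice_cont x 0 fc).2.
  have [z zI ->] := @mvt_eq R (fun y => f (x, y)) (fun y => fy (x, y)) y y' yy
    (fun z _ => fc' z) (fun z zI => dy x z ltac:(lra)).
  by rewrite normrM ler_wpM2r.
case: p q cp cq d1 d2 => [x y] [x' y'] cp cq /= d1 d2.
have [cx cy] := cp; have [cx' cy'] := cq.
move: cx cy cx' cy'; rewrite /= !in_itv /= => cx cy cx' cy'.
have -> : f (x, y) - f (x', y') = (f (x, y) - f (x', y)) + (f (x', y) - f (x', y')) by ring.
apply: le_trans (ler_normD _ _) _.
have E1 : `|f (x, y) - f (x', y)| <= M * cyl_dist T (x, y) (x', y').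
  case: (Lc x x' y) => [h|]; first by apply: le_trans h _; apply: ler_wpM2l.
  by rewrite ltNge ler_norml => /negP[]; apply/andP; split; lra.
have E2 : `|f (x', y) - f (x', y')| <= M * cyl_dist T (x, y) (x', y').
  by apply: le_trans (Ly x' y y' cy cy') _; apply: ler_wpM2l.
lra.
Qed.

(** The three translates of a square by multiples of T cover the ball of
    radius r about p on the cylinder. *)
Definition nbox (p : R * R) (r : R) : set plane :=
  (`[p.1 - r, p.1 + r] `|` (`[p.1 + T - r, p.1 + T + r] `|` `[p.1 - T - r, p.1 - T + r])) `*`
  `[p.2 - r, p.2 + r].

Lemma nbox_measurable p r : measurable (nbox p r).
Proof. by apply: measurableX; [do 2 (apply: measurableU; first exact: measurable_itv)|]; exact: measurable_itv. Qed.

Lemma nbox_measure p (r : R) : 0 < r -> (mu2 (nbox p r) <= (12 * r ^+ 2)%:E)%E.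
Proof.
move=> r0; rewrite /leb2 [leLHS]product_measure1E; [|do 2 (apply: measurableU; first exact: measurable_itv)|]; try exact: measurable_itv.
have I (c : R) : leb `[c - r, c + r]%classic = (2 * r)%:E.
  by rewrite lebesgue_measure_itv /= lte_fin ifT ?ltrD2l ?gtrN // -EFinB; congr EFin; ring.
rewrite (_ : 12 * r ^+ 2 = (2 * r + (2 * r + 2 * r)) * (2 * r)); last ring.
rewrite EFinM !EFinD.
pose A1 := `[p.1 - r, p.1 + r]%classic : set R; pose A2 := `[p.1 + T - r, p.1 + T + r]%classic : set R.
pose A3 := `[p.1 - T - r, p.1 - T + r]%classic : set R; pose A4 := `[p.2 - r, p.2 + r]%classic : set R.
change ((leb (A1 `|` (A2 `|` A3)) * leb A4 <= ((2 * r)%:E + ((2 * r)%:E + (2 * r)%:E)) * (2 * r)%:E)%E).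
rewrite /A1 /A2 /A3 /A4 I; apply: lee_wpmul2r; first by rewrite lee_fin mulr_ge0 // ltW.
have U A B : measurable (A : set (measurableTypeR R)) -> measurable (B : set (measurableTypeR R)) -> (leb (A `|` B) <= leb A + leb B)%E by exact: measureU2.
apply: le_trans (U _ _ _ _) _; [exact: measurable_itv|by apply: measurableU; exact: measurable_itv|].
rewrite I leeD2l //; apply: le_trans (U _ _ _ _) _; try exact: measurable_itv.
by rewrite !I.
Qed.

Lemma nbox_mem p q r : cell p -> cell q -> cyl_dist T p q <= r -> nbox p r q.
Proof.
move=> cp cq h; have [d1 d2] := cyl_dist_ge cp cq.
move: (le_trans d1 h) (le_trans d2 h) => {d1 d2 h}.
rewrite /circ_dist ge_min distrC (distrC p.2) !ler_norml => h1 h2; split; rewrite /= !in_itv /=; last by lra.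
case/orP: h1 => [h1|h1]; first by left; lra.
right; have [a|a] := leP 0 (q.1 - p.1).
  by left; move: h1 cp cq; rewrite ger0_norm // /Defs.cell /= !in_itv /= => h1 [/andP[? ?] _] [/andP[? ?] _]; lra.
by right; move: h1 cp cq; rewrite ltr0_norm // /Defs.cell /= !in_itv /= => h1 [/andP[? ?] _] [/andP[? ?] _]; lra.
Qed.

Variable theta : R.
Hypothesis thetaI : 0 < theta < 1.
(** The k-th dyadic shell has measure of order 4^-k, and the integrand is
    there of order sig^-k; as 4^-1 = sig tau, the sum over the shells is a
    geometric series of ratio tau < 1. *)
Let tau : R := 2^-1 `^ (2 - 2 * theta).
Let sig : R := 2^-1 `^ (2 * theta).
Let lam : R := (ell / 2) `^ (2 * theta).

Let tau_lt1 : 0 <= tau < 1.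
Proof.
rewrite powR_ge0 /=; have -> : 1 = (1 : R) `^ (2 - 2 * theta) by rewrite powR1.
have /andP[_ th1] := thetaI.
apply: gt0_ltr_powR; rewrite ?nnegrE ?invr_ge0 ?invf_lt1 ?ltr1n //.
by rewrite subr_gt0 gtr_pMr.
Qed.

Let sig_tau : sig * tau = 4^-1.
Proof.
rewrite -powRD; last by rewrite invr_eq0 pnatr_eq0 implybT.
rewrite addrCA subrr addr0 (powR_mulrn 2) ?invr_ge0 //.
by field.
Qed.

Let sig0 : 0 < sig. Proof. by rewrite powR_gt0 // invr_gt0. Qed.
Let lam0 : 0 < lam. Proof. by rewrite powR_gt0 // divr_gt0. Qed.

Lemma dyadic_radius (d : R) : 0 < d <= ell -> exists k : nat,
  ell * 2^-1 ^+ k.+1 < d <= ell * 2^-1 ^+ k.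
Proof.
move=> /andP[d0 dl].
have ex : exists k, ell * 2^-1 ^+ k.+1 < d.
  have [n hn] := half_pow_small ell (e := d) d0; exists n.
  apply: lt_le_trans hn; rewrite ltr_pM2l // exprS gtr_pMl ?exprn_gt0 ?invr_gt0 //.
  by rewrite invf_lt1 // ltr1n.
exists (ex_minn ex); case: ex_minnP => k hk kmin; rewrite hk /=.
case: k hk kmin => [|k] hk kmin; first by rewrite expr0 mulr1.
by rewrite leNgt; apply/negP => /kmin; rewrite ltnn.
Qed.

Lemma sig_pow (k : nat) : (ell * 2^-1 ^+ k.+1) `^ (2 * theta) = lam * sig ^+ k.
Proof.
elim: k => [|k IH]; first by rewrite expr1 expr0 mulr1.
have h : 0 <= ell * 2^-1 ^+ k.+1 by rewrite mulr_ge0 ?(ltW ell0) // exprn_ge0 // invr_ge0.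
by rewrite exprSr mulrA powRM ?invr_ge0 // IH -mulrA -exprSr.
Qed.

Let K : R := 48 * ell ^+ 2 / lam / (1 - tau).

(** For a Lipschitz function the integrand is at most 4 M^2 d^(- 2 theta);
    this is dominated by a sum of multiples of indicators of dyadic
    neighbourhoods, which is integrated term by term. *)
Lemma gagliardo_inner (M : R) f p : CB T y1 y2 M 1 f -> cell p ->
  (\int[mu2]_(q in cell) ((f p - f q) ^+ 2 / (cyl_dist T p q) `^ (2 + 2 * theta))%:E <= (K * M ^+ 2)%:E)%E.
Proof.
move=> Hf cp; have /andP[th0 th1] := thetaI; have /andP[tau0 tau1] := tau_lt1.
have M0 : 0 <= M by case: Hf => _ fM _ _; exact: le_trans (normr_ge0 _) (fM (0, 0)).
pose r k : R := ell * 2^-1 ^+ k.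
have r0 k : 0 < r k by rewrite mulr_gt0 // exprn_gt0 // invr_gt0.
pose c k : R := 4 * M ^+ 2 / (lam * sig ^+ k).
have lsk k : 0 < lam * sig ^+ k by rewrite mulr_gt0 // exprn_gt0.
have c0 k : 0 <= c k by rewrite divr_ge0 // ?(ltW (lsk k)) // mulr_ge0 // exprn_ge0.
pose h k (q : plane) : \bar R := ((c k)%:E * (\1_(nbox p (r k)) q)%:E)%E.
have h0 k q : (0 <= h k q)%E by rewrite mule_ge0 // lee_fin // indicE.
have mh k : measurable_fun cell (EFin \o (\1_(nbox p (r k)) : plane -> R)).
  by apply/measurable_EFinP; apply: measurable_realfun.measurable_indic; exact: nbox_measurable.
have mh' k : measurable_fun cell (h k).
  exact: measurable_funeM (mh k).
apply: (@le_trans _ _ (\int[mu2]_(q in cell) \big[+%E/0%E]_(0 <= k <oo) h k q)%E).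
  apply: ge0_le_integral_any => [q _|q cq].
    by rewrite lee_fin divr_ge0 ?sqr_ge0 // powR_ge0.
  have L := CB_lipschitz Hf cp cq; set d := cyl_dist T p q in L *.
  have d0 : 0 <= d by exact: sqrtr_ge0.
  move: d0; rewrite le_eqVlt => /orP[/eqP d0|d0].
    move: L; rewrite -d0 mulr0 normr_le0 => /eqP->; rewrite expr0n mul0r.
    exact: nneseries_ge0.
  have [k /andP[kd dk]] := dyadic_radius (d := d) ltac:(by rewrite d0 cyl_dist_le).
  have mem : nbox p (r k) q by exact: nbox_mem.
  apply: (@le_trans _ _ (\sum_(0 <= i < k.+1) h i q)%E); last exact: nneseries_lim_ge.
  rewrite big_nat_recr //= -[leLHS]add0e; apply: leeD; first exact: sume_ge0.
  rewrite /h indicE mem_set // mule1 lee_fin /c.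
  have dp : 0 < d `^ (2 * theta) by exact: powR_gt0.
  have -> : d `^ (2 + 2 * theta) = d ^+ 2 * d `^ (2 * theta).
    by rewrite powRD ?(gt_eqF d0) ?implybT // -(powR_mulrn 2) // ltW.
  apply: (@le_trans _ _ (4 * M ^+ 2 / d `^ (2 * theta))).
    rewrite invfM mulrA ler_wpM2r ?invr_ge0 ?(ltW dp) //.
    rewrite ler_pdivrMr ?exprn_gt0 // -[leLHS]real_normK ?num_real //.
    have -> : 4 * M ^+ 2 * d ^+ 2 = (2 * M * d) ^+ 2 by ring.
    by rewrite ler_pXn2r ?nnegrE // (le_trans _ L).
  apply: ler_wpM2l; first by rewrite mulr_ge0 // exprn_ge0.
  rewrite lef_pV2 ?posrE // -sig_pow; apply: ge0_ler_powR; rewrite ?nnegrE ?(ltW d0) ?(ltW kd) ?(ltW (r0 k.+1)) //.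
  by rewrite mulr_ge0 ?(ltW th0).
rewrite integral_nneseries //; last exact: cell_measurable.
pose g k : R := 48 * ell ^+ 2 / lam * M ^+ 2 * tau ^+ k.
have g0 k : 0 <= g k.
  apply: mulr_ge0; last exact: exprn_ge0.
  by apply: mulr_ge0; [apply: divr_ge0; [apply: mulr_ge0; rewrite ?sqr_ge0|exact: ltW]|exact: sqr_ge0].
have hg k : (\int[mu2]_(q in cell) h k q <= (g k)%:E)%E.
  rewrite ge0_integralZl_EFin; [|exact: cell_measurable|by move=> q _; rewrite lee_fin indicE|exact: mh|exact: c0].
  rewrite integral_indic; [|exact: cell_measurable|exact: nbox_measurable].
  have E : (mu2 (nbox p (r k) `&` cell) <= (12 * r k ^+ 2)%:E)%E.
    apply: le_trans (nbox_measure p (r0 k)); apply: le_measure; rewrite ?inE; last by move=> ? [].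
      by apply: measurableI; [exact: nbox_measurable|exact: cell_measurable].
    exact: nbox_measurable.
  apply: le_trans (lee_wpmul2l _ E) _; first by rewrite lee_fin.
  rewrite -EFinM lee_fin /c /g /r.
  have st : (sig ^+ k * tau ^+ k) = 4^-1 ^+ k by rewrite -exprMn sig_tau.
  have p4 : (2^-1 ^+ k) ^+ 2 = (4^-1 : R) ^+ k.
    by rewrite -exprM mulnC exprM; congr (_ ^+ _); field.
  have sk0 : sig ^+ k != 0 by rewrite expf_neq0 // gt_eqF.
  have -> : tau ^+ k = (2^-1 ^+ k) ^+ 2 / sig ^+ k by rewrite p4 -st mulrC mulKf.
  move: sk0 (gt_eqF lam0); generalize lam (sig ^+ k) (2^-1 ^+ k : R) => l S x sk0 l0.
  suff -> : 4 * M ^+ 2 / (l * S) * (12 * (ell * x) ^+ 2) = 48 * ell ^+ 2 / l * M ^+ 2 * (x ^+ 2 / S) by [].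
  by field; rewrite sk0 l0.
apply: (@le_trans _ _ (\big[+%E/0%E]_(0 <= k <oo) (g k)%:E)%E).
  by apply: lee_nneseries => // k _ _; exact: integral_ge0.
apply: lime_le; first by apply: is_cvg_nneseries => k _ _; rewrite lee_fin.
near=> n; rewrite sumEFin lee_fin /K.
have -> : \sum_(0 <= i < n) g i = series (geometric (48 * ell ^+ 2 / lam * M ^+ 2) tau) n by [].
rewrite geometric_seriesE ?lt_eqF // /=.
rewrite [leRHS](_ : _ = 48 * ell ^+ 2 / lam * M ^+ 2 / (1 - tau)); last by ring.
rewrite ler_wpM2r ?invr_ge0 ?subr_ge0 ?(ltW tau1) //.
rewrite ler_piMr //; first by have := g0 0%N; rewrite /g expr0 mulr1.
by rewrite gerBl exprn_ge0.
Unshelve. all: end_near.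
Qed.

Lemma gagliardo_bound : exists2 C : R, 0 <= C & forall (M : R) f, CB T y1 y2 M 1 f ->
  (gagliardo T y1 y2 theta f <= (C * M ^+ 2)%:E)%E.
Proof.
have /andP[tau0 tau1] := tau_lt1.
have K0 : 0 <= K.
  apply: divr_ge0; last by rewrite subr_ge0 ltW.
  by apply: divr_ge0; [rewrite mulr_ge0 ?sqr_ge0|exact: ltW].
exists (K * (T * (y2 - y1))); first by rewrite mulr_ge0 // mulr_ge0 ?subr_ge0 ?ltW.
move=> M f Hf; apply: (@le_trans _ _ (\int[mu2]_(p in cell) (cst (K * M ^+ 2)%:E p))%E).
  apply: ge0_le_integral_any => [p _|p cp]; last exact: gagliardo_inner.
  by apply: integral_ge0 => q _; rewrite lee_fin divr_ge0 ?sqr_ge0 // powR_ge0.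
rewrite integral_cst; last exact: cell_measurable.
by rewrite [X in (_ * X)%E]cell_measure // -EFinM lee_fin mulrAC.
Qed.
End Gagliardo.

Lemma sum_le_const (n : nat) (P : pred 'I_n) (a : 'I_n -> \bar R) (c : R) : 0 <= c ->
  (forall i, P i -> (a i <= c%:E)%E) -> (\sum_(i < n | P i) a i <= (n%:R * c)%:E)%E.
Proof.
move=> c0 h; rewrite big_mkcond /=.
apply: (@le_trans _ _ (\sum_(i < n) c%:E)%E).
  by apply: lee_sum => i _; case: ifP => [/h|_] //; rewrite lee_fin.
by rewrite sumEFin sumr_const card_ord mulr_natl.
Qed.

Lemma sum2_le_const (n : nat) (P : 'I_n -> 'I_n -> bool) (a : 'I_n -> 'I_n -> \bar R) (c : R) : 0 <= c ->
  (forall i j, P i j -> (a i j <= c%:E)%E) ->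
  (\sum_(i < n) \sum_(j < n | P i j) a i j <= (n%:R * (n%:R * c))%:E)%E.
Proof.
move=> c0 h; apply: sum_le_const => [|i _]; first by rewrite mulr_ge0.
by apply: sum_le_const => // j; exact: h.
Qed.

Lemma L2_bound (T y1 y2 M : R) N f : 0 < T -> y1 < y2 -> CB T y1 y2 M N f ->
  (L2_sqrnorm T y1 y2 f <= (T * (y2 - y1) * M ^+ 2)%:E)%E.
Proof.
move=> hT hy cf.
have fM p : `|f p| <= M by case: N cf => [|?] [].
apply: (@le_trans _ _ (\int[leb2 R]_(p in cell T y1 y2) (cst (M ^+ 2)%:E p))%E).
  apply: ge0_le_integral_any => [p _|p _]; first by rewrite lee_fin sqr_ge0.
  rewrite lee_fin -[leLHS]real_normK ?num_real // ler_pXn2r ?nnegrE //.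
  exact: le_trans (fM p).
rewrite integral_cst; last exact: cell_measurable.
by rewrite [X in (_ * X)%E]cell_measure // -EFinM lee_fin mulrC.
Qed.

(** One more classical derivative than the integer part of s makes the highest
    weak derivatives Lipschitz. *)
Lemma Hs_bound (T y1 y2 s : R) : 0 < T -> y1 < y2 -> 0 <= s ->
  exists2 C : R, 0 <= C & forall (M : R) f, CB T y1 y2 M (Num.truncn s).+1 f ->
    (Hs_sqrnorm T y1 y2 s f <= (C * M ^+ 2)%:E)%E.
Proof.
move=> hT hy s0; set m := Num.truncn s; set theta := s - m%:R.
have A0 : 0 <= T * (y2 - y1) by rewrite mulr_ge0 ?subr_ge0 ?ltW.
have th0 : 0 <= theta by rewrite subr_ge0 truncn_le.
have th1 : theta < 1 by rewrite ltrBlDr addrC natr1 truncnS_gt.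
have [C C0 HC] : exists2 C : R, 0 <= C & forall (M : R) f, CB T y1 y2 M 1 f -> theta != 0 ->
  (gagliardo T y1 y2 theta f <= (C * M ^+ 2)%:E)%E.
  have [->|tn] := eqVneq theta 0; first by exists 0 => // M f _; rewrite eqxx.
  have [|C C0 HC] := gagliardo_bound hT hy (theta := theta); first by rewrite lt_neqAle eq_sym tn th0.
  by exists C => // M f cf _; exact: HC.
pose n : R := m.+1%:R.
exists (n * (n * (T * (y2 - y1))) + n * (n * C)).
  by apply: addr_ge0; apply: mulr_ge0 => //; apply: mulr_ge0.
move=> M f cf.
have H (ij : nat * nat) : exists g, (ij.1 + ij.2 <= m)%N ->
    CB T y1 y2 M (m.+1 - (ij.1 + ij.2)) g /\ weak_deriv T y1 y2 ij.1 ij.2 f g.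
  have [h|h] := leqP (ij.1 + ij.2) m; last by exists f.
  by have [g g1 g2] := weak_deriv_ex hT hy (leqW h) cf; exists g.
have [D HD] := choice H.
pose D2 i j := D (i, j).
apply: (@le_trans _ _ _ _ _ (ereal_inf_lbound _)).
  exists D2; last by reflexivity.
  by move=> i j ij; have [] := HD (i, j) ij.
rewrite -/m -/theta mulrDl EFinD; apply: leeD.
  rewrite [_ * M ^+ 2](_ : _ = n * (n * (T * (y2 - y1) * M ^+ 2))); last by rewrite -!mulrA.
  apply: sum2_le_const => [|i j ij]; first by rewrite mulr_ge0 ?sqr_ge0.
  by have [cD _] := HD (nat_of_ord i, nat_of_ord j) ij; exact: L2_bound cD.
case: eqP => [_|/eqP tn].
  rewrite lee_fin; apply: mulr_ge0; last exact: sqr_ge0.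
  by apply: mulr_ge0 => //; apply: mulr_ge0.
rewrite [_ * M ^+ 2](_ : _ = n * (n * (C * M ^+ 2))); last by rewrite -!mulrA.
apply: sum2_le_const => [|i j ij]; first by rewrite mulr_ge0 ?sqr_ge0.
have [] := HD (nat_of_ord i, nat_of_ord j); first by rewrite /= (eqP ij).
rewrite /= (eqP ij) subSnn => cD _; exact: HC cD tn.
Qed.
End Slobodeckij.

(** * Functions of class H^2 on an interval *)

Section SobolevOnInterval.
Context {R : realType} (y1 y2 : R).
Hypothesis hy : y1 < y2.
Local Notation leb := (@lebesgue_measure R).
Local Notation I := (`[y1, y2]%classic : set R).
Local Notation clamp := (clamp y1 y2).
Local Notation cc f := (continuous (f \o clamp)).
Implicit Types f g : R -> R.

Lemma ae_imp (P Q : R -> Prop) : {ae leb, forall x, P x} -> (forall x, P x -> Q x) ->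
  {ae leb, forall x, Q x}.
Proof. by move=> p pq; apply: filterS p; [exact: (ae_filter_ringOfSetsType leb)|exact: pq]. Qed.

Lemma ae_and (P Q : R -> Prop) : {ae leb, forall x, P x} -> {ae leb, forall x, Q x} ->
  {ae leb, forall x, P x /\ Q x}.
Proof. by move=> p q; apply: filterI => //; exact: (ae_filter_ringOfSetsType leb). Qed.

Lemma near_interior (x : R) : y1 < x < y2 -> \forall z \near x, y1 < z < y2.
Proof.
move=> /andP[a b]; near=> z; apply/andP; split; near: z; [exact: lt_nbhsr|exact: lt_nbhsl].
Unshelve. all: end_near.
Qed.

Lemma cc_interior f (x : R) : cc f -> y1 < x < y2 -> {for x, continuous f}.
Proof.
move=> fc xI; have xI' : y1 <= x <= y2 by case/andP: xI => *; rewrite !ltW.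
have := fc x; rewrite /continuous_at /= clamp_id //; apply: cvg_trans.
apply: near_eq_cvg; apply: filterS (near_interior xI) => z /andP[a b].
by rewrite /= clamp_id // !ltW.
Qed.

Lemma within_cc f : {within I, continuous f} -> cc f.
Proof.
move=> /subspace_continuousP fc y.
have cI z : I (clamp z) by rewrite /= in_itv /= clampI.
have := fc _ (cI y); apply: cvg_comp => P.
move=> HP; have H := @clamp_cont R y1 y2 y _ HP.
have H' : \forall z \near y, I (clamp z) -> P (clamp z) by exact: H.
by apply: filterS H' => z; apply.
Qed.

Lemma integrable_interval f y : leb.-integrable I (EFin \o f) -> y <= y2 ->
  leb.-integrable `[y1, y] (EFin \o f).
Proof.
move=> fi yy; apply: integrableS fi; try exact: measurable_itv.
by apply: subset_itvl; rewrite bnd_simp.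
Qed.

Lemma integral_cc f : leb.-integrable I (EFin \o f) -> cc (fun y => \int[leb]_(z in `[y1, y]) f z).
Proof. by move=> fi; apply: within_cc; exact: parameterized_integral_continuous (ltW hy) fi. Qed.

Lemma integral_der f (x : R) : leb.-integrable I (EFin \o f) -> y1 < x < y2 -> {for x, continuous f} ->
  is_derive x 1 (fun y => \int[leb]_(z in `[y1, y]) f z) (f x).
Proof.
move=> fi /andP[a b] fx; have ax : (y1%:E < x%:E)%E by rewrite lte_fin.
have [] := continuous_FTC1 b fi ax fx.
by rewrite derive1E => h1 h2; split.
Qed.

(** Lebesgue's differentiation theorem. *)
Lemma integral_der_ae f : leb.-integrable I (EFin \o f) ->
  {ae leb, forall x, y1 < x < y2 -> is_derive x 1 (fun y => \int[leb]_(z in `[y1, y]) f z) (f x)}.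
Proof.
move=> fi; have fl := integrable_locally (measurable_itv _) fi.
apply: (ae_imp (lebesgue_differentiation fl)) => x xpt /andP[a b].
have fi' : leb.-integrable I (EFin \o (f \_ I)).
  by rewrite -restrict_EFin; apply/integrable_restrict => //=; rewrite ?setIid.
have ax : (y1%:E < x%:E)%E by rewrite lte_fin.
have [] := FTC1_lebesgue_pt b fi' ax xpt.
rewrite derive1E patchE mem_set; last by rewrite /= in_itv /= !ltW.
move=> h1 h2; have h : is_derive x 1 (fun y => \int[leb]_(z in `[y1, y]) (f \_ I) z) (f x) by split.
apply: near_eq_is_derive h; apply: filterS (near_interior (x := x) _) => [z /andP[c d]|]; last by rewrite a.
apply: eq_Rintegral => t; rewrite inE /= in_itv /= => /andP[ty tz].
by rewrite patchE mem_set //= in_itv /= ty (le_trans tz) // ltW.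
Qed.

Lemma sqr_integrable f : measurable_fun I f -> (\int[leb]_(y in I) ((f y) ^+ 2)%:E < +oo)%E ->
  leb.-integrable I (EFin \o f).
Proof.
move=> mf fi.
have i2 : leb.-integrable I (fun y => ((f y) ^+ 2)%:E).
  apply/integrableP; split.
    by apply/measurable_EFinP; exact: measurable_funX.
  by apply: le_lt_trans fi; apply: ge0_le_integral_any => y _ //=; rewrite lee_fin ger0_norm ?sqr_ge0.
have i1 : leb.-integrable I (fun=> (1 : R)%:E).
  apply: (continuous_compact_integrable (@segment_compact _ _ _)).
  by apply: continuous_subspaceT => y; exact: cvg_cst.
have i3 : leb.-integrable I (fun y => (1 + f y ^+ 2)%:E) by apply: (integrableD _ i1 i2); exact: measurable_itv.
apply: le_integrable i3; [exact: measurable_itv|exact/measurable_EFinP|move=> y _].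
rewrite /= lee_fin.
have : 0 <= (`|f y| - 1) ^+ 2 by exact: sqr_ge0.
rewrite sqrrB1 real_normK ?num_real // mulr2n => h.
have h2 : 0 <= f y ^+ 2 by exact: sqr_ge0.
have h3 : 0 <= `|f y| by [].
by rewrite [leRHS]ger0_norm; lra.
Qed.

(** The fundamental theorem of calculus, in its classical form for f' and in
    Lebesgue's form for f''. *)
Lemma H2D_der f f1 f2 : H2D_real y1 y2 f f1 f2 ->
  [/\ cc f, cc f1, (forall y, y1 < y < y2 -> is_derive y 1 f (f1 y)) &
      {ae leb, forall y, y1 < y < y2 -> is_derive y 1 f1 (f2 y)}].
Proof.
move=> [mf2 f2L f1E fE _]; have i2 := sqr_integrable mf2 f2L.
have ext g h : (forall y, I y -> g y = h y) -> cc h -> cc g.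
  move=> gh hc; rewrite (_ : _ \o _ = h \o clamp) //.
  by apply/funext => y /=; apply: gh; rewrite /= in_itv /= clampI.
have c1 : cc f1.
  apply: (ext _ _ f1E); apply: (cc_add (@cc_cst _ _ _ (f1 y1))); exact: integral_cc.
have i1 : leb.-integrable I (EFin \o f1).
  have : {within I, continuous (f1 \o clamp)} by exact: continuous_subspaceT.
  move/(continuous_compact_integrable (@segment_compact _ _ _)); apply: eq_integrable => //.
  by move=> y; rewrite inE /= in_itv /= => yI; rewrite clamp_id.
have c0 : cc f.
  apply: (ext _ _ fE); apply: (cc_add (@cc_cst _ _ _ (f y1))); exact: integral_cc.
split=> // [y yI|].
  have h := der_add (der_cst (f y1) y) (integral_der i1 yI (cc_interior c1 yI)).
  rewrite add0r in h; apply: near_eq_is_derive h.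
  by apply: filterS (near_interior yI) => z /andP[a b]; rewrite -fE //= in_itv /= !ltW.
apply: (ae_imp (integral_der_ae i2)) => y h yI.
have := der_add (der_cst (f1 y1) y) (h yI); rewrite add0r; apply: near_eq_is_derive.
by apply: filterS (near_interior yI) => z /andP[a b]; rewrite -f1E //= in_itv /= !ltW.
Qed.
End SobolevOnInterval.

Local Open Scope complex_scope.
(** * The Rayleigh operator *)

Section RayleighOperator.
Context {R : realType} (y1 y2 : R).
Hypothesis hy : y1 < y2.
Local Notation leb := (@lebesgue_measure R).
Local Notation I := (`[y1, y2]%classic : set R).
Local Notation clamp := (clamp y1 y2).
Local Notation cc f := (continuous (f \o clamp)).

Lemma H2D_real_eq (f g f1 f2 : R -> R) : f = g -> H2D_real y1 y2 f f1 f2 -> H2D_real y1 y2 g f1 f2.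
Proof. by move=> ->. Qed.

(** First derivatives are classical, so they agree everywhere; hence so do
    the second ones wherever all three exist. *)
Lemma H2D_lin (c : R) (f f1 f2 g g1 g2 h1 h2 : R -> R) : H2D_real y1 y2 f f1 f2 ->
  H2D_real y1 y2 g g1 g2 -> H2D_real y1 y2 (fun y => g y + c * f y) h1 h2 ->
  {ae leb, forall y, y1 < y < y2 -> h2 y = g2 y + c * f2 y}.
Proof.
move=> /(H2D_der hy)[_ _ df df1] /(H2D_der hy)[_ _ dg dg1] /(H2D_der hy)[_ _ dh dh1].
have E y : y1 < y < y2 -> h1 y = g1 y + c * f1 y.
  by move=> yI; exact: der_unique (dh y yI) (der_add (dg y yI) (der_scale c (df y yI))).
apply: (ae_imp (ae_and df1 (ae_and dg1 dh1))) => y [a [b d]] yI.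
apply: der_unique (d yI) _; apply: near_eq_is_derive (der_add (b yI) (der_scale c (a yI))).
by apply: filterS (near_interior yI) => z /E ->.
Qed.

Lemma re_im_eq (a b c : R) (g2 g f f2 : R[i]) :
  g2 - a%:C * g = - (b%:C * f - c%:C * (f2 - a%:C * f)) ->
  complex.Re g2 - a * complex.Re g =
    - (b * complex.Re f - c * (complex.Re f2 - a * complex.Re f)) /\
  complex.Im g2 - a * complex.Im g =
    - (b * complex.Im f - c * (complex.Im f2 - a * complex.Im f)).
Proof.
case: g2 g f f2 => [? ?] [? ?] [? ?] [? ?]; simpc => -[h1 h2]; split=> /=.
  by rewrite h1; ring.
by rewrite h2; ring.
Qed.

Lemma re_im_lin (c : R) (g f : R[i]) :
  complex.Re (g + c%:C * f) = complex.Re g + c * complex.Re f /\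
  complex.Im (g + c%:C * f) = complex.Im g + c * complex.Im f.
Proof. by case: g f => [? ?] [? ?]; simpc. Qed.

Section Equation.
Variables (u : R -> R) (a beta c : R).

(** The equation (u - c) (f'' - a^2 f) - (u'' - beta) f = g'' - a^2 g, which
    says that f is mapped to g by the operator minus c. *)
Definition rayleigh_eq (f g g2 : R -> R) := exists f1 f2, H2D_real y1 y2 f f1 f2 /\
  {ae leb, forall y, y1 < y < y2 -> (u y - c) * (f2 y - a ^+ 2 * f y) =
    g2 y - a ^+ 2 * g y + ((u^`(2))%classic y - beta) * f y}.

(** The coefficients are real, so real and imaginary parts separate. *)
Lemma rayleigh_real f g (gr gr1 gr2 gi gi1 gi2 : R -> R) :
  rayleigh_sub y1 y2 u a beta c%:C f g ->
  (forall y, complex.Re (g y) = gr y) -> (forall y, complex.Im (g y) = gi y) ->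
  H2D_real y1 y2 gr gr1 gr2 -> H2D_real y1 y2 gi gi1 gi2 ->
  rayleigh_eq (fun y => complex.Re (f y)) gr gr2 /\
  rayleigh_eq (fun y => complex.Im (f y)) gi gi2.
Proof.
move=> [f1 [f2 [h1 [h2 [[fr fi] [hr hi] E]]]]] gE gE' Hgr Hgi.
have hr' := H2D_real_eq (g := fun y => gr y + c * complex.Re (f y)) _ hr.
have hi' := H2D_real_eq (g := fun y => gi y + c * complex.Im (f y)) _ hi.
have {hr'}hr' := hr' ltac:(by apply/funext => y; rewrite (re_im_lin c _ _).1 gE).
have {hi'}hi' := hi' ltac:(by apply/funext => y; rewrite (re_im_lin c _ _).2 gE').
have er := H2D_lin fr Hgr hr'; have ei := H2D_lin fi Hgi hi'.
split; [exists (fun y => complex.Re (f1 y)), (fun y => complex.Re (f2 y))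
       |exists (fun y => complex.Im (f1 y)), (fun y => complex.Im (f2 y))]; split=> //.
  apply: (ae_imp (ae_and E er)) => y [Ey e] yI.
  have [+ _] := re_im_eq (Ey yI); rewrite (re_im_lin c _ _).1 gE (e yI) => H.
  apply/eqP; rewrite -subr_eq0; apply/eqP; move/eqP: H; rewrite -subr_eq0 => /eqP H.
  by rewrite -oppr0 -[in RHS]H; ring.
apply: (ae_imp (ae_and E ei)) => y [Ey e] yI.
have [_ +] := re_im_eq (Ey yI); rewrite (re_im_lin c _ _).2 gE' (e yI) => H.
apply/eqP; rewrite -subr_eq0; apply/eqP; move/eqP: H; rewrite -subr_eq0 => /eqP H.
by rewrite -oppr0 -[in RHS]H; ring.
Qed.
End Equation.

Lemma prim_integral (G h : R -> R) y : cc h -> y1 <= y <= y2 ->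
  (forall y, y1 <= y <= y2 -> {for y, continuous G}) ->
  (forall y, y1 < y < y2 -> is_derive y 1 G (h y)) ->
  \int[leb]_(z in `[y1, y]) h z = G y - G y1.
Proof.
move=> hc /andP[]; rewrite le_eqVlt => /orP[/eqP<- _ _ _|yy yy2 Gc dG].
  by rewrite set_itv1 Rintegral_set1 subrr.
have E : {in (`[y1, y]%classic : set R), h =1 h \o clamp}.
  move=> z; rewrite inE /= in_itv /= => /andP[z1 z2].
  by rewrite clamp_id // z1 (le_trans z2).
transitivity (\int[leb]_(z in `[y1, y]) (h \o clamp) z); first exact: eq_Rintegral.
rewrite /Rintegral (@continuous_FTC2 _ (h \o clamp) G y1 y yy) //.
- exact: continuous_subspaceT.
- split.
  + by move=> x; rewrite in_itv /= => /andP[a b]; have [] := dG x; rewrite ?a ?(lt_le_trans b).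
  + by apply: cvg_at_right_filter; apply: Gc; rewrite lexx ltW.
  + by apply: cvg_at_left_filter; apply: Gc; rewrite (ltW yy).
- move=> x; rewrite in_itv /= => /andP[a b]; rewrite derive1E /=.
  have xI : y1 < x < y2 by rewrite a (lt_le_trans b).
  by have [_ ->] := dG x xI; rewrite clamp_id //; case/andP: xI => *; rewrite !ltW.
Qed.

Lemma H2D_zero : H2D_real y1 y2 (fun=> 0) (fun=> 0) (fun=> 0).
Proof.
have z y : \int[leb]_(z in `[y1, y]) (0 : R) = 0 by rewrite Rintegral_cst ?mul0r //; exact: measurable_itv.
split=> //.
- by rewrite (eq_integral (fun=> 0%E)) ?integral0 // => y _; rewrite expr0n.
- by move=> y _; rewrite z addr0.
- by move=> y _; rewrite z addr0.
Qed.

(** A function with |f| >= k / |y - y0| on one side of y0 is not square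
    integrable: the interval between the distances t and 2 t contributes at
    least k^2 / (4 t). *)
Lemma sqr_pole (f : R -> R) (y0 sg d k : R) : measurable_fun I f ->
  (\int[leb]_(y in I) ((f y) ^+ 2)%:E < +oo)%E -> y1 < y0 < y2 -> sg = 1 \/ sg = -1 ->
  0 < d -> 0 < k ->
  {ae leb, forall y, y1 < y < y2 -> 0 < sg * (y - y0) < d -> k <= `|y - y0| * `|f y|} -> False.
Proof.
move=> mf fi /andP[y0a y0b] sgE d0 k0 fk.
have [B B0 HB] : exists2 B : R, 0 <= B & (\int[leb]_(y in I) ((f y) ^+ 2)%:E <= B%:E)%E.
  have i0 : (0 <= \int[leb]_(y in I) ((f y) ^+ 2)%:E)%E.
    by apply: integral_ge0 => y _; rewrite lee_fin sqr_ge0.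
  exists (fine (\int[leb]_(y in I) ((f y) ^+ 2)%:E)); first exact: fine_ge0.
  by rewrite fineK // ge0_fin_numE.
pose t := Num.min (Num.min (d / 4) (k ^+ 2 / (4 * (B + 1)))) (Num.min ((y0 - y1) / 4) ((y2 - y0) / 4)).
have B1 : 0 < 4 * (B + 1) by lra.
have t0 : 0 < t.
  rewrite /t !lt_min !divr_gt0 ?subr_gt0 //; exact: exprn_gt0.
have [[td tk] [ta tb]] : (t <= d / 4 /\ t <= k ^+ 2 / (4 * (B + 1))) /\ (t <= (y0 - y1) / 4 /\ t <= (y2 - y0) / 4).
  by rewrite /t !ge_min !lexx ?orbT.
clearbody t.
pose a := y0 + sg * (3 / 2 * t) - t / 2.
pose J : set R := `[a, a + t]%classic.
have JP y : J y -> t <= sg * (y - y0) <= 2 * t /\ `|y - y0| <= 2 * t.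
  rewrite /J /a /= in_itv /=; clear - t0 sgE; case: sgE => -> h; rewrite ?mul1r ?mulN1r ler_norml; split; lra.
have JI : J `<=` I.
  by move=> y /JP[_]; rewrite ler_norml /= in_itv /= => H; clear - t0 ta tb H; lra.
have mJ : measurable J by exact: measurable_itv.
have mf2 : measurable_fun I (fun y => ((f y) ^+ 2)%:E).
  by apply/measurable_EFinP; exact: measurable_funX.
have sq0 (A : set R) y : A y -> (0 <= ((f y) ^+ 2)%:E)%E by rewrite lee_fin sqr_ge0.
have h1 : (\int[leb]_(y in J) ((f y) ^+ 2)%:E <= B%:E)%E.
  by apply: le_trans HB; apply: ge0_subset_integral => //; exact: sq0.
have h2 : (\int[leb]_(y in J) (cst ((k / (2 * t)) ^+ 2)%:E y) <= \int[leb]_(y in J) ((f y) ^+ 2)%:E)%E.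
  apply: ae_ge0_le_integral => //.
  - by move=> y _; rewrite lee_fin sqr_ge0.
  - exact: sq0.
  - exact: measurable_funS JI mf2.
  apply: (ae_imp fk) => y h Jy; have [/andP[p1 p2] p3] := JP y Jy.
  have yI : y1 < y < y2 by move: p3; rewrite ler_norml; clear - t0 ta tb; lra.
  have {}h := h yI ltac:(clear - p1 p2 td t0 d0; lra).
  rewrite lee_fin -[leRHS]real_normK ?num_real // ler_pXn2r ?nnegrE ?divr_ge0 ?(ltW k0) ?mulr_ge0 ?(ltW t0) //.
  rewrite ler_pdivrMr ?mulr_gt0 // mulrC; apply: le_trans h _.
  by rewrite ler_wpM2r.
have := le_trans h2 h1; rewrite integral_cst // /J [X in (_ * X)%E]lebesgue_measure_itv /= lte_fin ltrDl t0.
rewrite -EFinB -EFinM lee_fin.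
have -> : (k / (2 * t)) ^+ 2 * (a + t - a) = k ^+ 2 / (4 * t) by field; rewrite gt_eqF.
rewrite ler_pdivrMr ?mulr_gt0 //; move: tk; rewrite ler_pdivlMr // => tk.
by clear - tk B0 t0; nra.
Qed.

(** A function of H^2 whose second derivative jumps at y0; an affine function
    is subtracted to meet the boundary conditions. *)
Lemma H2D_ramp (y0 : R) : y1 < y0 < y2 -> exists g g1 : R -> R,
  H2D_real y1 y2 g g1 (fun y => \1_(`]y0, +oo[) y).
Proof.
move=> /andP[a b].
pose m (y : R) : R := Num.max 0 (y - y0).
have mc : continuous m.
  move=> y; rewrite (_ : m = fun y => (0 + (y - y0) + `|0 - (y - y0)|) / 2); last first.
    by apply/funext => z; rewrite /m maxr_absE.
  have c1 : {for y, continuous (fun y => y - y0)} := c_sub (c_id y) (c_cst y0 y).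
  apply: c_mul; last exact: c_cst.
  by apply: c_add; [apply: c_add c1; exact: c_cst|apply: c_abs; apply: c_sub c1; exact: c_cst].
have [G0 Gd] := primP y1 mc; set G := prim y1 m in G0 Gd.
pose L := G y2 / (y2 - y1).
pose g (y : R) : R := G y - L * (y - y1); pose g1 (y : R) : R := m y - L.
have gd (y : R) : is_derive y 1 g (g1 y : R).
  by apply: der_eq (der_sub (Gd y) (der_scale L (der_sub (der_id y) (der_cst y1 y)))) _; rewrite subr0 mulr1.
exists g, g1; split.
- exact: measurable_indic.
- apply: (@le_lt_trans _ _ (\int[leb]_(y in I) (cst 1%:E y))%E).
    apply: ge0_le_integral_any => y _; rewrite lee_fin ?sqr_ge0 //.
  rewrite integral_cst; last exact: measurable_itv.
  by rewrite [X in (_ * X < _)%E]lebesgue_measure_itv /= lte_fin hy -EFinB mul1e ltry.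
- move=> y; rewrite /= in_itv /= => /andP[h1 h2].
  have -> : \int[leb]_(z in `[y1, y]) \1_(`]y0, +oo[) z = fine (leb (`]y0, +oo[ `&` `[y1, y])).
    by congr fine; apply: integral_indic; exact: measurable_itv.
  rewrite /g1 /m (max_l (x := 0) (y := y1 - y0)); last by lra.
  have [yy|yy] := leP y y0.
    rewrite (_ : _ `&` _ = set0) ?measure0 /=; last first.
      by rewrite -subset0 => z [/=]; rewrite !in_itv /=; lra.
    by rewrite max_l; lra.
  rewrite (_ : _ `&` _ = `]y0, y]%classic); last first.
    by apply/seteqP; split=> z /=; rewrite !in_itv /= => *; try split; lra.
  by rewrite [X in fine X]lebesgue_measure_itv /= lte_fin yy /= max_r; lra.
- move=> y; rewrite /= in_itv /= => yI; rewrite (@prim_integral g g1) // ?subrKC //.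
    by apply: cc_sub; [exact: cc_cont|exact: cc_cst].
  by move=> z _; exact: is_derive_cont (gd z).
- rewrite /g G0 subrr mulr0 subr0; split=> //.
  by rewrite /L divfK ?subrr // subr_eq0 gt_eqF.
Qed.
End RayleighOperator.

(** * Isolated eigenvalues are classical eigenvalues off the range *)

Section Spectrum.
Context {R : realType} (y1 y2 beta a : R) (u : R -> R) (W : nat -> R -> R).
Hypotheses (hy : y1 < y2) (beta0 : beta != 0).
Hypothesis Wd : forall i (y : R), is_derive y 1 (W i) (W i.+1 y).
Hypothesis uW : forall y, y1 <= y <= y2 -> u y = W 0%N y.
Local Notation leb := (@lebesgue_measure R).
Local Notation I := (`[y1, y2]%classic : set R).
Local Notation clamp := (clamp y1 y2).
Local Notation cc f := (continuous (f \o clamp)).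

Lemma interior_closed (y : R) : y1 < y < y2 -> y1 <= y <= y2.
Proof. by case/andP => *; rewrite !ltW. Qed.

Lemma d2_interior y : y1 < y < y2 -> (u^`(2))%classic y = W 2%N y.
Proof.
move=> yI; rewrite derive1nS derive1n1 derive1E.
have d (z : R) : y1 < z < y2 -> (u^`())%classic z = W 1%N z.
  move=> zI; rewrite derive1E; have [_ //] : is_derive z 1 u (W 1%N z).
  apply: near_eq_is_derive (Wd 0 z).
  by apply: filterS (near_interior zI) => t /interior_closed /uW.
have [_ //] : is_derive y 1 (u^`())%classic (W 2%N y).
apply: near_eq_is_derive (Wd 1 y).
by apply: filterS (near_interior yI) => t /d.
Qed.

(** Apply the surjectivity to the function of [H2D_ramp]. In (u - c) (f'' -
    a^2 f) = g'' - a^2 g + (u'' - beta) f the right-hand side jumps by 1 at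
    y0, so it stays away from zero on one side, where u - c = O(|y - y0|): f''
    has a pole there. *)
Lemma interior_value_spectrum (y0 : R) : y1 < y0 < y2 ->
  ~ resolvent_set y1 y2 u a beta (u y0)%:C.
Proof.
move=> y0I [onto _]; set c := u y0 in onto.
have y0I' := interior_closed y0I.
have [g [g1 Hg]] := H2D_ramp hy y0I.
have Hz := H2D_zero y1 y2.
pose z (r : R -> R) : R -> R[i] := fun y => (r y)%:C.
have [f /(rayleigh_real hy) Hf] := onto (z g) (z g1) (z (fun y => \1_(`]y0, +oo[) y)) (conj Hg Hz).
have [[f1 [f2 [H2f E]]] _] := Hf g g1 _ (fun=> 0) (fun=> 0) (fun=> 0) (fun=> erefl) (fun=> erefl) Hg Hz.
set F := fun y => complex.Re (f y) in H2f E.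
have [Fc _ _ _] := H2D_der hy H2f; have [gc _ _ _] := H2D_der hy Hg.
have [mf2 if2 _ _ _] := H2f.
pose h y := - a ^+ 2 * g y + (W 2%N y - beta) * F y.
have W2c : cc (W 2%N) by apply: cc_cont => y; exact: is_derive_cont (Wd 2 y).
have hc : {for y0, continuous h}.
  apply: (@cc_interior R y1 y2 h) => //; apply: cc_add; apply: cc_mul => //; try exact: cc_cst.
  by apply: cc_sub => //; exact: cc_cst.
have F0c := cc_interior Fc y0I.
have [r1 r10 Hr1] : exists2 r1 : R, 0 < r1 & forall h : R, `|h| < r1 ->
    `|W 0%N (y0 + h) - W 0%N y0 - h * W 1%N y0| <= 1 * `|h| := eps_is_derive (Wd 0 y0) ltr01.
pose K : R := `|W 1%N y0| + 1; have K0 : 0 < K by rewrite /K; have := normr_ge0 (W 1%N y0); lra.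
pose A : R := a ^+ 2 * (`|F y0| + 1); have A0 : 0 <= A by rewrite mulr_ge0 ?sqr_ge0 // addr_ge0.
have [r2 r20 Hr2] : exists2 r : R, 0 < r & forall y, `|y0 - y| < r ->
    [/\ y1 < y < y2, `|h y0 - h y| <= 1 / 4 & `|F y0 - F y| <= 1].
  have n1 := near_interior y0I.
  have n2 : \forall y \near y0, `|h y0 - h y| <= 1 / 4 by move/cvgrPdist_le: hc; apply; lra.
  have n3 : \forall y \near y0, `|F y0 - F y| <= 1 by move/cvgrPdist_le: F0c; apply.
  have n4 : \forall y \near y0, [/\ y1 < y < y2, `|h y0 - h y| <= 1 / 4 & `|F y0 - F y| <= 1].
    by apply: filterS3 n1 n2 n3.
  case/nbhs_ballP: n4 => r /= r0 Hr.
  by exists r => // y yr; exact: Hr y yr.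
pose d : R := Num.min (Num.min r1 r2) (1 / (8 * K * (A + 1))).
have AK : 0 < 8 * K * (A + 1) by rewrite !mulr_gt0 //; lra.
have d0 : 0 < d by rewrite /d !lt_min r10 r20 divr_gt0.
have [[d1 d2] d3] : (d <= r1 /\ d <= r2) /\ d <= 1 / (8 * K * (A + 1)).
  by rewrite /d !ge_min !lexx ?orbT.
clearbody d.
(* sg is the side on which the right-hand side stays away from zero *)
have [sg sgE sgH] : exists2 sg : R, sg = 1 \/ sg = -1 &
    forall y, 0 < sg * (y - y0) < d -> 1 / 4 <= `|\1_(`]y0, +oo[) y + h y|.
  have key (s : R) y : `|y0 - y| < d -> 1 / 2 <= `|s + h y0| -> 1 / 4 <= `|s + h y|.
    move=> yd hs; have [_ hh _] := Hr2 y (lt_le_trans yd d2).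
    have : `|s + h y0| <= `|s + h y| + `|h y0 - h y|.
      by rewrite (_ : s + h y0 = (s + h y) + (h y0 - h y)) ?ler_normD //; ring.
    lra.
  have [hl|hl] := leP (1 / 2) `|h y0|.
    exists (-1); first by right.
    move=> y yd; have -> : \1_(`]y0, +oo[) y = 0 :> R.
      by rewrite indicE memNset //= in_itv /= andbT; lra.
    by apply: key; rewrite ?add0r // ltr_norml; lra.
  exists 1; first by left.
  move=> y yd; have -> : \1_(`]y0, +oo[) y = 1 :> R.
    by rewrite indicE mem_set //= in_itv /= andbT; lra.
  apply: key; first by rewrite ltr_norml; lra.
  by move: hl; rewrite ltr_norml ler_normr => ?; apply/orP; left; lra.
apply: (@sqr_pole R y1 y2 f2 y0 sg d (1 / (8 * K))) => //; first by rewrite divr_gt0 // mulr_gt0.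
apply: (ae_imp E) => y Ey yI yd.
have yd' : `|y - y0| < d by case: sgE yd => ->; rewrite ?mul1r ?mulN1r ltr_norml; lra.
have [_ _ F1] : [/\ y1 < y < y2, `|h y0 - h y| <= 1 / 4 & `|F y0 - F y| <= 1].
  by apply: Hr2; rewrite distrC; exact: lt_le_trans yd' d2.
have {}Ey := Ey yI; rewrite (d2_interior yI) in Ey.
have uK : `|u y - c| <= K * `|y - y0|.
  rewrite /c !uW ?interior_closed //.
  have := Hr1 (y - y0) (lt_le_trans yd' d1); rewrite subrKC mul1r => H.
  have : `|W 0%N y - W 0%N y0| <= `|W 0%N y - W 0%N y0 - (y - y0) * W 1%N y0| + `|(y - y0) * W 1%N y0|.
    by rewrite -{1}(subrK ((y - y0) * W 1%N y0) (W 0%N y - W 0%N y0)) ler_normD.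
  by rewrite normrM /K; lra.
have S := sgH y yd.
have {}Ey : (u y - c) * (f2 y - a ^+ 2 * F y) = \1_(`]y0, +oo[) y + h y by rewrite Ey /h; ring.
rewrite -Ey normrM in S.
have FA : a ^+ 2 * `|F y| <= A.
  rewrite ler_wpM2l ?sqr_ge0 //.
  have : `|F y| <= `|F y0| + `|F y0 - F y|.
    by have := ler_normB (F y0) (F y0 - F y); rewrite subKr.
  lra.
have f2A : `|f2 y - a ^+ 2 * F y| <= `|f2 y| + A.
  apply: le_trans (ler_normB _ _) _; rewrite normrM (ger0_norm (sqr_ge0 a)); lra.
have S2 : 1 / 4 <= K * `|y - y0| * (`|f2 y| + A).
  by apply: le_trans S _; apply: ler_pM.
have dA : `|y - y0| * (A + 1) <= 1 / (8 * K).
  have : `|y - y0| <= 1 / (8 * K * (A + 1)) by apply: le_trans (ltW yd') d3.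
  have A1 : 0 < A + 1 by clear - hy beta0 Wd uW A0; lra.
  rewrite !ler_pdivlMr ?mulr_gt0 // => H; clear - hy beta0 Wd uW H; lra.
rewrite ler_pdivrMr ?mulr_gt0 //; rewrite ler_pdivlMr ?mulr_gt0 // in dA.
have p1 : 0 <= `|y - y0| by []. 
have p2 : 0 <= K * `|y - y0| by rewrite mulr_ge0 // ltW.
clear - hy beta0 Wd uW S2 dA p1 p2; lra.
Qed.

Lemma cc_integrable f : cc f -> leb.-integrable I (EFin \o f).
Proof.
move=> fc; have : {within I, continuous (f \o clamp)} by exact: continuous_subspaceT.
move/(continuous_compact_integrable (@segment_compact _ _ _)); apply: eq_integrable => //.
by move=> y; rewrite inE /= in_itv /= => yI; rewrite clamp_id.
Qed.

(** If u is constant, both u - c and u'' vanish and beta f = 0 remains. *)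
Lemma flat_kernel c f : (forall y, y1 <= y <= y2 -> u y = c) ->
  rayleigh_eq y1 y2 u a beta c f (fun=> 0) (fun=> 0) -> forall y, y1 <= y <= y2 -> f y = 0.
Proof.
move=> uc [f1 [f2 [Hf E]]].
have W1 (y : R) : y1 < y < y2 -> W 1%N y = 0.
  move=> yI; apply: der_unique (Wd 0 y) _; apply: near_eq_is_derive (der_cst c y).
  by apply: filterS (near_interior yI) => t /interior_closed tI; rewrite -uW // uc.
have W2 (y : R) : y1 < y < y2 -> W 2%N y = 0.
  move=> yI; apply: der_unique (Wd 1 y) _; apply: near_eq_is_derive (der_cst 0 y).
  by apply: filterS (near_interior yI) => t /W1.
have f0 : {ae leb, forall y, y1 < y < y2 -> f y = 0}.
  apply: (ae_imp E) => y Ey yI; have := Ey yI; rewrite (uc y (interior_closed yI)) (d2_interior yI) W2 //.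
  rewrite subrr mul0r mulr0 subr0 !add0r mulNr => /esym/eqP.
  by rewrite oppr_eq0 mulf_eq0 (negPf beta0) => /eqP.
have [fc _ _ _] := H2D_der hy Hf; have [_ _ _ _ [fy1 fy2]] := Hf.
have fi := cc_integrable fc.
have z (y : R) : y1 < y < y2 -> \int[leb]_(z in `[y1, y]) f z = 0.
  move=> /andP[p q]; rewrite -[RHS](_ : \int[leb]_(z in `[y1, y]) (0 : R) = 0).
    rewrite /Rintegral; congr fine; apply: ae_eq_integral.
    - exact: measurable_itv.
    - by have /integrableP[] := integrable_interval fi (ltW q).
    - exact: measurable_cst.
    have y1n : {ae leb, forall t, t != y1}.
      exists [set y1]; split; [exact: measurable_set1|exact: lebesgue_measure_set1|].
      by move=> t /= /negP; rewrite negbK => /eqP.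
    apply: (ae_imp (ae_and f0 y1n)) => t [ft ty] /=; rewrite in_itv /= => /andP[t1 t2].
    by rewrite ft // lt_neqAle eq_sym ty t1 (le_lt_trans t2).
  by rewrite Rintegral_cst ?mul0r //; exact: measurable_itv.
move=> y /andP[]; rewrite le_eqVlt => /orP[/eqP<- //|p]; rewrite le_eqVlt => /orP[/eqP-> //|q].
have yI : y1 < y < y2 by rewrite p.
apply: der_unique (integral_der fi yI (cc_interior fc yI)) _.
apply: near_eq_is_derive (der_cst 0 y).
by apply: filterS (near_interior yI) => t /z.
Qed.

(** Division by u - c shows that f'' has a continuous representative. *)
Lemma regular_kernel c f (Q s s1 : R -> R) : cc Q ->
  (forall y, y1 < y < y2 -> u y != c) ->
  (forall y, y1 < y < y2 -> (u y - c) * (Q y - a ^+ 2) = (u^`(2))%classic y - beta) ->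
  rayleigh_eq y1 y2 u a beta c f (fun=> 0) (fun=> 0) ->
  (exists2 y, y1 <= y <= y2 & f y != 0) -> shoot y1 y2 Q s s1 -> s y2 = 0.
Proof.
move=> Qc uc QE [f1 [f2 [Hf E]]] [yn ynI fyn] [ss s0 s10].
have [fc f1c fd _] := H2D_der hy Hf; have [_ _ f1E fE [fy1 fy2]] := Hf.
have Ph := cc_mul Qc fc.
have f2E : {ae leb, forall y, y1 < y < y2 -> f2 y = Q y * f y}.
  apply: (ae_imp E) => y Ey yI; have := Ey yI; rewrite mulr0 subrr add0r -(QE y yI) -mulrA.
  have ne : u y - c != 0 by rewrite subr_eq0 uc.
  by move/(mulfI ne)/eqP; rewrite mulrBl subr_eq subrK => /eqP.
have z0 : cc (fun _ : R => 0 : R) by exact: cc_cst.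
have [v [v1 [v0 v10 vs]]] := ivp_lin hy 0 (f1 y1) z0 Ph.
have vs' : sec y1 y2 (fun y => Q y * f y) v v1.
  by apply: (sec_ext hy) vs => y _; rewrite mul0r add0r.
have [vd v1d] := vs'.
have yy : y1 <= y1 <= y2 by rewrite lexx ltW.
have Phi := cc_integrable Ph.
have E1 y : y1 <= y <= y2 -> f1 y = v1 y.
  move=> yI; have [p q] := andP yI.
  rewrite f1E; last by rewrite /= in_itv.
  have -> : \int[leb]_(z in `[y1, y]) f2 z = \int[leb]_(z in `[y1, y]) (Q z * f z).
    have [mf2 if2 _ _ _] := Hf.
    rewrite /Rintegral; congr fine; apply: ae_eq_integral.
    - exact: measurable_itv.
    - by have /integrableP[] := integrable_interval (sqr_integrable mf2 if2) q.
    - by have /integrableP[] := integrable_interval Phi q.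
    have yn1 (r : R) : {ae leb, forall t, t != r}.
      exists [set r]; split; [exact: measurable_set1|exact: lebesgue_measure_set1|].
      by move=> t /= /negP; rewrite negbK => /eqP.
    apply: (ae_imp (ae_and f2E (ae_and (yn1 y1) (yn1 y2)))) => t [ft [ty ty']] /=.
    rewrite in_itv /= => /andP[t1 t2]; congr EFin.
    by apply: ft; rewrite !lt_neqAle (eq_sym y1) ty t1 ty' (le_trans t2).
  suff -> : \int[leb]_(z in `[y1, y]) (Q z * f z) = v1 y - v1 y1 by rewrite v10 subrKC.
  apply: (@prim_integral R y1 y2 hy v1 (fun z => Q z * f z)) => //.
    by move=> z _; exact: is_derive_cont (v1d z).
  by move=> z /interior_closed zI; have := v1d z; rewrite /= clamp_id.
have E0 y : y1 <= y <= y2 -> f y = v y.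
  move=> yI; rewrite fE; last by rewrite /= in_itv.
  suff -> : \int[leb]_(z in `[y1, y]) f1 z = v y - v y1 by rewrite v0 fy1 subr0 add0r.
  apply: (@prim_integral R y1 y2 hy v f1) => //.
    by move=> z _; exact: is_derive_cont (vd z).
  by move=> z /interior_closed zI; rewrite E1.
have vl : sec y1 y2 (fun y => Q y * v y + 0) v v1.
  by apply: (sec_ext hy) vs' => y yI; rewrite E0 // addr0.
have dl : sec y1 y2 (fun y => Q y * (v y - f1 y1 * s y) + 0) (fun y => v y - f1 y1 * s y) (fun y => v1 y - f1 y1 * s1 y).
  have [sd s1d] := ss; have [vd' v1d'] := vl; split=> y.
    exact: der_sub (vd' y) (der_scale _ (sd y)).
  by apply: der_eq (der_sub (v1d' y) (der_scale (f1 y1) (s1d y))) _; rewrite /=; ring.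
have D := lin_est0 hy Qc dl; rewrite /= v0 v10 s0 s10 mulr0 mulr1 !subrr in D.
have vE y : y1 <= y <= y2 -> v y = f1 y1 * s y.
  by move=> yI; have [/eqP + _] := D erefl erefl y yI; rewrite subr_eq0 => /eqP.
have y2I : y1 <= y2 <= y2 by rewrite lexx ltW.
have := vE y2 y2I; rewrite -E0 // fy2 => /esym/eqP; rewrite mulf_eq0 => /orP[/eqP f10|/eqP //].
by move: fyn; rewrite E0 // vE // f10 mul0r eqxx.
Qed.

Lemma realC_dist (c d : R) : `|c%:C - d%:C| = (`|c - d|)%:C.
Proof. by rewrite normc_def /= subrr expr0n addr0 sqrtr_sqr. Qed.

(** If c were in the range of u, then either u = c, which is excluded by
    [flat_kernel], or u takes at interior points values different from c and
    arbitrarily close to c, which are in the spectrum: c would not be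
    isolated. *)
Lemma spectrum_classical c : discrete_spectrum y1 y2 u a beta c%:C ->
  (forall y, y1 <= y <= y2 -> u y != c) /\
  (forall Q s s1 : R -> R, cc Q ->
     (forall y, y1 < y < y2 -> (u y - c) * (Q y - a ^+ 2) = (u^`(2))%classic y - beta) ->
     shoot y1 y2 Q s s1 -> s y2 = 0).
Proof.
move=> [[r r0 Hr] [f Hf [yn ynI fyn]] _].
have Hz := H2D_zero y1 y2.
have [Ere Eim] := rayleigh_real hy Hf (fun=> erefl) (fun=> erefl) Hz Hz.
have [g [Eg [yg ygI gyg]]] : exists g, rayleigh_eq y1 y2 u a beta c g (fun=> 0) (fun=> 0) /\
    exists2 y, y1 <= y <= y2 & g y != 0.
  have [re0|re0] := eqVneq (complex.Re (f yn)) 0.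
    exists (fun y => complex.Im (f y)); split=> //; exists yn => //.
    by apply: contraNN fyn => /eqP im0; rewrite eq_complex re0 im0 /= !eqxx.
  by exists (fun y => complex.Re (f y)); split=> //; exists yn.
have nr : forall y, y1 <= y <= y2 -> u y != c.
  move=> ys ysI; apply/eqP => uys.
  have [flat|] := pselect (forall y, y1 <= y <= y2 -> u y = c).
    by move: gyg; rewrite (flat_kernel flat Eg) ?eqxx.
  move/existsNP => [y' /not_implyP[y'I /eqP uy']].
  have W0c : continuous (W 0%N) by move=> y; exact: is_derive_cont (Wd 0 y).
  have del : exists2 y0 : R, y1 < y0 < y2 & u y0 != c /\ `|u y0 - c| < r.
    pose e := u y' - c; have e0 : e != 0 by rewrite subr_eq0.
    pose t := Num.min (1 / 2) (r / (2 * `|e|)).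
    have ne0 : 0 < `|e| by rewrite normr_gt0.
    have t0 : 0 < t by rewrite /t lt_min !divr_gt0 // mulr_gt0.
    have t1 : t < 1 by rewrite /t gt_min; apply/orP; left; lra.
    have tr : t * `|e| < r.
      have : t <= r / (2 * `|e|) by rewrite /t ge_min lexx orbT.
      by rewrite ler_pdivlMr ?mulr_gt0 //; lra.
    clearbody t; pose v := c + t * e.
    have vne : v != c by rewrite /v -subr_eq0 addrAC subrr add0r mulf_neq0 // gt_eqF.
    have vne' : v != u y'.
      rewrite /v -subr_eq0 (_ : _ - _ = (t - 1) * e); last by rewrite /e; ring.
      by rewrite mulf_neq0 // subr_eq0 lt_eqF.
    have vr : `|v - c| < r by rewrite /v addrAC subrr add0r normrM gtr0_norm.
    have vI : Num.min (u ys) (u y') <= v <= Num.max (u ys) (u y').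
      have -> : u y' = c + e by rewrite /e subrKC.
      rewrite uys /v; have [se|se] := ltP e 0.
        by rewrite min_r ?max_l; clear - hy beta0 Wd uW se t0 t1; [apply/andP; split; nra|lra|lra].
      by rewrite min_l ?max_r; clear - hy beta0 Wd uW se t0 t1; [apply/andP; split; nra|lra|lra].
    have ivt (p q : R) : y1 <= p -> q <= y2 -> p <= q -> Num.min (u p) (u q) <= v <= Num.max (u p) (u q) ->
        exists2 y0, p <= y0 <= q & u y0 = v.
      move=> p1 q1 pq; rewrite !uW; [|by rewrite (le_trans p1) // q1|by rewrite p1 (le_trans pq)] => h.
      have [y0] := IVT pq (continuous_subspaceT W0c) h; rewrite in_itv /= => /andP[h1 h2] E0.
      by exists y0; rewrite ?h1 // uW // (le_trans p1 h1) (le_trans h2).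
    have [y0 y0I uy0] : exists2 y0, Num.min ys y' <= y0 <= Num.max ys y' & u y0 = v.
      have /andP[s1 s2] := ysI; have /andP[s3 s4] := y'I.
      have [le|/ltW le] := leP ys y'; first exact: ivt.
      by apply: ivt => //; rewrite minC maxC.
    have n1 : y0 != ys by apply: contra_neq vne => E; rewrite -uy0 E.
    have n2 : y0 != y' by apply: contra_neq vne' => E; rewrite -uy0 E.
    exists y0; last by rewrite uy0.
    have /andP[s1 s2] := ysI; have /andP[s3 s4] := y'I.
    move: y0I; rewrite ge_min le_max => /andP[/orP m1 /orP m2].
    rewrite !lt_neqAle (le_trans _ (_ : Num.min ys y' <= y0)) ?le_min ?s1 ?s3 //; last first.
      by rewrite ge_min; apply/orP.
    rewrite (le_trans (_ : y0 <= Num.max ys y') _) ?ge_max ?s2 ?s4 // ?le_max; last by apply/orP.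
    rewrite !andbT; apply/andP; split; apply/eqP => E0.
      by case: m1 => h; [move: n1|move: n2]; rewrite -E0 => /eqP; apply; apply/eqP; rewrite eq_le ?s1 ?s3 ?E0 h.
    by case: m2 => h; [move: n1|move: n2]; rewrite E0 => /eqP; apply; apply/eqP; rewrite eq_le ?s2 ?s4 -?E0 h.
  have [y0 y0I [une ur]] := del.
  apply: (interior_value_spectrum y0I); apply: Hr.
    by rewrite eq_complex /= eqxx andbT.
  by rewrite realC_dist ltcR.
split=> // Q s s1 Qc QE ssh.
apply: (regular_kernel Qc _ QE Eg _ ssh); last by exists yg.
by move=> y /interior_closed; exact: nr.
Qed.
End Spectrum.

(** * Norms of the perturbation *)

Section Norms.
Context {R : realType} (T y1 y2 : R).
Hypotheses (hT : 0 < T) (hy : y1 < y2).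
Local Notation plane := (measurableTypeR R * measurableTypeR R)%type.
Local Notation mu2 := (leb2 R).
Local Notation leb := (@lebesgue_measure R).
Local Notation cell := (cell T y1 y2).

Lemma weak_deriv_ext i j (f f' g : R * R -> R) : (forall p, cell p -> f p = f' p) ->
  weak_deriv T y1 y2 i j f g -> weak_deriv T y1 y2 i j f' g.
Proof.
move=> E [fi gi H]; split=> //.
  by apply: eq_integrable fi; [exact: cell_measurable|move=> p /set_mem /E ->].
move=> eta te; rewrite -H //; apply: eq_Rintegral => p /set_mem /E -> //.
Qed.

Lemma Hs_sqrnorm_ext s (f f' : R * R -> R) : (forall p, cell p -> f p = f' p) ->
  Hs_sqrnorm T y1 y2 s f = Hs_sqrnorm T y1 y2 s f'.
Proof.
move=> E; rewrite /Hs_sqrnorm; congr ereal_inf; apply/seteqP; split=> N [D HD ->]; exists D => // i j ij.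
  exact: weak_deriv_ext E (HD i j ij).
by apply: weak_deriv_ext (HD i j ij) => p /E.
Qed.

Lemma Hs_norm_small s : 0 <= s -> exists2 d : R, 0 < d <= 1 / 2 & forall eps f g, 0 < eps ->
  CB T y1 y2 (d * eps) (Num.truncn s).+1 f -> CB T y1 y2 (d * eps) (Num.truncn s).+1 g ->
  (Hs_norm T y1 y2 s f g <= eps%:E)%E.
Proof.
move=> s0; have [C C0 HC] := Hs_bound hT hy s0.
exists (1 / (2 * (C + 1))).
  by rewrite divr_gt0 ?mulr_gt0 ?ltr_wpDl //= ler_pdivrMr ?mulr_gt0 ?ltr_wpDl //; lra.
move=> eps f g e0 cf cg; set d := 1 / _ in cf cg.
have {}cf := HC _ _ cf; have {}cg := HC _ _ cg.
rewrite /Hs_norm -[leRHS]gee0_abs ?lee_fin ?(ltW e0) // -sqrte_sqr lee_sqrt; last first.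
  by rewrite -EFin_expe lee_fin sqr_ge0.
apply: le_trans (leeD cf cg) _; rewrite -EFinD -EFin_expe lee_fin.
have d0 : 0 <= d by rewrite /d divr_ge0 // mulr_ge0 // addr_ge0.
have dC : d * (2 * (C + 1)) = 1 by rewrite /d divfK // mulf_neq0 // gt_eqF // ltr_wpDl.
have h : 2 * C * d ^+ 2 <= 1.
  have d1 : d <= 1 by nra.
  by have : C * d * d <= C * d * 1; [rewrite ler_wpM2l // mulr_ge0|nra].
by rewrite exprMn; have := sqr_ge0 eps; nra.
Qed.

(** A continuous function is bounded away from zero on a box, and periodicity
    moves the box into the cell. *)
Lemma L2_norm_neq0 (f : R * R -> R) (x y : R) : continuous f ->
  (forall x y, f (x + T, y) = f (x, y)) -> y1 < y < y2 -> f (x, y) != 0 ->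
  L2_norm T y1 y2 f != 0%E.
Proof.
move=> fc fp /andP[ya yb] fxy.
have [x' /andP[xa xb] fx'] := periodic_rep hT fp x y.
rewrite -fx' in fxy; move: x' fxy xa xb {fx'} => x' fxy xa xb.
pose c := `|f (x', y)| / 2; have c0 : 0 < c by rewrite divr_gt0 // normr_gt0.
have [d d0 Hd] : exists2 d : R, 0 < d & forall p : R * R, `|x' - p.1| < d -> `|y - p.2| < d -> c <= `|f p|.
  have n1 : \forall p \near (x', y), `|f (x', y) - f p| <= c by have := fc (x', y); move/cvgrPdist_le; apply.
  case/nbhs_ballP: n1 => d /= d0 Hd; exists d => // p p1 p2.
  have h : `|f (x', y) - f p| <= c by apply: Hd; split.
  have := ler_normD (f (x', y) - f p) (f p); rewrite subrK => h2.
  by move: h h2; rewrite /c; lra.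
pose t : R := Num.min (d / 2) (Num.min (T / 2) (y2 - y)).
have t0 : 0 < t by rewrite /t !lt_min !divr_gt0 //= subr_gt0.
have [td [tT ty]] : t <= d / 2 /\ (t <= T / 2 /\ t <= y2 - y).
  by rewrite /t !ge_min !lexx ?orbT.
clearbody t.
have [a [a0 aT ax]] : exists a : R, [/\ 0 <= a, a + t <= T & a <= x' <= a + t].
  have [h|h] := leP x' (T / 2); [exists x'|exists (x' - t)]; split; lra.
pose J : set plane := `[a, a + t] `*` `[y, y + t].
have mJ : measurable J by apply: measurableX; exact: measurable_itv.
have Jc : J `<=` cell.
  by move=> p [/= ]; rewrite !in_itv /= => p1 p2; split; rewrite /= in_itv /=; lra.
have mf2 : measurable_fun cell (fun p : plane => ((f p) ^+ 2)%:E).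
  apply/measurable_EFinP; apply: measurable_funX; apply: measurable_funTS; exact: cont_measurable2.
have sq0 (A : set plane) p : A p -> (0 <= ((f p) ^+ 2)%:E)%E by rewrite lee_fin sqr_ge0.
have lb : ((c ^+ 2 * (t * t))%:E <= L2_sqrnorm T y1 y2 f)%E.
  apply: (@le_trans _ _ (\int[mu2]_(p in J) ((f p) ^+ 2)%:E)%E); last first.
    by apply: ge0_subset_integral => //; [exact: cell_measurable|exact: sq0].
  apply: (@le_trans _ _ (\int[mu2]_(p in J) (cst (c ^+ 2)%:E p))%E).
    rewrite integral_cst // /J /leb2 [X in (_ * X)%E]product_measure1E; [|exact: measurable_itv|exact: measurable_itv].
    rewrite [X in (_ * (X * _))%E](_ : _ = t%:E); last first.
      by rewrite [LHS]lebesgue_measure_itv /= lte_fin ltrDl t0 -EFinB addrAC subrr add0r.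
    rewrite [X in (_ * (_ * X))%E](_ : _ = t%:E); last first.
      by rewrite [LHS]lebesgue_measure_itv /= lte_fin ltrDl t0 -EFinB addrAC subrr add0r.
    by rewrite -!EFinM.
  apply: ge0_le_integral_any => p Jp; first by rewrite lee_fin sqr_ge0.
  rewrite lee_fin -[leRHS]real_normK ?num_real // ler_pXn2r ?nnegrE ?(ltW c0) //.
  case: Jp => /=; rewrite !in_itv /= => p1 p2.
  by apply: Hd; rewrite ltr_norml; lra.
apply/eqP => h0; move: lb; rewrite -[L2_sqrnorm _ _ _ _]sqr_sqrte; last by apply: integral_ge0; exact: sq0.
rewrite -/(L2_norm T y1 y2 f) h0 expe2 mule0 lee_fin.
by rewrite leNgt mulr_gt0 ?exprn_gt0 // mulr_gt0.
Qed.
End Norms.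

Lemma smooth_tower (R : realType) (w : R -> R) :
  (forall n y, derivable (w^`(n))%classic y 1) ->
  forall n (y : R), is_derive y 1 (w^`(n))%classic ((w^`(n.+1))%classic y).
Proof. by move=> wd n y; rewrite derive1nS derive1E; split. Qed.

(** * Travelling waves near the shear flow *)

Section Flows.
Context {R : realType} (y1 y2 T beta c0 s : R) (u : R -> R) (k : nat) (U : nat -> R -> R).
Hypotheses (hy : y1 < y2) (hT : 0 < T) (hs : 0 <= s) (k0 : (0 < k)%N).
Hypothesis Ud : forall i (y : R), is_derive y 1 (U i) (U i.+1 y).
Hypothesis U0 : forall y, y1 <= y <= y2 -> U 0%N y != 0.
Hypothesis uU : forall y, y1 <= y <= y2 -> u y = c0 + U 0%N y.
Local Notation q0 := (fF beta U 1%N).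
Local Notation kap := (k%:R * (2 * pi / T)).
Hypothesis mode1 : forall s s1, shoot y1 y2 (pot kap q0 1) s s1 -> s y2 = 0.
Hypothesis modes : forall n s s1, (2 <= n)%N -> shoot y1 y2 (pot kap q0 n) s s1 -> s y2 != 0.

(** The speed is c0 for all amplitudes, because the frame may be chosen
    beforehand: U = u - c0 is the given flow seen from it. The bound by eps
    keeps the horizontal velocity in this frame away from zero. *)
Lemma travelling_waves : exists2 eps0 : R, 0 < eps0 & forall eps : R, exists w : (R * R -> R) * (R * R -> R),
  0 < eps < eps0 ->
  [/\ beta_plane_euler T y1 y2 beta
        (fun p => w.1 (p.1.2 - c0 * p.1.1, p.2)) (fun p => w.2 (p.1.2 - c0 * p.1.1, p.2)),
      (Hs_norm T y1 y2 s (fun p => w.1 p - u p.2)%R w.2 <= eps%:E)%E,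
      L2_norm T y1 y2 w.2 != 0%E &
      forall x y : R, y1 <= y <= y2 -> w.1 (x, y) - c0 != 0].
Proof.
have [m m0 Um] := U_lower hy Ud U0.
have [d /andP[d0 d1] Hd] := Hs_norm_small hT hy hs.
have kap0 : 0 < kap by rewrite mulr_gt0 ?ltr0n // divr_gt0 // mulr_gt0 // pi_gt0.
have kT : kap * T = k%:R * (pi * 2) by rewrite -mulrA divfK ?gt_eqF // (mulrC pi).
have q0c := @fF_cc R y1 y2 beta U hy Ud U0 1.
have [phi [phi1 phiS]] := shoot_ex hy (@pot_cc _ y1 y2 kap _ 1 q0c).
exists m => // eps; have [/andP[e0 em]|] := boolP (0 < eps < m); last by exists (fun=> 0, fun=> 0).
have de0 : 0 < d * eps by rewrite mulr_gt0.
have [F [psi [X [Y [Xx [Xy [Yy [ST [x [y [yI Xxy]]]]]]]]]]] :=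
  steady_waves hy Ud U0 kap0 kT phiS (mode1 phiS) modes (Num.truncn s).+1 de0.
have U0c : continuous (U 0%N) by move=> z; exact: is_derive_cont (Ud 0 z).
have SX := st_X ST; have SY := st_Y ST.
have nX : CB T y1 y2 (d * eps) (Num.truncn s).+1 (fun p => - X p).
  have n1 : `|-1| <= 1 :> R by rewrite normrN1.
  have := CB_scale n1 SX; rewrite mul1r.
  by rewrite (_ : (fun p => _) = fun p => - X p) //; apply/funext => p; rewrite mulN1r.
exists (fun p => c0 + Y p, fun p => - X p) => _; split=> /=.
- exact: (steady_euler c0 hy U0c ST).
- rewrite /Hs_norm (@Hs_sqrnorm_ext R T y1 y2 s _ (fun p => Y p - U 0%N (clamp y1 y2 p.2))); first exact: Hd.
  move=> p [_ /=]; rewrite in_itv /= => pI.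
  by rewrite clamp_id // uU // opprD addrACA subrr add0r.
- have [Xc _ Xp _] := SX; apply: (@L2_norm_neq0 R T y1 y2 hT _ x y) => //.
  + by move=> p; apply: c_opp; exact: Xc.
  + by move=> x' y'; rewrite Xp.
  + by rewrite oppr_eq0.
- move=> x' y' y'I; rewrite addrAC subrr add0r; apply/eqP => Y0.
  have [_ /(_ (x', y')) /=] := SY; rewrite Y0 sub0r normrN clamp_id // => h _ _.
  have := Um y' y'I; rewrite leNgt => /negP; apply.
  apply: le_lt_trans h _; apply: le_lt_trans em.
  by rewrite ler_piMl ?(ltW e0) // (le_trans d1) //; lra.
Qed.
End Flows.

Lemma shoot_unique (R : realType) (y1 y2 : R) (Q s s1 v v1 : R -> R) : y1 < y2 ->
  continuous (Q \o clamp y1 y2) -> shoot y1 y2 Q s s1 -> shoot y1 y2 Q v v1 ->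
  forall y, y1 <= y <= y2 -> s y = v y.
Proof.
move=> hy Qc [[sd s1d] s0 s10] [[vd v1d] v0 v10].
have dl : sec y1 y2 (fun y => Q y * (s y - v y) + 0) (fun y => s y - v y) (fun y => s1 y - v1 y).
  split=> y; first exact: der_sub (sd y) (vd y).
  by apply: der_eq (der_sub (s1d y) (v1d y)) _; rewrite /=; ring.
have D := lin_est0 hy Qc dl; rewrite /= s0 s10 v0 v10 !subrr in D.
by move=> y yI; have [/eqP + _] := D erefl erefl y yI; rewrite subr_eq0 => /eqP.
Qed.

Theorem corollary2p6 (R : realType) (y1 y2 : R) (hy : y1 < y2)
    (T : R) (hT : 0 < T) (alpha : R) (halpha : alpha = 2 * pi / T)
    (beta : R) (hbeta : beta != 0)
    (u : R -> R) (hu : smooth_on y1 y2 u)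
    (s : R) (hs : 3 <= s) (c0 : R)
    (hc0 : (\bigcup_(k in [set k : nat | (1 <= k)%N])
              discrete_spectrum y1 y2 u (k%:R * alpha) beta) c0%:C) :
  exists (eps0 : R) (ueps veps : R -> R * R -> R) (ceps : R -> R),
    0 < eps0 /\
    (forall eps : R, 0 < eps < eps0 ->
       [/\ beta_plane_euler T y1 y2 beta
             (fun p => ueps eps (p.1.2 - ceps eps * p.1.1, p.2))
             (fun p => veps eps (p.1.2 - ceps eps * p.1.1, p.2)),
           (Hs_norm T y1 y2 s (fun p => ueps eps p - u p.2)%R (veps eps)
              <= eps%:E)%E,
           L2_norm T y1 y2 (veps eps) != 0%E,
           ~ Ran y1 y2 u (ceps eps) &
           forall x y : R, y1 <= y <= y2 ->
             ueps eps (x, y) - ceps eps != 0]) /\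
    ceps eps @[eps --> 0^'+] --> c0.
Proof.
have [w [wd uw]] := hu; have Wd := smooth_tower wd.
pose W n := (w^`(n))%classic.
have uW y : y1 <= y <= y2 -> u y = W 0%N y by move=> yI; apply: uw; rewrite in_itv.
have [k0 /= k01 hk0] := hc0.
have [nr _] := spectrum_classical hy hbeta Wd uW hk0.
pose U n y := if n is 0 then w y - c0 else W n y.
have Ud i (y : R) : is_derive y 1 (U i) (U i.+1 y).
  case: i => [|i]; last by have := Wd i.+1 y.
  by apply: der_eq (der_sub (Wd 0 y) (der_cst c0 y)) _; rewrite subr0.
have U0 y : y1 <= y <= y2 -> U 0%N y != 0.
  by move=> yI; rewrite /U subr_eq0 -[w y](uW y yI) nr.
have uU y : y1 <= y <= y2 -> u y = c0 + U 0%N y.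
  by move=> yI; rewrite uW // /U /W /= subrKC.
pose q0 := fF beta U 1%N.
have q0c : continuous (q0 \o clamp y1 y2) by exact: fF_cc.
have alpha0 : 0 < alpha by rewrite halpha divr_gt0 // mulr_gt0 // pi_gt0.
(* the wave numbers k alpha for which the eigenvalue problem is solvable *)
pose P k := `[< (0 < k)%N /\ exists2 s, (exists s1, shoot y1 y2 (pot alpha q0 k) s s1) & s y2 = 0 >].
have exP : exists k, P k.
  exists k0; apply/asboolP; split=> //.
  have pc := @pot_cc _ y1 y2 alpha _ k0 q0c.
  have [t [t1 tS]] := shoot_ex hy pc; exists t; first by exists t1.
  have [_ H] := spectrum_classical hy hbeta Wd uW hk0; apply: (H _ _ _ pc _ tS).
  move=> y yI; have yI' := interior_closed yI; rewrite /pot addrK.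
  rewrite (d2_interior Wd uW) //.
  by rewrite /q0 uU // addrAC subrr add0r (fF1E _ Ud U0) // mulrC divfK ?U0.
have [n Pn] : exists n, forall k, P k -> (k <= n)%N.
  have [kq kq0 kqb] := bounded_cc hy q0c.
  exists (Num.truncn ((kq + 1) / alpha)) => k /asboolP[kpos [t [t1 tS] t2]].
  rewrite leqNgt; apply/negP => kn.
  have kk : kq + 1 < k%:R * alpha.
    rewrite -ltr_pdivrMr //; apply: lt_le_trans (truncnS_gt _) _.
    by rewrite ler_nat.
  have : t y2 != 0.
    apply: (shoot_neq0 hy (@pot_cc _ y1 y2 alpha _ k q0c) _ tS) => y yI.
    have := kqb y yI; rewrite /pot ler_norml => /andP[h1 _].
    have : kq + 1 <= (k%:R * alpha) ^+ 2 by rewrite expr2; nra.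
    by move: h1; rewrite -/q0; lra.
  by rewrite t2 eqxx.
have [k /asboolP[kpos [t [t1 tS] t2]] kmax] := ex_maxnP exP Pn.
have kapE n' : pot (k%:R * alpha) q0 n' = pot alpha q0 (n' * k).
  by apply/funext => y; rewrite /pot mulrA -natrM.
have [|s' s1' h|n' s' s1' n2 h|eps0 eps00 H] := @travelling_waves R y1 y2 T beta c0 s u k U hy hT _ kpos Ud U0 uU.
- lra.
- move: h; rewrite -halpha kapE mul1n => h.
  have yI : y1 <= y2 <= y2 by rewrite lexx ltW.
  by rewrite -(shoot_unique hy (@pot_cc _ y1 y2 alpha _ k q0c) tS h yI).
- move: h; rewrite -halpha kapE => h; apply/eqP => s0.
  have : P (n' * k)%N by apply/asboolP; split; [rewrite muln_gt0 kpos andbT ltnW|exists s' => //; exists s1'].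
  by move/kmax; rewrite leqNgt -[X in (X < _)%N]mul1n ltn_mul2r kpos n2.
have [g Hg] := choice H.
exists eps0, (fun e => (g e).1), (fun e => (g e).2), (fun=> c0); split=> //; split; last exact: cvg_cst.
move=> eps e; have [h1 h2 h3 h4] := Hg eps e; split=> //.
by move=> [y /=]; rewrite in_itv /= => yI /eqP; apply/negP; exact: nr.
Qed.
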